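(* Let $N\geqslant1$, let $\lambda$ be a strict partition of $n$ and let $\mathcal U$ be a standard barred tableau of shape $\lambda$. Then the character of the $\mathfrak q_N$-module $M(\lambda)=\mathcal E_{\mathcal U}(\mathbb C^{N|N})^{\otimes n}$ coincides with the Schur $Q$-polynomial $Q_\lambda(y)=Q_\lambda(y_1,\dots,y_N)$. Moreover, $$\mathrm{str}\,\mathcal E_{\mathcal U}\,Y_1\cdots Y_n=Q_\lambda(y),$$ where the supertrace is taken over all $n$ copies of the endomorphism algebra $\mathrm{End}\,\mathbb C^{N|N}$.
   Context: All vector spaces and algebras are over $\mathbb C$; tensor products of superalgebras are graded: $(a\otimes b)(c\otimes d)=(-1)^{\deg b\deg c}\,ac\otimes bd$. Sergeev superalgebra. $\mathcal S_n=\mathbb C\mathfrak S_n\ltimes \mathcal{C}l_n$, where elements of $\mathfrak S_n$ are even, the Clifford superalgebra $\mathcal{C}l_n$ is generated by odd $c_1,\dots,c_n$ with $c_a^2=-1$, $c_ac_b=-c_bc_a$ ($a\neq b$), and $\sigma c_a=c_{\sigma(a)}\sigma$ for $\sigma\in\mathfrak S_n$. Jucys–Murphy elements: $x_1=0$, $x_b=\sum_{a=1}^{b-1}(a,b)(1+c_ac_b)$ for $b=2,\dots,n$. Tableaux. A strict partition $\lambda=(\lambda_1>\dots>\lambda_\ell>0)$ of $n$ has shifted Young diagram with boxes $(i,j)$, $1\le i\le \ell$, $i\le j\le i+\lambda_i-1$. A standard $\lambda$-tableau is a bijective filling of the boxes by $1,\dots,n$ increasing along rows and down columns. A standard barred tableau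 is obtained from a standard tableau by putting bars on some (possibly none) of the entries not lying in diagonal boxes $(i,i)$. If the entry $a$ or $\bar a$ of $\mathcal U$ is in box $(i,j)$, put $\sigma_a=j-i$; its signed content is $\kappa_a(\mathcal U)=\sqrt{\sigma_a(\sigma_a+1)}$ if the entry is unbarred, and $\kappa_a(\mathcal U)=-\sqrt{\sigma_a(\sigma_a+1)}$ if it is barred. Idempotents. $e_{\mathcal U}\in\mathcal S_n$ is defined inductively: $e_{\mathcal U}=1$ for the one-box tableau, and $e_{\mathcal U}=e_{\mathcal V}\,\frac{(x_n-b_1)\cdots(x_n-b_p)}{(\kappa-b_1)\cdots(\kappa-b_p)}$, where $\mathcal V$ is obtained from $\mathcal U$ by removing the box containing $n$ (or $\bar n$), $\kappa=\kappa_n(\mathcal U)$, and $b_1,\dots,b_p$ are the signed contents of the new entry over all the other ways (other than the one giving $\mathcal U$) of adding an entry $n$ or $\bar n$ to $\mathcal V$ in an addable box to get a standard barred tableau. Superspace and $\mathfrak q_N$. $\mathbb C^{N|N}$ has basis $e_{-N},\dots,e_{-1},e_1,\dots,e_N$, with $e_i$ of parity $\bar\imath=1$ for $i<0$ and $\bar\imath=0$ for $i>0$ (index sums skip $0$). $E_{ij}\in\mathrm{End}\,\mathbb C^{N|N}$ are the matrix units, of parity $\bar\imath+\bar\jmath$, also viewed as a basis of $\mathfrak{gl}_{N|N}$. The queer Lie superalgebra $\mathfrak q_N\subset\mathfrak{gl}_{N|N}$ is spanned by $F_{ij}=E_{ij}+E_{-i,-j}$, and acts naturally on $\mathbb C^{N|N}$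 and on $(\mathbb C^{N|N})^{\otimes n}$. Put $J=\sum_{i}E_{i,-i}(-1)^{\bar\imath}$ and $P=\sum_{i,j}E_{ij}\otimes E_{ji}(-1)^{\bar\jmath}$; subscripts indicate copies of $\mathrm{End}\,\mathbb C^{N|N}$ in $(\mathrm{End}\,\mathbb C^{N|N})^{\otimes n}$. The algebra $\mathcal S_n$ acts on $(\mathbb C^{N|N})^{\otimes n}$ by $c_a\mapsto J_a$, $(a,b)\mapsto P_{ab}$; this action commutes with that of $\mathfrak q_N$ (in the super sense). $\mathcal E_{\mathcal U}$ denotes the image of $e_{\mathcal U}$. The character of a finite-dimensional $\mathfrak q_N$-module on which $F_{11},\dots,F_{NN}$ act diagonalizably with integer eigenvalues is $\sum_\mu \dim(M_\mu)\,y_1^{\mu_1}\cdots y_N^{\mu_N}$, where $M_\mu$ is the simultaneous eigenspace with $F_{kk}$ acting as $\mu_k$. $Y=\sum_{i=-N}^Ny_iE_{ii}(-1)^{\bar\imath}$ with variables $y_1,\dots,y_N$ and $y_{-i}=y_i$; $Y_a=1^{\otimes(a-1)}\otimes Y\otimes1^{\otimes(n-a)}$. The supertrace satisfies $\mathrm{str}\,E_{ij}=\delta_{ij}(-1)^{\bar\imath}$ in each copy. Schur $Q$-polynomial. Order the alphabet $1'<1<2'<2<\dots<N'<N$, with $|k|=|k'|=k$. A marked shifted tableau $\mathcal T$ of shape $\lambda$ is a filling of the boxes of the shifted diagram of $\lambda$ with these symbols, weakly increasing along rows and down columns, with at most one $k$ in each column and at most one $k'$ in each row, for each $k$. Then $Q_\lambda(y)=\sum_{\mathcal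 T}\prod_{\alpha\in\lambda}y_{|\mathcal T(\alpha)|}$, summed over marked shifted tableaux of shape $\lambda$. *)

(* Defs.v *)
From HB Require Import structures.
From mathcomp Require Import all_boot all_order all_fingroup all_algebra.
From mathcomp Require Import reals complex mpoly.

Set Implicit Arguments.
Unset Strict Implicit.
Unset Printing Implicit Defensive.

Import GRing.Theory Num.Theory.
Local Open Scope ring_scope.

Section TwistedBilinear.
Variables (K : comNzRingType).

Definition basis_elt (X : finType) (k : X) : {ffun X -> K^o} :=
  [ffun m => (m == k)%:R].

(* The bilinear extension of (g, k) |-> (-1)^(sg g k) (op g k) from basis
   elements to all vectors. *)
Definition twisted (G X Z : finType) (op : G -> X -> Z) (sg : G -> X -> bool)
    (x : {ffun G -> K^o}) (v : {ffun X -> K^o}) : {ffun Z -> K^o} :=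
  \sum_g \sum_k ((-1) ^+ sg g k * (x g * v k)) *: basis_elt (op g k).

Lemma basis_decomp (X : finType) (v : {ffun X -> K^o}) :
  v = \sum_k v k *: basis_elt k.
Proof.
apply/ffunP => m; rewrite sum_ffunE (bigD1 m) //= !ffunE eqxx big1.
  by rewrite addr0 /GRing.scale /= mulr1.
by move=> k km; rewrite !ffunE eq_sym (negbTE km) scaler0.
Qed.

Lemma twisted_linearr (G X Z : finType) (op : G -> X -> Z) sg x :
  linear (@twisted G X Z op sg x).
Proof.
move=> c u v; rewrite /twisted scaler_sumr -big_split; apply: eq_bigr => g _.
rewrite scaler_sumr -big_split; apply: eq_bigr => k _ /=.
rewrite scalerA -scalerDl !ffunE; congr (_ *: _).
rewrite /GRing.scale /= !mulrDr; congr (_ + _).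
by rewrite [x g * _]mulrCA [RHS]mulrCA.
Qed.

Lemma twisted_linearl (G X Z : finType) (op : G -> X -> Z) sg v :
  linear (fun x => @twisted G X Z op sg x v).
Proof.
move=> c x y; rewrite /twisted scaler_sumr -big_split; apply: eq_bigr => g _.
rewrite scaler_sumr -big_split; apply: eq_bigr => k _ /=.
rewrite scalerA -scalerDl !ffunE; congr (_ *: _).
by rewrite /GRing.scale /= mulrDl mulrDr -mulrA mulrCA.
Qed.

HB.instance Definition _ (G X Z : finType) op sg x :=
  GRing.isLinear.Build K _ _ _ _ (@twisted_linearr G X Z op sg x).

Lemma twistedZl (G X Z : finType) (op : G -> X -> Z) sg c x v :
  twisted op sg (c *: x) v = c *: twisted op sg x v.
Proof.
rewrite /twisted scaler_sumr; apply: eq_bigr => g _; rewrite scaler_sumr.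
apply: eq_bigr => k _; rewrite scalerA !ffunE; congr (_ *: _).
by rewrite /GRing.scale /= -mulrA mulrCA.
Qed.

Lemma twisted_suml (G X Z I : finType) (op : G -> X -> Z) sg
    (F : I -> {ffun G -> K^o}) v :
  twisted op sg (\sum_i F i) v = \sum_i twisted op sg (F i) v.
Proof.
rewrite /twisted [RHS]exchange_big; apply: eq_bigr => g _.
rewrite [RHS]exchange_big; apply: eq_bigr => k _ /=.
rewrite -scaler_suml; congr (_ *: _).
by rewrite sum_ffunE mulr_suml mulr_sumr.
Qed.

Lemma twistedZr (G X Z : finType) (op : G -> X -> Z) sg c x v :
  twisted op sg x (c *: v) = c *: twisted op sg x v.
Proof. exact: linearZ. Qed.

Lemma twisted_sumr (G X Z I : finType) (op : G -> X -> Z) sg x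
    (F : I -> {ffun X -> K^o}) :
  twisted op sg x (\sum_i F i) = \sum_i twisted op sg x (F i).
Proof. exact: linear_sum. Qed.

Lemma twisted_basis (G X Z : finType) (op : G -> X -> Z) sg g k :
  twisted op sg (basis_elt g) (basis_elt k)
    = (-1) ^+ sg g k *: basis_elt (op g k).
Proof.
rewrite /twisted (bigD1 g) //= [X in _ + X]big1 ?addr0.
  rewrite (bigD1 k) //= [X in _ + X]big1 ?addr0 ?ffunE ?eqxx ?mulr1 //.
  by move=> l lk; rewrite !ffunE (negbTE lk) !mulr0 scale0r.
move=> h hg; apply: big1 => l _.
by rewrite !ffunE (negbTE hg) mul0r mulr0 scale0r.
Qed.

Lemma twisted_assoc (G H X Y Z T : finType) (op1 : G -> H -> Y)
    (op2 : Y -> X -> T) (op3 : H -> X -> Z) (op4 : G -> Z -> T)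
    sg1 sg2 sg3 sg4 :
  (forall g h k, op2 (op1 g h) k = op4 g (op3 h k)) ->
  (forall g h k, sg1 g h (+) sg2 (op1 g h) k
                   = sg3 h k (+) sg4 g (op3 h k)) ->
  forall x y v, twisted op2 sg2 (twisted op1 sg1 x y) v
    = twisted op4 sg4 x (twisted op3 sg3 y v).
Proof.
move=> opA sgA x y v.
rewrite (basis_decomp x) (twisted_suml op1) (twisted_suml op2) (twisted_suml op4).
apply: eq_bigr => g _; rewrite !twistedZl; congr (_ *: _).
rewrite (basis_decomp y) (twisted_sumr op1) (twisted_suml op2) (twisted_suml op3).
rewrite (twisted_sumr op4); apply: eq_bigr => h _.
rewrite !(twistedZr, twistedZl); congr (_ *: _).
rewrite (basis_decomp v) (twisted_sumr op2) (twisted_sumr op3) (twisted_sumr op4).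
apply: eq_bigr => k _; rewrite !twistedZr; congr (_ *: _).
rewrite !twisted_basis twistedZl twistedZr !twisted_basis !scalerA.
by rewrite -!signr_addb sgA opA.
Qed.

End TwistedBilinear.

Section Signs.
Local Open Scope nat_scope.
Variable n : nat.
Implicit Types (I J K : {set 'I_n}) (s t : 'S_n).

Definition symdiff I J : {set 'I_n} := [set a | (a \in I) (+) (a \in J)].

(* Parity of the number of pairs (a, b) in I x J with b <= a: writing c_I for
   the increasing product of the c_a, a in I, the relations give
   c_I c_J = (-1)^(clifford_sign I J) c_(symdiff I J). *)
Definition clifford_sign I J : bool :=
  \big[addb/false]_(a < n) \big[addb/false]_(b < n)
     [&& a \in I, b \in J & b <= a].

(* Parity of the number of inversions of s on I, so that
   s c_I = (-1)^(inversion_sign s I) c_(s(I)) s. *)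
Definition inversion_sign s I : bool :=
  \big[addb/false]_(a < n) \big[addb/false]_(b < n)
     [&& a \in I, b \in I, a < b & s b < s a].

Lemma mem_perm_imset s I a : (a \in s @: I) = ((s^-1)%g a \in I).
Proof. by rewrite -{1}(permKV s a) mem_imset //; exact: perm_inj. Qed.

Lemma perm_imset_symdiff s I J :
  s @: symdiff I J = symdiff (s @: I) (s @: J).
Proof. by apply/setP => a; rewrite mem_perm_imset !inE !mem_perm_imset. Qed.

Lemma perm_imsetM s t I : (t * s)%g @: I = s @: (t @: I).
Proof. by apply/setP => a; rewrite !mem_perm_imset invMg permM. Qed.

Lemma clifford_signDl I J K : clifford_sign (symdiff I J) K
  = clifford_sign I K (+) clifford_sign J K.
Proof.
rewrite /clifford_sign -big_split; apply: eq_bigr => a _.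
rewrite -big_split; apply: eq_bigr => b _ /=.
by rewrite inE andb_addl.
Qed.

Lemma clifford_signDr I J K : clifford_sign I (symdiff J K)
  = clifford_sign I J (+) clifford_sign I K.
Proof.
rewrite /clifford_sign -big_split; apply: eq_bigr => a _.
rewrite -big_split; apply: eq_bigr => b _ /=.
by rewrite inE andb_addl andb_addr.
Qed.

Lemma clifford_sign_imset s I J : clifford_sign (s @: I) (s @: J)
  = \big[addb/false]_(a < n) \big[addb/false]_(b < n)
     [&& a \in I, b \in J & s b <= s a].
Proof.
rewrite /clifford_sign (reindex_inj (@perm_inj _ s)); apply: eq_bigr => a _ /=.
rewrite (reindex_inj (@perm_inj _ s)); apply: eq_bigr => b _ /=.
by rewrite !mem_imset //; exact: perm_inj.
Qed.

Lemma inversion_signD s I J : inversion_sign s (symdiff I J)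
  = inversion_sign s I (+) inversion_sign s J
    (+) (clifford_sign (s @: I) (s @: J) (+) clifford_sign I J).
Proof.
rewrite clifford_sign_imset /inversion_sign /clifford_sign.
pose X a b := [&& a \in I, b \in J, a < b & s b < s a].
pose Y a b := [&& a \in J, b \in I, a < b & s b < s a].
pose T (F : 'I_n -> 'I_n -> bool) :=
  \big[addb/false]_(a < n) \big[addb/false]_(b < n) F a b.
have TD F G : T F (+) T G = T (fun a b => F a b (+) G a b).
  rewrite /T -big_split; apply: eq_bigr => a _.
  by rewrite -big_split; apply: eq_bigr.
have eqT F G : F =2 G -> T F = T G.
  by move=> FG; apply: eq_bigr => a _; apply: eq_bigr => b _.
have TC F : T F = T (fun a b => F b a) by rewrite /T exchange_big.
have -> : T (fun a b => [&& a \in I, b \in J & s b <= s a])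
          (+) T (fun a b => [&& a \in I, b \in J & b <= a]) = T X (+) T Y.
  rewrite [T Y]TC !TD; apply: eqT => a b; rewrite /X /Y.
  case: (a \in I); case: (b \in J) => //=.
  case: (ltngtP a b) => [ab|ba|/val_inj ->]; last by rewrite leqnn.
  - have : (s a : nat) != s b.
      apply: contraTneq ab => /val_inj/perm_inj ->; by rewrite ltnn.
    by case: ltngtP.
  - have : (s a : nat) != s b.
      apply: contraTneq ba => /val_inj/perm_inj ->; by rewrite ltnn.
    by case: ltngtP.
rewrite -/(T _) -/(T _) -/(T _) !TD; apply: eqT => a b; rewrite /X /Y !inE.
by case: (a \in I); case: (b \in I); case: (a \in J); case: (b \in J);
  case: (a < b)%N; case: (s b < s a)%N.
Qed.

Lemma inversion_signM s t I : inversion_sign (t * s)%g I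
  = inversion_sign t I (+) inversion_sign s (t @: I).
Proof.
pose T (F : 'I_n -> 'I_n -> bool) :=
  \big[addb/false]_(a < n) \big[addb/false]_(b < n) F a b.
have TD F G : T F (+) T G = T (fun a b => F a b (+) G a b).
  rewrite /T -big_split; apply: eq_bigr => a _.
  by rewrite -big_split; apply: eq_bigr.
have eqT F G : F =2 G -> T F = T G.
  by move=> FG; apply: eq_bigr => a _; apply: eq_bigr => b _.
have TC F : T F = T (fun a b => F b a) by rewrite /T exchange_big.
have -> : inversion_sign s (t @: I)
  = T (fun a b => [&& a \in I, b \in I, t a < t b & s (t b) < s (t a)]).
  rewrite /inversion_sign (reindex_inj (@perm_inj _ t)).
  apply: eq_bigr => a _ /=.
  rewrite (reindex_inj (@perm_inj _ t)); apply: eq_bigr => b _ /=.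
  by rewrite !mem_imset //; exact: perm_inj.
pose Z a b := [&& a \in I, b \in I & [&& a < b, t b < t a & s (t a) < s (t b)]].
have -> : T (fun a b => [&& a \in I, b \in I, t a < t b & s (t b) < s (t a)])
  = T (fun a b => [&& a \in I, b \in I, a < b
                    & (t a < t b) && (s (t b) < s (t a))]) (+) T Z.
  rewrite [T Z]TC TD; apply: eqT => a b; rewrite /Z.
  case: (a \in I); case: (b \in I) => //=.
  case: (ltngtP a b) => [ab|ba|/val_inj ->] /=; last by rewrite ltnn.
    by rewrite addbF.
  by [].
rewrite /inversion_sign -/(T _) -/(T _) !TD; apply: eqT => a b; rewrite /Z !permM.
case: (a \in I); case: (b \in I) => //=.
case: (ltnP a b) => //= ab.
have : (t a : nat) != t b.
  apply: contraTneq ab => /val_inj/perm_inj ->; by rewrite ltnn.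
have : (s (t a) : nat) != s (t b).
  apply: contraTneq ab => /val_inj/perm_inj/perm_inj ->; by rewrite ltnn.
by case: (ltngtP (s (t a)) (s (t b))) => // _ _;
  case: (ltngtP (t a) (t b)).
Qed.

End Signs.

Section SergeevAlgebra.
Variables (K : comNzRingType) (n : nat).

(* The index (I, s) stands for the basis element c_I s of the semidirect
   product.  Since (t * s)%g is "t, then s", the product of permutations used
   in the algebra, the composite of s and t, is (t * s)%g. *)
Definition sergeev_index : finType := ({set 'I_n} * 'S_n)%type.

Definition index_mul (g h : sergeev_index) : sergeev_index :=
  (symdiff g.1 (g.2 @: h.1), (h.2 * g.2)%g).

Definition index_sign (g h : sergeev_index) : bool :=
  inversion_sign g.2 h.1 (+) clifford_sign g.1 (g.2 @: h.1).

Lemma index_mulA g h k : index_mul (index_mul g h) k = index_mul g (index_mul h k).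
Proof.
rewrite /index_mul /= mulgA perm_imset_symdiff -perm_imsetM; congr (_, _).
by apply/setP => a; rewrite !inE addbA.
Qed.

Lemma index_sign_cocycle s t (I J L : {set 'I_n}) :
  (inversion_sign s J (+) clifford_sign I (s @: J))
  (+) (inversion_sign (t * s)%g L
       (+) clifford_sign (symdiff I (s @: J)) ((t * s)%g @: L))
  = (inversion_sign t L (+) clifford_sign J (t @: L))
    (+) (inversion_sign s (symdiff J (t @: L))
         (+) clifford_sign I (s @: symdiff J (t @: L))).
Proof.
rewrite inversion_signD inversion_signM perm_imset_symdiff perm_imsetM.
rewrite clifford_signDl clifford_signDr.
case: (inversion_sign s J); case: (inversion_sign t L);
case: (inversion_sign s (t @: L)); case: (clifford_sign I (s @: J));
case: (clifford_sign I (s @: (t @: L))); case: (clifford_sign J (t @: L));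
by case: (clifford_sign (s @: J) (s @: (t @: L))).
Qed.

Definition sergeev : Type := {ffun sergeev_index -> K^o}.
HB.instance Definition _ := GRing.Lmodule.copy sergeev {ffun sergeev_index -> K^o}.

Definition sergeev_elt (g : sergeev_index) : sergeev := basis_elt K g.
Definition sergeev_one : sergeev := sergeev_elt (set0, 1%g).
Definition sergeev_mul : sergeev -> sergeev -> sergeev :=
  twisted index_mul index_sign.

Lemma sergeev_mulA : associative sergeev_mul.
Proof.
move=> x y z; apply/esym/twisted_assoc; first exact: index_mulA.
by move=> g h k; exact: index_sign_cocycle.
Qed.

Lemma imset_perm1 (I : {set 'I_n}) : (1 : 'S_n)%g @: I = I.
Proof. by apply/setP => a; rewrite mem_perm_imset invg1 perm1. Qed.

Lemma clifford_sign0l (I : {set 'I_n}) : clifford_sign set0 I = false.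
Proof. by rewrite /clifford_sign big1 // => a _; rewrite big1 // => b _; rewrite inE. Qed.

Lemma clifford_sign0r (I : {set 'I_n}) : clifford_sign I set0 = false.
Proof.
by rewrite /clifford_sign big1 // => a _; rewrite big1 // => b _; rewrite inE andbF.
Qed.

Lemma inversion_sign1 (I : {set 'I_n}) : inversion_sign 1 I = false.
Proof.
rewrite /inversion_sign big1 // => a _; rewrite big1 // => b _.
by rewrite !perm1; case: ltngtP; rewrite ?andbF.
Qed.

Lemma inversion_sign0 (s : 'S_n) : inversion_sign s set0 = false.
Proof.
by rewrite /inversion_sign big1 // => a _; rewrite big1 // => b _; rewrite inE.
Qed.

Lemma sergeev_mul1l : left_id sergeev_one sergeev_mul.
Proof.
move=> x; rewrite {1}(basis_decomp x) /sergeev_mul (twisted_sumr index_mul).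
rewrite [RHS](basis_decomp x); apply: eq_bigr => -[I s] _.
rewrite twistedZr twisted_basis /index_sign /index_mul /= mulg1 imset_perm1.
rewrite inversion_sign1 clifford_sign0l expr0 scale1r.
by congr (_ *: basis_elt _ (_, _)); apply/setP => a; rewrite !inE.
Qed.

Lemma sergeev_mul1r : right_id sergeev_one sergeev_mul.
Proof.
move=> x; rewrite {1}(basis_decomp x) /sergeev_mul (twisted_suml index_mul).
rewrite [RHS](basis_decomp x); apply: eq_bigr => -[I s] _.
rewrite twistedZl twisted_basis /index_sign /index_mul /= mul1g imset0.
rewrite inversion_sign0 clifford_sign0r expr0 scale1r.
by congr (_ *: basis_elt _ (_, _)); apply/setP => a; rewrite !inE addbF.
Qed.

Lemma sergeev_mulDl : left_distributive sergeev_mul +%R.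
Proof.
move=> x y z; have := twisted_linearl index_mul index_sign z 1 x y.
by rewrite !scale1r.
Qed.

Lemma sergeev_mulDr : right_distributive sergeev_mul +%R.
Proof.
move=> x y z; have := twisted_linearr index_mul index_sign x 1 y z.
by rewrite !scale1r.
Qed.

Lemma sergeev_one_neq0 : sergeev_one != 0.
Proof.
apply/eqP => /ffunP/(_ (set0, 1%g)); rewrite !ffunE eqxx => /eqP.
by rewrite oner_eq0.
Qed.

HB.instance Definition _ := GRing.Zmodule_isNzRing.Build sergeev
  sergeev_mulA sergeev_mul1l sergeev_mul1r sergeev_mulDl sergeev_mulDr
  sergeev_one_neq0.

HB.instance Definition _ := GRing.Lmodule_isLalgebra.Build K sergeev
  (fun a x y => esym (twistedZl index_mul index_sign a x y)).

HB.instance Definition _ := GRing.Lalgebra_isAlgebra.Build K sergeev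
  (fun a x y => esym (twistedZr index_mul index_sign a x y)).

Definition clifford_gen (a : 'I_n) : sergeev := sergeev_elt ([set a], 1%g).
Definition perm_elt (s : 'S_n) : sergeev := sergeev_elt (set0, s).

Lemma sergeev_elt_mul g h : sergeev_elt g * sergeev_elt h
  = (-1) ^+ index_sign g h *: sergeev_elt (index_mul g h).
Proof. exact: twisted_basis. Qed.

Lemma clifford_sign1 (a b : 'I_n) : clifford_sign [set a] [set b] = (b <= a)%N.
Proof.
rewrite /clifford_sign (bigD1 a) //= [X in _ (+) X]big1 ?addbF => [|i ia].
  rewrite (bigD1 b) //= [X in _ (+) X]big1 ?addbF => [|j jb].
    by rewrite !inE !eqxx.
  by rewrite !inE (negbTE jb) andbF.
by rewrite big1 // => j _; rewrite !inE (negbTE ia).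
Qed.

Lemma clifford_gen_sqr a : clifford_gen a * clifford_gen a = -1.
Proof.
rewrite sergeev_elt_mul /index_sign /index_mul /= imset_perm1 inversion_sign1.
rewrite clifford_sign1 leqnn /= expr1 scaleN1r mulg1; congr (- sergeev_elt (_, _)).
by apply/setP => i; rewrite !inE addbb.
Qed.

Lemma clifford_gen_anti a b : a != b ->
  clifford_gen a * clifford_gen b = - (clifford_gen b * clifford_gen a).
Proof.
move=> ab; rewrite !sergeev_elt_mul /index_sign /index_mul /= !imset_perm1.
rewrite !inversion_sign1 !clifford_sign1 /= mulg1.
have -> : symdiff [set a] [set b] = symdiff [set b] [set a].
  by apply/setP => i; rewrite !inE addbC.
move: ab; rewrite -val_eqE /=.
by case: ltngtP => //= _ _; rewrite expr0 expr1 scale1r scaleN1r ?opprK.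
Qed.

Lemma perm_elt_mul s t : perm_elt s * perm_elt t = perm_elt (t * s)%g.
Proof.
rewrite sergeev_elt_mul /index_sign /index_mul /= imset0 inversion_sign0.
rewrite clifford_sign0r expr0 scale1r; congr (sergeev_elt (_, _)).
by apply/setP => i; rewrite !inE.
Qed.

Lemma perm_clifford s a :
  perm_elt s * clifford_gen a = clifford_gen (s a) * perm_elt s.
Proof.
rewrite !sergeev_elt_mul /index_sign /index_mul /= !imset_set1 imset0 mul1g mulg1.
rewrite clifford_sign0l clifford_sign0r inversion_sign0 addbF.
have -> : inversion_sign s [set a] = false.
  rewrite /inversion_sign big1 // => i _; rewrite big1 // => j _.
  rewrite !inE; case: eqP => //= ->; case: eqP => //= ->.
  by rewrite ltnn.
rewrite expr0 !scale1r; congr (sergeev_elt (_, _)).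
by apply/setP => i; rewrite !inE addbF.
Qed.

Lemma clifford_prod (r : seq 'I_n) : sorted ltn (map val r) ->
  \prod_(a <- r) clifford_gen a = sergeev_elt ([set a in r], 1%g).
Proof.
elim: r => [|a r IH] /=; first by rewrite big_nil set_nil.
move=> ar; rewrite big_cons IH ?(path_sorted ar) //.
rewrite sergeev_elt_mul /index_sign /index_mul /= imset_perm1 inversion_sign1.
have ltr b : b \in r -> (a < b)%N.
  move=> br; move: ar; rewrite (path_sortedE ltn_trans) => /andP[/allP + _].
  by apply; exact: map_f.
rewrite mulg1 [clifford_sign _ _]big1 => [|i _]; last first.
  rewrite big1 // => j _; rewrite !inE; case: eqP => //= ->.
  by case: (boolP (j \in r)) => // /ltr; rewrite ltnNge => /negbTE.
rewrite expr0 scale1r; congr (sergeev_elt (_, _)).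
apply/setP => b; rewrite !inE; case: eqP => [->|] //=.
by case: (boolP (a \in r)) => // /ltr; rewrite ltnn.
Qed.

Lemma sergeev_eltE (I : {set 'I_n}) s :
  sergeev_elt (I, s) = (\prod_(a <- enum I) clifford_gen a) * perm_elt s.
Proof.
rewrite clifford_prod; last first.
  have -> : map val (enum I) = [seq i <- iota 0 n | i \in map val (enum I)].
    rewrite -val_enum_ord filter_map; congr map.
    rewrite {1}/enum_mem -enumT; apply: eq_filter => a /=.
    by rewrite mem_map ?mem_enum //; exact: val_inj.
  by apply: sorted_filter; [exact: ltn_trans | exact: iota_ltn_sorted].
rewrite sergeev_elt_mul /index_sign /index_mul /= imset0 mulg1.
rewrite inversion_sign0 clifford_sign0r expr0 scale1r.
by congr (sergeev_elt (_, _)); apply/setP => a; rewrite !inE mem_enum addbF.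
Qed.

(* Jucys-Murphy element with 0-based index m, which is x_(m+1) in the usual
   numbering. *)
Definition jucys_murphy (m : nat) : sergeev :=
  \sum_(b < n | b == m :> nat) \sum_(a < n | (a < b)%N)
    perm_elt (tperm a b) * (1 + clifford_gen a * clifford_gen b).

End SergeevAlgebra.

Section Operators.
Variable K : comNzRingType.

(* Operators on the free module with basis I, given by their matrix entries:
   basis_elt j is sent to \sum_i M i j *: basis_elt i. *)
Definition operator_fun (I : finType) (M : I -> I -> K) (v : {ffun I -> K^o}) :
  {ffun I -> K^o} := [ffun i => \sum_j M i j * v j].

Lemma operator_fun_linear (I : finType) M : linear (@operator_fun I M).
Proof.
move=> c u v; apply/ffunP => i; rewrite !ffunE /GRing.scale /= mulr_sumr.
rewrite -big_split; apply: eq_bigr => j _ /=.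
by rewrite !ffunE mulrDr; congr (_ + _); rewrite mulrCA.
Qed.

HB.instance Definition _ (I : finType) M :=
  GRing.isLinear.Build K _ _ _ _ (@operator_fun_linear I M).

Definition operator (I : finType) (M : I -> I -> K) : 'End({ffun I -> K^o}) :=
  linfun (operator_fun M).

Definition entry (I : finType) (A : 'End({ffun I -> K^o})) (i j : I) : K :=
  A (basis_elt K j) i.

Lemma operatorE (I : finType) (M : I -> I -> K) v i :
  operator M v i = \sum_j M i j * v j.
Proof. by rewrite lfunE ffunE. Qed.

Lemma entry_operator (I : finType) (M : I -> I -> K) i j :
  entry (operator M) i j = M i j.
Proof.
rewrite /entry operatorE (bigD1 j) //= ffunE eqxx mulr1 big1 ?addr0 //.
by move=> k kj; rewrite ffunE (negbTE kj) mulr0.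
Qed.

Lemma entryP (I : finType) (A B : 'End({ffun I -> K^o})) :
  entry A =2 entry B -> A = B.
Proof.
move=> AB; apply/lfunP => v; rewrite (basis_decomp v) !linear_sum.
apply: eq_bigr => j _; rewrite !linearZ; congr (_ *: _).
by apply/ffunP => i; exact: AB.
Qed.

Variable N : nat.

(* The index set {-N, ..., -1, 1, ..., N}: (false, k) is k + 1 and (true, k) is
   -(k + 1), so that the parity of i is i.1. *)
Definition super_index : finType := (bool * 'I_N)%type.
Definition opp_index (i : super_index) : super_index := (~~ i.1, i.2).

Definition superspace := {ffun super_index -> K^o}.
Definition matrix_unit (i j : super_index) : 'End(superspace) :=
  operator (fun k l => ((k == i) && (l == j))%:R).

Variable n : nat.

(* The n-th tensor power, through its basis e_(k 0) (x) ... (x) e_(k n.-1). *)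
Definition multi_index : finType := {ffun 'I_n -> super_index}.
Definition tensor_space := {ffun multi_index -> K^o}.

(* X acting in the a-th tensor factor, with the sign rule
   (1 (x) X) (u (x) v) = (-1)^(deg X deg u) u (x) X v
   applied to the homogeneous components of X. *)
Definition in_copy (a : 'I_n) (X : 'End(superspace)) : 'End(tensor_space) :=
  operator (fun k l : multi_index =>
    if [forall b, (b != a) ==> (k b == l b)] then
      (-1) ^+ (((k a).1 (+) (l a).1)
               && \big[addb/false]_(b < n | (b < a)%N) (l b).1)
      * entry X (k a) (l a)
    else 0).

Definition queer_J : 'End(superspace) :=
  \sum_(i : super_index) (-1) ^+ i.1 *: matrix_unit i (opp_index i).

(* The tensor E_ij (x) E_ji placed in copies a < b is the composite of E_ij in
   copy a and E_ji in copy b. *)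
Definition super_flip (a b : 'I_n) : 'End(tensor_space) :=
  \sum_(i : super_index) \sum_(j : super_index) (-1) ^+ j.1 *:
    (in_copy a (matrix_unit i j) \o in_copy b (matrix_unit j i))%VF.

Definition super_trace (A : 'End(tensor_space)) : K :=
  \sum_(k : multi_index) (-1) ^+ (\big[addb/false]_(a < n) (k a).1) * entry A k k.

End Operators.

Section SergeevAction.
Variables (K : comNzRingType) (N n : nat).

Definition odd_places (k : multi_index N n) : {set 'I_n} := [set a | (k a).1].

(* c_I s sends the basis tensor e_k to (-1)^(act_sign (I, s) k) times the basis
   tensor act_index (I, s) k; see sergeev_act_clifford, sergeev_act_tperm and
   sergeev_actM below. *)
Definition act_index (g : sergeev_index n) (k : multi_index N n) :
    multi_index N n :=
  [ffun a => if a \in g.1 then opp_index (k ((g.2^-1)%g a))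
             else k ((g.2^-1)%g a)].

Definition act_sign (g : sergeev_index n) (k : multi_index N n) : bool :=
  odd #|g.1| (+) inversion_sign g.2 (odd_places k)
  (+) clifford_sign g.1 (g.2 @: odd_places k).

Definition sergeev_act (x : sergeev K n) : 'End(tensor_space K N n) :=
  linfun (twisted act_index act_sign x).

Lemma odd_places_act g k :
  odd_places (act_index g k) = symdiff g.1 (g.2 @: odd_places k).
Proof.
apply/setP => a; rewrite !inE mem_perm_imset !inE ffunE.
by case: (a \in g.1).
Qed.

Lemma opp_indexK : involutive (@opp_index N).
Proof. by case=> b i; rewrite /opp_index /= negbK. Qed.

Lemma act_indexM g h k :
  act_index (index_mul g h) k = act_index g (act_index h k).
Proof.
apply/ffunP => a; rewrite !ffunE /= inE mem_perm_imset invMg permM.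
by case: (a \in g.1); case: (_ \in h.1); rewrite /= ?opp_indexK.
Qed.

Lemma odd_card_symdiff (I J : {set 'I_n}) :
  odd #|symdiff I J| = odd #|I| (+) odd #|J|.
Proof.
have odd_card (A : {set 'I_n}) : odd #|A| = \big[addb/false]_a (a \in A).
  rewrite -sum1_card (big_morph odd oddD (erefl _ : odd 0 = false)).
  by rewrite [LHS]big_mkcond; apply: eq_bigr => a _; case: (a \in A).
rewrite !odd_card -big_split; apply: eq_bigr => a _.
by rewrite inE.
Qed.

Lemma sergeev_actE x v : sergeev_act x v = twisted act_index act_sign x v.
Proof. exact: lfunE. Qed.

Lemma sergeev_act_linear : linear sergeev_act.
Proof.
move=> c x y; apply/lfunP => v; rewrite add_lfunE scale_lfunE !sergeev_actE.
exact: twisted_linearl.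
Qed.

HB.instance Definition _ :=
  GRing.isLinear.Build K _ _ _ _ sergeev_act_linear.

Lemma sergeev_actM x y :
  sergeev_act (x * y) = (sergeev_act x \o sergeev_act y)%VF.
Proof.
apply/lfunP => v; rewrite comp_lfunE !sergeev_actE.
apply: twisted_assoc => [|g h k]; first exact: act_indexM.
rewrite /act_sign /index_sign odd_places_act odd_card_symdiff.
rewrite card_imset; last exact: perm_inj.
move: (index_sign_cocycle g.2 h.2 g.1 h.1 (odd_places k)).
rewrite /index_mul /=.
case: (odd #|g.1|); case: (odd #|h.1|); case: (inversion_sign g.2 h.1);
case: (clifford_sign g.1 (g.2 @: h.1)); case: (inversion_sign h.2 _);
case: (clifford_sign h.1 _); case: (inversion_sign (h.2 * g.2)%g _);
case: (clifford_sign (symdiff _ _) _); case: (inversion_sign g.2 _);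
by case: (clifford_sign g.1 _).
Qed.

Lemma sergeev_act1 : sergeev_act 1 = \1%VF.
Proof.
apply/lfunP => v; rewrite sergeev_actE id_lfunE {1}(basis_decomp v).
rewrite (twisted_sumr act_index) [RHS](basis_decomp v).
apply: eq_bigr => k _; rewrite twistedZr twisted_basis /act_sign /=.
rewrite cards0 inversion_sign1 clifford_sign0l expr0 scale1r.
congr (_ *: basis_elt _ _); apply/ffunP => a.
by rewrite ffunE inE invg1 perm1.
Qed.

Lemma entry_sergeev_act g k l : entry (sergeev_act (sergeev_elt K g)) k l
  = (-1) ^+ act_sign g l * (k == act_index g l)%:R.
Proof. by rewrite /entry sergeev_actE twisted_basis !ffunE. Qed.

Lemma entry_matrix_unit (i j k l : super_index N) :
  entry (matrix_unit K i j) k l = ((k == i) && (l == j))%:R.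
Proof. exact: entry_operator. Qed.

Lemma entry_queer_J (k l : super_index N) :
  entry (queer_J K N) k l = (-1) ^+ k.1 * (l == opp_index k)%:R.
Proof.
rewrite /queer_J /entry sum_lfunE sum_ffunE (bigD1 k) //= big1 => [|i ik].
  rewrite addr0 scale_lfunE ffunE; congr (_ * _).
  by rewrite [LHS]entry_matrix_unit eqxx.
rewrite scale_lfunE ffunE [X in _ *: X]entry_matrix_unit.
by rewrite eq_sym (negbTE ik) scaler0.
Qed.

Lemma act_sign_clifford (a : 'I_n) (l : multi_index N n) :
  act_sign ([set a], 1%g) l
    = ~~ \big[addb/false]_(b < n | (b <= a)%N) (l b).1.
Proof.
rewrite /act_sign /= cards1 inversion_sign1 imset_perm1 /= /clifford_sign.
rewrite (bigD1 a) //= [X in _ (+) X]big1 ?addbF => [|i ia]; last first.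
  by rewrite big1 // => j _; rewrite !inE (negbTE ia).
rewrite [in RHS]big_mkcond; congr (~~ _); apply: eq_bigr => b _.
by rewrite !inE eqxx /= andbC; case: leqP.
Qed.

Lemma sergeev_act_clifford a :
  sergeev_act (clifford_gen K a) = in_copy a (queer_J K N).
Proof.
apply: entryP => k l; rewrite entry_sergeev_act entry_operator.
rewrite act_sign_clifford entry_queer_J.
have -> : (k == act_index ([set a], 1%g) l)
    = [forall b, (b != a) ==> (k b == l b)] && (l a == opp_index (k a)).
  apply/eqP/andP => [->|[/forallP kl /eqP la]].
    split; last by rewrite ffunE inE eqxx invg1 perm1 opp_indexK.
    apply/forallP => b; apply/implyP => ba.
    by rewrite ffunE inE (negbTE ba) invg1 perm1.
  apply/ffunP => b; rewrite ffunE inE invg1 perm1.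
  case: eqP => [->|/eqP ba]; first by rewrite la opp_indexK.
  by have /implyP/(_ ba)/eqP := kl b.
case: ifP => _ /=; last by rewrite mulr0.
case: eqP => [la|]; last by rewrite !mulr0.
rewrite !mulr1 -signr_addb; congr (_ ^+ nat_of_bool _).
rewrite (bigD1 a) //= la /=.
rewrite (eq_bigl (fun b : 'I_n => (b < a)%N)) => [|b]; last first.
  by rewrite ltn_neqAle andbC.
by case: (k a).1; case: (\big[_/_]_(_ < _ | _) _).
Qed.

Definition update (l : multi_index N n) (a : 'I_n) (i : super_index N) :
    multi_index N n := [ffun b => if b == a then i else l b].

Definition odd_before (l : multi_index N n) (a : 'I_n) : bool :=
  \big[addb/false]_(b < n | (b < a)%N) (l b).1.

Lemma in_copy_matrix_unit a i j (l : multi_index N n) :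
  in_copy a (matrix_unit K i j) (basis_elt K l) =
    ((-1) ^+ ((i.1 (+) j.1) && odd_before l a) * (l a == j)%:R)
      *: basis_elt K (update l a i).
Proof.
apply/ffunP => k; rewrite -[LHS]/(entry _ k l) entry_operator.
rewrite entry_matrix_unit !ffunE.
have -> : (k == update l a i)
    = [forall b, (b != a) ==> (k b == l b)] && (k a == i).
  apply/eqP/andP => [->|[/forallP kl /eqP ka]].
    split; last by rewrite ffunE eqxx.
    by apply/forallP => b; apply/implyP => ba; rewrite ffunE (negbTE ba).
  apply/ffunP => b; rewrite ffunE; case: eqP => [->//|/eqP ba].
  by have /implyP/(_ ba)/eqP := kl b.
case: ifP => _ /=; last by rewrite scaler0.
case: eqP => [ka|_] /=; last by rewrite mulr0 scaler0.
case: eqP => [la|_] /=; last by rewrite !mulr0 scale0r.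
by rewrite ka la /GRing.scale /= !mulr1.
Qed.

Lemma big_addb_if (P : pred 'I_n) (F : 'I_n -> bool) :
  \big[addb/false]_(i | P i) F i = \big[addb/false]_i (P i && F i).
Proof. by rewrite big_mkcond; apply: eq_bigr => i _; case: (P i). Qed.

Lemma inversion_sign_tperm (a b : 'I_n) (I : {set 'I_n}) : (a < b)%N ->
  inversion_sign (tperm a b) I = ((a \in I) && (b \in I)) (+)
    (((a \in I) (+) (b \in I))
     && \big[addb/false]_(c < n | (a < c < b)%N) (c \in I)).
Proof.
move=> ab; have neq_ab : a != b by rewrite -val_eqE /= neq_ltn ab.
rewrite /inversion_sign.
pose X (c d : 'I_n) := [&& c == a, d == b, a \in I & b \in I].
pose Y (c d : 'I_n) := [&& c == a, (a < d < b)%N, a \in I & d \in I].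
pose Z (c d : 'I_n) := [&& d == b, (a < c < b)%N, c \in I & b \in I].
pose T (F : 'I_n -> 'I_n -> bool) :=
  \big[addb/false]_(c < n) \big[addb/false]_(d < n) F c d.
transitivity (T X (+) (T Y (+) T Z)).
  rewrite /T -!big_split; apply: eq_bigr => c _; rewrite -!big_split.
  apply: eq_bigr => d _ /=; rewrite /X /Y /Z.
  have [ca|ca] := eqVneq c a; have [db|db] := eqVneq d b;
    [subst c d | subst c | subst d | ];
    rewrite ?tpermL ?tpermR ?ab ?ltnn /= ?andbT ?andbF ?addbF //.
  - case: (tpermP a b d) db => [->|->|/eqP da _ _]; rewrite ?ltnn ?eqxx ?andbF //.
    move: da; rewrite -val_eqE /=.
    case: (a \in I); case: (d \in I) => //=; rewrite ?andbF //=.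
    by rewrite andbT.
  - case: (tpermP a b c) ca => [->|->|_ /eqP cb _]; rewrite ?ltnn ?eqxx ?andbF //.
    move: cb; rewrite -val_eqE /=.
    case: (b \in I); case: (c \in I) => //=; rewrite ?andbF //=.
    by rewrite andbT andbC.
  - case: (tpermP a b c) ca => [->|->|_ /eqP cb ca]; rewrite ?eqxx //.
      case: (tpermP a b d) db => [->|->|_ _ _ _]; rewrite ?eqxx //.
        by rewrite (ltnNge b a) (ltnW ab) /= ?andbF.
      case: (ltnP b d) => [bd|]; rewrite ?andbF //=.
      by rewrite (ltnNge d a) (ltnW (ltn_trans ab bd)) /= !andbF.
    case: (tpermP a b d) db => [->|->|_ _ _]; rewrite ?eqxx //.
      case: (ltnP c a) => [ca'|]; rewrite ?andbF //=.
      by rewrite (ltnNge b c) (ltnW (ltn_trans ca' ab)) /= !andbF.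
    by case: (ltngtP c d); rewrite ?andbF.
have TX : T X = (a \in I) && (b \in I).
  rewrite /T (bigD1 a) //= [X in _ (+) X]big1 ?addbF => [|c ca]; last first.
    by rewrite big1 // => d _; rewrite /X (negbTE ca).
  rewrite (bigD1 b) //= [X in _ (+) X]big1 ?addbF => [|d db].
    by rewrite /X !eqxx.
  by rewrite /X (negbTE db) andbF.
have TY : T Y = (a \in I)
    && \big[addb/false]_(c < n | (a < c < b)%N) (c \in I).
  rewrite /T (bigD1 a) //= [X in _ (+) X]big1 ?addbF => [|c ca]; last first.
    by rewrite big1 // => d _; rewrite /Y (negbTE ca).
  rewrite /Y eqxx /=; case: (a \in I) => /=; first by rewrite [RHS]big_addb_if.
  by rewrite big1 // => d _; rewrite andbF.
have TZ : T Z = (b \in I)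
    && \big[addb/false]_(c < n | (a < c < b)%N) (c \in I).
  rewrite /T exchange_big (bigD1 b) //= [X in _ (+) X]big1 ?addbF => [|d db].
    rewrite /Z eqxx /=; case: (b \in I) => /=.
      by rewrite [RHS]big_addb_if; apply: eq_bigr => c _; rewrite andbT.
    by rewrite big1 // => c _; rewrite !andbF.
  by rewrite big1 // => c _; rewrite /Z (negbTE db).
by rewrite TX TY TZ andb_addl.
Qed.

Lemma sergeev_act_tperm (a b : 'I_n) : (a < b)%N ->
  sergeev_act (perm_elt K (tperm a b)) = super_flip K N a b.
Proof.
move=> ab; have neq_ab : a != b by rewrite -val_eqE /= neq_ltn ab.
apply: entryP => k l; rewrite /entry; congr (fun_of_fin _ k).
rewrite sergeev_actE twisted_basis.
rewrite /super_flip sum_lfunE (bigD1 (l b)) //= [X in _ + X]big1 => [|i ib].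
  rewrite addr0 sum_lfunE (bigD1 (l a)) //= [X in _ + X]big1 => [|j ja].
    rewrite addr0 scale_lfunE comp_lfunE in_copy_matrix_unit eqxx mulr1.
    rewrite linearZ /= in_copy_matrix_unit ffunE (negbTE neq_ab) eqxx mulr1.
    rewrite !scalerA -!signr_addb; congr (_ ^+ nat_of_bool _ *: basis_elt _ _).
      rewrite /act_sign /= cards0 clifford_sign0l addbF /=.
      rewrite inversion_sign_tperm // !inE.
      have -> : odd_before (update l b (l a)) a = odd_before l a.
        apply: eq_bigr => c ca; rewrite ffunE; case: eqP ca => // ->.
        by rewrite ltnNge (ltnW ab).
      have -> : odd_before l b = odd_before l a (+) ((l a).1
          (+) \big[addb/false]_(c < n | (a < c < b)%N) (l c).1).
        rewrite /odd_before (bigID (fun c : 'I_n => (c < a)%N)) /=.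
        congr (_ (+) _).
          apply: eq_bigl => c; case: (ltnP c a) => ca; last by rewrite andbF.
          by rewrite (ltn_trans ca ab).
        rewrite (bigD1 a) /=; last by rewrite ab ltnn.
        congr (_ (+) _); apply: eq_bigl => c; rewrite -leqNgt -val_eqE /=.
        by case: (ltngtP a c) => //=; rewrite ?andbT ?andbF.
      have -> : \big[addb/false]_(c < n | (a < c < b)%N) (c \in odd_places l)
          = \big[addb/false]_(c < n | (a < c < b)%N) (l c).1.
        by apply: eq_bigr => c _; rewrite inE.
      case: (l a).1; case: (l b).1; case: (odd_before l a);
      by case: (\big[addb/false]_(_ < _ | _) _).
    apply/ffunP => c; rewrite !ffunE inE tpermV.
    by case: tpermP => [->|->|/eqP ca /eqP cb];
      rewrite ?eqxx ?(eq_sym b a) ?(negbTE neq_ab) ?(negbTE ca) ?(negbTE cb).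
  rewrite scale_lfunE comp_lfunE in_copy_matrix_unit linearZ /=.
  rewrite in_copy_matrix_unit ffunE (negbTE neq_ab) eq_sym (negbTE ja).
  by rewrite mulr0 scale0r !scaler0.
rewrite sum_lfunE big1 // => j _.
rewrite scale_lfunE comp_lfunE in_copy_matrix_unit eq_sym (negbTE ib).
by rewrite mulr0 scale0r linear0 scaler0.
Qed.
End SergeevAction.

(* Boxes are pairs (row, column), numbered from 0. *)
Definition strict_partition (lam : seq nat) : bool :=
  sorted gtn lam && (0%N \notin lam).

Definition shifted_diagram (lam : seq nat) : seq (nat * nat) :=
  [seq (i, (i + j)%N) | i <- iota 0 (size lam), j <- iota 0 (nth 0%N lam i)].

(* A barred tableau with entries 1, ..., n is the sequence of length n whose
   a-th term gives the box of the entry a and tells whether a is barred. *)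
Definition barred_entry : eqType := (nat * nat * bool)%type.

Definition increasing_boxes (p q : nat * nat) : bool :=
  ((p.1 == q.1) ==> (p.2 < q.2)%N) && ((p.2 == q.2) ==> (p.1 < q.1)%N).

(* Entries increase along rows and down columns exactly when, for all entries
   a < b in the same row (column), a is to the left of (above) b. *)
Definition standard_barred (lam : seq nat) (U : seq barred_entry) : bool :=
  [&& perm_eq (unzip1 U) (shifted_diagram lam),
      pairwise increasing_boxes (unzip1 U)
    & all (fun x : barred_entry => x.2 ==> (x.1.1 != x.1.2)) U].

Definition row_lengths (U : seq barred_entry) : seq nat :=
  [seq count (fun x : barred_entry => x.1.1 == i) U
     | i <- iota 0 (size (undup [seq x.1.1 | x <- U]))].

Definition is_standard_barred (U : seq barred_entry) : bool :=
  strict_partition (row_lengths U) && standard_barred (row_lengths U) U.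

(* All ways to add an entry to V so as to get a standard barred tableau; the
   coordinates of the boxes of a shifted diagram with size V + 1 boxes are at
   most size V. *)
Definition additions (V : seq barred_entry) : seq barred_entry :=
  [seq x <- [seq (p, b) | p <- [seq (i, j) | i <- iota 0 (size V).+1,
                                             j <- iota 0 (size V).+1],
                          b <- [:: false; true]]
    | is_standard_barred (rcons V x)].

Section Idempotents.
Variables (C : numClosedFieldType) (n : nat).

Definition signed_content (x : barred_entry) : C :=
  let sigma := (x.1.2 - x.1.1)%N in
  (-1) ^+ x.2 * sqrtC (sigma * sigma.+1)%:R.

Definition idempotent_step (V : seq barred_entry) (x : barred_entry) :
    sergeev C n :=
  let kappa := signed_content x in
  let bs := [seq signed_content y | y <- additions V & y != x] in
  (\prod_(b <- bs) (kappa - b))^-1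
    *: \prod_(b <- bs) (jucys_murphy C n (size V) - b%:A).

(* The idempotent of the tableau formed by the entries 1, ..., m of U, in the
   algebra with n >= m letters: the algebras with fewer letters are identified
   with subalgebras of it. *)
Fixpoint idempotent_upto (U : seq barred_entry) (m : nat) : sergeev C n :=
  if m is m'.+1 then
    idempotent_upto U m' * idempotent_step (take m' U) (nth (0, 0, false)%N U m')
  else 1.

Definition tableau_idempotent (U : seq barred_entry) : sergeev C n :=
  idempotent_upto U (size U).

End Idempotents.

Section QueerModules.
Variables (K : fieldType) (N n : nat).

Definition queer_F (i j : super_index N) : 'End(superspace K N) :=
  matrix_unit K i j + matrix_unit K (opp_index i) (opp_index j).

Definition queer_algebra : {vspace 'End(superspace K N)} :=
  <<[seq queer_F i j | i <- enum (super_index N), j <- enum (super_index N)]>>%VS.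

Definition tensor_action (X : 'End(superspace K N)) : 'End(tensor_space K N n) :=
  \sum_(a < n) in_copy a X.

Implicit Types M : {vspace tensor_space K N n}.

Definition queer_submodule M : Prop :=
  forall X, X \in queer_algebra -> (tensor_action X @: M <= M)%VS.

(* The weight (mu_1, ..., mu_N) is in Z^N. *)
Definition weight_space M (mu : {ffun 'I_N -> int}) : {vspace tensor_space K N n} :=
  (M :&: \bigcap_(k < N)
     passmx.leigenspace (tensor_action (queer_F (false, k) (false, k)))
       (mu k)%:~R)%VS.

Definition integral_weight_module M : Prop :=
  exists mus : seq {ffun 'I_N -> int},
    (M <= \sum_(mu <- mus) weight_space M mu)%VS.

(* The coefficient of y_1^mu_1 ... y_N^mu_N in the polynomial p, viewed as a
   Laurent polynomial. *)
Definition laurent_coef (p : {mpoly K[N]}) (mu : {ffun 'I_N -> int}) : K :=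
  if [forall k, 0 <= mu k] then p@_[multinom `|mu k|%N | k < N] else 0.

(* M is a submodule of the tensor power on which the F_kk act diagonalizably
   with integer eigenvalues, and its character is p. *)
Definition has_character M (p : {mpoly K[N]}) : Prop :=
  [/\ queer_submodule M, integral_weight_module M
    & forall mu, (\dim (weight_space M mu))%:R = laurent_coef p mu].

End QueerModules.

Section SchurQ.
Variables (K : comNzRingType) (N : nat) (lam : seq nat).

(* (k, true) stands for k' and (k, false) for k; the order of the alphabet is
   that of the codes. *)
Definition marked_symbol : finType := ('I_N * bool)%type.
Definition symbol_code (s : marked_symbol) : nat := (s.1.*2 + ~~ s.2)%N.

Definition diagram_box : finType := seq_sub (shifted_diagram lam).

Definition marked_shifted (T : {ffun diagram_box -> marked_symbol}) : bool :=
  [forall p : diagram_box, forall q : diagram_box,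
     [&& ((val p).1 == (val q).1) && ((val p).2 < (val q).2)%N ==>
           (symbol_code (T p) <= symbol_code (T q))%N
             && ~~ ((T p == T q) && (T p).2)
       & ((val p).2 == (val q).2) && ((val p).1 < (val q).1)%N ==>
           (symbol_code (T p) <= symbol_code (T q))%N
             && ~~ ((T p == T q) && ~~ (T p).2)]].

Definition schur_Q : {mpoly K[N]} :=
  \sum_(T : {ffun diagram_box -> marked_symbol} | marked_shifted T)
    \prod_(p : diagram_box) 'X_(T p).1.

End SchurQ.

Section SupertraceY.
Variables (K : comNzRingType) (N n : nat).

Definition extend_scalars (L : comNzRingType) (f : K -> L)
    (A : 'End(tensor_space K N n)) : 'End(tensor_space L N n) :=
  operator (fun k l => f (entry A k l)).

(* Y has coefficients in the polynomial ring in y_1, ..., y_N. *)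
Definition variable_Y : 'End(superspace {mpoly K[N]} N) :=
  \sum_(i : super_index N) ((-1) ^+ i.1 * 'X_(i.2)) *: matrix_unit _ i i.

Definition tensor_Y : 'End(tensor_space {mpoly K[N]} N n) :=
  \big[(fun A B => (A \o B)%VF)/(\1%VF)]_(a < n) in_copy a variable_Y.

End SupertraceY.

(* Main.v *)
(* The spectrum of the squared Jucys-Murphy elements x_a^2 is described by
   standard sequences T of contents, giving orthogonal idempotents e_T with sum
   1; the bars of a tableau only split e_T further, conjugation by the odd c_a
   exchanging the two signs of x_a.  Every weight space of the tensor power is a
   cyclic module over the image of an idempotent symmetrizing a Young subgroup,
   so the dimension of its e_T-part is bounded by counting horizontal strips
   between shifted shapes, which is the branching rule for Schur Q-polynomials.
   Summing these bounds over all T and all weights gives exactly (2N)^n by the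
   Pieri rule, so each bound is an equality. *)

Require Import Defs.
From HB Require Import structures.
From mathcomp Require Import all_boot all_order all_fingroup all_algebra.
From mathcomp Require Import all_field.
From mathcomp Require Import reals complex mpoly.
From mathcomp Require Import zify ring.

Set Implicit Arguments.
Unset Strict Implicit.
Unset Printing Implicit Defensive.
Import GRing.Theory Num.Theory.
Delimit Scope nat_scope with N.
Local Open Scope ring_scope.

(** * Standard content sequences *)

(** No module is classified: since the global count turns upper bounds into equalities, only
    spanning sets and vanishing statements are proved. A shape enters through the multiset of its
    contents, so having the same shape means [perm_eq]. Three estimates meet. The corner of [e_T] is
    spanned by 2 or 4 words per box. The invariants of a strip with [m] boxes and [r] connected
    components have at most [2 ^ r / 2 ^ m] times the ambient dimension: adjacent strip boxes yield
    an annihilator linear in the odd [c_i] and [c_i x_i], and multiplying by another such element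
    then doubles the space. A strip with a repeated content reduces to two annihilators with nonzero
    scalar anticommutator, so nothing survives. The powers of 2 left over are the coefficients of
    [Q_1 Q_lambda], whence a total governed by [Q_1 ^ n]. That the [x_a ^ 2] have no nilpotent part
    comes from a positive definite form for which the [x_a] are self-adjoint. Passing from [e_T] to
    [e_U] divides all traces by one constant, and the signs of [Y] cancel those of the
    supertrace. *)

Section ContentSequences.
Local Open Scope nat_scope.
Implicit Types (T R : seq nat) (a b s t : nat).

(** A shifted shape is recorded by the number of its boxes on each diagonal. These numbers determine
    it, so two standard sequences fill the same shape exactly when they are permutations of each
    other. *)
Definition mult T s := count_mem s T.

Lemma mult_cons a T s : mult (a :: T) s = (a == s) + mult T s.
Proof. by []. Qed.

Lemma mult_cat T R s : mult (T ++ R) s = mult T s + mult R s.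
Proof. exact: count_cat. Qed.

Lemma mult_gt0 T s : (0 < mult T s) = (s \in T).
Proof. by rewrite -has_count has_pred1. Qed.

Lemma eq_mult T T' : perm_eq T T' -> mult T =1 mult T'.
Proof. by move=> /seq.permP TT' s; apply: TT'. Qed.

Lemma mult_rcons T a s : mult (rcons T a) s = mult T s + (a == s).
Proof. by rewrite -cats1 mult_cat mult_cons addn0. Qed.

(** The next box on diagonal [s] lies in row [mult T s]. Its left neighbour is on diagonal [s.-1]
    and must be present unless [s == 0]; its upper neighbour is on diagonal [s.+1], and since a
    shape has [mult T s.+1 <= mult T s], its presence becomes an equality. *)
Definition addable T s :=
  ((s == 0) || (mult T s < mult T s.-1))
  && (mult T s == mult T s.+1).

Fixpoint std_ext T R :=
  if R is a :: R' then addable T a && std_ext (rcons T a) R' else true.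

Definition std T := std_ext [::] T.

Definition far a b := (a.+1 < b) || (b.+1 < a).

Lemma eq_addable T T' s : perm_eq T T' -> addable T s = addable T' s.
Proof. by move=> TT'; rewrite /addable !(eq_mult TT'). Qed.

Lemma eq_std_ext T T' R : perm_eq T T' -> std_ext T R = std_ext T' R.
Proof.
elim: R T T' => //= a R IH T T' TT'; rewrite (eq_addable _ TT'); congr (_ && _).
by apply: IH; rewrite -!cats1 perm_cat2r.
Qed.

Lemma std_ext_cat T R1 R2 :
  std_ext T (R1 ++ R2) = std_ext T R1 && std_ext (T ++ R1) R2.
Proof.
elim: R1 T => [|a R1 IH] T /=; first by rewrite cats0.
by rewrite IH andbA cat_rcons.
Qed.

Lemma std_cat T R : std (T ++ R) = std T && std_ext T R.
Proof. exact: std_ext_cat. Qed.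

Lemma std_rcons T a : std (rcons T a) = std T && addable T a.
Proof. by rewrite -cats1 std_cat /= andbT. Qed.

(** [mult T s] is the number of rows longer than [s]; as the row lengths are distinct, it drops by
    at most one from a diagonal to the next. *)
Lemma std_count T s : std T ->
  mult T s.+1 <= mult T s <= (mult T s.+1).+1.
Proof.
elim/last_ind: T => // T a IH; rewrite std_rcons => /andP[/IH {}IH].
rewrite /addable !mult_rcons.
case: (eqVneq a s) => [->|nas]; case: (eqVneq a s.+1) => [eas|neas] //=.
all: subst; move=> /andP[] /=; lia.
Qed.

Lemma std_lt_size T s : std T -> s \in T -> s < size T.
Proof.
elim/last_ind: T s => // T a IH s; rewrite std_rcons => /andP[sT /andP[aT _]].
rewrite mem_rcons inE size_rcons => /orP[/eqP->|/(IH _ sT)]; last by move/ltnW.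
case/orP: aT => [/eqP -> //|aT].
have /(IH _ sT) : a.-1 \in T by rewrite -mult_gt0; lia.
lia.
Qed.

Lemma addable_le_size T s : std T -> addable T s -> s <= size T.
Proof.
move=> sT sa; have := @std_lt_size (rcons T s) s.
by rewrite std_rcons sT sa mem_rcons mem_head size_rcons ltnS => ->.
Qed.

Lemma std_ext_far T a b R : far a b ->
  std_ext T [:: a, b & R] -> std_ext T [:: b, a & R].
Proof.
move=> fab /= /and3P[aT bT abR]; apply/and3P; split; last first.
- suff /eq_std_ext <- : perm_eq (rcons (rcons T a) b) (rcons (rcons T b) a) by [].
  by rewrite -!cats1 -!catA perm_cat2l (perm_catC [:: a]).
- move: aT; rewrite /addable !mult_rcons; move: fab; rewrite /far.
  case: (eqVneq b a) => [|?]; case: (eqVneq b a.+1) => [|?];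
  case: (eqVneq b a.-1) => [|?] /=; lia.
move: bT; rewrite /addable !mult_rcons; move: fab; rewrite /far.
case: (eqVneq a b) => [|?]; case: (eqVneq a b.+1) => [|?];
case: (eqVneq a b.-1) => [|?] /=; lia.
Qed.

Lemma std_ext_neq T a b R : std_ext T [:: a, b & R] -> a != b.
Proof.
move=> /= /and3P[]; rewrite /addable !mult_rcons => aT bT _.
by apply/eqP => eab; subst b; move: aT bT; rewrite !eqxx; case: eqVneq; lia.
Qed.

(** When the contents differ by one, the second box touches the first, and only the first makes room
    for it. *)
Lemma std_ext_near T a b R : std_ext T [:: a, b & R] -> ~~ far a b ->
  ~~ addable T b.
Proof.
move=> abR nf; have nab := std_ext_neq abR; move: abR => /= /and3P[aT _ _].
apply/negP => bT; move: aT bT; rewrite /addable.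
have [->|->] : b = a.+1 \/ a = b.+1 by move: nf; rewrite /far; lia.
all: rewrite /=; lia.
Qed.

(* [P] ranges over properties transported by exchanging two consecutive
   entries with non-adjacent boxes. *)
Definition far_closed T (P : seq nat -> Prop) :=
  forall R1 a b R2, std_ext T (R1 ++ [:: a, b & R2]) -> far a b ->
    P (R1 ++ [:: a, b & R2]) -> P (R1 ++ [:: b, a & R2]).

Lemma std_ext_far_cat T R1 a b R2 : far a b ->
  std_ext T (R1 ++ [:: a, b & R2]) -> std_ext T (R1 ++ [:: b, a & R2]).
Proof. by move=> fab; rewrite !std_ext_cat => /andP[-> /(std_ext_far fab)]. Qed.

Lemma far_sym a b : far a b = far b a.
Proof. by rewrite /far orbC. Qed.

Lemma bubble_right T P R1 a R2 R3 : far_closed T P -> all (far a) R2 ->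
  std_ext T (R1 ++ a :: R2 ++ R3) -> P (R1 ++ a :: R2 ++ R3) ->
  std_ext T (R1 ++ R2 ++ a :: R3) /\ P (R1 ++ R2 ++ a :: R3).
Proof.
move=> cP; elim: R2 R1 => // b R2 IH R1 /= /andP[ab aR2] st Pa.
have /= := IH (rcons R1 b) aR2; rewrite !cat_rcons; apply.
  exact: std_ext_far_cat.
exact: cP.
Qed.

Lemma bubble_left T P R1 a R2 R3 : far_closed T P -> all (far a) R2 ->
  std_ext T (R1 ++ R2 ++ a :: R3) -> P (R1 ++ R2 ++ a :: R3) ->
  std_ext T (R1 ++ a :: R2 ++ R3) /\ P (R1 ++ a :: R2 ++ R3).
Proof.
move=> cP; elim/last_ind: R2 R3 => // R2 b IH R3; rewrite all_rcons => /andP[ab aR2].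
rewrite !cat_rcons => st Pa; apply: (IH (b :: R3)) => //.
  by move: st; rewrite !catA; apply: std_ext_far_cat; rewrite far_sym.
by move: st Pa; rewrite !catA => st; apply: cP => //; rewrite far_sym.
Qed.

(** The last box on diagonal [s] is a corner: nothing to its right (diagonal [s.+1]) and nothing
    below it (diagonal [s.-1]). *)
Definition removable T s :=
  (mult T s.+1 < mult T s) && ((s == 0) || (mult T s == mult T s.-1)).

Lemma last_removable T a : std (rcons T a) -> removable (rcons T a) a.
Proof.
rewrite std_rcons => /andP[sT]; have := std_count a.-1 sT.
rewrite /addable /removable !mult_rcons eqxx (_ : a == a.+1 = false); last by lia.
case: a => [|a] /= h; rewrite !addn0.
  by move=> /eqP ->; rewrite addn1 ltnS leqnn.
rewrite (_ : a.+1 == a = false) ?addn0 ?addn1; last by lia.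
move=> /andP[h1 /eqP e]; move: h; rewrite -e ltnS leqnn /= => /andP[_ h].
by rewrite eqn_leq h1 h.
Qed.

(** A later entry of content [a.+1] or [a.-1] would put a box to the right of or below the last box
    of content [a], which is a corner of the final shape. *)
Lemma removable_far T a R : std (T ++ a :: R) -> a \notin R ->
  removable (T ++ a :: R) a -> all (far a) R.
Proof.
move=> v aR r; apply/allP => b bR; have nab : b != a by apply: contraNneq aR => <-.
have a1 : addable T a by move: v; rewrite std_cat /= => /and3P[].
have na : mult R a = 0 by apply/count_memPn.
have cb : 0 < mult R b by rewrite mult_gt0.
have := std_count a v; have := std_count a.-1 v.
move: a1 r nab cb; rewrite /addable /removable /far !mult_cat !mult_cons eqxx na.
rewrite (_ : a == a.+1 = false); last by lia.
have na2 : (0 < a) ==> (mult R a.-1.+1 == 0) by case: (a) na => //= ? ->.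
move: na2; clear; case: a => [|a] /=.
  by case: (eqVneq b 1) => [->|]; lia.
rewrite (_ : a.+1 == a = false) ?eqxx; last by lia.
case: (eqVneq b a.+2) => [->|]; first by lia.
case: (eqVneq b a) => [->|]; lia.
Qed.

Lemma last_occurrence a R : a \in R ->
  exists R1 R2, R = R1 ++ a :: R2 /\ a \notin R2.
Proof.
elim/last_ind: R => // R b IHR; case: (eqVneq b a) => [<- _|nba].
  by exists R, [::]; rewrite cats1.
rewrite mem_rcons inE eq_sym (negbTE nba) => /IHR [R1 [R2 [-> aR2]]].
exists R1, (rcons R2 b); rewrite rcons_cat; split=> //.
by rewrite mem_rcons inE eq_sym (negbTE nba).
Qed.

Lemma removable_perm T a : std T -> removable T a ->
  exists2 W, std (rcons W a) & perm_eq (rcons W a) T.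
Proof.
move=> sT r; have aT : a \in T by rewrite -mult_gt0; case/andP: r; lia.
have [R1 [R2 [eT aR2]]] := last_occurrence aT.
have fR2 : all (far a) R2 by apply: (@removable_far R1) => //; rewrite -eT.
have [] := @bubble_right [::] (fun _ => True) R1 a R2 [::] _ fR2; rewrite ?cats0 -?eT //.
move=> st _; exists (R1 ++ R2); rewrite -cats1 -?catA //.
by rewrite eT perm_cat2l perm_catC.
Qed.

(** Let [a] be the last entry of [R']. Its last occurrence in [R] is a corner of the common shape,
    so far exchanges bring it to the end of [R]; the induction then runs on the remaining entries,
    for the property that [P] holds once [a] is appended. *)
Lemma far_conn T P R R' : far_closed T P -> std T -> perm_eq R R' ->
  std_ext T R -> std_ext T R' -> P R -> P R'.
Proof.
move=> + sT; have [m] := ubnP (size R); elim: m R R' P => // m IH R R' P.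
case/lastP: R' => [|R' a] szR cP eRR' stR stR' PR.
  by have /eqP := perm_size eRR'; rewrite size_eq0 => /eqP <-.
have aR : a \in R by rewrite (perm_mem eRR') mem_rcons mem_head.
have [R1 [R2 [eR aR2]]] := last_occurrence aR.
have e1 : perm_eq (R1 ++ R2) R'.
  rewrite -(perm_cons a); move: eRR'; rewrite eR perm_sym perm_rcons => e.
  by rewrite perm_sym (perm_trans e) // -cat1s perm_catCA.
have farR2 : all (far a) R2.
  have v : std (T ++ R1 ++ a :: R2) by rewrite std_cat sT -eR.
  apply: (@removable_far (T ++ R1)); rewrite -?catA // /removable.
  have e : perm_eq (T ++ R1 ++ a :: R2) (rcons (T ++ R') a).
    by rewrite -eR rcons_cat perm_cat2l.
  rewrite !(eq_mult e); apply: last_removable.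
  by rewrite rcons_cat std_cat sT.
have [] := @bubble_right T P R1 a R2 [::] cP farR2; rewrite ?cats0 -?eR //.
rewrite catA cats1 => st2 P2; rewrite -cats1.
suff [] : std_ext T (R' ++ [:: a]) /\ P (R' ++ [:: a]) by [].
apply: (IH (R1 ++ R2) R' (fun Q => std_ext T (Q ++ [:: a]) /\ P (Q ++ [:: a]))) => //.
- by move: szR; rewrite eR !size_cat /=; lia.
- move=> Q1 b d Q2 sQ fbd; rewrite -!catA /= => -[s1 p1]; split.
    exact: std_ext_far_cat fbd s1.
  exact: cP.
- by move: st2; rewrite -cats1 std_ext_cat => /andP[].
- by move: stR'; rewrite -cats1 std_ext_cat => /andP[].
- by rewrite !cats1.
Qed.

End ContentSequences.

(** * Standard barred tableaux as content sequences *)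

Section TableauGrowth.
Local Open Scope nat_scope.

Lemma subn_chain a b c : a <= b -> b <= c -> c - b + (b - a) = c - a.
Proof. by lia. Qed.

Section Growth.
Implicit Types (B : seq (nat * nat)) (p b : nat * nat) (U V : seq barred_entry).

Definition content b := b.2 - b.1.
Definition contents B := map content B.

Definition grows B p := [&& p \notin B, p.1 <= p.2,
  (p.1 < p.2) ==> ((p.1, p.2.-1) \in B) & (0 < p.1) ==> ((p.1.-1, p.2) \in B)].

(** Unlike [standard_barred], this form does not mention row lengths, so it passes to prefixes and
    to extensions by one box. *)
Definition growth B := all (fun m => grows (take m B) (nth (0, 0) B m)) (iota 0 (size B)).

Lemma growth_rcons B p : growth (rcons B p) = growth B && grows B p.
Proof.
rewrite /growth size_rcons -addn1 iotaD all_cat /= andbT add0n; congr (_ && _).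
  apply: eq_in_all => m; rewrite mem_iota add0n => /= mB.
  by rewrite -cats1 takel_cat ?nth_cat ?mB // ltnW.
by rewrite -cats1 take_size_cat // nth_cat ltnn subnn.
Qed.

Lemma growth_cat B1 B2 : growth (B1 ++ B2) -> growth B1.
Proof.
by elim/last_ind: B2 => [|B2 p IH]; rewrite ?cats0 // -rcons_cat growth_rcons => /andP[/IH].
Qed.

Lemma growth_take m B : growth B -> growth (take m B).
Proof. by rewrite -{1}(cat_take_drop m B) => /growth_cat. Qed.

Lemma growth_uniq B : growth B -> uniq B.
Proof.
elim/last_ind: B => // B p IH; rewrite growth_rcons rcons_uniq => /andP[/IH ->].
by rewrite andbT => /and4P[].
Qed.

Lemma mult_mono T s d : std T -> mult T (s + d) <= mult T s <= mult T (s + d) + d.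
Proof.
move=> sT; elim: d => [|d IH]; first by rewrite !addn0 leqnn.
by move: (std_count (s + d) sT) IH; rewrite addnS; clear; lia.
Qed.

(** The boxes present on each diagonal form an initial segment of it, so the new box must be the
    next one on its diagonal, and the conditions on its neighbours become comparisons of counts. *)
Lemma growsE B p : std (contents B) ->
  (forall b, (b \in B) = (b.1 <= b.2) && (b.1 < mult (contents B) (content b))) ->
  grows B p = [&& p.1 <= p.2, eq_op p.1 (mult (contents B) (content p))
                & addable (contents B) (content p)].
Proof.
move=> sT dB; case: p => i j; rewrite /grows /content /= !dB /content /=.
have [ij|] := leqP i j; last by [].
have -> : j.-1 - i = (j - i).-1 by clear -ij; lia.
rewrite /addable; have := std_count (j - i) sT.
case: (posnP i) => [->|i0].
  rewrite !subn0; move: (mult _ j) (mult _ j.+1) (mult _ j.-1) => x y z; clear => h.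
  by apply/idP/idP => h'; lia.
have -> : j - i.-1 = (j - i).+1 by clear -ij i0; lia.
move: (mult _ (j - i)) (mult _ (j - i).+1) (mult _ (j - i).-1) => x y z h.
by clear -ij i0 h; apply/idP/idP => h'; lia.
Qed.

Lemma growthP B : growth B -> std (contents B) /\
  forall b, (b \in B) = (b.1 <= b.2) && (b.1 < mult (contents B) (content b)).
Proof.
elim/last_ind: B => [|B p IH]; first by split=> // b; rewrite in_nil /mult /= ltn0 andbF.
rewrite growth_rcons => /andP[/IH[sB dB]]; rewrite growsE // => /and3P[p12 /eqP p1 aP].
rewrite /contents map_rcons -/(contents B); split; first by rewrite std_rcons sB.
move=> b; rewrite mem_rcons inE dB mult_rcons.
have [->|bp] /= := eqVneq b p; first by rewrite p12 -p1 eqxx addn1 leqnn.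
have [b12|//] := leqP b.1 b.2; rewrite /=.
have [e|_] := eqVneq (content p) (content b); last by rewrite addn0.
rewrite addn1 -e -p1 [RHS]ltnS [RHS]leq_eqVlt; case: eqP => // e1; case/eqP: bp.
move: e e1 p12 b12; rewrite /content; clear; case: b p => [b1 b2] [p1 p2] /= *; congr (_, _); lia.
Qed.

Lemma growth_increasing B : growth B -> pairwise increasing_boxes B.
Proof.
elim/last_ind: B => // B p IH; rewrite growth_rcons pairwise_rcons => /andP[gB gp].
rewrite IH // andbT; have [sT dB] := growthP gB; apply/allP => q qB.
case/and4P: gp => pB p12 _ _; move: qB pB; rewrite !dB p12 /= -leqNgt => /andP[q12 hq] hp.
rewrite /increasing_boxes; apply/andP; split; apply/implyP => /eqP e; rewrite ltnNge; apply/negP => h.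
  have /andP[] := mult_mono (content p) (q.2 - p.2) sT.
  have -> : content p + (q.2 - p.2) = content q by rewrite /content e addnC subn_chain.
  by move=> h1 _; have := leq_trans hq (leq_trans h1 hp); rewrite e ltnn.
have /andP[_] := mult_mono (content q) (q.1 - p.1) sT.
have -> : content q + (q.1 - p.1) = content p by rewrite /content subn_chain // e.
by move=> h1; have := leq_trans hq (leq_trans h1 (leq_add hp (leqnn _))); rewrite subnKC // ltnn.
Qed.

Lemma growth_closed B : uniq B -> pairwise increasing_boxes B ->
  (forall p, p \in B -> [/\ p.1 <= p.2, p.1 < p.2 -> (p.1, p.2.-1) \in B
     & 0 < p.1 -> (p.1.-1, p.2) \in B]) -> growth B.
Proof.
elim/last_ind: B => // B p IH; rewrite rcons_uniq pairwise_rcons growth_rcons.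
move=> /andP[pB uB] /andP[/allP incp pw] H; apply/andP; split.
  apply: IH => // q qB; have qp : q \in rcons B p by rewrite mem_rcons inE qB orbT.
  have [q12 l u] := H q qp; split=> // h; [have := l h | have := u h];
    rewrite mem_rcons inE => /orP[/eqP e|//]; exfalso; move: (incp _ qB);
    rewrite /increasing_boxes -e /= eqxx /= => /andP[h1 h2]; move: h h1 h2; clear; lia.
have [p12 l u] := H p (etrans (mem_rcons _ _ _) (mem_head _ _)).
apply/and4P; split=> //; apply/implyP => h; [have := l h | have := u h];
  rewrite mem_rcons inE => /orP[/eqP e|//]; exfalso;
  [have /= := congr1 snd e | have /= := congr1 fst e]; move: h p12; clear; lia.
Qed.

Lemma mem_diagram lam p :
  (p \in shifted_diagram lam) = [&& p.1 < size lam, p.1 <= p.2 & p.2 < p.1 + nth 0 lam p.1].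
Proof.
apply/allpairsPdep/idP => [[i [j [+ + ->]]]|].
  by rewrite !mem_iota !add0n /= => -> jl; rewrite leq_addr ltn_add2l.
case: p => i j /= /and3P[h1 h2 h3]; exists i, (j - i).
by rewrite !mem_iota !add0n /= h1 subnKC // ltn_subLR.
Qed.

Lemma diagram_uniq lam : uniq (shifted_diagram lam).
Proof.
apply: allpairs_uniq_dep => [|i _|]; rewrite ?iota_uniq //.
by move=> [i j] [i' j'] _ _ /= [-> /addnI ->].
Qed.

Lemma strict_growth lam U : strict_partition lam -> standard_barred lam U -> growth (unzip1 U).
Proof.
move=> /andP[sl l0] /and3P[pm pw _].
apply: growth_closed => //; first by rewrite (perm_uniq pm) diagram_uniq.
move=> [i j]; rewrite !(perm_mem pm) !mem_diagram /= => /and3P[h1 h2 h3]; split=> // h.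
  by rewrite h1 /=; move: h h3; clear; lia.
have /(sortedP 0)/(_ i.-1) := sl; rewrite prednK // => /(_ h1) /=.
by move: h h1 h2 h3; clear; lia.
Qed.

(** Serves to read the length of a row off the set of contents in it, which is an initial segment of
    the integers. *)
Lemma down_iota (s : seq nat) : uniq s -> (forall i, i.+1 \in s -> i \in s) ->
  forall i, (i \in s) = (i < size s).
Proof.
move=> us dn; have ex : exists k, k \notin s.
  case: (boolP (all (fun k => k \in s) (iota 0 (size s).+1))) => [/allP h|/allPn[k _ kn]]; last by exists k.
  by have := uniq_leq_size (iota_uniq 0 (size s).+1) h; rewrite size_iota ltnn.
case: (ex_minnP ex) => k kn kmin.
have up i : k <= i -> i \notin s.
  by move=> /subnK <-; elim: (i - k) => // d hd; rewrite addSn; apply: contra hd; exact: dn.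
have eq i : (i \in s) = (i < k).
  case: ltnP => [ik|/up/negbTE //]; apply/negPn/negP => /kmin; by rewrite leqNgt ik.
have : perm_eq s (iota 0 k) by apply: uniq_perm; rewrite ?iota_uniq // => i; rewrite mem_iota eq.
by move/perm_size; rewrite size_iota => ->.
Qed.

Definition bar_ok (x : barred_entry) : bool := x.2 ==> (x.1.1 != x.1.2).

(** The number of rows is the number [mult T 0] of diagonal boxes, and the row lengths decrease
    strictly because the diagonal counts drop by at most one at a time. *)
Lemma growth_standard U : growth (unzip1 U) -> all bar_ok U -> is_standard_barred U.
Proof.
move=> gU bU; have [sT dB] := growthP gU; set B := unzip1 U in gU sT dB *; set T := contents B in sT dB.
have uB := growth_uniq gU.
have rowsE i : (i \in [seq x.1.1 | x <- U]) = (i < mult T 0).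
  apply/mapP/idP => [[x xU ->]|h].
    have : x.1 \in B by apply: map_f.
    rewrite dB => /andP[_ h]; apply: leq_trans h _.
    by have /andP[] := mult_mono 0 (content x.1) sT; rewrite add0n.
  have : (i, i) \in B by rewrite dB /content /= leqnn subnn.
  by case/mapP => x xU e; exists x => //; rewrite -e.
have er : size (undup [seq x.1.1 | x <- U]) = mult T 0.
  rewrite -[RHS](size_iota 0); apply/perm_size/uniq_perm; rewrite ?undup_uniq ?iota_uniq // => i.
  by rewrite mem_undup rowsE mem_iota.
pose len i := count (fun x : barred_entry => x.1.1 == i) U.
have lenE i j : ((i, j) \in B) = (i <= j) && (j < i + len i).
  pose s := [seq content b | b <- B & b.1 == i].
  have sE d : (d \in s) = ((i, i + d) \in B).
    apply/mapP/idP => [[[b1 b2]]|h]; last by exists (i, i + d); rewrite ?mem_filter ?eqxx //= /content /= addKn.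
    rewrite mem_filter /= => /andP[/eqP -> bB] ->; rewrite /content /= subnKC //.
    by move: bB; rewrite dB => /andP[].
  have szs : size s = len i by rewrite size_map size_filter /B /unzip1 count_map.
  have us : uniq s.
    rewrite map_inj_in_uniq ?filter_uniq // => -[a b] [a' b'].
    rewrite !mem_filter /= => /andP[/eqP -> h1] /andP[/eqP -> h2].
    move: h1 h2; rewrite !dB /content /= => /andP[h1 _] /andP[h2 _] e; congr (_, _).
    by move: h1 h2 e; clear; lia.
  have dn d : d.+1 \in s -> d \in s.
    rewrite !sE !dB /content /= !addKn !leq_addr /= => h; apply: leq_trans h _.
    by have /andP[] := std_count d sT.
  have [ij|ji] := leqP i j; last by rewrite dB /= leqNgt ji.
  by rewrite -{1}(subnKC ij) -sE down_iota // szs /= ltn_subLR.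
have rlE : row_lengths U = [seq len i | i <- iota 0 (mult T 0)] by rewrite /row_lengths er.
have szr : size (row_lengths U) = mult T 0 by rewrite rlE size_map size_iota.
have nthr i : i < mult T 0 -> nth 0 (row_lengths U) i = len i.
  by move=> h; rewrite rlE (nth_map 0) ?size_iota // nth_iota.
have diag i : i < mult T 0 -> 0 < len i.
  move=> h; have : (i, i) \in B by rewrite dB /content /= leqnn subnn.
  by rewrite lenE leqnn /=; clear; lia.
apply/andP; split.
  apply/andP; split.
    apply/(sortedP 0) => i; rewrite szr => h; rewrite /= !nthr ?(ltnW h) //.
    have /diag l0 := h.
    have : (i.+1, i + len i.+1) \in B by rewrite lenE; move: l0; clear; lia.
    rewrite dB /content /= => /andP[h1 h2].
    have : (i, i + len i.+1) \in B.
      rewrite dB /content /= leq_addr /=; have := std_count (i + len i.+1 - i.+1) sT.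
      by rewrite subnSK // => /andP[_ h3]; rewrite -ltnS; apply: leq_trans h2 h3.
    by rewrite lenE; clear; lia.
  by rewrite rlE; apply/mapP => [[k]]; rewrite mem_iota add0n /= => /diag l0 e; rewrite -e in l0.
apply/and3P; split=> //; last exact: growth_increasing.
apply: uniq_perm; rewrite ?diagram_uniq // => -[i j]; rewrite mem_diagram /= szr.
have [h|h] := ltnP i (mult T 0); first by rewrite nthr // lenE.
rewrite /= dB /content /=; apply/negP => /andP[h1 h2].
have /andP[h3 _] := mult_mono 0 (j - i) sT; rewrite add0n in h3.
by move: h2 h3 h; clear; lia.
Qed.

Lemma std_size_bound T s : std T -> s \in T -> mult T s + s <= size T.
Proof.
elim/last_ind: T s => // T a IH s; rewrite std_rcons mem_rcons inE mult_rcons size_rcons.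
move=> /andP[sT aT]; rewrite (eq_sym s a); have [<-|_] /= := eqVneq a s.
  rewrite addn1 addSn ltnS => _; have [/(IH _ sT) //|/count_memPn e] := boolP (a \in T).
  by rewrite /mult e add0n addable_le_size.
by rewrite addn0 => /(IH _ sT); clear; lia.
Qed.

Lemma additions_grows V y : y \in additions V -> grows (unzip1 V) y.1 && bar_ok y.
Proof.
rewrite mem_filter => /andP[/andP[st sb] _]; have := strict_growth st sb.
rewrite /unzip1 map_rcons growth_rcons => /andP[_ ->] /=.
by case/and3P: sb => _ _; rewrite all_rcons => /andP[].
Qed.

(** With [additions_grows], this identifies the competitors in the definition of the idempotent: the
    addable boxes, each with both signs off the main diagonal. *)
Lemma grows_additions V y : growth (unzip1 V) -> all bar_ok V ->
  grows (unzip1 V) y.1 -> bar_ok y -> y \in additions V.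
Proof.
move=> gV bV gy by_; rewrite mem_filter; apply/andP; split.
  apply: growth_standard; last by rewrite all_rcons by_.
  by rewrite /unzip1 map_rcons growth_rcons gV.
have [sT dB] := growthP gV; move: gy; rewrite growsE // => /and3P[p12 /eqP p1 aP].
have szT : size (contents (unzip1 V)) = size V by rewrite !size_map.
have b : y.1.1 + content y.1 <= size V.
  rewrite {1}p1 -szT; have [h|/count_memPn e] := boolP (content y.1 \in contents (unzip1 V)).
    exact: std_size_bound.
  by rewrite /mult e add0n addable_le_size.
rewrite [X in _ <= X]/= in b; apply/allpairsP; exists (y.1, y.2); split=> //; last first.
- by rewrite /= -surjective_pairing.
- by rewrite /=; case: y.2.
apply/allpairsP; exists (y.1.1, y.1.2); rewrite !mem_iota !add0n !ltnS /=; split.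
- exact: leq_trans (leq_addr _ _) b.
- by rewrite -(subnKC p12).
by rewrite /= -surjective_pairing.
Qed.
End Growth.
End TableauGrowth.

From Stdlib Require Import Ncring Ncring_tac.
Delimit Scope nat_scope with N.
Local Open Scope ring_scope.

(** * Spectrum of the squared Jucys-Murphy elements *)

Section NoncommutativeRing.
Variable A : nzRingType.
Definition nc_ops : @Ring_ops A 0 1 +%R *%R (fun x y => x - y) -%R eq := Build_Ring_ops _ _ _ _ _ _ _.
#[local] Existing Instance nc_ops.
Lemma nc_ring : @Ring A 0 1 +%R *%R (fun x y => x - y) -%R eq nc_ops.
Proof.
split; rewrite /equality /addition /multiplication /subtraction /opposite /zero
  /one /= /eq_notation /add_notation /mul_notation /sub_notation /opp_notation
  /zero_notation /one_notation //=; try exact _.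
all: try by move=> ? ? e ? ? e'; rewrite e e'.
all: try by move=> ? ? e; rewrite e.
all: move=> *.
all: rewrite ?add0r ?mul1r ?mulr1 ?addrA ?mulrA ?mulrDl ?mulrDr ?subrr //; apply: addrC.
Qed.
End NoncommutativeRing.
#[export] Existing Instance nc_ops.
#[export] Existing Instance nc_ring.

(* [non_commutative_ring] wants all operations to come from the ring structure,
   while scaled terms carry those of the module structure. *)
Ltac ring_form A t := lazymatch t with
  | @Algebra.add _ ?a ?b =>
      let a' := ring_form A a in let b' := ring_form A b in
      constr:(@Algebra.add (A : nzRingType) a' b')
  | @Algebra.opp _ ?a =>
      let a' := ring_form A a in constr:(@Algebra.opp (A : nzRingType) a')
  | @GRing.mul _ ?a ?b =>
      let a' := ring_form A a in let b' := ring_form A b in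
      constr:(@GRing.mul (A : nzRingType) a' b')
  | @Algebra.zero _ => constr:(@Algebra.zero (A : nzRingType))
  | @GRing.one _ => constr:(@GRing.one (A : nzRingType))
  | _ => t
  end.
Ltac ncr A :=
  repeat match goal with |- context [@GRing.scale ?R ?V ?a ?b] =>
    let v := fresh "v" in
    set v : A := (@GRing.scale R V a b); clearbody v
  end;
  lazymatch goal with |- @eq _ ?l ?r =>
    let l' := ring_form A l in let r' := ring_form A r in
    change (@eq (A : nzRingType) l' r')
  end; non_commutative_ring.

(** * Two consecutive letters and their intertwiner *)

Section LocalRelations.
Variables (A : nzRingType) (c c' x x' s : A).
Hypotheses (cc : c * c = -1) (cc' : c' * c' = -1) (cN : c' * c = - (c * c')).
Hypotheses (ss : s * s = 1) (sc : s * c = c' * s) (xx : x' * x = x * x').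
Hypotheses (xc : x * c = - (c * x)) (xc' : x * c' = c' * x).
Hypotheses (x'c : x' * c = c * x') (x'c' : x' * c' = - (c' * x')).
Hypothesis x's : x' * s = s * x + 1 - c * c'.

Let d := c * x.
Let d' := c' * x'.
Let X := x * x.
Let Y := x' * x'.
Let u := c - c'.
Let w := d - d'.
Let phi := s * (X - Y) - u * w.

Lemma loc_sc' : s * c' = c * s.
Proof. by rewrite -[c * s]mul1r -ss -!mulrA [s * (c * s)]mulrA sc -!mulrA ss mulr1. Qed.

Let dc : d * c = - (c * d).
Proof. by rewrite /d -mulrA xc mulrN. Qed.
Let dc' : d * c' = - (c' * d).
Proof. by rewrite /d -mulrA xc' !mulrA cN mulNr opprK. Qed.
Let d'c : d' * c = - (c * d').
Proof. by rewrite /d' -mulrA x'c !mulrA cN mulNr. Qed.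
Let d'c' : d' * c' = - (c' * d').
Proof. by rewrite /d' -mulrA x'c' mulrN. Qed.
Let d'd : d' * d = - (d * d').
Proof.
rewrite /d' /d -!mulrA [x' * _]mulrA x'c -!mulrA xx !mulrA cN -!mulrA.
by rewrite [x * (c' * _)]mulrA xc' -!mulrA mulNr -!mulrA.
Qed.
Lemma loc_dd : d * d = X.
Proof. by rewrite /d -!mulrA [x * _]mulrA xc mulNr mulrN !mulrA cc !mulN1r mulNr opprK. Qed.
Lemma loc_d'd' : d' * d' = Y.
Proof. by rewrite /d' -!mulrA [x' * _]mulrA x'c' mulNr mulrN !mulrA cc' !mulN1r mulNr opprK. Qed.

Lemma loc_sd : s * d = d' * s + u.
Proof.
have e : c' * (c * c') = c.
  by rewrite mulrA cN mulNr -mulrA cc' mulrN1 opprK.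
rewrite /d /d' /u mulrA sc -!mulrA x's mulrBr e; non_commutative_ring.
Qed.

Let su : s * u = - (u * s).
Proof. by rewrite /u mulrBr mulrBl sc loc_sc' opprB. Qed.

Lemma loc_sd' : s * d' = d * s + u.
Proof.
move: loc_sd su; clearbody d d' u => sd su'.
have e : d' * s = s * d - u by rewrite sd addrK.
rewrite -[LHS]mulr1 -ss !mulrA -[s * d' * s]mulrA e mulrBr mulrA ss mul1r.
by rewrite mulrBl su' mulNr opprK -mulrA ss mulr1.
Qed.

Let mA (a b r z : A) : a * b = r -> a * (b * z) = r * z.
Proof. by move=> <-; rewrite mulrA. Qed.
Let dist := (@mulrDl, @mulrDr, @mulNr, @mulrN, @opprD, @opprK, @mul1r, @mulr1).
Ltac nf :=
  rewrite -?loc_dd -?loc_d'd';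
  move: dc dc' d'c d'c' d'd loc_sd loc_sd'; rewrite /w /u; clearbody d d';
  let e1 := fresh in let e2 := fresh in let e3 := fresh in let e4 := fresh in
  let e5 := fresh in let e6 := fresh in let e7 := fresh in
  move=> e1 e2 e3 e4 e5 e6 e7; repeat (progress rewrite ?dist -?mulrA
    ?(cc, cc', cN, ss, sc, loc_sc', e1, e2, e3, e4, e5, e6, e7)
    ?(mA _ cc, mA _ cc', mA _ cN, mA _ ss, mA _ sc, mA _ loc_sc', mA _ e1,
      mA _ e2, mA _ e3, mA _ e4, mA _ e5, mA _ e6, mA _ e7));
  non_commutative_ring.

Lemma loc_sX : s * X = Y * s + u * w.
Proof. nf. Qed.
Lemma loc_sY : s * Y = X * s - u * w.
Proof. nf. Qed.
Lemma loc_suw : s * (u * w) = u * w * s.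
Proof. nf. Qed.
Lemma loc_uwuw : u * w * (u * w) = (X + Y) + (X + Y).
Proof. nf. Qed.

Let XY : Y * X = X * Y.
Proof. by rewrite -loc_dd -loc_d'd'; nf. Qed.
Let Xq : X * (u * w) = u * w * X.
Proof. nf. Qed.
Let Yq : Y * (u * w) = u * w * Y.
Proof. nf. Qed.

Lemma loc_phiX : phi * X = Y * phi.
Proof.
move: loc_sX Yq; rewrite /phi; move: (u * w) => q sX Yq'; move: X Y sX Yq' XY.
clear => X Y sX Yq XY; rewrite [LHS]mulrBl [RHS]mulrBr Yq mulrA.
rewrite -[s * (X - Y) * X]mulrA (_ : (X - Y) * X = X * (X - Y)).
  by rewrite mulrA sX; non_commutative_ring.
by rewrite mulrBl mulrBr XY.
Qed.
Lemma loc_phiY : phi * Y = X * phi.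
Proof.
move: loc_sY Xq; rewrite /phi; move: (u * w) => q sY Xq'; move: X Y sY Xq' XY.
clear => X Y sY Xq XY; rewrite [LHS]mulrBl [RHS]mulrBr Xq mulrA.
rewrite -[s * (X - Y) * Y]mulrA (_ : (X - Y) * Y = Y * (X - Y)).
  by rewrite mulrA sY; non_commutative_ring.
by rewrite mulrBl mulrBr XY.
Qed.
Lemma loc_phic : phi * c = c' * phi.
Proof. rewrite /phi; nf. Qed.
Lemma loc_phic' : phi * c' = c * phi.
Proof. rewrite /phi; nf. Qed.
Lemma loc_phid : phi * d = d' * phi.
Proof. rewrite /phi; nf. Qed.
Lemma loc_phid' : phi * d' = d * phi.
Proof. rewrite /phi; nf. Qed.

(** Exchanging [c] with [c'] and [d] with [d'], [phi] changes the sign of both [u] and [w] and so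
    commutes with [u * w]; what remains is the square of [u * w] minus that of [X - Y]. *)
Lemma loc_phiphi : phi * phi = (X + Y) + (X + Y) - (X - Y) * (X - Y).
Proof.
have pq : phi * (u * w) = u * w * phi.
  have pu : phi * u = - (u * phi) by rewrite /u mulrBr loc_phic loc_phic' mulrBl opprB.
  have pw : phi * w = - (w * phi) by rewrite /w mulrBr loc_phid loc_phid' mulrBl opprB.
  by rewrite mulrA pu mulNr -!mulrA pw mulrN opprK.
rewrite -loc_uwuw {2}/phi mulrBr pq.
move: loc_sX loc_sY loc_suw; rewrite /phi; move: (u * w) => q.
move: XY; move: X Y => X0 Y0 XY0 sX sY sq; rewrite mulrA.
have -> : (s * (X0 - Y0) - q) * s = Y0 - X0 + q * s.
  have -> : s * (X0 - Y0) = Y0 * s - X0 * s + (q + q).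
    by rewrite mulrBr sX sY; non_commutative_ring.
  transitivity (Y0 * (s * s) - X0 * (s * s) + q * s); last by rewrite ss !mulr1.
  non_commutative_ring.
have e : X0 * Y0 - Y0 * X0 = 0 by rewrite XY0 subrr.
transitivity (q * q - (X0 - Y0) * (X0 - Y0)); last by [].
non_commutative_ring.
Qed.
End LocalRelations.

(** Letters are numbered from 0 and [s i] exchanges the letters [i] and [i.+1]. The last two fields
    say that [x i] and [x i * x i - a] have no nilpotent part; for the concrete algebra they are
    supplied by a positive definite Hermitian form. *)
Record sergeev_system (C : fieldType) (A : falgType C) (n : nat)
    (c x s : nat -> A) : Prop := SergeevSystem {
  sys_cc : forall i : nat, (i < n)%N -> c i * c i = -1;
  sys_cN : forall i j : nat, (i < n)%N -> (j < n)%N -> i != j ->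
    c i * c j = - (c j * c i);
  sys_ss : forall i : nat, (i.+1 < n)%N -> s i * s i = 1;
  sys_sc : forall i : nat, (i.+1 < n)%N -> s i * c i = c i.+1 * s i;
  sys_scj : forall i j : nat, (i.+1 < n)%N -> (j < n)%N -> j != i -> j != i.+1 ->
    s i * c j = c j * s i;
  sys_braid : forall i : nat, (i.+2 < n)%N ->
    s i * s i.+1 * s i = s i.+1 * s i * s i.+1;
  sys_far : forall i j : nat, (i.+1 < j)%N -> (j.+1 < n)%N -> s i * s j = s j * s i;
  sys_sx : forall i : nat, (i.+1 < n)%N ->
    x i.+1 * s i = s i * x i + 1 - c i * c i.+1;
  sys_sxj : forall i j : nat, (i.+1 < n)%N -> (j < n)%N -> j != i -> j != i.+1 ->
    s i * x j = x j * s i;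
  sys_x0 : x 0%N = 0;
  sys_xx : forall i j : nat, (i < n)%N -> (j < n)%N -> x i * x j = x j * x i;
  sys_xc : forall i j : nat, (i < n)%N -> (j < n)%N -> i != j -> x i * c j = c j * x i;
  sys_xcN : forall i : nat, (i < n)%N -> x i * c i = - (c i * x i);
  sys_xss : forall (i : nat) z, (i < n)%N -> x i * (x i * z) = 0 -> x i * z = 0;
  sys_Xss : forall (i a : nat) z, (i < n)%N ->
    let h := x i * x i - a%:R in h * (h * z) = 0 -> h * z = 0 }.

Lemma half0 (C : numFieldType) (V : lmodType C) (v : V) : v + v = 0 -> v = 0.
Proof. by move=> /eqP; rewrite -mulr2n -scaler_nat scaler_eq0 pnatr_eq0 => /eqP. Qed.

Section System.
Variables (C : numClosedFieldType) (A : falgType C) (n : nat) (c x s : nat -> A).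
Hypothesis sys : sergeev_system n c x s.
Implicit Types (i j k : nat) (z : A).

Definition od i := c i * x i.
Definition sq i := x i * x i.
Definition du i := c i - c i.+1.
Definition dw i := od i - od i.+1.
Definition intw i := s i * (sq i - sq i.+1) - du i * dw i.

Section Local.
Variable i : nat.
Hypothesis lti : (i.+1 < n)%N.
Let lti' : (i < n)%N := ltnW lti.

Let nii : (i.+1 != i)%N.
Proof. by rewrite gtn_eqF. Qed.
Let nii' : (i != i.+1)%N.
Proof. by rewrite ltn_eqF. Qed.

Ltac loc L := rewrite /intw /du /dw /od /sq; apply: L;
  first [exact: (sys_cc sys) | exact: (sys_cN sys) | exact: (sys_ss sys)
  | exact: (sys_sc sys) | exact: (sys_xx sys) | exact: (sys_xcN sys)
  | exact: (sys_xc sys) | exact: (sys_sx sys)].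

Lemma sc' : s i * c i.+1 = c i * s i. Proof. loc loc_sc'. Qed.
Lemma ssq : s i * sq i = sq i.+1 * s i + du i * dw i. Proof. loc loc_sX. Qed.
Lemma ssq' : s i * sq i.+1 = sq i * s i - du i * dw i. Proof. loc loc_sY. Qed.
Lemma intw_sq : intw i * sq i = sq i.+1 * intw i. Proof. loc loc_phiX. Qed.
Lemma intw_sq' : intw i * sq i.+1 = sq i * intw i. Proof. loc loc_phiY. Qed.
Lemma intw_c : intw i * c i = c i.+1 * intw i. Proof. loc loc_phic. Qed.
Lemma intw_od : intw i * od i = od i.+1 * intw i. Proof. loc loc_phid. Qed.
Lemma intw_intw : intw i * intw i = (sq i + sq i.+1) + (sq i + sq i.+1)
  - (sq i - sq i.+1) * (sq i - sq i.+1).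
Proof. loc loc_phiphi. Qed.
Lemma du_dw_sqr : du i * dw i * (du i * dw i) = (sq i + sq i.+1) + (sq i + sq i.+1).
Proof. loc (@loc_uwuw A (c i) (c i.+1) (x i) (x i.+1) (s i)). Qed.
End Local.

Lemma od_sqr i : (i < n)%N -> od i * od i = sq i.
Proof.
move=> ni; rewrite /od -!mulrA [x i * _]mulrA (sys_xcN sys) // mulNr mulrN !mulrA.
by rewrite (sys_cc sys) // !mulN1r mulNr opprK.
Qed.

Lemma od_c i : (i < n)%N -> od i * c i = - (c i * od i).
Proof. by move=> ni; rewrite /od -mulrA (sys_xcN sys) // mulrN. Qed.

Lemma od_cj i j : (i < n)%N -> (j < n)%N -> i != j -> od i * c j = - (c j * od i).
Proof.
move=> ni nj nij; rewrite /od -mulrA (sys_xc sys) // !mulrA.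
by rewrite (sys_cN sys) // mulNr.
Qed.

Lemma c_od i j : (i < n)%N -> (j < n)%N -> c j * od i = - (od i * c j).
Proof.
move=> ni nj; have [<-|nij] := eqVneq i j; first by rewrite od_c ?opprK.
by rewrite od_cj ?opprK.
Qed.

Lemma x_odj i j : (i < n)%N -> (j < n)%N -> i != j -> x i * od j = od j * x i.
Proof.
by move=> ni nj nij; rewrite /od mulrA (sys_xc sys) // -!mulrA (sys_xx sys).
Qed.

Lemma od_odj i j : (i < n)%N -> (j < n)%N -> i != j -> od i * od j = - (od j * od i).
Proof.
move=> ni nj nij; rewrite {1}/od -mulrA x_odj // mulrA c_od //.
by rewrite mulNr -mulrA.
Qed.

Lemma sq_c i j : (i < n)%N -> (j < n)%N -> sq i * c j = c j * sq i.
Proof.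
move=> ni nj; rewrite /sq -mulrA; have [<-|nij] := eqVneq i j.
  by rewrite (sys_xcN sys) // mulrN [x i * (c i * _)]mulrA (sys_xcN sys) // mulNr opprK !mulrA.
by rewrite (sys_xc sys) // [x i * _]mulrA (sys_xc sys) // !mulrA.
Qed.

Lemma sq_x i j : (i < n)%N -> (j < n)%N -> sq i * x j = x j * sq i.
Proof. by move=> ni nj; rewrite /sq -mulrA (sys_xx sys) // [x i * _]mulrA (sys_xx sys) // !mulrA. Qed.

Lemma sq_od i j : (i < n)%N -> (j < n)%N -> sq i * od j = od j * sq i.
Proof. by move=> ni nj; rewrite [od j]/od mulrA sq_c // -[c j * sq i * x j]mulrA sq_x // mulrA. Qed.

Lemma sq_sq i j : (i < n)%N -> (j < n)%N -> sq i * sq j = sq j * sq i.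
Proof. by move=> ni nj; rewrite [sq j]/sq mulrA sq_x // -[x j * sq i * x j]mulrA sq_x // mulrA. Qed.

Lemma s_odj i j : (i.+1 < n)%N -> (j < n)%N -> j != i -> j != i.+1 ->
  s i * od j = od j * s i.
Proof.
by move=> ni nj n1 n2; rewrite /od mulrA (sys_scj sys) // -!mulrA (sys_sxj sys).
Qed.

Lemma s_sqj i j : (i.+1 < n)%N -> (j < n)%N -> j != i -> j != i.+1 ->
  s i * sq j = sq j * s i.
Proof.
by move=> ni nj n1 n2; rewrite /sq mulrA (sys_sxj sys) // -!mulrA (sys_sxj sys).
Qed.

Lemma sq_du i j : (i < n)%N -> (j.+1 < n)%N -> sq i * du j = du j * sq i.
Proof.
move=> ni nj; have nj' := ltnW nj.
by rewrite /du mulrBr mulrBl !sq_c.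
Qed.

Lemma sq_dw i j : (i < n)%N -> (j.+1 < n)%N -> sq i * dw j = dw j * sq i.
Proof.
move=> ni nj; have nj' := ltnW nj.
by rewrite /dw mulrBr mulrBl !sq_od.
Qed.

Lemma intw_sqj i j : (i.+1 < n)%N -> (j < n)%N -> j != i -> j != i.+1 ->
  intw i * sq j = sq j * intw i.
Proof.
move=> ni nj n1 n2; have ni' := ltnW ni; rewrite /intw [LHS]mulrBl [RHS]mulrBr.
congr (_ - _); last by rewrite -mulrA -sq_dw // mulrA -sq_du // mulrA.
rewrite -mulrA [(_ - _) * _]mulrBl (sq_sq ni' nj) (sq_sq ni nj) -mulrBr mulrA.
by rewrite s_sqj // mulrA.
Qed.

Lemma du_od i j : (i < n)%N -> (j.+1 < n)%N -> od i * du j = - (du j * od i).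
Proof.
move=> ni nj; have nj' := ltnW nj.
by rewrite /du mulrBr mulrBl !c_od // opprB opprK addrC.
Qed.

Lemma du_dw i j : (i.+1 < n)%N -> (j.+1 < n)%N -> dw i * du j = - (du j * dw i).
Proof.
move=> ni nj; have ni' := ltnW ni.
by rewrite [dw i in LHS]/dw mulrBl !du_od // -opprD -mulrBr.
Qed.

Lemma du_sqr i : (i.+1 < n)%N -> du i * du i = - 1 - 1.
Proof.
move=> ni; have ni' := ltnW ni.
rewrite /du mulrBl !mulrBr !(sys_cc sys) // [c i.+1 * c i](sys_cN sys) ?gtn_eqF //.
non_commutative_ring.
Qed.

Lemma dw_sqr i : (i.+1 < n)%N -> dw i * dw i = sq i + sq i.+1.
Proof.
move=> ni; have ni' := ltnW ni.
rewrite /dw mulrBl !mulrBr !od_sqr // [od i.+1 * od i]od_odj ?gtn_eqF //.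
non_commutative_ring.
Qed.

Lemma du_du i : (i.+2 < n)%N -> du i.+1 * du i = 1 + 1 - du i * du i.+1.
Proof.
move=> ni; have ni' := ltnW ni; have ni'' := ltnW ni'.
rewrite /du !mulrBl !mulrBr !(sys_cc sys) // [c i.+1 * c i](sys_cN sys) ?gtn_eqF //.
rewrite [c i.+2 * c i](sys_cN sys) // ?[c i.+2 * c i.+1](sys_cN sys) ?gtn_eqF //.
non_commutative_ring.
Qed.

Lemma dw_dw i : (i.+2 < n)%N ->
  dw i.+1 * dw i = - (sq i.+1 + sq i.+1) - dw i * dw i.+1.
Proof.
move=> ni; have ni' := ltnW ni; have ni'' := ltnW ni'.
rewrite /dw !mulrBl !mulrBr !od_sqr // [od i.+1 * od i]od_odj ?gtn_eqF //.
rewrite [od i.+2 * od i]od_odj // ?[od i.+2 * od i.+1]od_odj ?gtn_eqF //.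
non_commutative_ring.
Qed.

Definition weight3 i (tau sig : C) z :=
  [/\ sq i * z = tau *: z, sq i.+1 * z = sig *: z & sq i.+2 * z = tau *: z].

Lemma weight3M i tau sig y z : (i.+2 < n)%N ->
  sq i * y = y * sq i -> sq i.+1 * y = y * sq i.+1 -> sq i.+2 * y = y * sq i.+2 ->
  weight3 i tau sig z -> weight3 i tau sig (y * z).
Proof.
move=> ni e1 e2 e3 [z1 z2 z3].
by split; rewrite mulrA (e1, e2, e3) -mulrA (z1, z2, z3) scalerAr.
Qed.

(* On the eigenspaces of the pattern (tau, sig, tau), s_i and s_(i+1) act as
   multiples of du_i dw_i and du_(i+1) dw_(i+1), and the braid relation forces
   (c_i - c_(i+2)) (d_i - d_(i+2)) to vanish. *)
Lemma braid_pattern i (tau sig : C) : (i.+2 < n)%N ->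
  tau != 0 -> sig + sig + (sig + tau) != 0 ->
  (forall z, weight3 i tau sig z -> intw i * z = 0 /\ intw i.+1 * z = 0) ->
  forall z, weight3 i tau sig z -> z = 0.
Proof.
move=> ni t0 st0 H z Nz; have ni' := ltnW ni; have ni'' := ltnW ni'.
set K := sig + tau in st0.
pose u1 := du i; pose u2 := du i.+1; pose w1 := dw i; pose w2 := dw i.+1.
have Nu1 y : weight3 i tau sig y -> weight3 i tau sig (u1 * y).
  by apply: weight3M => //; apply: sq_du.
have Nu2 y : weight3 i tau sig y -> weight3 i tau sig (u2 * y).
  by apply: weight3M => //; apply: sq_du.
have Nw1 y : weight3 i tau sig y -> weight3 i tau sig (w1 * y).
  by apply: weight3M => //; apply: sq_dw.
have Nw2 y : weight3 i tau sig y -> weight3 i tau sig (w2 * y).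
  by apply: weight3M => //; apply: sq_dw.
pose D := tau - sig.
have s1E y : weight3 i tau sig y -> u1 * (w1 * y) = D *: (s i * y).
  move=> Ny; have [+ _] := H y Ny; case: Ny => y1 y2 _.
  rewrite /intw mulrBl -!mulrA mulrBl y1 y2 -scalerBl -scalerAr -/D => /eqP.
  by rewrite subr_eq0 => /eqP <-.
have s2E y : weight3 i tau sig y -> u2 * (w2 * y) = - D *: (s i.+1 * y).
  move=> Ny; have [_] := H y Ny; case: Ny => _ y2 y3.
  rewrite /intw mulrBl -!mulrA mulrBl y2 y3 -scalerBl -scalerAr /D opprB => /eqP.
  by rewrite subr_eq0 => /eqP <-.
(* [u1 w1] acts as [D s_i] and [u2 w2] as [- D s_(i+1)], so the two triple products are [- D ^ 3]
   and [D ^ 3] times the two sides of the braid relation. *)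
have sum0 : u1 * (w1 * (u2 * (w2 * (u1 * (w1 * z)))))
    + u2 * (w2 * (u1 * (w1 * (u2 * (w2 * z))))) = 0.
  have zz := Nz.
  rewrite (s1E (u2 * (w2 * (u1 * (w1 * z))))); last by auto 10.
  rewrite (s2E (u1 * (w1 * z))) ?(s1E z) //; last by rewrite -s1E //; auto 10.
  rewrite (s2E (u1 * (w1 * (u2 * (w2 * z))))); last by auto 10.
  rewrite (s1E (u2 * (w2 * z))) ?(s2E z) //; last by rewrite -s2E //; auto 10.
  rewrite -!(scalerAr, scalerA, scalerAl) !scalerA !mulrA (sys_braid sys) //.
  by rewrite -scalerDl; apply/eqP; rewrite scaler_eq0; apply/orP; left; apply/eqP; ring.
have K1 y : weight3 i tau sig y -> w1 * (w1 * y) = K *: y.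
  by case=> y1 y2 _; rewrite mulrA dw_sqr // mulrDl y1 y2 -scalerDl addrC.
have K2 y : weight3 i tau sig y -> w2 * (w2 * y) = K *: y.
  by case=> _ y2 y3; rewrite mulrA dw_sqr // mulrDl y2 y3 -scalerDl.
have K21 y : weight3 i tau sig y ->
    w2 * (w1 * y) = - (sig + sig) *: y - w1 * (w2 * y).
  case=> _ y2 _; rewrite !mulrA dw_dw // mulrBl mulNr mulrDl y2 -scalerDl.
  by rewrite scaleNr.
have swap1 (a b y : A) : a * b = - (b * a) -> a * (b * y) = - (b * (a * y)).
  by move=> e; rewrite mulrA e mulNr mulrA.
have w1u1 := @du_dw i i ni' ni'; have w1u2 := @du_dw i i.+1 ni' ni.
have w2u1 := @du_dw i.+1 i ni ni'; have w2u2 := @du_dw i.+1 i.+1 ni ni.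
have {}sum0 : (u1 * u2 * u1) * (w1 * (w2 * (w1 * z)))
    + (u2 * u1 * u2) * (w2 * (w1 * (w2 * z))) = 0.
  apply/oppr_inj; rewrite oppr0 -sum0 opprD; congr (_ + _).
    rewrite (swap1 w1 u2) // mulrN; congr (- _); rewrite -!mulrA.
    by rewrite (swap1 w2 u1) // !mulrN (swap1 w1 u1) // !mulrN opprK.
  rewrite (swap1 w2 u1) // mulrN; congr (- _); rewrite -!mulrA.
  by rewrite (swap1 w1 u2) // !mulrN (swap1 w2 u2) // !mulrN opprK.
have e1 : w1 * (w2 * (w1 * z)) = - ((sig + sig) *: (w1 * z)) - K *: (w2 * z).
  rewrite K21 // mulrBr (K1 (w2 * z)) ?scaleNr ?mulrN -?scalerAr //.
  exact: Nw2.
have e2 : w2 * (w1 * (w2 * z)) = - ((sig + sig) *: (w2 * z)) - K *: (w1 * z).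
  rewrite (K21 (w2 * z)); last exact: Nw2.
  rewrite K2 // -scalerAr scaleNr //.
have e3 : u1 * u2 * u1 = (u1 + u2) + (u1 + u2).
  have e := du_du ni; rewrite -/u1 -/u2 in e; rewrite -mulrA e mulrBr mulrA du_sqr //.
  non_commutative_ring.
have e4 : u2 * u1 * u2 = (u1 + u2) + (u1 + u2).
  have e := du_du ni; rewrite -/u1 -/u2 in e; rewrite e mulrBl -mulrA du_sqr //.
  non_commutative_ring.
move: sum0; rewrite e1 e2 e3 e4 -mulrDr.
have -> : - ((sig + sig) *: (w1 * z)) - K *: (w2 * z)
    + (- ((sig + sig) *: (w2 * z)) - K *: (w1 * z))
    = - (sig + sig + K) *: ((w1 + w2) * z).
  rewrite /K; clearbody w1 w2; rewrite mulrDl !(scaleNr, scalerDr, scalerDl); ncr A.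
rewrite mulrDl => /half0; rewrite -scalerAr => /eqP; rewrite scaler_eq0 oppr_eq0.
rewrite (negbTE st0) /= => /eqP uw0.
(* [u1 + u2] is [c_i - c_(i+2)], whose square is [- 2], so it cancels. Likewise [w1 + w2] is
   [d_i - d_(i+2)], whose square acts on [z] as [2 tau], which is not 0. *)
have {uw0} : (w1 + w2) * z = 0.
  have : (u1 + u2) * ((u1 + u2) * ((w1 + w2) * z)) = 0 by rewrite uw0 mulr0.
  have e := du_du ni; rewrite -/u1 -/u2 in e.
  rewrite mulrA (_ : (u1 + u2) * (u1 + u2) = - (1 + 1)).
    by rewrite mulNr mulrDl mul1r => /eqP; rewrite oppr_eq0 => /eqP /half0.
  have f1 := du_sqr ni'; have f2 := du_sqr ni; rewrite -/u1 -/u2 in f1 f2.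
  by clearbody u1 u2; rewrite mulrDl !mulrDr e f1 f2; non_commutative_ring.
move=> w0; have : (w1 + w2) * ((w1 + w2) * z) = 0 by rewrite w0 mulr0.
move: (K1 z Nz) (K2 z Nz) (K21 z Nz); clearbody w1 w2 => k1 k2 k21.
rewrite !(mulrDl, mulrDr) k1 k2 k21 => h.
have {h} : (tau + tau) *: z = 0.
  by rewrite -h /K;  rewrite !(scaleNr, scalerDl); ncr A.
by move/eqP; rewrite scaler_eq0 -mulr2n mulrn_eq0 /= (negbTE t0) => /eqP.
Qed.

End System.

Notation intw_def := intw (only parsing).

Section HornerAlg.
Variables (C : fieldType) (A : falgType C).
Implicit Types (p : {poly C}) (y z : A).

Lemma horner_alg_intertwine y z z' p : y * z = z' * y ->
  y * horner_alg z p = horner_alg z' p * y.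
Proof.
move=> e; elim/poly_ind: p => [|p a IH]; first by rewrite !rmorph0 mulr0 mul0r.
rewrite !rmorphD !rmorphM /= !horner_algX !horner_algC mulrDr mulrDl.
by rewrite !mulrA IH -!mulrA e -scalerAr -scalerAl mulr1 mul1r.
Qed.

Lemma horner_alg_eig y z (t : C) p : z * y = t *: y ->
  horner_alg z p * y = p.[t] *: y.
Proof.
move=> e; elim/poly_ind: p => [|p a IH].
  by rewrite rmorph0 mul0r horner0 scale0r.
rewrite rmorphD rmorphM /= horner_algX horner_algC mulrDl -mulrA e -scalerAr IH.
by rewrite hornerMXaddC scalerDl scalerA mulrC -scalerAl mul1r.
Qed.

Lemma horner_alg_eigr y z (t : C) p : y * z = t *: y ->
  y * horner_alg z p = p.[t] *: y.
Proof.
move=> e; elim/poly_ind: p => [|p a IH].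
  by rewrite rmorph0 mulr0 horner0 scale0r.
rewrite rmorphD rmorphM /= horner_algX horner_algC mulrDr mulrA IH -scalerAl e.
by rewrite hornerMXaddC scalerDl scalerA -scalerAr mulr1.
Qed.
End HornerAlg.

(** * Squared contents and interpolation at addable contents *)

Section SquaredContents.
Variable C : numFieldType.
Implicit Types (a b : nat).

Definition k2 a : C := (a * a.+1)%:R.

Lemma k2_inj : injective k2.
Proof.
move=> a b /eqP; rewrite eqr_nat => /eqP e.
by case: (ltngtP a b) => // h; exfalso; nia.
Qed.

(** By [intw_intw], the scalar by which the square of the intertwiner acts on vectors where the two
    squares have the values [k2 a] and [k2 b]. *)
Definition norm2 a b : C := (k2 a + k2 b) + (k2 a + k2 b) - (k2 a - k2 b) * (k2 a - k2 b).

Lemma norm2C a b : norm2 a b = norm2 b a.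
Proof. by rewrite /norm2; ring. Qed.

(** With [d = b - a] and [m = a + b + 1] one has [k2 b - k2 a = m d] and
    [2 (k2 a + k2 b) = m ^ 2 + d ^ 2 - 1], whence the factorization; it vanishes only if [d] or [m]
    is 1 in absolute value. *)
Lemma norm2_neq0 a b : far a b -> norm2 a b != 0.
Proof.
wlog lab : a b / (a.+1 < b)%N.
  move=> H; rewrite /far => /orP[h|h]; first by apply: H; rewrite /far ?h.
  by rewrite norm2C; apply: H; rewrite // /far h.
move=> _; pose d := (b - a)%N; pose m := (a + b.+1)%N.
have -> : norm2 a b = - ((m ^ 2 - 1) * (d ^ 2 - 1))%:R.
  have [db mb] : (1 < d)%N /\ (1 < m)%N by rewrite /d /m; lia.
  have eb : b = (a + d)%N by rewrite /d; lia.
  rewrite natrM !natrB ?expn_gt0 ?(ltnW db) ?(ltnW mb) // /norm2 /k2 /m eb.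
  by rewrite !natrX !(natrM, natrD) -!natr1 !natrD; ring.
rewrite oppr_eq0 pnatr_eq0 muln_eq0 negb_or !subn_eq0 -!ltnNge.
by rewrite !expnS !expn0 /d /m; apply/andP; split; nia.
Qed.
End SquaredContents.

Section Interpolation.
Variable C : numFieldType.
Implicit Types (W T : seq nat) (a b : nat).

Definition adds W : seq nat := [seq a <- iota 0 (size W).+1 | addable W a].

Lemma mem_adds W a : std W -> (a \in adds W) = addable W a.
Proof.
move=> sW; rewrite mem_filter mem_iota /= add0n ltnS.
by case: (boolP (addable W a)) => //= /(addable_le_size sW) ->.
Qed.

Lemma adds_uniq W : uniq (adds W).
Proof. by rewrite filter_uniq // iota_uniq. Qed.

Definition addp W : {poly C} := \prod_(a <- adds W) ('X - (k2 C a)%:P).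
Definition lagp W a : {poly C} := \prod_(b <- adds W | b != a)
  ((k2 C a - k2 C b)^-1 *: ('X - (k2 C b)%:P)).

Lemma lagp_eq1 W a : (lagp W a).[k2 C a] = 1.
Proof.
rewrite /lagp horner_prod big1 // => b ba; rewrite hornerZ hornerXsubC mulVf //.
by rewrite subr_eq0 (inj_eq (@k2_inj C)) eq_sym.
Qed.

Lemma lagp_eq0 W a b : b \in adds W -> b != a -> (lagp W a).[k2 C b] = 0.
Proof.
move=> bW ba; rewrite /lagp horner_prod (big_rem b) //= ba hornerZ hornerXsubC.
by rewrite subrr mulr0 mul0r.
Qed.

Lemma lagp_addp W a : a \in adds W ->
  exists k, ('X - (k2 C a)%:P) * lagp W a = k *: addp W.
Proof.
move=> aW; exists (\prod_(b <- adds W | b != a) (k2 C a - k2 C b)^-1).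
rewrite /lagp /addp scaler_prod (bigD1_seq a) ?adds_uniq //=.
by rewrite -scalerAr.
Qed.

(** The difference of the two sides has degree less than the number of addable contents and vanishes
    at each [k2 C a]. *)
Lemma sum_lagp W : adds W != [::] -> \sum_(a <- adds W) lagp W a = 1.
Proof.
move=> nW; set r := adds W in nW *; have ur : uniq r := adds_uniq W.
have lagE a : lagp W a = (\prod_(b <- r | b != a) (k2 C a - k2 C b)^-1)
    *: \prod_(b <- [seq b <- r | b != a]) ('X - (k2 C b)%:P).
  by rewrite /lagp scaler_prod big_filter.
have szs a : a \in r -> (size (lagp W a) <= size r)%N.
  move=> ar; rewrite lagE (leq_trans (size_scale_leq _ _)) // size_prod_XsubC.
  by rewrite size_filter -(count_predC (pred1 a) r) addnC -addn1 leq_add2l -has_count has_pred1.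
have szS : (size (\sum_(a <- r) lagp W a - 1)%R <= size r)%N.
  rewrite (leq_trans (size_polyD _ _)) // geq_max size_polyN size_poly1.
  rewrite lt0n size_eq0 nW andbT.
  rewrite big_seq; elim/big_ind: _ => [|p q hp hq|a /szs //].
    by rewrite size_poly0.
  by rewrite (leq_trans (size_polyD _ _)) // geq_max hp hq.
apply/eqP; rewrite -subr_eq0; apply: contraTT szS => nz; rewrite -ltnNge.
rewrite -(size_map (k2 C)); apply: max_poly_roots => //.
  apply/allP => _ /mapP[b br ->]; rewrite rootE hornerD hornerN hornerC horner_sum.
  rewrite (bigD1_seq b) //= lagp_eq1 big1 ?addr0 ?subrr // => a ab.
  by rewrite lagp_eq0 // eq_sym.
by rewrite map_inj_uniq //; exact: k2_inj.
Qed.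
End Interpolation.

Notation k2_def := k2 (only parsing).

Section Pairs.
Local Open Scope nat_scope.
Implicit Types (R : seq nat) (a b j : nat).
Lemma nth_pair0 R1 a b R2 : nth 0 (R1 ++ [:: a, b & R2]) (size R1) = a.
Proof. by rewrite nth_cat ltnn subnn. Qed.
Lemma nth_pair1 R1 a b R2 : nth 0 (R1 ++ [:: a, b & R2]) (size R1).+1 = b.
Proof. by rewrite nth_cat ltnNge leqnSn /= subSnn. Qed.
Lemma nth_pairj R1 a b R2 j : j != size R1 -> j != (size R1).+1 ->
  nth 0 (R1 ++ [:: a, b & R2]) j = nth 0 (R1 ++ [:: b, a & R2]) j.
Proof.
move=> n1 n2; rewrite !nth_cat; case: ltnP => // ij.
by case: (j - size R1) (subnKC ij) => [|[|m]] //= e; lia.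
Qed.
Lemma size_pair R1 a b R2 :
  size (R1 ++ [:: a, b & R2]) = (size R1 + size R2).+2.
Proof. by rewrite size_cat /= !addnS. Qed.
End Pairs.

Section Spectrum.
Variables (C : numClosedFieldType) (A : falgType C) (n : nat) (c x s : nat -> A).
Hypothesis sys : sergeev_system n c x s.
Implicit Types (i j k : nat) (y z : A) (T R W : seq nat) (a b : nat).
Local Notation X i := (sq x i).
Local Notation k2 := (k2 C).
Local Notation intw := (intw c x s).

(** The subalgebra on the first [k] letters, given by words so that its properties are proved by
    induction on them. Scalars come from [gen_one] and [gen_scale], and the [x i] belong to it by
    [gen_x]. *)
Inductive gen k : A -> Prop :=
| gen_one : gen k 1
| gen_c i : (i < k)%N -> gen k (c i)
| gen_s i : (i.+1 < k)%N -> gen k (s i)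
| gen_add y z : gen k y -> gen k z -> gen k (y + z)
| gen_scale (t : C) y : gen k y -> gen k (t *: y)
| gen_mul y z : gen k y -> gen k z -> gen k (y * z).

Lemma gen_opp k y : gen k y -> gen k (- y).
Proof. by move=> gy; rewrite -scaleN1r; apply: gen_scale. Qed.

Lemma gen_sub k y z : gen k y -> gen k z -> gen k (y - z).
Proof. by move=> gy gz; apply: gen_add => //; apply: gen_opp. Qed.

Lemma gen_zero k : gen k 0.
Proof. by rewrite -(scale0r (1 : A)); apply: gen_scale; apply: gen_one. Qed.

Lemma gen_le k l y : (k <= l)%N -> gen k y -> gen l y.
Proof.
move=> kl; elim=> [|i ik|i ik|{}y z _ gy _ gz|t {}y _ gy|{}y z _ gy _ gz].
- exact: gen_one.
- by apply: gen_c; apply: leq_trans kl.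
- by apply: gen_s; apply: leq_trans kl.
- exact: gen_add.
- exact: gen_scale.
exact: gen_mul.
Qed.

Lemma gen_x k i : (k <= n)%N -> (i < k)%N -> gen k (x i).
Proof.
move=> kn; elim: i => [|i IH] ik; first by rewrite (sys_x0 sys); apply: gen_zero.
have iln := leq_trans ik kn.
have -> : x i.+1 = (s i * x i + 1 - c i * c i.+1) * s i.
  by rewrite -(sys_sx sys) // -mulrA (sys_ss sys) // mulr1.
apply: gen_mul; last exact: gen_s.
apply: gen_sub; first apply: gen_add.
- by apply: gen_mul; [apply: gen_s | apply: IH; apply: ltnW].
- exact: gen_one.
by apply: gen_mul; apply: gen_c => //; apply: ltnW.
Qed.

Lemma gen_sq k i : (k <= n)%N -> (i < k)%N -> gen k (X i).
Proof. by move=> kn ik; apply: gen_mul; apply: gen_x. Qed.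

Lemma gen_od k i : (k <= n)%N -> (i < k)%N -> gen k (od c x i).
Proof. by move=> kn ik; apply: gen_mul; [apply: gen_c | apply: gen_x]. Qed.

Lemma gen_intw k i : (k <= n)%N -> (i.+1 < k)%N -> gen k (intw i).
Proof.
move=> kn ik; have ik' := ltnW ik.
apply: gen_sub; apply: gen_mul; try apply: gen_sub; try apply: gen_sq => //.
- exact: gen_s.
- exact: gen_c.
- exact: gen_c.
- exact: gen_od.
exact: gen_od.
Qed.

Lemma gen_horner k y (p : {poly C}) : gen k y -> gen k (horner_alg y p).
Proof.
move=> gy; elim/poly_ind: p => [|p a IH]; first by rewrite rmorph0; apply: gen_zero.
rewrite rmorphD rmorphM /= horner_algX horner_algC; apply: gen_add.
  exact: gen_mul.
by apply: gen_scale; apply: gen_one.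
Qed.

Lemma gen_comm_x k j y : (k <= j)%N -> (j < n)%N -> gen k y -> y * x j = x j * y.
Proof.
move=> kj jn; elim=> [|i ik|i ik|{}y z _ gy _ gz|t {}y _ gy|{}y z _ gy _ gz].
- by rewrite mul1r mulr1.
- by rewrite (sys_xc sys) //; lia.
- by rewrite (sys_sxj sys) //; lia.
- by rewrite mulrDl mulrDr gy gz.
- by rewrite -scalerAl -scalerAr gy.
by rewrite -mulrA gz mulrA gy mulrA.
Qed.

Lemma gen_comm_sq k j y : (k <= j)%N -> (j < n)%N -> gen k y -> y * X j = X j * y.
Proof. by move=> kj jn gy; rewrite /sq mulrA (gen_comm_x kj jn gy) -mulrA (gen_comm_x kj jn gy) mulrA. Qed.

(** At every entry the Lagrange polynomial in the current [x_m ^ 2] selects the content really added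
    among all addable ones. *)
Fixpoint eprojx W R : A :=
  if R is a :: R' then horner_alg (X (size W)) (lagp C W a) * eprojx (rcons W a) R'
  else 1.
Definition eproj T := eprojx [::] T.

Lemma eprojx_cat W R1 R2 : eprojx W (R1 ++ R2) = eprojx W R1 * eprojx (W ++ R1) R2.
Proof.
elim: R1 W => [|a R1 IH] W /=; first by rewrite mul1r cats0.
by rewrite IH -mulrA cat_rcons.
Qed.

Lemma eproj_cat T R : eproj (T ++ R) = eproj T * eprojx T R.
Proof. exact: eprojx_cat. Qed.

Lemma eproj_rcons T a : eproj (rcons T a) = eproj T * horner_alg (X (size T)) (lagp C T a).
Proof. by rewrite -cats1 eproj_cat /= mulr1. Qed.

Lemma comm_eprojx y W R :
  (forall i, (size W <= i < size W + size R)%N -> y * X i = X i * y) ->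
  y * eprojx W R = eprojx W R * y.
Proof.
elim: R W => [|a R IH] W /= H; first by rewrite mulr1 mul1r.
rewrite mulrA (@horner_alg_intertwine _ _ y _ (X (size W))); last first.
  by apply: H; rewrite leqnn addnS ltnS leq_addr.
rewrite -!mulrA; congr (_ * _); apply: IH => i; rewrite size_rcons => /andP[h1 h2].
by apply: H; rewrite (ltnW h1) addnS -addSn.
Qed.

Lemma comm_eproj y T : (forall i, (i < size T)%N -> y * X i = X i * y) ->
  y * eproj T = eproj T * y.
Proof. by move=> H; apply: comm_eprojx => i /= /H. Qed.

Lemma sq_eprojx i W R : (i < n)%N -> (size W + size R <= n)%N ->
  X i * eprojx W R = eprojx W R * X i.
Proof.
move=> ni nT; apply: comm_eprojx => j /andP[_ jT]; apply: (sq_sq sys) => //.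
exact: leq_trans nT.
Qed.

Lemma sq_eproj i T : (i < n)%N -> (size T <= n)%N -> X i * eproj T = eproj T * X i.
Proof. by move=> ni nT; apply: sq_eprojx. Qed.

Lemma c_eproj i T : (i < n)%N -> (size T <= n)%N -> c i * eproj T = eproj T * c i.
Proof.
move=> ni nT; apply: comm_eproj => j jT; rewrite (sq_c sys) //.
exact: leq_trans nT.
Qed.

Lemma x_eproj i T : (i < n)%N -> (size T <= n)%N -> x i * eproj T = eproj T * x i.
Proof.
move=> ni nT; apply: comm_eproj => j jT; rewrite (sq_x sys) //.
exact: leq_trans nT.
Qed.

Lemma od_eproj i T : (i < n)%N -> (size T <= n)%N ->
  od c x i * eproj T = eproj T * od c x i.
Proof. by move=> ni nT; rewrite /od -mulrA x_eproj // mulrA c_eproj // mulrA. Qed.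

Lemma gen_eproj k T : (size T <= k)%N -> (k <= n)%N -> gen k (eproj T).
Proof.
move=> Tk kn; elim/last_ind: T Tk => [|T a IH]; first by move=> _; apply: gen_one.
rewrite size_rcons eproj_rcons => Tk; apply: gen_mul; first by apply: IH; apply: ltnW.
by apply: gen_horner; apply: gen_sq.
Qed.

(* The next box of a tableau T has one of the contents predicted by the
   addable boxes of its shape. *)
Definition spectral T := horner_alg (X (size T)) (addp C T) * eproj T = 0.

Definition spectral_below k := forall T, std T -> (size T < k)%N -> spectral T.

Definition has_weight T z := forall i, (i < size T)%N -> X i * z = k2 (nth 0%N T i) *: z.

Section Below.
Variable k : nat.
Hypotheses (Gk : spectral_below k) (kn : (k <= n)%N).

Lemma eproj_step T a : std (rcons T a) -> (size T < k)%N ->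
  X (size T) * eproj (rcons T a) = k2 a *: eproj (rcons T a).
Proof.
rewrite std_rcons => /andP[sT aT] Tk; have Tn := leq_trans Tk kn.
have [t e] : exists t, ('X - (k2 a)%:P) * lagp C T a = t *: addp C T.
  by apply: lagp_addp; rewrite mem_adds.
have Tn' := ltnW Tn; rewrite eproj_rcons (horner_alg_intertwine _ (esym (sq_eproj Tn Tn'))).
apply/eqP; rewrite -subr_eq0 -mulr_algl -mulrBl mulrA.
have -> : X (size T) - (k2 a)%:A = horner_alg (X (size T)) ('X - (k2 a)%:P).
  by rewrite rmorphB /= horner_algX horner_algC.
by rewrite -rmorphM /= e linearZ /= mulr_algl -scalerAl (Gk sT Tk : _ = 0) scaler0.
Qed.

Lemma eproj_weight T : std T -> (size T <= k)%N -> has_weight T (eproj T).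
Proof.
elim/last_ind: T => [|T a IH] // sT' Tk i; move: (sT'); rewrite std_rcons => /andP[sT aT].
move: Tk; rewrite size_rcons ltnS => Tk; rewrite leq_eqVlt => /orP[/eqP->|iT].
  by rewrite nth_rcons ltnn eqxx eproj_step.
rewrite nth_rcons iT eproj_rcons mulrA IH ?scalerAl //; exact: ltnW.
Qed.

Lemma eproj_fix T z : std T -> (size T <= n)%N -> has_weight T z -> eproj T * z = z.
Proof.
elim/last_ind: T => [|T a IH]; first by rewrite mul1r.
rewrite std_rcons size_rcons => /andP[sT aT] Tn wz.
have wT : has_weight T z.
  by move=> i iT; rewrite wz ?size_rcons ?nth_rcons ?iT // ltnW.
rewrite eproj_rcons -mulrA (horner_alg_eig _ (t := k2 a)).
  by rewrite lagp_eq1 scale1r (IH sT (ltnW Tn) wT).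
by rewrite wz ?size_rcons // nth_rcons ltnn eqxx.
Qed.

Lemma eproj_fixr T z : std T -> (size T <= n)%N ->
  (forall i, (i < size T)%N -> z * X i = k2 (nth 0%N T i) *: z) -> z * eproj T = z.
Proof.
elim/last_ind: T => [|T a IH]; first by rewrite mulr1.
rewrite std_rcons size_rcons => /andP[sT aT] Tn wz.
have wT i : (i < size T)%N -> z * X i = k2 (nth 0%N T i) *: z.
  by move=> iT; rewrite wz ?size_rcons ?nth_rcons ?iT // ltnW.
rewrite eproj_rcons mulrA (IH sT (ltnW Tn) wT) (horner_alg_eigr _ (t := k2 a)).
  by rewrite lagp_eq1 scale1r.
by rewrite wz ?size_rcons // nth_rcons ltnn eqxx.
Qed.

Lemma eproj_weightM T y : std T -> (size T <= k)%N -> has_weight T (eproj T * y).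
Proof. by move=> sT Tk i iT; rewrite mulrA eproj_weight // scalerAl. Qed.

Lemma eproj_weightr T i : std T -> (size T <= k)%N -> (i < size T)%N ->
  eproj T * X i = k2 (nth 0%N T i) *: eproj T.
Proof.
by move=> sT Tk iT; rewrite -sq_eproj ?(leq_trans Tk) ?(leq_trans iT) // ?eproj_weight // (leq_trans Tk).
Qed.

Lemma eproj_idem T : std T -> (size T <= k)%N -> eproj T * eproj T = eproj T.
Proof.
by move=> sT Tk; apply: eproj_fix => //; [apply: leq_trans kn | apply: eproj_weight].
Qed.

Lemma eproj_orth T R : std T -> std R -> size T = size R -> (size T <= k)%N ->
  T != R -> eproj T * eproj R = 0.
Proof.
move=> sT sR eTR Tk nTR; have Rk : (size R <= k)%N by rewrite -eTR.
have [i iT nTRi] : exists2 i, (i < size T)%N & nth 0%N T i != nth 0%N R i.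
  have [h|/hasPn h] := boolP (has (fun i => nth 0%N T i != nth 0%N R i) (iota 0 (size T))).
    by case/hasP: h => i; rewrite mem_iota /= add0n => iT; exists i.
  case/eqP: nTR; apply: (@eq_from_nth _ 0%N) => // i iT.
  by have := h i; rewrite mem_iota /= add0n iT negbK => /(_ isT)/eqP.
have e := eproj_weight sR Rk; rewrite /has_weight -eTR in e.
apply/eqP; have : (k2 (nth 0%N T i) - k2 (nth 0%N R i)) *: (eproj T * eproj R) = 0.
  by rewrite scalerBl scalerAl -eproj_weightr // -mulrA e // -scalerAr subrr.
by move/eqP; rewrite scaler_eq0 subr_eq0 (inj_eq (@k2_inj C)) (negbTE nTRi).
Qed.

Lemma has_weight_swap R1 a b R2 z : let i := size R1 in
  (size (R1 ++ [:: a, b & R2]) <= n)%N ->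
  has_weight (R1 ++ [:: a, b & R2]) z ->
  has_weight (R1 ++ [:: b, a & R2]) (intw i * z).
Proof.
move=> i; rewrite size_pair => Rn wz j; rewrite size_pair => jR.
have ni : (i.+1 < n)%N by rewrite /i; lia.
have nj : (j < n)%N by lia.
have [->|nji] := eqVneq j i.
  rewrite nth_pair0 mulrA -(intw_sq' sys) // -mulrA wz ?nth_pair1 ?scalerAr //.
  by rewrite size_pair /i; lia.
have [->|nji'] := eqVneq j i.+1.
  rewrite nth_pair1 mulrA -(intw_sq sys) // -mulrA wz ?nth_pair0 ?scalerAr //.
  by rewrite size_pair /i; lia.
rewrite mulrA -(intw_sqj sys) // -mulrA wz ?size_pair // -scalerAr.
by rewrite nth_pairj.
Qed.

(** Both sides equal [eproj T' * intw i * eproj T]: the intertwiner carries the weight of either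
    sequence to that of the other, from the left as well as from the right. *)
Lemma intw_eproj R1 a b R2 : let i := size R1 in
  std (R1 ++ [:: a, b & R2]) -> std (R1 ++ [:: b, a & R2]) ->
  (size (R1 ++ [:: a, b & R2]) <= k)%N ->
  intw i * eproj (R1 ++ [:: a, b & R2]) = eproj (R1 ++ [:: b, a & R2]) * intw i.
Proof.
move=> i s1 s2 Rk; set T := R1 ++ _; set T' := R1 ++ _.
have Rk' : (size T' <= k)%N by move: Rk; rewrite /T' !size_cat.
have Tn := leq_trans Rk kn; have Tn' := leq_trans Rk' kn.
transitivity (eproj T' * (intw i * eproj T)).
  rewrite eproj_fix //; apply: has_weight_swap => //.
  exact: eproj_weight.
rewrite mulrA eproj_fixr // => j jT.
have ni : (i.+1 < n)%N by move: Tn; rewrite size_pair /i; lia.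
have nj := leq_trans jT Tn; move: (jT); rewrite size_pair => jR.
have w := eproj_weightr s2 Rk'.
have [->|nji] := eqVneq j i.
  rewrite nth_pair0 -mulrA (intw_sq sys) // mulrA w ?nth_pair1 ?scalerAl //.
  by rewrite size_pair /i; lia.
have [->|nji'] := eqVneq j i.+1.
  rewrite nth_pair1 -mulrA (intw_sq' sys) // mulrA w ?nth_pair0 ?scalerAl //.
  by rewrite size_pair /i; lia.
rewrite -mulrA (intw_sqj sys) // mulrA w ?size_pair // -scalerAl.
by rewrite nth_pairj.
Qed.

Lemma intw_sqr_eproj R1 a b R2 : let i := size R1 in let T := R1 ++ [:: a, b & R2] in
  std T -> (size T <= k)%N ->
  intw i * intw i * eproj T = norm2 C a b *: eproj T.
Proof.
move=> i T sT Tk; have Tn := leq_trans Tk kn; move: (Tn); rewrite size_pair => Tn'.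
have ni : (i.+1 < n)%N by rewrite /i; lia.
have w0 : X i * eproj T = k2 a *: eproj T.
  by rewrite (eproj_weight sT Tk) ?nth_pair0 // size_pair /i; lia.
have w1 : X i.+1 * eproj T = k2 b *: eproj T.
  by rewrite (eproj_weight sT Tk) ?nth_pair1 // size_pair /i; lia.
have w2 : (X i - X i.+1) * eproj T = (k2 a - k2 b) *: eproj T.
  by rewrite mulrBl w0 w1 scalerBl.
rewrite (intw_intw sys) // mulrBl -mulrA w2 -scalerAr w2 !mulrDl w0 w1.
by rewrite -!scalerDl scalerA -scalerBl.
Qed.

(* Standard fillings of the same shape have equivalent idempotents. *)
Lemma eproj_link T R : std T -> std R -> perm_eq T R -> (size T <= k)%N ->
  exists y z, [/\ gen (size T) y, gen (size T) z & eproj T = y * eproj R * z].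
Proof.
move=> sT sR eTR Tk.
suff [_] : size R = size T /\ exists y z,
  [/\ gen (size T) y, gen (size T) z & eproj T = y * eproj R * z] by [].
apply: (@far_conn [::] (fun R => size R = size T /\ exists y z,
  [/\ gen (size T) y, gen (size T) z & eproj T = y * eproj R * z]) T R) => //.
  move=> R1 a b R2 st fab [szR [y [z [gy gz e]]]]; split.
    by rewrite -szR !size_cat.
  have st' : std (R1 ++ [:: b, a & R2]) by apply: std_ext_far_cat fab st.
  have Rk : (size (R1 ++ [:: a, b & R2]) <= k)%N by rewrite szR.
  have Rk' : (size (R1 ++ [:: b, a & R2]) <= k)%N by move: Rk; rewrite !size_cat.
  have gi : gen (size T) (intw (size R1)).
    by apply: gen_intw; [apply: leq_trans kn | rewrite -szR size_cat /=; lia].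
  exists (y * intw (size R1)), ((norm2 C a b)^-1 *: (intw (size R1) * z)); split.
  - exact: gen_mul.
  - by apply: gen_scale; apply: gen_mul.
  (* A far exchange is invertible between the two idempotents, because the square of its intertwiner
     is the nonzero scalar [norm2 C a b]. *)
  have := intw_sqr_eproj st Rk; rewrite -mulrA intw_eproj // => e2.
  rewrite e -[eproj (R1 ++ _) in LHS]scale1r -(mulVf (norm2_neq0 C fab)) -scalerA -e2.
  by rewrite -!(scalerAl, scalerAr) !mulrA.
by split=> //; exists 1, 1; split; rewrite ?mulr1 ?mul1r //; apply: gen_one.
Qed.
End Below.
End Spectrum.

Lemma mul_sqr_eq (R : nzRingType) (p q y : R) :
  p * y = q * y -> p * q = q * p -> p * p * y = q * q * y.
Proof. by move=> e pq; rewrite -!mulrA e !mulrA pq -mulrA e mulrA. Qed.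

Section SpectrumTheorem.
Variables (C : numClosedFieldType) (A : falgType C) (n : nat) (c x s : nat -> A).
Hypothesis sys : sergeev_system n c x s.
Implicit Types (i j k : nat) (y z : A) (T R W : seq nat) (a b : nat).
Local Notation X i := (sq x i).
Local Notation k2 := (k2 C).
Local Notation intw := (intw c x s).
Local Notation eproj := (@eproj C A x).
Local Notation gen := (@gen C A c s).

Lemma sq_semisimple i a z : (i < n)%N ->
  (X i - (k2 a)%:A) * ((X i - (k2 a)%:A) * z) = 0 -> (X i - (k2 a)%:A) * z = 0.
Proof. by rewrite /k2_def scaler_nat; apply: (sys_Xss sys). Qed.

(* Equal consecutive eigenvalues are impossible: s_i z would otherwise be a
   generalised eigenvector of x_(i+1)^2. *)
Lemma equal_pattern i a z : (i.+1 < n)%N ->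
  X i * z = k2 a *: z -> X i.+1 * z = k2 a *: z -> z = 0.
Proof.
move=> ni z0 z1; have ni' := ltnW ni.
pose q := du c i * dw c x i.
have qX : X i.+1 * q = q * X i.+1.
  by rewrite /q mulrA (sq_du sys) // -mulrA (sq_dw sys) // mulrA.
have Ysz : (X i.+1 - (k2 a)%:A) * (s i * z) = - (q * z).
  have e : X i.+1 * (s i * z) = k2 a *: (s i * z) - q * z.
    have := congr1 (fun w => w * z) (ssq sys ni); rewrite -mulrA z0 -scalerAr mulrDl.
    by rewrite -mulrA => ->; rewrite addrK.
  by rewrite mulrBl mulr_algl e addrC addKr.
have qz : q * z = 0.
  apply: oppr_inj; rewrite oppr0 -Ysz; apply: sq_semisimple => //.
  rewrite Ysz mulrN mulrBl mulrA qX -mulrA z1 mulr_algl -scalerAr subrr.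
  by rewrite oppr0.
have h : (k2 a + k2 a + (k2 a + k2 a)) *: z = 0.
  have := congr1 (fun w => w * z) (du_dw_sqr sys ni).
  by rewrite /= -mulrA -/q qz mulr0 !mulrDl z0 z1 -!scalerDl => <-.
have [a0|a0] := eqVneq a 0%N; last first.
  move/eqP: h; rewrite scaler_eq0 -!natrD pnatr_eq0 !addn_eq0 muln_eq0.
  by rewrite (negbTE a0) => /eqP.
(* For content 0 both [x_i] and [x_(i+1)] kill [z], so [x_(i+1)] kills [s_i z] by semisimplicity,
   that is [(1 - c_i c_(i+1)) z = 0]. This forces [z = 0], as
   [(1 + c_i c_(i+1)) (1 - c_i c_(i+1)) = 2]. *)
move: z0 z1; rewrite a0 /k2_def mul0n !scale0r /sq -!mulrA => z0 z1.
have {}z0 := sys_xss sys ni' z0; have {}z1 := sys_xss sys ni z1.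
have xs : x i.+1 * (s i * z) = (1 - c i * c i.+1) * z.
  by rewrite mulrA (sys_sx sys) // -addrA mulrDl -mulrA z0 mulr0 add0r.
have cx : x i.+1 * (c i * c i.+1) = - (c i * c i.+1) * x i.+1.
  rewrite mulrA (sys_xc sys) ?gtn_eqF // -mulrA (sys_xcN sys) // mulrN mulrA.
  by rewrite mulNr.
have : x i.+1 * (x i.+1 * (s i * z)) = 0.
  by rewrite xs mulrA mulrBr mulr1 cx mulNr opprK mulrDl -mulrA z1 mulr0 addr0.
move/(sys_xss sys ni); rewrite xs => h1.
have : (1 + c i * c i.+1) * ((1 - c i * c i.+1) * z) = 0 by rewrite h1 mulr0.
rewrite mulrA (_ : (_ + _) * (_ - _) = 1 + 1).
  by rewrite mulrDl mul1r => /half0.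
have e : c i * c i.+1 * (c i * c i.+1) = - 1.
  rewrite [c i * c i.+1]( sys_cN sys) ?ltn_eqF // mulrN mulNr opprK.
  rewrite -mulrA [c i * _]mulrA.
  rewrite [c i * c i.+1](sys_cN sys) ?ltn_eqF //.
  rewrite mulNr mulrN -mulrA (sys_cc sys) // mulrN1 mulrN opprK (sys_cc sys) //.
by rewrite mulrDl mul1r mulrBr e mulr1 opprK addrA subrK.
Qed.

Lemma addable_rcons W a b : addable W a -> addable W b -> a != b ->
  addable (rcons W a) b.
Proof.
rewrite /addable !mult_rcons => ha hb ab; rewrite (negbTE ab).
move: ha hb ab; case: (eqVneq a b.+1) => [->|n1]; last case: (eqVneq a b.-1) => [->|n2]; rewrite /=; lia.
Qed.

(** The place to the right of the new box can be blocked only by a missing box above it, of content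
    [a.+2]; then the last box of content [a.+1] is a corner of [W]. *)
Lemma addable_up W a : addable W a -> std W ->
  ~~ addable (rcons W a) a.+1 -> removable W a.+1.
Proof.
move=> aW /std_count v; have := v a.+1; have := v a; move: aW.
have m0 : mult (rcons W a) a = (mult W a).+1 by rewrite mult_rcons eqxx addn1.
have m1 : mult (rcons W a) a.+1 = mult W a.+1 by rewrite mult_rcons ltn_eqF ?addn0.
have m2 : mult (rcons W a) a.+2 = mult W a.+2 by rewrite mult_rcons ltn_eqF ?addn0.
rewrite /addable /removable /= m0 m1 m2; lia.
Qed.

Lemma addable_down W a : addable W a -> std W -> a != 0%N ->
  ~~ addable (rcons W a) a.-1 -> (a.-1 != 0%N) && removable W a.-1.
Proof.
case: a => // a aW /std_count v _; have := v a; have := v a.-1; move: aW.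
have m0 : mult (rcons W a.+1) a.+1 = (mult W a.+1).+1 by rewrite mult_rcons eqxx addn1.
have m1 : mult (rcons W a.+1) a = mult W a by rewrite mult_rcons gtn_eqF ?addn0.
have m2 : mult (rcons W a.+1) a.-1 = mult W a.-1.
  by rewrite mult_rcons gtn_eqF ?addn0 // ltnS leq_pred.
rewrite /addable /removable /= m0 m1 m2; case: a {m0 m1 m2} => [|a] /=; lia.
Qed.

Lemma k2_neq0 a : a != 0%N -> k2 a != 0.
Proof. by move=> a0; rewrite pnatr_eq0 muln_eq0 orbF. Qed.

Section Step.
Variable k : nat.
Hypotheses (Gk : spectral_below x k) (kn : (k < n)%N).

Lemma near_pattern W a b z : std (rcons W a) -> size (rcons W a) = k ->
  (b == a.+1) || ((a == b.+1) && (b != 0%N)) -> removable W b ->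
  has_weight x (rcons W a) z -> X k * z = k2 b *: z -> z = 0.
Proof.
move=> sW szk ab r wz zb; have kn' := ltnW kn.
have [sW' aW] : std W /\ addable W a by move: sW; rewrite std_rcons => /andP[].
have [W2 sW2 eW2] := removable_perm sW' r.
have e : perm_eq (rcons W a) (rcons (rcons W2 b) a) by rewrite -!cats1 perm_cat2r perm_sym cats1.
have s2 : std (rcons (rcons W2 b) a).
  by rewrite std_rcons sW2 (eq_addable _ eW2).
have Tk : (size (rcons W a) <= k)%N by rewrite szk.
have [y1 [y2 [g1 g2 eT]]] := eproj_link sys Gk kn' sW s2 e Tk.
have sz2 : size W2 = k.-2.
  by rewrite -szk size_rcons; move: (perm_size e); rewrite !size_rcons => -[->].
have k_ge2 : (1 < k)%N by rewrite -szk (perm_size e) !size_rcons.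
have szn : (size (rcons W a) <= n)%N by rewrite szk.
rewrite -(eproj_fix sW szn wz) eT -!mulrA.
suff -> : eproj (rcons (rcons W2 b) a) * (y2 * z) = 0 by rewrite mulr0.
have Tk2 : (size (rcons (rcons W2 b) a) <= k)%N by rewrite -(perm_size e).
have w2 := eproj_weightM sys Gk kn' (y2 * z) s2 Tk2.
have k0 : k.-2.+2 = k by rewrite -[RHS](ltn_predK k_ge2) -(ltn_predK (_ : (0 < k.-1)%N)) //; lia.
set m := k.-2 in sz2 k0; have m2 : (m.+2 < n)%N by rewrite k0.
have m1 : (m.+1 < n)%N by apply: ltnW.
have m0 : (m < n)%N by apply: ltnW.
rewrite -k0 in zb; apply: (@braid_pattern _ _ _ _ _ _ sys m (k2 b) (k2 a)) => //.
- by apply: k2_neq0; case/orP: ab => [/eqP->//|/andP[]].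
- rewrite -!natrD pnatr_eq0 !addn_eq0 !muln_eq0 /= !orbF !andbA.
  by apply/negP => /andP[/andP[/andP[/eqP a0 _] _] /eqP b0]; move: ab; rewrite a0 b0.
- move=> v [v0 v1 v2]; split.
    apply: (@equal_pattern m.+1 b) => //.
      by rewrite mulrA -(intw_sq sys) // -mulrA v0 scalerAr.
    by rewrite mulrA -(intw_sqj sys) ?gtn_eqF // -mulrA v2 scalerAr.
  apply: (@equal_pattern m b) => //.
    by rewrite mulrA -(intw_sqj sys) ?ltn_eqF // -mulrA v0 scalerAr.
  by rewrite mulrA -(intw_sq' sys) // -mulrA v2 scalerAr.
have szW2 : size (rcons (rcons W2 b) a) = m.+2 by rewrite !size_rcons sz2.
split.
- by rewrite w2 ?szW2 // !nth_rcons size_rcons sz2 ltnS leqnn ltnn eqxx.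
- by rewrite w2 ?szW2 // nth_rcons size_rcons sz2 ltnn eqxx.
have e1 : X m.+2 * eproj (rcons (rcons W2 b) a) = eproj (rcons (rcons W2 b) a) * X m.+2.
  by apply: (sq_eproj sys); rewrite ?szW2 // ltnW.
have e2 : y2 * X m.+2 = X m.+2 * y2.
  by apply: (gen_comm_sq sys _ _ g2); rewrite ?szk ?k0.
by rewrite mulrA e1 -mulrA [X m.+2 * _]mulrA -e2 -mulrA zb -!scalerAr.
Qed.

(* An eigenvalue of x_k^2 over T comes from an addable box of T. *)
Lemma addable_eigenvalue T a b z : std (rcons T a) -> size (rcons T a) = k ->
  has_weight x (rcons T a) z -> X k * z = k2 b *: z ->
  (addable T b || (b == a.+1) || (b == a.-1)) -> ~~ addable (rcons T a) b -> z = 0.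
Proof.
move=> sT szk wz zb hb nb; have [sT' aT] : std T /\ addable T a.
  by move: sT; rewrite std_rcons => /andP[].
have [eab|nab] := eqVneq b a.
  have szT : size T = k.-1 by rewrite -szk size_rcons.
  have kp : k.-1.+1 = k by rewrite -szk size_rcons.
  apply: (@equal_pattern k.-1 a); rewrite ?kp //; last by rewrite -eab.
  have := wz k.-1; rewrite szk nth_rcons szT ltnn eqxx; apply.
  by rewrite -[Z in (_ < Z)%N]kp.
case/orP: hb => [/orP[h|/eqP h]|/eqP h].
- by move: nb; rewrite addable_rcons // eq_sym.
- apply: (@near_pattern T a b) => //; first by rewrite h eqxx.
  by rewrite h; apply: addable_up => //; rewrite -h.
have a0 : a != 0%N by apply: contraNneq nab => a0; rewrite h a0.
have := addable_down aT sT' a0; rewrite -h => /(_ nb)/andP[b0 r].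
apply: (@near_pattern T a b) => //; rewrite b0 h prednK ?lt0n // eqxx.
by rewrite orbT.
Qed.
End Step.

(** A factor whose root has no eigenvector in [P] is cancelled, and a factor repeated is reduced to
    a simple one by [sq_semisimple]. *)
Lemma strip_factors i (L M : seq nat) (P : A -> Prop) : (i < n)%N ->
  (forall y a, P y -> P ((X i - (k2 a)%:A) * y)) ->
  (forall b y, b \in L -> b \notin M -> P y -> X i * y = k2 b *: y -> y = 0) ->
  uniq M -> forall y, P y ->
  horner_alg (X i) (\prod_(a <- L) ('X - (k2 a)%:P)) * y = 0 ->
  horner_alg (X i) (\prod_(a <- M) ('X - (k2 a)%:P)) * y = 0.
Proof.
move=> ni PX + uM; have hX b : horner_alg (X i) ('X - (k2 b)%:P) = X i - (k2 b)%:A.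
  by rewrite rmorphB /= horner_algX horner_algC.
have hc p q : horner_alg (X i) p * horner_alg (X i) q = horner_alg (X i) q * horner_alg (X i) p.
  by rewrite -!rmorphM mulrC.
have PM (r : seq nat) y : P y -> P (horner_alg (X i) (\prod_(a <- r) ('X - (k2 a)%:P)) * y).
  elim: r y => [|b r IH] y Py; first by rewrite big_nil rmorph1 mul1r.
  by rewrite big_cons rmorphM /= -mulrA hX; apply: PX; apply: IH.
elim: L => [|b L IH] H y Py.
  by rewrite big_nil rmorph1 mul1r => ->; rewrite mulr0.
rewrite big_cons mulrC rmorphM /= -mulrA hX => h.
have {}h := IH (fun a z aL => H a z (mem_behead (s := b :: L) aL)) _ (PX _ b Py) h.
set p := \prod_(a <- M) _ in h *.
have {}h : (X i - (k2 b)%:A) * (horner_alg (X i) p * y) = 0.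
  by rewrite mulrA -hX hc -mulrA hX.
have [bM|bM] := boolP (b \in M); last first.
  apply: (H b) => //; [exact: mem_head | exact: PM |].
  by apply/eqP; rewrite -subr_eq0 -mulr_algl -mulrBl h.
move: h; rewrite /p (big_rem b) //= rmorphM /= -!mulrA hX => h.
exact: sq_semisimple h.
Qed.

(** Write the sequence as [W] followed by [a]. The intertwiner carries the equation of [x_(k-1) ^ 2]
    over [W] to [x_k ^ 2], so [addp C W] at [x_k ^ 2], times the square of the intertwiner, kills
    the idempotent. That square is a quadratic in [x_k ^ 2] with roots [k2 a.+1] and [k2 a.-1]. The
    only candidates are thus the addable contents of [W] and the neighbours of [a], and
    [addable_eigenvalue] removes the wrong ones. *)
Theorem spectrum k : (k <= n)%N -> spectral_below x k.
Proof.
elim: k => [|k IH] kn; first by move=> T.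
have {IH}Gk := IH (ltnW kn); move=> T sT; rewrite ltnS leq_eqVlt => /orP[/eqP szT|]; last exact: Gk.
rewrite /spectral szT; case/lastP: T sT szT => [|W a] sT szT.
  rewrite /addp /adds /= big_cons big_nil mulr1 rmorphB /= horner_algX horner_algC.
  by rewrite -szT /sq (sys_x0 sys) mulr0 /k2_def mul0n scale0r subrr mul0r.
have [sW aW] : std W /\ addable W a by move: sT; rewrite std_rcons => /andP[].
have kn' := ltnW kn; have szW : size W = k.-1 by rewrite -szT size_rcons.
have kp : k.-1.+1 = k by rewrite -szT size_rcons.
have ni : (k.-1.+1 < n)%N by rewrite kp.
have Tk : (size (rcons W a) <= k)%N by rewrite szT.
pose L := adds W ++ [:: a.+1; a.-1].
pose P y := has_weight x (rcons W a) y.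
have Pe : P (eproj (rcons W a)) by apply: (eproj_weight sys Gk kn').
rewrite /addp; apply: (@strip_factors k L (adds (rcons W a)) P) => //.
- move=> y b Py i; rewrite szT => ik; have ni' := ltn_trans ik kn.
  have e : X i * (X k - (k2 b)%:A) = (X k - (k2 b)%:A) * X i.
    by rewrite mulrBr mulrBl (sq_sq sys ni' kn) mulr_algr mulr_algl.
  by rewrite mulrA e -mulrA Py ?szT // scalerAr.
- move=> b y bL bM Py yb; apply: (@addable_eigenvalue k Gk kn W a b) => //.
    by move: bL; rewrite mem_cat !inE mem_adds // orbA.
  by rewrite -mem_adds.
- exact: adds_uniq.
have eW : intw k.-1 * eproj W = eproj W * intw k.-1.
  apply: comm_eproj => i; rewrite szW => iW; rewrite (intw_sqj sys) //; lia.
have Xe : intw k.-1 * X k.-1 = X k * intw k.-1 by rewrite (intw_sq sys) // kp.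
have h : horner_alg (X k) (addp C W) * (intw k.-1 * intw k.-1 * eproj (rcons W a)) = 0.
  rewrite eproj_rcons [intw _ * intw _ * _]mulrA -[intw _ * intw _ * _]mulrA eW.
  rewrite !mulrA -(horner_alg_intertwine _ Xe) -[intw _ * _ * eproj W]mulrA.
  have := Gk W sW; rewrite /spectral szW => ->; last by rewrite -szT size_rcons.
  by rewrite mulr0 !mul0r.
rewrite big_cat big_cons big_seq1 /= rmorphM /= -mulrA -/(addp C W).
suff e : intw k.-1 * intw k.-1 * eproj (rcons W a) =
    - (horner_alg (X k) (('X - (k2 a.+1)%:P) * ('X - (k2 a.-1)%:P)) * eproj (rcons W a)).
  by apply: oppr_inj; rewrite oppr0 -h e mulrN.
have Xa : X k.-1 * eproj (rcons W a) = k2 a *: eproj (rcons W a).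
  have := Pe k.-1; rewrite szT nth_rcons szW ltnn eqxx; apply.
  by rewrite -[Z in (_ < Z)%N]kp.
have Xc : X k.-1 * X k = X k * X k.-1 by apply: (sq_sq sys) => //; apply: ltnW.
rewrite (intw_intw sys) // kp.
have -> : ((X k.-1 + X k) + (X k.-1 + X k) - (X k.-1 - X k) * (X k.-1 - X k)) * eproj (rcons W a)
  = horner_alg (X k) (((k2 a)%:P + 'X) + ((k2 a)%:P + 'X) - ((k2 a)%:P - 'X) * ((k2 a)%:P - 'X))
    * eproj (rcons W a).
  rewrite rmorphB rmorphM rmorphB /= !rmorphD /= horner_algX horner_algC.
  have e : (X k.-1 - X k) * eproj (rcons W a) = ((k2 a)%:A - X k) * eproj (rcons W a).
    by rewrite [LHS]mulrBl [RHS]mulrBl Xa mulr_algl.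
  have eD : (X k.-1 - X k) * ((k2 a)%:A - X k) = ((k2 a)%:A - X k) * (X k.-1 - X k).
    by rewrite [LHS]mulrBl [RHS]mulrBl !mulrBr Xc !mulr_algl !mulr_algr; ncr A.
  have e2 : (X k.-1 - X k) * (X k.-1 - X k) * eproj (rcons W a)
      = ((k2 a)%:A - X k) * ((k2 a)%:A - X k) * eproj (rcons W a).
    exact: mul_sqr_eq e eD.
  rewrite [LHS]mulrBl [RHS]mulrBl e2; congr (_ - _).
  by rewrite !mulrDl Xa mulr_algl.
suff -> : ((k2 a)%:P + 'X) + ((k2 a)%:P + 'X) - ((k2 a)%:P - 'X) * ((k2 a)%:P - 'X)
    = - (('X - (k2 a.+1)%:P) * ('X - (k2 a.-1)%:P)) by rewrite rmorphN mulNr.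
(* For [a = 0] the truncated predecessor 0 is the right root, because the contents 0 and [- 1] have
   the same squared content 0. *)
rewrite /k2_def; case: (a) => [|d] /=.
  by rewrite mul0n mul1n !polyCMn; ring.
rewrite !natrM !polyCM -!natr1 !polyCD !polyC1.
by move: (d%:R)%:P 'X => t Z; ring.
Qed.
End SpectrumTheorem.

Section Enumeration.
Local Open Scope nat_scope.
Fixpoint stds k : seq (seq nat) :=
  if k is k'.+1 then [seq rcons T a | T <- stds k', a <- adds T] else [:: [::]].

Lemma mem_stds k T : (T \in stds k) = std T && (size T == k).
Proof.
elim: k T => [|k IH] T /=; first by case: T => [|a T] //=; rewrite inE andbF.
apply/allpairsPdep/andP => [[W [a [+ + ->]]]|[]].
  rewrite IH => /andP[sW /eqP <-]; rewrite mem_adds // => aW.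
  by rewrite std_rcons sW aW size_rcons eqxx.
case/lastP: T => // W a; rewrite std_rcons size_rcons eqSS => /andP[sW aW] szW.
by exists W, a; rewrite IH sW szW mem_adds.
Qed.

Lemma stds_uniq k : uniq (stds k).
Proof.
elim: k => //= k IH; apply: allpairs_uniq_dep => // [T _|].
  exact: adds_uniq.
by move=> [T a] [W b] _ _ /= /eqP; rewrite eqseq_rcons => /andP[/eqP -> /eqP ->].
Qed.
End Enumeration.

Lemma perm_pair (R1 : seq nat) a b R2 :
  perm_eq (R1 ++ [:: a, b & R2]) (R1 ++ [:: b, a & R2]).
Proof. by rewrite perm_cat2l; have := perm_catCA [:: a] [:: b] R2; rewrite /= => ->. Qed.

(** * Resolution of the identity, shape projections, words in one more letter *)

Section Decomposition.
Variables (C : numClosedFieldType) (A : falgType C) (n : nat) (c x s : nat -> A).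
Hypothesis sys : sergeev_system n c x s.
Implicit Types (i j k : nat) (y z p q : A) (T R W : seq nat) (a b : nat).
Local Notation X i := (sq x i).
Local Notation k2 := (k2 C).
Local Notation intw := (intw c x s).
Local Notation eproj := (@eproj C A x).
Local Notation gen := (@gen C A c s).
Let Gn : spectral_below x n := spectrum sys (leqnn n).
Let nn := leqnn n.

Lemma std_wt T i : std T -> (size T <= n)%N -> (i < size T)%N ->
  X i * eproj T = k2 (nth 0%N T i) *: eproj T.
Proof. by move=> sT Tn iT; apply: (eproj_weight sys Gn). Qed.

Lemma std_wtr T i : std T -> (size T <= n)%N -> (i < size T)%N ->
  eproj T * X i = k2 (nth 0%N T i) *: eproj T.
Proof. by move=> sT Tn iT; apply: (eproj_weightr sys Gn). Qed.

Lemma std_idem T : std T -> (size T <= n)%N -> eproj T * eproj T = eproj T.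
Proof. by move=> sT Tn; apply: (eproj_idem sys Gn). Qed.

Lemma std_orth T R : std T -> std R -> size T = size R -> (size T <= n)%N ->
  T != R -> eproj T * eproj R = 0.
Proof. by move=> sT sR e Tn nTR; apply: (eproj_orth sys Gn). Qed.

Lemma sum_adds_eproj T : std T -> (size T < n)%N ->
  \sum_(a <- adds T) eproj (rcons T a) = eproj T.
Proof.
move=> sT Tn; have [a0|a0] := eqVneq (adds T) [::].
  have := Gn sT Tn; rewrite /spectral /addp a0 !big_nil rmorph1 mul1r.
  by move->.
under eq_bigr do rewrite eproj_rcons.
by rewrite -mulr_sumr -rmorph_sum /= sum_lagp ?rmorph1 ?mulr1.
Qed.

Lemma sum_stds k : (k <= n)%N -> \sum_(T <- stds k) eproj T = 1.
Proof.
elim: k => [|k IH] kn /=; first by rewrite big_seq1.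
rewrite big_allpairs_dep /= -IH ?(ltnW kn) // big_seq [RHS]big_seq.
apply: eq_bigr => T; rewrite mem_stds => /andP[sT /eqP szT].
by rewrite sum_adds_eproj // szT.
Qed.

Lemma non_addable T b z : std T -> (size T < n)%N -> ~~ addable T b ->
  eproj T * z = z -> X (size T) * z = k2 b *: z -> z = 0.
Proof.
move=> sT Tn nb ez zb; have := congr1 (fun y => y * z) (Gn sT Tn).
rewrite /= -mulrA ez (horner_alg_eig _ zb) mul0r => /eqP.
rewrite scaler_eq0 horner_prod => /orP[|/eqP //].
rewrite prodf_seq_eq0 => /hasP[a aT /=]; rewrite hornerXsubC subr_eq0.
by rewrite (inj_eq (@k2_inj C)) => /eqP ab; rewrite ab -mem_adds // aT in nb.
Qed.

(* If s_i moves T to a non-standard filling, the intertwiner vanishes. *)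
Lemma intw_near R1 a b R2 : let T := R1 ++ [:: a, b & R2] in
  std T -> (size T <= n)%N -> ~~ far a b -> intw (size R1) * eproj T = 0.
Proof.
move=> T sT Tn nf; set i := size R1.
have [sR /std_ext_near/(_ nf) nb] : std R1 /\ std_ext R1 [:: a, b & R2].
  by apply/andP; rewrite -std_cat.
have Tn' := Tn; rewrite size_pair in Tn'.
have w1 : X i.+1 * eproj T = k2 b *: eproj T.
  by rewrite std_wt // ?nth_pair1 // size_pair /i; lia.
have ni : (i.+1 < n)%N by rewrite /i; lia.
apply: (@non_addable R1 b) => //; [by rewrite -/i; lia | | ].
  apply: eproj_fix; rewrite -?/i; [by []|by rewrite /i in ni; apply: ltnW; apply: ltnW|].
  move=> j jR; have nj : (j < n)%N by rewrite /i in ni; lia.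
  rewrite mulrA -(intw_sqj sys) //; try by rewrite /i; lia.
  rewrite -mulrA std_wt ?size_pair -?scalerAr //; last by lia.
  by rewrite nth_cat jR.
by rewrite -/i mulrA -(intw_sq' sys) // -mulrA w1 scalerAr.
Qed.

Lemma split_pair T i : (i.+1 < size T)%N -> exists R1 a b R2,
  T = R1 ++ [:: a, b & R2] /\ size R1 = i.
Proof.
move=> iT; exists (take i T), (nth 0%N T i), (nth 0%N T i.+1), (drop i.+2 T).
by rewrite -!drop_nth ?cat_take_drop ?size_take ?(ltnW iT) // ltnW.
Qed.

Definition shape_proj m T := \sum_(W <- stds m | perm_eq W T) eproj W.

Lemma eq_shape_proj m T R : perm_eq T R -> shape_proj m T = shape_proj m R.
Proof. by move=> e; apply: eq_bigl => W; apply: permPr. Qed.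

Lemma shape_projE m T R : (m <= n)%N -> std R -> size R = m ->
  shape_proj m T * eproj R = if perm_eq R T then eproj R else 0.
Proof.
move=> mn sR szR; rewrite /shape_proj mulr_suml.
have H W : W \in stds m -> eproj W * eproj R = if W == R then eproj R else 0.
  rewrite mem_stds => /andP[sW /eqP szW]; case: eqVneq => [->|nWR].
    by rewrite std_idem ?szR.
  by rewrite std_orth ?szW.
rewrite big_seq_cond (eq_bigr (fun W => if W == R then eproj R else 0)); last first.
  by move=> W /andP[/H].
rewrite -big_mkcondr /=.
have [eRT|nRT] := ifPn.
  rewrite (eq_bigl (pred1 R)) => [|W /=]; last first.
    case: (eqVneq W R) => [->|]; last by rewrite andbF.
    by rewrite mem_stds sR szR eRT eqxx.
  rewrite -big_filter filter_pred1_uniq ?stds_uniq ?big_seq1 //.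
  by rewrite mem_stds sR szR eqxx.
rewrite big1 // => W /andP[/andP[_ eWT] /eqP eWR].
by rewrite -eWR eWT in nRT.
Qed.

Lemma shape_proj_comm_eproj m T R : (m <= n)%N -> std R -> size R = m ->
  eproj R * shape_proj m T = shape_proj m T * eproj R.
Proof.
move=> mn sR szR; rewrite /shape_proj mulr_sumr mulr_suml big_seq_cond [RHS]big_seq_cond.
apply: eq_bigr => W /andP[]; rewrite mem_stds => /andP[sW /eqP szW] _.
apply: comm_eproj => i iW; symmetry; apply: (sq_eproj sys); rewrite ?szR //.
by apply: leq_trans iW _; rewrite szW.
Qed.

Lemma delta_neq0 R1 a b R2 : std (R1 ++ [:: a, b & R2]) -> k2 a - k2 b != 0.
Proof.
rewrite std_cat => /andP[_ /std_ext_neq ab].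
by rewrite subr_eq0 (inj_eq (@k2_inj C)).
Qed.

Lemma s_eproj R1 a b R2 : let T := R1 ++ [:: a, b & R2] in let i := size R1 in
  std T -> (size T <= n)%N ->
  (k2 a - k2 b) *: (s i * eproj T) = intw i * eproj T + du c i * dw c x i * eproj T.
Proof.
move=> T i sT Tn; have Tn' := Tn; rewrite size_pair in Tn'.
have ni : (i.+1 < n)%N by rewrite /i; lia.
have w0 : X i * eproj T = k2 a *: eproj T.
  by rewrite std_wt ?nth_pair0 // size_pair /i; lia.
have w1 : X i.+1 * eproj T = k2 b *: eproj T.
  by rewrite std_wt ?nth_pair1 // size_pair /i; lia.
by rewrite /intw_def [in RHS]mulrBl subrK -mulrA mulrBl w0 w1 -scalerBl scalerAr.
Qed.

(** On each idempotent [s i] is a combination of the intertwiner, which leads to a filling of the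
    same shape or to 0, and of [du * dw], which commutes with all the idempotents. Neither changes
    the shape. *)
Lemma shape_proj_s m T i : (m <= n)%N -> (i.+1 < m)%N ->
  shape_proj m T * s i = s i * shape_proj m T.
Proof.
move=> mn im; suff key W : W \in stds m ->
    shape_proj m T * s i * eproj W = s i * shape_proj m T * eproj W.
  rewrite -[LHS]mulr1 -[RHS]mulr1 -(sum_stds mn); move: (shape_proj m T) key => Z key.
  by rewrite !mulr_sumr big_seq [RHS]big_seq; apply: eq_bigr => W /key.
rewrite mem_stds => /andP[sW /eqP szW].
have [R1 [a [b [R2 [eW eR1]]]]] := split_pair (T := W) (i := i) (etrans (congr1 _ szW) im).
subst W i; set W := R1 ++ _ in sW szW *; set i := size R1 in im *.
have ni : (i.+1 < n)%N by apply: leq_trans im mn.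
have uw_e R : std R -> size R = m -> du c i * dw c x i * eproj R = eproj R * (du c i * dw c x i).
  move=> sR szR; apply: comm_eproj => j; rewrite szR => jm.
  have nj : (j < n)%N by apply: leq_trans jm mn.
  by rewrite [RHS]mulrA (sq_du sys) // -[RHS]mulrA (sq_dw sys) // [RHS]mulrA.
rewrite -!mulrA shape_projE //; apply: (scalerI (delta_neq0 sW)).
rewrite scalerAr s_eproj ?szW // mulrDr uw_e // [_ * (eproj W * _)]mulrA shape_projE //.
have phiE : shape_proj m T * (intw i * eproj W)
    = if perm_eq W T then intw i * eproj W else 0.
  have [fab|nfab] := boolP (far a b); last first.
    by rewrite intw_near ?szW // mulr0 if_same.
  have sW' : std (R1 ++ [:: b, a & R2]) by apply: std_ext_far_cat fab sW.
  have e : perm_eq W (R1 ++ [:: b, a & R2]).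
    exact: perm_pair.
  rewrite (intw_eproj sys Gn nn sW sW') ?szW // mulrA shape_projE //; last first.
    by rewrite -szW (perm_size e).
  by rewrite (permPl e); case: ifP; rewrite ?mul0r.
rewrite phiE; case: ifP => _; last by rewrite mul0r addr0 mulr0 scaler0.
by rewrite s_eproj ?szW // uw_e.
Qed.

Lemma shape_proj_gen m T y : (m <= n)%N -> gen m y ->
  shape_proj m T * y = y * shape_proj m T.
Proof.
move=> mn; elim=> [|i im|i im|{}y z _ ey _ ez|t {}y _ ey|{}y z _ ey _ ez].
- by rewrite mul1r mulr1.
- rewrite /shape_proj mulr_sumr mulr_suml big_seq_cond [RHS]big_seq_cond.
  apply: eq_bigr => W /andP[]; rewrite mem_stds => /andP[sW /eqP szW] _.
  by rewrite (c_eproj sys) ?szW // (leq_trans im).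
- exact: shape_proj_s.
- by rewrite mulrDl mulrDr ey ez.
- by rewrite -scalerAl -scalerAr ey.
by rewrite mulrA ey -mulrA ez mulrA.
Qed.

Lemma eproj_gen_eproj0 T R y : std T -> std R -> size T = size R ->
  (size T <= n)%N -> ~~ perm_eq T R -> gen (size T) y ->
  eproj T * y * eproj R = 0.
Proof.
move=> sT sR e Tn nTR gy.
have -> : eproj T = eproj T * shape_proj (size T) T.
  by rewrite shape_proj_comm_eproj // shape_projE // perm_refl.
rewrite -[eproj T * _ * y]mulrA shape_proj_gen // -!mulrA shape_projE //.
by rewrite perm_sym (negbTE nTR) !mulr0.
Qed.

(** [y'] is the image of [y] under the parity automorphism, which fixes the [s i] and changes the
    sign of the [c i]. *)
Lemma gen_twist k j y : (k <= j)%N -> (j < n)%N -> gen k y ->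
  exists2 y', gen k y' & [/\ c j * y = y' * c j, y * c j = c j * y'
    & od c x j * y = y' * od c x j].
Proof.
move=> kj jn; have kn : (k <= n)%N by apply: leq_trans (ltnW jn).
elim=> [|i ik|i ik|{}y z _ [y' gy [e1 e2 e3]] _ [z' gz [f1 f2 f3]]
  |t {}y _ [y' gy [e1 e2 e3]]|{}y z _ [y' gy [e1 e2 e3]] _ [z' gz [f1 f2 f3]]].
- by exists 1; [exact: gen_one | rewrite !mulr1 !mul1r].
- have ni : (i < n)%N by apply: leq_trans kn.
  have ji : j != i by rewrite gtn_eqF // (leq_trans ik).
  exists (- c i); first by apply: gen_opp; apply: gen_c.
  rewrite !mulNr !mulrN; split.
  + exact: (sys_cN sys).
  + by rewrite (sys_cN sys) // eq_sym.
  exact: (od_cj sys).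
- have ni : (i.+1 < n)%N by apply: leq_trans kn.
  have [j1 j2] : j != i /\ j != i.+1 by split; rewrite gtn_eqF //; apply: leq_trans kj => //; apply: ltnW.
  exists (s i); first exact: gen_s.
  by rewrite (sys_scj sys) // (s_odj sys).
- exists (y' + z'); first exact: gen_add.
  by split; rewrite [LHS](mulrDr, mulrDl) [RHS](mulrDr, mulrDl) (e1, e2, e3) (f1, f2, f3).
- exists (t *: y'); first exact: gen_scale.
  by split; rewrite -scalerAl -scalerAr (e1, e2, e3).
exists (y' * z'); first exact: gen_mul.
split.
- by rewrite mulrA e1 -!mulrA f1.
- by rewrite -mulrA f2 !mulrA e2.
by rewrite mulrA e3 -[LHS]mulrA f3 mulrA.
Qed.

(* gen k.+1 = gen k + gen k c_k + gen k s_(k-1) gen k *)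
Inductive dec k : A -> Prop :=
| dec_gen y : gen k y -> dec k y
| dec_c y : gen k y -> dec k (y * c k)
| dec_s p q : (0 < k)%N -> gen k p -> gen k q -> dec k (p * s k.-1 * q)
| dec_add y z : dec k y -> dec k z -> dec k (y + z).

Lemma s_gen k y : (k.+1 < n)%N -> gen k y -> s k * y = y * s k.
Proof.
move=> kn; elim=> [|i ik|i ik|{}y z _ ey _ ez|t {}y _ ey|{}y z _ ey _ ez].
- by rewrite mul1r mulr1.
- by rewrite (sys_scj sys) //; lia.
- by symmetry; apply: (sys_far sys).
- by rewrite mulrDl mulrDr ey ez.
- by rewrite -scalerAl -scalerAr ey.
by rewrite mulrA ey -mulrA ez mulrA.
Qed.

(** The elements decomposed in this way are stable under left multiplication by the generators. The
    one hard product is [s k * p * s k]: there [p] is decomposed one level lower and the braid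
    relation is used. *)
Lemma gen_dec k y : (k < n)%N -> gen k.+1 y -> dec k y.
Proof.
elim: k y => [|k IHk] y kn gy.
  suff : forall z, dec 0 z -> dec 0 (y * z).
    by move=> /(_ 1); rewrite mulr1; apply; apply: dec_gen; apply: gen_one.
  elim: gy => [|i ik|i //|{}y z _ ey _ ez|t {}y _ ey|{}y z _ ey _ ez] w dw.
  - by rewrite mul1r.
  - move: ik dw; rewrite ltnS leqn0 => /eqP ->; elim=> [z gz|z gz|//|y1 y2 _ d1 _ d2].
    + by have [z' gz' [-> _ _]] := gen_twist (leqnn 0) kn gz; apply: dec_c.
    + have [z' gz' [e _ _]] := gen_twist (leqnn 0) kn gz.
      rewrite mulrA e -mulrA (sys_cc sys) // mulrN1; apply: dec_gen; exact: gen_opp.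
    by rewrite mulrDr; apply: dec_add.
  - by rewrite mulrDl; apply: dec_add; [apply: ey | apply: ez].
  - by rewrite -scalerAl scalerAr; apply: ey; elim: dw => [z gz|z gz|//|y1 y2 _ d1 _ d2];
      [apply: dec_gen; apply: gen_scale | rewrite scalerAl; apply: dec_c; apply: gen_scale
      | rewrite scalerDr; apply: dec_add].
  by rewrite -mulrA; apply: ey; apply: ez.
have kn' := ltnW kn; have k1n := leqnn k.+1.
suff : forall z, dec k.+1 z -> dec k.+1 (y * z).
  by move=> /(_ 1); rewrite mulr1; apply; apply: dec_gen; apply: gen_one.
elim: gy => [|i ik|i ik|{}y z _ ey _ ez|t {}y _ ey|{}y z _ ey _ ez] w dw.
- by rewrite mul1r.
- move: ik dw; rewrite ltnS leq_eqVlt => /orP[/eqP -> |ik]; elim=> [z gz|z gz|p q _ gp gq|y1 y2 _ d1 _ d2];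
    try by rewrite mulrDr; apply: dec_add.
  + by have [z' gz' [-> _ _]] := gen_twist k1n kn gz; apply: dec_c.
  + have [z' gz' [e _ _]] := gen_twist k1n kn gz.
    rewrite mulrA e -mulrA (sys_cc sys) // mulrN1; apply: dec_gen; exact: gen_opp.
  + have [p' gp' [e _ _]] := gen_twist k1n kn gp.
    rewrite !mulrA e -[p' * _ * _]mulrA /= -(sys_sc sys) // mulrA -mulrA.
    apply: dec_s => //; apply: gen_mul => //; exact: gen_c.
  + by apply: dec_gen; apply: gen_mul => //; apply: gen_c.
  + by rewrite mulrA; apply: dec_c; apply: gen_mul => //; apply: gen_c.
  by rewrite !mulrA; apply: dec_s => //;
     apply: gen_mul => //; apply: gen_c.
- move: ik dw; rewrite ltnS leq_eqVlt => /orP[/eqP[->] |ik]; last first.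
    elim=> [z gz|z gz|p q _ gp gq|y1 y2 _ d1 _ d2]; try by rewrite mulrDr; apply: dec_add.
    + by apply: dec_gen; apply: gen_mul => //; apply: gen_s.
    + by rewrite mulrA; apply: dec_c; apply: gen_mul => //; apply: gen_s.
    by rewrite !mulrA; apply: dec_s => //;
      apply: gen_mul => //; apply: gen_s.
  elim=> [z gz|z gz|p q _ gp gq|y1 y2 _ d1 _ d2]; try by rewrite mulrDr; apply: dec_add.
  + by rewrite -[s k]mul1r; apply: (@dec_s k.+1) => //; apply: gen_one.
  + have [z' gz' [_ e _]] := gen_twist k1n kn gz.
    rewrite e mulrA -[c k.+1](mulr1) mulr1 (sc' sys) //.
    by apply: (@dec_s k.+1) => //; apply: gen_c.
  rewrite /= !mulrA; elim: {p gp}(IHk p kn' gp) => [p gp|p gp|p1 q1 k0 gp gq1|y1 y2 _ d1 _ d2].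
  + rewrite s_gen // -[p * s k * s k]mulrA (sys_ss sys) // mulr1; apply: dec_gen.
    by apply: gen_mul => //; apply: gen_le gp.
  + rewrite mulrA s_gen // -!mulrA [c k * _]mulrA [s k * (_ * _)]mulrA [s k * (c k * s k)]mulrA (sys_sc sys) //.
    rewrite -[c k.+1 * s k * s k]mulrA (sys_ss sys) // mulr1.
    have [q' gq' [-> _ _]] := gen_twist k1n kn gq.
    rewrite mulrA; apply: dec_c; apply: gen_mul => //; exact: gen_le gp.
  + have kp : k.-1.+1 = k by rewrite prednK.
    rewrite !mulrA (s_gen kn gp) -[_ * q1 * s k]mulrA -(s_gen kn gq1).
    have := sys_braid sys (i := k.-1); rewrite kp => /(_ kn) br.
    rewrite !mulrA -[p1 * s k * s k.-1]mulrA -[p1 * (s k * s k.-1) * s k]mulrA -br.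
    rewrite !mulrA -[_ * q1 * q]mulrA -[_ * s k.-1 * (q1 * q)]mulrA.
    apply: (@dec_s k.+1) => //; apply: gen_mul.
    * exact: gen_le gp.
    * by apply: gen_s; rewrite kp.
    * by apply: gen_s; rewrite kp.
    by apply: gen_mul => //; apply: gen_le gq1.
  by rewrite !mulrDr !mulrDl; apply: dec_add.
- by rewrite mulrDl; apply: dec_add; [apply: ey | apply: ez].
- rewrite -scalerAl scalerAr; apply: ey.
  elim: dw => [z gz|z gz|p q k0 gp gq|y1 y2 _ d1 _ d2].
  + by apply: dec_gen; apply: gen_scale.
  + by rewrite scalerAl; apply: dec_c; apply: gen_scale.
  + by rewrite !scalerAl; apply: dec_s => //; apply: gen_scale.
  by rewrite scalerDr; apply: dec_add.
by rewrite -mulrA; apply: ey; apply: ez.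
Qed.
End Decomposition.

Notation shape_proj_def := shape_proj (only parsing).

(** * Spanning sets of corner algebras *)

Section Corners.
Variables (C : numClosedFieldType) (A : falgType C) (n : nat) (c x s : nat -> A).
Hypothesis sys : sergeev_system n c x s.
Implicit Types (i j k : nat) (y z p q : A) (T R W : seq nat) (a b : nat).
Local Notation X i := (sq x i).
Local Notation k2 := (k2 C).
Local Notation intw := (intw c x s).
Local Notation eproj := (@eproj C A x).
Local Notation gen := (@gen C A c s).
Let Gn : spectral_below x n := spectrum sys (leqnn n).
Let nn := leqnn n.

Definition box_weight T : nat := \prod_(a <- T) (if a == 0%N then 2 else 4).

Lemma box_weight_rcons T a :
  box_weight (rcons T a) = (box_weight T * (if a == 0%N then 2 else 4))%N.
Proof. by rewrite /box_weight -cats1 big_cat big_seq1. Qed.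

(** The letter [k] contributes the even and odd words in [c_k] and [d_k = c_k x_k]. On a box of
    content 0 the element [x_k] vanishes, and with it [d_k]; hence 2 words instead of 4. *)
Definition local_words k a : seq A :=
  if a == 0%N then [:: 1; c k] else [:: 1; c k; od c x k; c k * od c x k].

Lemma od_eproj0 T : std (rcons T 0%N) -> (size T < n)%N ->
  od c x (size T) * eproj (rcons T 0%N) = 0.
Proof.
move=> sT Tn; rewrite /od -mulrA (sys_xss sys) ?mulr0 // mulrA.
rewrite -/(sq x _) (std_wt sys) ?size_rcons // nth_rcons ltnn eqxx.
by rewrite /k2_def mul0n scale0r.
Qed.

Lemma intw_alt i : (i.+1 < n)%N ->
  intw i = (X i.+1 - X i) * s i + du c i * dw c x i.
Proof.
move=> ni; move: (ssq sys ni) (ssq' sys ni); rewrite /intw_def.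
move: (du c i * dw c x i) (X i) (X i.+1) => q X0 X1 e e'.
by rewrite mulrBr mulrBl e e'; ncr A.
Qed.

Lemma eproj_rcons_fix V a : std (rcons V a) -> (size V < n)%N ->
  horner_alg (X (size V)) (lagp C V a) * eproj (rcons V a) = eproj (rcons V a).
Proof.
move=> sT Vn; rewrite (horner_alg_eig (t := k2 a)) ?lagp_eq1 ?scale1r //.
by rewrite (std_wt sys) ?size_rcons // nth_rcons ltnn eqxx.
Qed.

Lemma eproj_prefix V R : std (V ++ R) -> (size (V ++ R) <= n)%N ->
  eproj V * eproj (V ++ R) = eproj (V ++ R).
Proof.
move=> sT Tn; apply: eproj_fix.
- by move: sT; rewrite std_cat => /andP[].
- by apply: leq_trans Tn; rewrite size_cat leq_addr.
move=> i iV; rewrite (std_wt sys) // ?nth_cat ?iV //.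
by rewrite size_cat ltn_addr.
Qed.

Section Corner.
Variables (V : seq nat) (a : nat).
Hypotheses (sT : std (rcons V a)) (Vn : (size V < n)%N).
Let k := size V.
Let T := rcons V a.
Let L := horner_alg (X k) (lagp C V a).
Let sV : std V. Proof. by move: sT; rewrite std_rcons => /andP[]. Qed.
Let aV : addable V a. Proof. by move: sT; rewrite std_rcons => /andP[]. Qed.
Let Vn' : (size V <= n)%N := ltnW Vn.
Let VT : eproj V * eproj T = eproj T.
Proof. by rewrite /T -cats1 eproj_prefix ?cats1 ?size_rcons. Qed.

(** The Lagrange factor of the last box commutes with [z], which involves earlier letters only, and
    with [h]; so the left copy is absorbed by the right one. *)
Lemma corner_word z h : gen k z -> h * eproj V = eproj V * h -> h * X k = X k * h ->
  eproj T * (z * h) * eproj T = eproj V * z * eproj V * (h * eproj T).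
Proof.
move=> gz hV hX; have LT : L * eproj T = eproj T by apply: eproj_rcons_fix.
have zL : z * L = L * z by apply: horner_alg_intertwine; apply: (gen_comm_sq sys) gz.
have hL : h * L = L * h by apply: horner_alg_intertwine.
have e1 : eproj V * (h * eproj T) = h * eproj T by rewrite mulrA -hV -mulrA VT.
have e2 : L * (z * (h * eproj T)) = z * (h * eproj T).
  by rewrite [LHS]mulrA -zL -[LHS]mulrA; congr (_ * _); rewrite [LHS]mulrA -hL -[LHS]mulrA LT.
rewrite -[RHS]mulrA e1 -[RHS]mulrA -e2 {1}/T eproj_rcons -/k -/L.
by rewrite -[LHS]mulrA -[LHS]mulrA -[z * h * _]mulrA.
Qed.

Variable r : seq A.
Hypothesis rP : forall y, gen k y -> exists2 m, m \in <<r>>%VS & eproj V * y * eproj V = m * eproj V.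
Let r' := [seq m * h | m <- r, h <- local_words k a].
Let ok y := exists2 m, m \in <<r'>>%VS & eproj T * y * eproj T = m * eproj T.

Let okD y z : ok y -> ok z -> ok (y + z).
Proof.
move=> [m mr e] [m' mr' e']; exists (m + m'); first exact: memvD.
by rewrite mulrDr !mulrDl e e'.
Qed.

Let okZ (t : C) y : ok y -> ok (t *: y).
Proof.
move=> [m mr e]; exists (t *: m); first exact: memvZ.
by rewrite -scalerAr -!scalerAl e.
Qed.

Let ok_word z h : gen k z -> h \in [:: 1; c k; od c x k; c k * od c x k] -> ok (z * h).
Proof.
move=> gz hw; have gk := leqnn k.
have [hV hX] : h * eproj V = eproj V * h /\ h * X k = X k * h.
  move: hw; rewrite !inE => /or4P[] /eqP ->.
  - by rewrite !mul1r !mulr1.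
  - by rewrite (c_eproj sys) // (sq_c sys).
  - by rewrite (od_eproj sys) // (sq_od sys).
  rewrite -mulrA (od_eproj sys) // mulrA (c_eproj sys) // -mulrA; split=> //.
  by rewrite -mulrA -(sq_od sys) // mulrA -(sq_c sys) // mulrA.
have [m mr e] := rP gz.
have [hl|hl] := boolP (h \in local_words k a).
  exists (m * h); last by rewrite corner_word // e -!mulrA (mulrA (eproj V)) -hV -mulrA VT.
  have -> : m * h = amulr h m by rewrite lfunE.
  have : amulr h m \in (amulr h @: <<r>>)%VS by apply: memv_img.
  rewrite limg_span; apply: subvP; apply: sub_span => _ /mapP[y yr ->].
  by apply/allpairsP; exists (y, h); split=> //=; rewrite lfunE.
exists 0; first exact: mem0v.
rewrite mul0r corner_word //; suff -> : h * eproj T = 0 by rewrite mulr0.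
move: hl hw; rewrite /local_words; case: eqP => [a0|_]; last by move/negbTE->.
rewrite !inE => /norP[/negbTE-> /negbTE->] /= /orP[] /eqP ->.
  by rewrite /T a0 od_eproj0 // -a0.
by rewrite -mulrA /T a0 od_eproj0 ?mulr0 // -a0.
Qed.

(** Insert the sum of all [eproj S] after [p]. A shape other than that of [V] gives 0. For [S]
    ending in [b], the intertwiner contributes nothing, being squeezed between the distinct
    eigenvalues [k2 b] and [k2 a] of [X k]; so [s k.-1] acts as [du * dw] divided by [k2 b - k2 a],
    which expands into words already treated. *)
Let ok_s p q : (0 < k)%N -> gen k p -> gen k q -> ok (p * s k.-1 * q).
Proof.
move=> k0 gp gq; have gk := leqnn k; have kp : k.-1.+1 = k by rewrite prednK.
have ni : (k.-1.+1 < n)%N by rewrite kp.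
have XqT : X k * (q * eproj T) = k2 a *: (q * eproj T).
  rewrite mulrA -(gen_comm_sq sys gk Vn gq) -mulrA (std_wt sys) ?size_rcons //.
  by rewrite nth_rcons ltnn eqxx scalerAr.
suff okS S : S \in stds k -> ok (p * eproj S * s k.-1 * q).
  rewrite -[p]mulr1 -(sum_stds sys (k := k)) // mulr_sumr !mulr_suml big_seq.
  elim/big_ind: _ => //; exists 0; first exact: mem0v.
  by rewrite mulr0 !mul0r.
rewrite mem_stds => /andP[sS /eqP szS].
have gS : gen k (eproj S) by apply: (gen_eproj sys) => //; rewrite szS.
have gpS : gen k (p * eproj S) by apply: gen_mul.
have [eSV|nSV] := boolP (perm_eq V S); last first.
  exists 0; first exact: mem0v.
  have -> : eproj T * (p * eproj S * s k.-1 * q) = eproj T * (p * eproj S) * s k.-1 * q.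
    by rewrite !mulrA.
  have -> : eproj T * (p * eproj S) = 0; last by rewrite !mul0r.
  have zL : p * L = L * p by apply: horner_alg_intertwine; apply: (gen_comm_sq sys) gp.
  have VL : eproj V * L = L * eproj V.
    by apply: horner_alg_intertwine; rewrite (sq_eproj sys).
  rewrite {1}/T eproj_rcons -/k -/L VL -mulrA [eproj V * _]mulrA.
  by rewrite (eproj_gen_eproj0 sys) ?mulr0 ?szS.
have sSa : std (rcons S a) by rewrite std_rcons sS -(eq_addable _ eSV).
case/lastP: S => [|W b] in sS szS gS gpS eSV sSa *; first by rewrite -szS in k0.
have szW : size W = k.-1 by rewrite -szS size_rcons.
have D0 : k2 b - k2 a != 0.
  by apply: (@delta_neq0 C W b a [::]); rewrite -cat_rcons cats1.
set y := eproj T * (p * eproj (rcons W b)).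
have yX : y * X k.-1 = k2 b *: y.
  rewrite /y -!mulrA (std_wtr sys) ?szS //; last by rewrite -[Z in (_ < Z)%N]kp.
  by rewrite nth_rcons szW ltnn eqxx -!scalerAr.
have yX' : y * X k = k2 a *: y.
  rewrite /y -mulrA (gen_comm_sq sys gk Vn gpS) mulrA (std_wtr sys) ?size_rcons //.
  by rewrite nth_rcons ltnn eqxx -scalerAl.
have y0 : y * intw k.-1 * (q * eproj T) = 0.
  have e : y * intw k.-1 * X k = k2 b *: (y * intw k.-1).
    have := intw_sq' sys ni; rewrite kp => e; rewrite -mulrA e mulrA yX.
    by rewrite -scalerAl.
  apply: (scalerI D0); rewrite scaler0 scalerBl scalerAl -e.
  by rewrite -[_ * X k * _]mulrA XqT -scalerAr subrr.
have e : (k2 b - k2 a) *: (y * s k.-1 * (q * eproj T))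
    = y * (du c k.-1 * dw c x k.-1) * (q * eproj T).
  have e0 : y * intw k.-1 = (k2 a - k2 b) *: (y * s k.-1) + y * (du c k.-1 * dw c x k.-1).
    rewrite (intw_alt ni) kp mulrDr [y * (_ * s _)]mulrA [y * (X _ - _)]mulrBr yX yX'.
    by rewrite -scalerBl -scalerAl.
  move: y0; rewrite e0 mulrDl -scalerAl -[k2 a - k2 b]opprB scaleNr addrC => /eqP.
  by rewrite subr_eq0 => /eqP <-.
suff : ok (p * eproj (rcons W b) * (du c k.-1 * dw c x k.-1) * q).
  move=> /(okZ (k2 b - k2 a)^-1) [m mr em]; exists m => //.
  rewrite -em -scalerAr -scalerAl.
  have -> : eproj T * (p * eproj (rcons W b) * (du c k.-1 * dw c x k.-1) * q) * eproj T
      = y * (du c k.-1 * dw c x k.-1) * (q * eproj T) by rewrite /y !mulrA.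
  by rewrite -e scalerA mulVf // scale1r /y !mulrA.
have gc : gen k (c k.-1) by apply: gen_c; rewrite -[Z in (_ < Z)%N]kp.
have gd : gen k (od c x k.-1) by apply: (gen_od sys) => //; rewrite -[Z in (_ < Z)%N]kp.
have [q1 gq1 [eq1 _ _]] := gen_twist sys gk Vn gq.
have [q2 gq2 [_ _ eq2]] := gen_twist sys gk Vn gq.
have [q3 gq3 [eq3 _ _]] := gen_twist sys gk Vn gq2.
have [q4 gq4 [eq4 _ _]] := gen_twist sys gk Vn (gen_mul gd gq).
set P := p * _ in gpS *; rewrite /du /dw kp.
have -> : P * ((c k.-1 - c k) * (od c x k.-1 - od c x k)) * q =
   P * c k.-1 * od c x k.-1 * q * 1 - P * c k.-1 * (od c x k * q)
   - P * (c k * (od c x k.-1 * q)) + P * (c k * (od c x k * q)) by ncr A.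
have -> : P * (c k * (od c x k * q)) = P * q3 * (c k * od c x k).
  by rewrite eq2 [c k * _]mulrA eq3 -[q3 * c k * _]mulrA [LHS]mulrA.
have -> : P * c k.-1 * (od c x k * q) = P * c k.-1 * q2 * od c x k by rewrite eq2 mulrA.
have -> : P * (c k * (od c x k.-1 * q)) = P * q4 * c k by rewrite eq4 mulrA.
have okN z : ok z -> ok (- z) by rewrite -scaleN1r; apply: okZ.
apply: okD; first apply: okD; first apply: okD.
- by apply: ok_word; rewrite ?inE ?eqxx //; do 3 apply: gen_mul => //.
- by apply: okN; apply: ok_word; rewrite ?inE ?eqxx ?orbT //; do 2 apply: gen_mul => //.
- by apply: okN; apply: ok_word; rewrite ?inE ?eqxx ?orbT //; apply: gen_mul.
by apply: ok_word; rewrite ?inE ?eqxx ?orbT //; apply: gen_mul.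
Qed.

Lemma corner_step y : gen k.+1 y -> exists2 m, m \in <<r'>>%VS & eproj T * y * eproj T = m * eproj T.
Proof.
move=> gy; rewrite -/(ok y); elim: (gen_dec sys Vn gy) => [z gz|z gz|p q k0 gp gq|y1 y2 _ d1 _ d2].
- by rewrite -[z]mulr1; apply: ok_word; rewrite ?inE ?eqxx.
- by apply: ok_word; rewrite ?inE ?eqxx ?orbT.
- exact: ok_s.
exact: okD.
Qed.
End Corner.

Lemma corner_span T : std T -> (size T <= n)%N ->
  exists2 r : seq A, size r = box_weight T &
    forall y, gen (size T) y -> exists2 m, m \in <<r>>%VS & eproj T * y * eproj T = m * eproj T.
Proof.
elim/last_ind: T => [|V a IH] sT Tn.
  exists [:: 1]; first by rewrite /box_weight big_nil.
  move=> y gy; have [t ->] : exists t : C, y = t%:A.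
    elim: gy => [|//|//|{}y z _ [t ->] _ [t' ->]|t {}y _ [t' ->]|{}y z _ [t ->] _ [t' ->]].
    - by exists 1; rewrite scale1r.
    - by exists (t + t'); rewrite scalerDl.
    - by exists (t * t'); rewrite scalerA.
    by exists (t * t'); rewrite mulr_algl scalerA.
  exists t%:A; first by rewrite span_seq1 memvZ // memv_line.
  by rewrite mul1r.
move: Tn; rewrite size_rcons => Vn; have sV : std V by move: sT; rewrite std_rcons => /andP[].
have [r szr rP] := IH sV (ltnW Vn).
exists [seq m * h | m <- r, h <- local_words (size V) a].
  by rewrite size_allpairs szr box_weight_rcons /local_words; case: eqP.
by apply: corner_step.
Qed.

Hypothesis gen_full : forall y, gen n y.

Definition right_part (M : {vspace A}) y : {vspace A} := (amulr y @: M)%VS.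

Lemma right_partP (M : {vspace A}) y z :
  reflect (exists2 v, v \in M & z = v * y) (z \in right_part M y).
Proof. by apply: (iffP memv_imgP) => -[v vM ->]; exists v => //; rewrite lfunE. Qed.

(** The right ideal generated by [y], image of left multiplication by [y]; it is stable under
    multiplication on the right. *)
Definition left_ideal_part y : {vspace A} := (amull y @: fullv)%VS.

Lemma left_ideal_partP y z :
  reflect (exists v, z = y * v) (z \in left_ideal_part y).
Proof.
apply: (iffP memv_imgP) => [[v _ ->]|[v ->]]; exists v; rewrite ?lfunE //.
exact: memvf.
Qed.

(** Writing [eproj R] as [y * eproj T * z], the space is contained in the image of the corner of
    [eproj T] under right multiplication by [z]. *)
Lemma dim_corner T R : std T -> std R -> size T = n -> size R = n ->
  (\dim (right_part (left_ideal_part (eproj T)) (eproj R))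
     <= if perm_eq T R then box_weight T else 0)%N.
Proof.
move=> sT sR szT szR; have Tn : (size T <= n)%N by rewrite szT.
case: ifPn => [eTR|nTR]; last first.
  rewrite leqn0 dimv_eq0 -subv0; apply/subvP => y /right_partP[v /left_ideal_partP[z ->] ->].
  by rewrite (eproj_gen_eproj0 sys) ?mem0v ?szT ?szR.
have [r szr rP] := corner_span sT Tn.
have [y [z [gy gz eR]]] := eproj_link sys Gn nn sR sT (etrans (perm_sym _ _) eTR) (etrans (congr1 (leq^~ n) szR) nn).
have sub : (right_part (left_ideal_part (eproj T)) (eproj R) <= right_part <<r>> (eproj T * z)%R)%VS.
  apply/subvP => w /right_partP[v /left_ideal_partP[v' ->] ->].
  have [|m mr e] := rP (v' * y)%R; first by rewrite szT.
  apply/right_partP; exists m => //.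
  by rewrite eR [RHS]mulrA -e !mulrA.
rewrite (leq_trans (dimvS sub)) // -szr (leq_trans _ (dim_span r)) //.
by rewrite -(limg_ker_dim (amulr (eproj T * z)) <<r>>) leq_addl.
Qed.
End Corners.

(** * Invariants of Young subgroups *)

Section Reflection.
Variables (A : nzRingType) (ca cr da dr : A).
Hypotheses (caa : ca * ca = -1) (crr : cr * cr = -1) (cra : cr * ca = - (ca * cr)).
Hypotheses (daca : da * ca = - (ca * da)) (dacr : da * cr = - (cr * da)).
Hypotheses (drca : dr * ca = - (ca * dr)) (drcr : dr * cr = - (cr * dr)).
Hypothesis drda : dr * da = - (da * dr).
Let u := ca - cr.
Let w := da - dr.
Let q := u * w.
Let mA (a b r z : A) : a * b = r -> a * (b * z) = r * z.
Proof. by move=> <-; rewrite mulrA. Qed.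
Let dist := (@mulrDl, @mulrDr, @mulNr, @mulrN, @opprD, @opprK, @mul1r, @mulr1).
Ltac nf := rewrite /q /u /w; repeat (progress rewrite ?dist -?mulrA
    ?(caa, crr, cra, daca, dacr, drca, drcr, drda)
    ?(mA _ caa, mA _ crr, mA _ cra, mA _ daca, mA _ dacr, mA _ drca, mA _ drcr, mA _ drda));
  non_commutative_ring.

Lemma refl_c : q * ca = ca * q + (w + w).
Proof. nf. Qed.
Lemma refl_d : q * da = da * q + da * da * (u + u).
Proof. nf. Qed.
Lemma refl_wq : w * q = - ((da * da + dr * dr) * u).
Proof. nf. Qed.
Lemma refl_uq : u * q = - (w + w).
Proof. nf. Qed.
Lemma refl_qq : q * q = (da * da + dr * dr) + (da * da + dr * dr).
Proof. nf. Qed.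
End Reflection.

Section ReflectionStep.
Variables (C : fieldType) (A : falgType C) (ca cr da dr g y : A) (t ka kr al be : C).
Hypotheses (caa : ca * ca = -1) (crr : cr * cr = -1) (cra : cr * ca = - (ca * cr)).
Hypotheses (daca : da * ca = - (ca * da)) (dacr : da * cr = - (cr * da)).
Hypotheses (drca : dr * ca = - (ca * dr)) (drcr : dr * cr = - (cr * dr)).
Hypothesis drda : dr * da = - (da * dr).
Hypotheses (ga : ca * g = - (g * ca)) (gr : cr * g = - (g * cr)).
Hypotheses (gda : da * g = - (g * da)) (gdr : dr * g = - (g * dr)).
Hypotheses (ya : y * (da * da) = ka *: y) (yr : y * (dr * dr) = kr *: y).
Let u := ca - cr.
Let w := da - dr.
Let q := u * w.
Let f := al *: ca + be *: da + g.
Hypothesis yf : t *: (y * f) = y * (q * f).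

Let rc : q * ca = ca * q + (w + w). Proof. exact: refl_c. Qed.
Let rd : q * da = da * q + da * da * (u + u). Proof. exact: refl_d. Qed.
Let rwq : w * q = - ((da * da + dr * dr) * u). Proof. exact: refl_wq. Qed.
Let ruq : u * q = - (w + w). Proof. exact: refl_uq. Qed.
Let rqq : q * q = (da * da + dr * dr) + (da * da + dr * dr). Proof. exact: refl_qq. Qed.

Definition step_c := t * t * al - (t + t) * ka * be.
Definition step_d := (t * t + (ka - kr) + (ka - kr)) * be - (t + t) * al.
Definition step_g : A := ((t + t) * ka * be - (ka + kr + (ka + kr)) * al) *: cr
  + ((t + t) * al - (ka + ka + (ka + ka)) * be) *: dr
  + (t * t - (ka + kr + (ka + kr))) *: g.

(** With [q f = f q + r], the hypothesis reads [y f (t - q) = y r]. Multiply by [t + q] on the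
    right: since [q ^ 2] acts after [y f] as the scalar [2 (ka + kr)], the result is linear in the
    odd elements, with the coefficients named above. *)
Lemma reflection_step : y * (step_c *: ca + step_d *: da + step_g) = 0.
Proof.
have qg : q * g = g * q.
  have wg : w * g = - (g * w) by rewrite /w mulrBl mulrBr gda gdr opprB opprK addrC.
  have ug : u * g = - (g * u) by rewrite /u mulrBl mulrBr ga gr opprB opprK addrC.
  by rewrite /q -[LHS]mulrA wg mulrN [_ * (g * w)]mulrA ug mulNr opprK -[LHS]mulrA.
pose S := ka + kr.
have yS : y * (da * da + dr * dr) = S *: y by rewrite mulrDr ya yr -scalerDl.
pose r := al *: (w + w) + be *: (da * da * (u + u)).
have qf : q * f = f * q + r.
  have q1 : q * (al *: ca) = al *: ca * q + al *: (w + w) by rewrite -scalerAl -scalerDr -rc scalerAr.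
  have q2 : q * (be *: da) = be *: da * q + be *: (da * da * (u + u)) by rewrite -scalerAl -scalerDr -rd scalerAr.
  by rewrite /f /r [LHS]mulrDr [_ * (al *: ca + _)]mulrDr q1 q2 qg ![_ * q in RHS]mulrDl; ncr A.
have yS2 : y * (da * da + dr * dr + (da * da + dr * dr)) = (S + S) *: y.
  by rewrite [LHS]mulrDr yS [RHS]scalerDl.
have fS : y * f * (q * q) = (S + S) *: (y * f).
  rewrite rqq -mulrA.
  have com (h : A) : da * h = - (h * da) -> h * (da * da) = da * da * h.
    by move=> e; rewrite -[RHS]mulrA e mulrN [da * (h * _)]mulrA e mulNr opprK -[RHS]mulrA.
  have com' (h : A) : dr * h = - (h * dr) -> h * (dr * dr) = dr * dr * h.
    by move=> e; rewrite -[RHS]mulrA e mulrN [dr * (h * _)]mulrA e mulNr opprK -[RHS]mulrA.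
  rewrite (_ : f * (da * da + dr * dr + (da * da + dr * dr))
      = (da * da + dr * dr + (da * da + dr * dr)) * f).
    by rewrite [LHS]mulrA yS2 -scalerAl.
  have cz (z : A) : z * (da * da) = da * da * z -> z * (dr * dr) = dr * dr * z ->
      z * (da * da + dr * dr + (da * da + dr * dr)) = (da * da + dr * dr + (da * da + dr * dr)) * z.
    by move=> e1 e2; rewrite !(mulrDr z) !(mulrDl _ _ z) e1 e2.
  have cZ (k : C) (z r1 : A) : z * r1 = r1 * z -> (k *: z) * r1 = r1 * (k *: z).
    by move=> e; rewrite -scalerAl e -scalerAr.
  by rewrite /f [LHS]mulrDl [_ * _ in LHS]mulrDl [RHS]mulrDr [_ * _ in RHS]mulrDr (cZ al ca) ?(cZ be da) ?(cz g) // ?(com g) ?(com' g) //; apply: cz; rewrite ?(com ca) ?(com' ca) ?(com' da) // mulrA.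
have yrE : y * r = al *: (y * (w + w)) + (be * ka) *: (y * (u + u)).
  rewrite /r [LHS]mulrDr -!scalerAr; congr (_ + _).
  by rewrite [y * (da * da * _)]mulrA ya -scalerAl scalerA.
have rq : y * (r * q) = - ((al * S) *: (y * (u + u))) - ((be * ka) *: (y * (w + w + (w + w)))).
  have e1 : (w + w) * q = - ((da * da + dr * dr) * (u + u)).
    by rewrite [LHS]mulrDl rwq [in RHS]mulrDr opprD.
  have e2 : (u + u) * q = - (w + w + (w + w)) by rewrite [LHS]mulrDl ruq [RHS]opprD.
  rewrite /r [_ * q]mulrDl [y * _]mulrDr; congr (_ + _).
    by rewrite -[_ * q]scalerAl e1 -[LHS]scalerAr mulrN scalerN [y * (_ * _)]mulrA yS -scalerAl scalerA.
  by rewrite -[_ * q]scalerAl -[_ * q]mulrA e2 -[LHS]scalerAr mulrN mulrN scalerN [y * (_ * _)]mulrA ya -scalerAl scalerA.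
have key : (t * t - (S + S)) *: (y * f) - t *: (y * r) - y * (r * q) = 0.
  have h1 : t *: (y * f) = y * f * q + y * r by rewrite yf qf [LHS]mulrDr [y * (f * q)]mulrA.
  have h2 : t *: (y * f * q) = (S + S) *: (y * f) + y * (r * q).
    by rewrite scalerAl h1 [LHS]mulrDl -fS -[y * r * q]mulrA -[y * f * q * q]mulrA.
  rewrite scalerBl -scalerA h1 [t *: (_ + _)]scalerDr h2; ncr A.
have fE : y * f = al *: (y * ca) + be *: (y * da) + y * g.
  by rewrite /f !(mulrDr y) -!(scalerAr _ y).
have uE : y * (u + u) = y * ca + y * ca - y * cr - y * cr.
  by rewrite /u; ncr A.
have wE : y * (w + w) = y * da + y * da - y * dr - y * dr.
  by rewrite /w; ncr A.
have wE2 : y * (w + w + (w + w)) = y * (w + w) + y * (w + w) by rewrite mulrDr.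
rewrite -key rq yrE fE wE2 uE wE /step_g !(mulrDr y) -!(scalerAr _ y) /step_c /step_d -/S.
move: (y * ca) (y * cr) (y * da) (y * dr) (y * g) => v1 v2 v3 v4 v5.
have eQ : t * t = t * t - (S + S) + (S + S) by ring.
move: (t * t - (S + S)) eQ => Q ->; have -> : S = ka + kr by [].
have [b eb] : exists b, b = be * ka by exists (be * ka).
rewrite -eb; have -> : ka - kr = (ka + ka) - (ka + kr) by ring.
rewrite -[ka + kr]/S; move: (S) => S'.
have -> : (t + t) * ka * be = t * b + t * b by rewrite eb; ring.
have -> : (ka + ka + (ka + ka)) * be = b + b + (b + b) by rewrite eb; ring.
rewrite -[RHS]addr0 !(scalerDr, scalerBr, scalerA) [in RHS]scalerN.
have -> : (Q + (S' + S')) * al - (t * b + t * b) = Q * al + (al * S' + al * S') - (t * b + t * b) by ring.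
have -> : (Q + (S' + S') + (ka + ka - S') + (ka + ka - S')) * be - (t + t) * al
   = Q * be + (b + b + (b + b)) - (t * al + t * al) by rewrite eb; ring.
have -> : (S' + S') * al = al * S' + al * S' by ring.
have -> : (t + t) * al = t * al + t * al by ring.
rewrite !(scalerDl, scalerBl, scaleNr, scalerN, scalerA) ; ncr A.
Qed.

End ReflectionStep.

Section StripCombinatorics.
Local Open Scope nat_scope.
Implicit Types (T R : seq nat) (a b : nat).

(** The number of maximal intervals of integers in [R], that is of connected components of a strip
    with distinct contents [R]. Content 0 always starts one and is singled out because [0.-1] is
    0. *)
Definition runs R := count (fun a => (a == 0) || (a.-1 \notin R)) R.

Lemma std_ext_filter T R (p : pred nat) :
  (forall a b, a \in R -> b \in R -> p a -> ~~ p b -> far b a) ->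
  std_ext T R -> std_ext T (filter p R ++ filter (predC p) R).
Proof.
elim: R T => //= d R IH T H /andP[aT sR].
have {IH sR} IH : std_ext (rcons T d) (filter p R ++ filter (predC p) R).
  by apply: IH => // a b aR bR; apply: H; rewrite inE ?aR ?bR orbT.
case: ifP => [pd|/negbT npd] /=; first by rewrite aT.
have cl : far_closed T (fun _ => True) by [].
have := @bubble_right T _ [::] d (filter p R) (filter (predC p) R) cl _ _ I.
case=> //=; last by rewrite aT.
apply/allP => b; rewrite mem_filter => /andP[pb bR].
by apply: H => //; rewrite inE ?eqxx ?bR ?orbT.
Qed.

(** Contents on opposite sides of [a] are far from each other, so those on the side of [b] may all
    be moved forward. Among them only [b] is adjacent to [a], so everything left between [a] and [b]
    is far from [a]. *)
Lemma near_first T a b R : uniq (a :: R) -> (b == a.+1) || (a == b.+1) ->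
  std_ext T (a :: R) -> b \in R ->
  exists Z Q, [/\ perm_eq (Z ++ b :: Q) R, all (far a) Z & std_ext T (a :: Z ++ b :: Q)].
Proof.
move=> /andP[aR uR] nab sR bR; pose p := if b == a.+1 then (fun d => a < d) else (fun d => d < a).
have [pb pfar] : p b /\ forall d, p d -> d != b -> far a d.
  by rewrite /p; move: nab; case: eqP => [->|] /=; split; rewrite /far //; lia.
have sF : std_ext T (a :: (filter p R ++ filter (predC p) R)).
  move: sR => /= /andP[-> sR]; apply: std_ext_filter => // d e dR eR.
  have da : d != a by apply: contraNneq aR => <-.
  have ea : e != a by apply: contraNneq aR => <-.
  rewrite /p; case: ifP => _; rewrite /far; lia.
have bF : b \in filter p R by rewrite mem_filter pb bR.
have [Z [Q eF]] : exists Z Q, filter p R = Z ++ b :: Q.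
  by case/splitPr: bF => Z Q; exists Z, Q.
have := filter_uniq p uR; rewrite eF in sF * => uF.
exists Z, (Q ++ filter (predC p) R); split.
- by rewrite -cat_cons catA -eF (permPl (permEl (perm_filterC _ _))).
- apply/allP => d dZ; apply: pfar.
    have : d \in filter p R by rewrite eF mem_cat dZ.
    by rewrite mem_filter => /andP[].
  move: uF; rewrite cat_uniq => /and3P[_ /norP[bZ _] _].
  by apply: contraNneq bZ => <-.
- by move: sF; rewrite -!catA.
Qed.

(** A new content opens an interval, and each of its neighbours already present merges it with
    another one. *)
Lemma runs_cons a R : uniq (a :: R) ->
  (runs (a :: R) + (a.+1 \in R) + ((0 < a) && (a.-1 \in R)) = (runs R).+1).
Proof.
move=> /= /andP[aR uR]; rewrite /runs /=.
have -> : (a == 0) || (a.-1 \notin a :: R) = ~~ ((0 < a) && (a.-1 \in R)).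
  by case: a aR => [|a] aR //=; rewrite inE ltn_eqF.
have key (p q : pred nat) Q : (forall d, d \in Q -> p d + (d == a.+1 :> nat) = q d) ->
    count p Q + count_mem a.+1 Q = count q Q.
  elim: Q => //= d Q IH H; rewrite addnACA (H d (mem_head _ _)) IH // => e eQ.
  by apply: H; rewrite inE eQ orbT.
have := key (fun d => (d == 0) || (d.-1 \notin a :: R)) (fun d => (d == 0) || (d.-1 \notin R)) R.
rewrite (count_uniq_mem _ uR) => <-; first by case: (_ && _) => /=; lia.
move=> d dR; rewrite inE; case: d dR => [|d] //= dR; rewrite eqSS.
by case: (eqVneq d a) aR => [->|] /=; [case: (a \in R) | case: (d \in R)].
Qed.
End StripCombinatorics.

Section Strip.
Variables (C : numClosedFieldType) (A : falgType C) (n : nat) (c x s : nat -> A).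
Hypothesis sys : sergeev_system n c x s.
Implicit Types (i j k : nat) (y z v f g : A) (T R W : seq nat) (a b : nat).
Local Notation X i := (sq x i).
Local Notation k2 := (k2 C).
Local Notation intw := (intw c x s).
Local Notation od := (od c x).
Local Notation eproj := (@eproj C A x).
Local Notation shape_proj := (@shape_proj C A x).
Local Notation gen := (@gen C A c s).
Let nn := leqnn n.

(** Linear combinations of the odd elements of the letters [j] and later. Annihilators will be a
    leading part [d_k + t c_k] plus such a tail, which anticommutes with the odd elements of all
    earlier letters. *)
Inductive tail j : A -> Prop :=
| tail_c i : (j <= i)%N -> (i < n)%N -> tail j (c i)
| tail_od i : (j <= i)%N -> (i < n)%N -> tail j (od i)
| tail_add y z : tail j y -> tail j z -> tail j (y + z)
| tail_scale (t : C) y : tail j y -> tail j (t *: y).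

Lemma tail_le j l g : (j <= l)%N -> tail l g -> tail j g.
Proof.
move=> jl; elim=> [i li ni|i li ni|y z _ ty _ tz|t y _ ty].
- by apply: tail_c; rewrite ?(leq_trans jl).
- by apply: tail_od; rewrite ?(leq_trans jl).
- exact: tail_add.
- exact: tail_scale.
Qed.

Lemma tail_opp j g : tail j g -> tail j (- g).
Proof. by rewrite -scaleN1r; apply: tail_scale. Qed.

Lemma tail_anti i j g h : (i < j)%N -> (i < n)%N -> h \in [:: c i; od i] -> tail j g ->
  h * g = - (g * h).
Proof.
move=> ij ni hi; elim=> [l jl nl|l jl nl|y z _ ty _ tz|t y _ ty].
- have il : i != l by lia.
  by move: hi; rewrite !inE => /orP[] /eqP ->; [apply: (sys_cN sys) | apply: (od_cj sys)].
- have il : i != l by lia.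
  by move: hi; rewrite !inE => /orP[] /eqP ->; [apply: (c_od sys) | apply: (od_odj sys)].
- by rewrite mulrDr mulrDl ty tz opprD.
- by rewrite -scalerAr -scalerAl ty scalerN.
Qed.

Lemma tail_s i j g : (i.+1 < j)%N -> (i.+1 < n)%N -> tail j g -> s i * g = g * s i.
Proof.
move=> ij ni; elim=> [l jl nl|l jl nl|y z _ ty _ tz|t y _ ty].
- by rewrite (sys_scj sys) //; lia.
- by rewrite (s_odj sys) //; lia.
- by rewrite mulrDr mulrDl ty tz.
- by rewrite -scalerAr -scalerAl ty.
Qed.

Lemma tail_sq i j g : (i < n)%N -> tail j g -> X i * g = g * X i.
Proof.
move=> ni; elim=> [l jl nl|l jl nl|y z _ ty _ tz|t y _ ty].
- by rewrite (sq_c sys).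
- by rewrite (sq_od sys).
- by rewrite mulrDr mulrDl ty tz.
- by rewrite -scalerAr -scalerAl ty.
Qed.

Lemma tail_intw i j g : (i.+1 < j)%N -> (i.+1 < n)%N -> tail j g ->
  intw i * g = g * intw i.
Proof.
move=> ij ni tg; have ni' := ltnW ni; have ij' := ltnW ij.
have anti h : h \in [:: c i; od i; c i.+1; od i.+1] -> h * g = - (g * h).
  rewrite !inE => /or4P[] /eqP ->.
  - by apply: (tail_anti ij') tg; rewrite ?inE ?eqxx.
  - by apply: (tail_anti ij') tg; rewrite ?inE ?eqxx ?orbT.
  - by apply: (tail_anti ij) tg; rewrite ?inE ?eqxx.
  - by apply: (tail_anti ij) tg; rewrite ?inE ?eqxx ?orbT.
have eu : du c i * g = - (g * du c i).
  by rewrite /du mulrBl mulrBr !anti ?inE ?eqxx ?orbT //; ncr A.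
have ew : dw c x i * g = - (g * dw c x i).
  by rewrite /dw mulrBl mulrBr !anti ?inE ?eqxx ?orbT //; ncr A.
have es := tail_s ij ni tg; have e0 := tail_sq ni' tg; have e1 := tail_sq ni tg.
rewrite /intw_def; move: (du c i) (dw c x i) (X i) (X i.+1) eu ew es e0 e1 => u w X0 X1 eu ew es e0 e1.
have ex : (X0 - X1) * g = g * (X0 - X1) by rewrite mulrBl mulrBr e0 e1.
rewrite [LHS]mulrBl [RHS]mulrBr; congr (_ - _); first by rewrite -[LHS]mulrA ex [LHS]mulrA es -[LHS]mulrA.
by rewrite -[LHS]mulrA ew mulrN [u * (g * w)]mulrA eu mulNr opprK -[LHS]mulrA.
Qed.

Lemma du_eproj i W : (i.+1 < n)%N -> (size W <= n)%N -> du c i * eproj W = eproj W * du c i.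
Proof.
by move=> ni Wn; rewrite /du mulrBl mulrBr !(c_eproj sys) ?(ltnW ni).
Qed.

Lemma dw_eproj i W : (i.+1 < n)%N -> (size W <= n)%N -> dw c x i * eproj W = eproj W * dw c x i.
Proof.
by move=> ni Wn; rewrite /dw mulrBl mulrBr !(od_eproj sys) ?(ltnW ni).
Qed.

(** What [reflection_step] leaves beyond the letter [i], divided by [step_d = D (D + 2 - 2 t)] so
    that [d_i] gets the coefficient 1. *)
Definition far_tail i a b (t : C) g : A := let D := k2 a - k2 b in
  (D * (D + (1 + 1) - (t + t)))^-1 *: step_g (c i.+1) (od i.+1) g D (k2 a) (k2 b) t 1.

Lemma tail_far_tail i a b t g : (i.+1 < n)%N -> tail i.+2 g -> tail i.+1 (far_tail i a b t g).
Proof.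
move=> ni tg; apply/tail_scale/tail_add; [apply: tail_add|]; apply: tail_scale;
  [exact: tail_c|exact: tail_od|exact: tail_le tg].
Qed.

Section Pair.
Variables (R1 R2 : seq nat) (a b : nat).
Let W := R1 ++ [:: a, b & R2].
Let W' := R1 ++ [:: b, a & R2].
Let i := size R1.
Hypotheses (sW : std W) (Wn : (size W <= n)%N).
Variables (v : A).
Hypothesis vs : v * s i = v.

Let Wsz : size W = (size R1 + size R2).+2 := size_pair R1 a b R2.
Let ni1 : (i.+1 < n)%N. Proof. by move: Wn; rewrite Wsz /i; lia. Qed.
Let ni : (i < n)%N := ltnW ni1.
Let i0W : (i < size W)%N. Proof. by rewrite Wsz /i; lia. Qed.
Let i1W : (i.+1 < size W)%N. Proof. by rewrite Wsz /i; lia. Qed.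

Lemma invariant_intw : v * intw i * eproj W
  = (k2 a - k2 b) *: (v * eproj W) - v * eproj W * (du c i * dw c x i).
Proof.
rewrite /intw_def mulrBr mulrBl; congr (_ - _).
  rewrite mulrA vs -mulrA mulrBl !(std_wt sys) // nth_pair0 nth_pair1.
  by rewrite -scalerBl -scalerAr.
have := dw_eproj ni1 Wn; have := du_eproj ni1 Wn.
move: (du c i) (dw c x i) (eproj W) => u w e eu ew.
by rewrite -[LHS]mulrA -[RHS]mulrA -[u * w * e]mulrA ew [u * (e * w)]mulrA eu -[e * u * w]mulrA.
Qed.

Lemma invariant_weight j : (j < size W)%N ->
  v * eproj W * X j = k2 (nth 0%N W j) *: (v * eproj W).
Proof. by move=> jW; rewrite -mulrA (std_wtr sys) // -scalerAr. Qed.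

(** The intertwiner vanishes here, which leaves [- 2 t y = y u w] for [y = v * eproj W]. Right
    multiplication by [w], whose square acts as [2 t ^ 2], makes this linear. The sign of [t] tells
    the direction: [t = a + 1] for [b = a + 1] and [t = - a] for [b = a - 1]. *)
Lemma near_annihilator (t : C) : ~~ far a b -> t != 0 -> k2 a = t * t - t -> k2 b = t * t + t ->
  v * eproj W * (od i + t *: c i - (od i.+1 + t *: c i.+1)) = 0.
Proof.
move=> nf t0 ka kb.
have := invariant_intw; rewrite -mulrA (intw_near sys) // mulr0.
have wX : v * eproj W * (X i + X i.+1) = (t * t + t * t) *: (v * eproj W).
  rewrite mulrDr !invariant_weight // /W nth_pair0 nth_pair1 ka kb -scalerDl.
  by congr (_ *: _); ring.
have -> : k2 a - k2 b = - (t + t) by rewrite ka kb; ring.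
move: wX; set y := v * eproj W => wX /esym/eqP; rewrite subr_eq0 => /eqP e.
have : - (t + t) *: (y * dw c x i) = (t * t + t * t) *: (y * du c i).
  rewrite scalerAl e scalerAl -wX; move: (dw_sqr sys ni1) (sq_du sys ni ni1) (sq_du sys ni1 ni1).
  move: (du c i) (dw c x i) (X i) (X i.+1) => u w X0 X1 ew e0 e1.
  rewrite -[y * (u * w) * w]mulrA -[u * w * w]mulrA ew -[RHS]mulrA; congr (y * _).
  by rewrite [LHS]mulrDr [RHS]mulrDl e0 e1.
move/(congr1 (fun z => (- (t + t))^-1 *: z)).
have tt0 : t + t != 0 by rewrite -mulr2n -mulr_natr mulf_neq0 // pnatr_eq0.
rewrite scalerA mulVf ?oppr_eq0 // scale1r scalerA.
have -> : (- (t + t))^-1 * (t * t + t * t) = - t.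
  by rewrite -mulrDl mulrA invrN mulNr mulVf // mulN1r.
rewrite /dw /du => ew; have {}ew : y * od i - y * od i.+1 = - t *: (y * c i - y * c i.+1).
  by rewrite -[LHS](mulrBr y) ew; congr (_ *: _); rewrite mulrBr.
have {}ew : y * od i = y * od i.+1 - t *: (y * c i - y * c i.+1).
  by rewrite -scaleNr -ew; ncr A.
by rewrite !mulrDr mulrN mulrDr -!scalerAr ew scalerBr; ncr A.
Qed.

Hypothesis fab : far a b.
Let sW' : std W'.
Proof. by move: sW; rewrite /W /W' !std_cat => /andP[-> /(std_ext_far fab)]. Qed.
Let Wn' : (size W' <= n)%N. Proof. by move: Wn; rewrite !size_pair. Qed.

Lemma far_eproj_intw : v * eproj W' * intw i
  = (k2 a - k2 b) *: (v * eproj W) - v * eproj W * (du c i * dw c x i).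
Proof.
have := intw_eproj sys (spectrum sys nn) nn sW sW' Wn => e.
by rewrite -invariant_intw -mulrA -e mulrA.
Qed.

(** If [y = v * eproj W] satisfies [D y = y u w], applying this twice gives
    [D ^ 2 y = 2 (k2 a + k2 b) y], that is [norm2 C a b *: y = 0]. *)
Lemma far_eproj0 : v * eproj W' = 0 -> v * eproj W = 0.
Proof.
move=> e; have := far_eproj_intw; rewrite e mul0r; set y := v * eproj W.
move=> /esym/eqP; rewrite subr_eq0 => /eqP e1.
have : norm2 C a b *: y = 0.
  have wX : y * (X i + X i.+1) = (k2 a + k2 b) *: y.
    by rewrite mulrDr !invariant_weight // /W nth_pair0 nth_pair1 -scalerDl.
  have qq := du_dw_sqr sys ni1.
  move: (du c i * dw c x i) qq e1 wX => q; move: (X i) (X i.+1) => X0 X1 qq e1 wX.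
  have e2 : ((k2 a - k2 b) * (k2 a - k2 b)) *: y = (k2 a + k2 b + (k2 a + k2 b)) *: y.
    rewrite -scalerA e1 scalerAl e1 -[LHS]mulrA qq [LHS]mulrDr wX.
    by rewrite [in RHS]scalerDl.
  by rewrite /norm2 scalerBl e2 subrr.
by move/eqP; rewrite scaler_eq0 (negbTE (norm2_neq0 C fab)) => /eqP.
Qed.

(** An annihilator is carried across a far exchange by [reflection_step]. Because
    [k2 a = t ^ 2 - t], the coefficient [step_c] is [t] times [step_d], so the parameter [t] is
    preserved. *)
Lemma far_annihilator (t : C) g :
  t = a.+1%:R \/ t = - a%:R -> tail i.+2 g ->
  v * eproj W' * (od i.+1 + t *: c i.+1 + g) = 0 ->
  v * eproj W * (od i + t *: c i + far_tail i a b t g) = 0.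
Proof.
move=> ta tg f0; have k2E d : k2 d = d%:R * d%:R + d%:R by rewrite /k2 natrM -natr1 mulrDr mulr1.
have ka : k2 a = t * t - t.
  by rewrite k2E; case: ta => ->; rewrite -?natr1; ring.
pose D := k2 a - k2 b.
have D0 : D != 0 by rewrite /D (delta_neq0 C sW).
have E0 : D * (D + (1 + 1) - (t + t)) != 0.
  (* This is the squared content of [a.-1] when [t = a + 1] and of [a.+1] when [t = - a]; both
     differ from [b], which is far from [a]. *)
  rewrite mulf_neq0 // /D; have [d db e] : exists2 d, d != b & k2 a + (1 + 1) - (t + t) = k2 d.
    case: ta => ->.
      exists a.-1; first by move: fab; rewrite /far; lia.
      by rewrite !k2E; case: (a) => [|d] /=; rewrite -?natr1; ring.
    by exists a.+1; [move: fab; rewrite /far; lia | rewrite !k2E -natr1; ring].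
  have -> : k2 a - k2 b + (1 + 1) - (t + t) = k2 d - k2 b by rewrite -e; ring.
  by rewrite subr_eq0 (inj_eq (@k2_inj C)).
set y := v * eproj W; pose f := t *: c i + 1 *: od i + g.
have yf : D *: (y * f) = y * (du c i * dw c x i * f).
  have : v * eproj W' * (od i.+1 + t *: c i.+1 + g) * intw i = 0 by rewrite f0 mul0r.
  rewrite -mulrA (_ : (od i.+1 + t *: c i.+1 + g) * intw i = intw i * f); last first.
    have e1 := intw_od sys ni1; have e2 := intw_c sys ni1.
    have := tail_intw (leqnn _) ni1 tg; rewrite /f scale1r.
    move: e1 e2; move: (intw i) (od i) (od i.+1) => p d d' e1 e2 e3.
    rewrite [LHS]mulrDl [_ * p in LHS]mulrDl -e1 -e3 -scalerAl -e2.
    by rewrite [RHS]mulrDr [p * (_ + d)]mulrDr -scalerAr [p * d + _]addrC.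
  rewrite mulrA far_eproj_intw -/y -/D [LHS]mulrBl -scalerAl => /eqP; rewrite subr_eq0 => /eqP ->.
  by rewrite -[LHS]mulrA.
have i1 : (i.+1 != i)%N by rewrite gtn_eqF.
have := @reflection_step C A (c i) (c i.+1) (od i) (od i.+1) g y D (k2 a) (k2 b) t 1.
have anti h j : (j < i.+2)%N -> (j < n)%N -> h \in [:: c j; od j] -> h * g = - (g * h).
  by move=> ji nj hj; apply: (tail_anti ji nj hj).
rewrite (sys_cc sys) // (sys_cc sys) // (sys_cN sys) // (od_c sys) // (od_c sys) //.
rewrite (od_cj sys) 1?eq_sym // (od_cj sys) // (od_odj sys) // (od_sqr sys) // (od_sqr sys) //.
rewrite (anti (c i) i) ?inE ?eqxx // (anti (c i.+1) i.+1) ?inE ?eqxx //.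
rewrite (anti (od i) i) ?inE ?eqxx ?orbT // (anti (od i.+1) i.+1) ?inE ?eqxx ?orbT //.
move=> /(_ erefl erefl erefl erefl erefl erefl erefl erefl erefl erefl erefl erefl).
rewrite !invariant_weight // /W nth_pair0 nth_pair1 => /(_ erefl erefl yf) h.
rewrite /far_tail -/D; apply: (scalerI E0); rewrite scaler0 -h scalerAr; congr (_ * _).
rewrite [LHS]scalerDr scalerA mulfV // scale1r; congr (_ + _).
rewrite scalerDr scalerA [RHS]addrC; congr (_ *: _ + _ *: _).
  by rewrite /step_d /D; ring.
by rewrite /step_c -/D ka; ring.
Qed.
End Pair.
End Strip.

Section StripBound.
Variables (C : numClosedFieldType) (A : falgType C) (n : nat) (c x s : nat -> A).
Hypothesis sys : sergeev_system n c x s.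
Implicit Types (i j k : nat) (y z v f g : A) (T R W Z : seq nat) (a b : nat).
Local Notation X i := (sq x i).
Local Notation k2 := (k2 C).
Local Notation od := (od c x).
Local Notation eproj := (@eproj C A x).
Local Notation shape_proj := (@shape_proj C A x).
Local Notation gen := (@gen C A c s).
Local Notation tail := (@tail C A n c x).
Let nn := leqnn n.

Lemma shape_proj_idem m T : (m <= n)%N -> shape_proj m T * shape_proj m T = shape_proj m T.
Proof.
move=> mn; rewrite [in LHS](_ : shape_proj m T * _ = \sum_(W <- stds m | perm_eq W T) shape_proj m T * eproj W);
  last by rewrite -mulr_sumr.
rewrite [RHS]/shape_proj_def big_seq_cond [RHS]big_seq_cond; apply: eq_bigr => W /andP[].
by rewrite mem_stds => /andP[sW /eqP szW] pW; rewrite (shape_projE sys) // pW.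
Qed.

(** The full shape is imposed through [shape_proj], because the idempotent of one filling does not
    commute with the transpositions of the strip, whereas the shape projection does. *)
Definition strip_inv T R v := [/\ forall i, (size T <= i)%N -> (i.+1 < size T + size R)%N -> v * s i = v,
  v * eproj T = v & v * shape_proj (size T + size R) (T ++ R) = v].

Lemma strip_inv_perm T R R' v : perm_eq R R' -> strip_inv T R v -> strip_inv T R' v.
Proof.
move=> pR [h1 h2 h3]; rewrite /strip_inv -(perm_size pR); split=> //.
by rewrite -(@eq_shape_proj C A x _ (T ++ R)) // perm_cat2l.
Qed.

Lemma strip_inv_add T R v w : strip_inv T R v -> strip_inv T R w -> strip_inv T R (v + w).
Proof.
by move=> [h1 h2 h3] [g1 g2 g3]; split=> [i i1 i2||]; rewrite mulrDl ?h1 ?g1 ?h2 ?g2 ?h3 ?g3.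
Qed.

Lemma strip_inv_mul T R v h : (size T + size R <= n)%N -> gen (size T + size R) h ->
  h * eproj T = eproj T * h ->
  (forall i, (size T <= i)%N -> (i.+1 < size T + size R)%N -> h * s i = s i * h) ->
  strip_inv T R v -> strip_inv T R (v * h).
Proof.
move=> Tn gh hT hs [h1 h2 h3]; split=> [i i1 i2||].
- by rewrite -mulrA hs // mulrA h1.
- by rewrite -mulrA hT mulrA h2.
- by rewrite -mulrA -(shape_proj_gen sys) // mulrA h3.
Qed.

(** [v] is the sum of the [v * eproj W] over the fillings [W] of the shape. Those not starting with
    [T] vanish, and the others are reached from [T ++ R] by far exchanges inside the strip, along
    which [far_eproj0] transports the vanishing. *)
Lemma strip_inv_zero T R v : std (T ++ R) -> (size (T ++ R) <= n)%N -> strip_inv T R v ->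
  v * eproj (T ++ R) = 0 -> v = 0.
Proof.
move=> sTR TRn [h1 h2 h3] v0; have Tn : (size T <= n)%N by rewrite size_cat in TRn; lia.
have sT : std T by move: sTR; rewrite std_cat => /andP[].
rewrite -h3 /shape_proj_def mulr_sumr big_seq_cond big1 // => W /andP[].
rewrite mem_stds => /andP[sW /eqP szW] pW.
have [eT|nT] := eqVneq (take (size T) W) T; last first.
  have szt : size (take (size T) W) = size T by rewrite size_takel // szW leq_addr.
  have sz : std (take (size T) W) by move: sW; rewrite -{1}(cat_take_drop (size T) W) std_cat => /andP[].
  rewrite -h2 -mulrA -(cat_take_drop (size T) W) eproj_cat [eproj T * _]mulrA.
  by rewrite (std_orth sys) ?mul0r ?mulr0 // eq_sym.
have eW : W = T ++ drop (size T) W by rewrite -[LHS](cat_take_drop (size T)) eT.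
move: pW sW; rewrite eW perm_cat2l perm_sym std_cat => pW /andP[_ sW].
have sR : std_ext T R by move: sTR; rewrite std_cat => /andP[].
have szR := perm_size pW.
apply: (far_conn (P := fun R' => size R' = size R -> v * eproj (T ++ R') = 0) _ sT pW sR sW) => //.
move=> R1 a b R2 sab fab P1 szab; have fba : far b a by rewrite far_sym.
have e0 R' : size (R1 ++ [:: a, b & R']) = size (R1 ++ [:: b, a & R']) by rewrite !size_pair.
rewrite catA in P1; rewrite catA.
apply: (far_eproj0 sys _ _ _ fba).
- by rewrite -catA std_cat sT /= std_ext_far_cat.
- by rewrite -catA size_cat szab -size_cat.
- apply: h1; rewrite size_cat ?leq_addr // -szab size_pair; lia.
- by apply: P1; rewrite -szab e0.
Qed.

Lemma strip_inv_first T R a v : std (T ++ a :: R) -> (size (T ++ a :: R) <= n)%N ->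
  strip_inv T (a :: R) v -> strip_inv (rcons T a) R (v * eproj (rcons T a)).
Proof.
move=> sTR TRn [h1 h2 h3]; rewrite /strip_inv size_rcons cat_rcons addSn -addnS.
have ss : (size T + (size R).+1 = size (T ++ a :: R))%N by rewrite size_cat.
have sTa : std (rcons T a) by move: sTR; rewrite -cat_rcons std_cat => /andP[].
have Tan : (size (rcons T a) <= n)%N by rewrite size_rcons; move: TRn; rewrite -ss; lia.
split=> [i i1 i2||].
- have ni : (i.+1 < n)%N by apply: leq_trans i2 _; rewrite ss.
  have gi : gen i (eproj (rcons T a)) by apply: (gen_eproj sys); rewrite ?size_rcons // ltnW // ltnW.
  by rewrite -mulrA -(s_gen sys ni gi) mulrA h1 ?(ltnW i1).
- by rewrite -mulrA (std_idem sys).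
- have mn : (size T + (size R).+1 <= n)%N by rewrite ss.
  have gm : gen (size T + (size R).+1) (eproj (rcons T a)).
    by apply: (gen_eproj sys); rewrite ?size_rcons //; lia.
  by rewrite -mulrA -(shape_proj_gen sys _ mn gm) mulrA h3.
Qed.

Lemma strip_inv_last T R a v : std (T ++ rcons R a) -> (size (T ++ rcons R a) <= n)%N ->
  strip_inv T (rcons R a) v -> strip_inv T R (v * shape_proj (size T + size R) (T ++ R)).
Proof.
move=> sTR TRn [h1 h2 h3]; have ss : (size T + (size R).+1 = size (T ++ rcons R a))%N by rewrite size_cat size_rcons.
have mn : (size T + size R <= n)%N by move: TRn; rewrite -ss; lia.
split=> [i i1 i2||].
- by rewrite -mulrA (shape_proj_s sys) // mulrA h1 // size_rcons; lia.
- have gT : gen (size T + size R) (eproj T) by apply: (gen_eproj sys) => //; lia.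
  by rewrite -mulrA (shape_proj_gen sys _ mn gT) mulrA h2.
- by rewrite -mulrA shape_proj_idem.
Qed.

Lemma strip_inv_last0 T R a v : std (T ++ rcons R a) -> (size (T ++ rcons R a) <= n)%N ->
  strip_inv T (rcons R a) v -> v * shape_proj (size T + size R) (T ++ R) = 0 -> v = 0.
Proof.
move=> sTR TRn iv v0; apply: (strip_inv_zero sTR TRn iv).
have sTR' : std (T ++ R) by move: sTR; rewrite -rcons_cat std_rcons => /andP[].
have TRn' : (size T + size R <= n)%N by move: TRn; rewrite size_cat size_rcons; lia.
have := shape_projE sys (T ++ R) TRn' sTR' (size_cat _ _); rewrite perm_refl => e.
by rewrite -rcons_cat eproj_rcons mulrA -e mulrA v0 !mul0r.
Qed.

Lemma strip_inv_first0 T R a v : std (T ++ a :: R) -> (size (T ++ a :: R) <= n)%N ->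
  strip_inv T (a :: R) v -> v * eproj (rcons T a) = 0 -> v = 0.
Proof.
move=> sTR TRn iv v0; apply: (strip_inv_zero sTR TRn iv).
by rewrite -cat_rcons eproj_cat mulrA v0 mul0r.
Qed.

Lemma annihilator_left T R1 Z a R2 (t : C) g : let k := (size T + size R1)%N in
  t = a.+1%:R \/ t = - a%:R -> all (far a) Z ->
  std (T ++ R1 ++ Z ++ a :: R2) -> (size (T ++ R1 ++ Z ++ a :: R2) <= n)%N ->
  tail (k + size Z).+1 g ->
  exists2 g', tail k.+1 g' & forall v,
    (forall i, (k <= i)%N -> (i < k + size Z)%N -> v * s i = v) ->
    v * eproj (T ++ R1 ++ Z ++ a :: R2) * (od (k + size Z) + t *: c (k + size Z) + g) = 0 ->
    v * eproj (T ++ R1 ++ a :: Z ++ R2) * (od k + t *: c k + g') = 0.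
Proof.
move=> k ta; elim/last_ind: Z R2 g => [|Z b IH] R2 g.
  by move=> _ _ _ tg; exists g => [|v _]; move: tg; rewrite addn0.
rewrite all_rcons size_rcons addnS => /andP[fab fZ] sW Wn tg.
rewrite cat_rcons in sW Wn.
have e1 (p q : nat) : T ++ R1 ++ Z ++ [:: p, q & R2] = (T ++ R1 ++ Z) ++ [:: p, q & R2] by rewrite -!catA.
have sz : size (T ++ R1 ++ Z) = (k + size Z)%N by rewrite !size_cat addnA.
rewrite !e1 in sW Wn.
have sW' : std ((T ++ R1 ++ Z) ++ [:: a, b & R2]).
  by move: sW; rewrite !std_cat => /andP[->] /=; apply: std_ext_far; rewrite far_sym.
have Wn' : (size ((T ++ R1 ++ Z) ++ [:: a, b & R2]) <= n)%N by move: Wn; rewrite !size_pair.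
have ni : ((k + size Z).+1 < n)%N by move: Wn; rewrite size_pair sz; lia.
rewrite -e1 in sW' Wn'.
have [g2 tg2 H2] := IH (b :: R2) _ fZ sW' Wn' (tail_far_tail a b t ni tg).
rewrite e1 in sW' Wn'; exists g2 => // v vs; rewrite !cat_rcons => e; apply: H2 => [i i1 i2|]; first by apply: vs => //; lia.
rewrite e1 -sz; apply: (far_annihilator sys) => //; rewrite ?sz -?e1 //.
by apply: vs; lia.
Qed.

Lemma near_annihilator_tail T R1 a b R2 (t : C) : let k := (size T + size R1)%N in
  k2 a = t * t - t -> k2 b = t * t + t -> t != 0 -> ~~ far a b ->
  std (T ++ R1 ++ [:: a, b & R2]) -> (size (T ++ R1 ++ [:: a, b & R2]) <= n)%N ->
  exists2 g, tail k.+1 g & forall v, v * s k = v ->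
    v * eproj (T ++ R1 ++ [:: a, b & R2]) * (od k + t *: c k + g) = 0.
Proof.
move=> k ka kb t0 nf; rewrite catA => sW Wn.
have ni : (k.+1 < n)%N by move: Wn; rewrite size_pair size_cat -/k; lia.
exists (- (od k.+1 + t *: c k.+1)) => [|v vs].
  by apply/tail_opp/tail_add; [apply: tail_od|apply/tail_scale/tail_c].
have := near_annihilator sys sW Wn _ nf t0 ka kb; rewrite size_cat; exact.
Qed.

Lemma k2E a : k2 a = a%:R * a%:R + a%:R.
Proof. by rewrite /k2_def natrM -natr1 mulrDr mulr1. Qed.

Definition neighbour a b (t : C) := (b = a.+1 /\ t = a.+1%:R) \/ (a = b.+1 /\ t = - a%:R).

Lemma neighbourP a b t : neighbour a b t ->
  [/\ k2 a = t * t - t, k2 b = t * t + t, t != 0, ~~ far a b & t = a.+1%:R \/ t = - a%:R].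
Proof.
case=> -[-> ->]; rewrite !k2E ?oppr_eq0 pnatr_eq0 /far; split=> //; try by [rewrite -natr1; ring|left|right].
- by rewrite ltnn ltnNge leqW.
- by rewrite ltnn orbF ltnNge leqW.
Qed.

(** Reorder the strip so that [a] meets [b], take the annihilator of [near_annihilator] there, and
    carry it back to the first letter of the strip past entries far from [a]. *)
Lemma first_annihilator T a b R (t : C) : neighbour a b t -> uniq (a :: R) -> b \in R ->
  std (T ++ a :: R) -> (size (T ++ a :: R) <= n)%N ->
  exists2 R', perm_eq R' R /\ std (T ++ a :: R') &
  exists2 g, tail (size T).+1 g & forall v, strip_inv T (a :: R) v ->
    v * eproj (T ++ a :: R') * (od (size T) + t *: c (size T) + g) = 0.
Proof.
move=> nb uR bR sTR TRn; have [ka kb t0 nf ta] := neighbourP nb.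
have [sT sR] : std T /\ std_ext T (a :: R) by apply/andP; rewrite -std_cat.
have [|Z [Q [pQ fZ sQ]]] := near_first uR _ sR bR.
  by case: nb => -[-> _]; rewrite eqxx ?orbT.
have cl : far_closed T (fun=> True) by [].
have [sZ _] := @bubble_right T _ [::] a Z (b :: Q) cl fZ sQ I.
exists (Z ++ b :: Q); first by split; rewrite // std_cat sT.
have szR : size R = (size Z + (size Q).+1)%N by rewrite -(perm_size pQ) size_cat.
have sZ' : std (T ++ Z ++ [:: a, b & Q]) by rewrite std_cat sT.
have Zn' : (size (T ++ Z ++ [:: a, b & Q]) <= n)%N.
  by move: TRn; rewrite !size_cat /= szR !addnS.
have [g1 tg1 H1] := near_annihilator_tail ka kb t0 nf sZ' Zn'.
have [|g2 tg2 H2] := @annihilator_left T [::] Z a (b :: Q) t g1 ta fZ sZ' Zn'.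
  by rewrite addn0.
rewrite addn0 /= in tg2 H2; exists g2 => // v [h1 _ _].
have h1' i : (size T <= i)%N -> (i <= size T + size Z)%N -> v * s i = v.
  move=> i1 i2; apply: h1 => //; rewrite /= szR !addnS !ltnS addnA.
  exact: leq_trans i2 (leq_addr _ _).
apply: H2 => [i i1 i2|]; first by apply: h1' => //; apply: ltnW.
by apply: H1; apply: h1'; rewrite ?leqnn ?leq_addr.
Qed.
End StripBound.

Notation strip_inv_def := strip_inv (only parsing).

Lemma dim_add_mul (C : numClosedFieldType) (A : falgType C) (U : {vspace A}) (h : A) :
  (forall v, v \in U -> v * h \in U -> v = 0) ->
  \dim (U + right_part U h) = (2 * \dim U)%N.
Proof.
move=> H; have UI : (U :&: right_part U h)%VS = 0%VS.
  apply/eqP; rewrite -subv0; apply/subvP => w; rewrite memv_cap => /andP[wU /right_partP[v vU ew]].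
  by rewrite ew (H v vU) ?mul0r ?mem0v // -ew.
rewrite dimv_disjoint_sum // mul2n -addnn; congr (_ + _)%N.
apply: limg_dim_eq; apply/eqP; rewrite -subv0; apply/subvP => w.
rewrite memv_cap memv_ker lfunE /= => /andP[wU /eqP w0].
by rewrite (H w) ?mem0v // w0 mem0v.
Qed.

Lemma expn_cancel p q e r d D : (2 ^ p * (2 ^ e * d) <= 2 ^ q * D -> r + e = q.+1 ->
  2 ^ p.+1 * d <= 2 ^ r * D)%N.
Proof.
move=> H re; rewrite -(leq_pmul2l (m := 2 ^ e)) ?expn_gt0 // [in leqRHS]mulnA -expnD addnC re.
by rewrite !expnS -!mulnA mulnCA leq_pmul2l // mulnCA.
Qed.

Section StripBound.
Variables (C : numClosedFieldType) (A : falgType C) (n : nat) (c x s : nat -> A).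
Hypothesis sys : sergeev_system n c x s.
Implicit Types (i j k : nat) (y z v f g : A) (T R W Z : seq nat) (a b : nat).
Local Notation X i := (sq x i).
Local Notation k2 := (k2 C).
Local Notation od := (od c x).
Local Notation eproj := (@eproj C A x).
Local Notation shape_proj := (@shape_proj C A x).
Local Notation gen := (@gen C A c s).
Local Notation tail := (@tail C A n c x).
Local Notation strip_inv := (@strip_inv C A x s).

Lemma anticommutator k g (t d : C) : (k < n)%N -> tail k.+1 g ->
  (od k + t *: c k + g) * (od k + d *: c k) + (od k + d *: c k) * (od k + t *: c k + g)
  = X k + X k - (t * d + t * d)%:A.
Proof.
move=> kn tg; have := od_sqr sys kn; have := od_c sys kn; have := sys_cc sys kn.
have := tail_anti sys (ltnSn k) kn (h := c k) _ tg; have := tail_anti sys (ltnSn k) kn (h := od k) _ tg.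
rewrite !inE !eqxx ?orbT => /(_ isT) + /(_ isT).
move: (od k) (c k) (X k) => p q X0 e1 e2 e3 e4 e5.
rewrite !mulrDl !mulrDr -!scalerAl -!scalerAr e1 e2 e4 e3 e5.
rewrite !scalerN !scalerA scalerDl [d * t]mulrC; ncr A.
Qed.

Section Step.
Variables (T R : seq nat) (a : nat) (M : {vspace A}).
Let k := size T.
Let m := (k + size R).+1.
Hypotheses (sTR : std (T ++ a :: R)) (TRn : (size (T ++ a :: R) <= n)%N).
Hypothesis Mgen : forall v y, v \in M -> gen m y -> v * y \in M.

Let eTR : size (T ++ a :: R) = m. Proof. by rewrite size_cat /= addnS. Qed.
Let mn : (m <= n)%N. Proof. by rewrite -eTR. Qed.
Let kn : (k < n)%N. Proof. by apply: leq_trans mn; rewrite /m ltnS leq_addr. Qed.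

(** Spaces obtained from the invariants of the strip by multiplying with odd elements of the letter
    [k]. Invariance is kept only for the later letters, which is what the induction over [R]
    needs. *)
Definition stage (V : {vspace A}) :=
  (V <= M)%VS /\ forall v, v \in V -> strip_inv (rcons T a) R v.

Definition killed (V : {vspace A}) (t : C) := exists R' g,
  [/\ perm_eq R' R, std (T ++ a :: R'), tail k.+1 g
    & forall v, v \in V -> v * eproj (T ++ a :: R') * (od k + t *: c k + g) = 0].

Let key (V : {vspace A}) (t d : C) R' g v : perm_eq R' R -> std (T ++ a :: R') -> tail k.+1 g ->
    v * eproj (T ++ a :: R') * (od k + t *: c k + g) = 0 ->
  v * (od k + d *: c k) * eproj (T ++ a :: R') * (od k + t *: c k + g)
    = (k2 a - t * d + (k2 a - t * d)) *: (v * eproj (T ++ a :: R')).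
Proof.
move=> pR sR tg e0; have szR : (size (T ++ a :: R') <= n)%N.
  by rewrite size_cat /= (perm_size pR) addnS.
have he : (od k + d *: c k) * eproj (T ++ a :: R') = eproj (T ++ a :: R') * (od k + d *: c k).
  by rewrite mulrDl mulrDr -scalerAl -scalerAr (od_eproj sys) // (c_eproj sys).
have Xe : eproj (T ++ a :: R') * X k = k2 a *: eproj (T ++ a :: R').
  rewrite (std_wtr sys) // ?nth_cat ?ltnn ?subnn //.
  by rewrite size_cat /= /k addnS ltnS leq_addr.
have := anticommutator t d kn tg.
move: (od k + t *: c k + g) (od k + d *: c k) (X k) he Xe e0 => f h X0 he Xe e0 eq.
have -> : v * h * eproj (T ++ a :: R') * f = v * eproj (T ++ a :: R') * (f * h + h * f).
  by rewrite mulrDr [_ * (f * h)]mulrA e0 mul0r add0r -[v * h * _]mulrA he !mulrA.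
rewrite eq -[LHS]mulrA mulrBr [_ * (X0 + X0)]mulrDr Xe -scalerAr mulr1 -!scalerDl -scalerBl -scalerAr; congr (_ *: _).
by rewrite opprD addrACA.
Qed.

(** For [h = d_k + d c_k] the anticommutator with the annihilator is the nonzero scalar
    [2 (k2 a - t d)], so [v] and [v * h] cannot both be killed unless [v = 0]: the space meets its
    image under [h] trivially. A second annihilator with [t' d = k2 a] anticommutes with [h] there
    and therefore survives. *)
Lemma stage_double V (t d : C) : stage V -> killed V t -> k2 a - t * d != 0 ->
  exists V', [/\ stage V', \dim V' = (2 * \dim V)%N
    & forall t', k2 a - t' * d = 0 -> killed V t' -> killed V' t'].
Proof.
move=> [VM Vinv] [R1 [g1 [p1 s1 tg1 K1]]] td; pose h := od k + d *: c k.
have gh : gen k.+1 h by apply: gen_add; [apply: (gen_od sys)|apply/gen_scale/gen_c].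
exists (V + right_part V h)%VS; split.
- split=> [|v /memv_addP[v1 V1 [v2 /right_partP[v3 V3 ->] ->]]].
    apply/subvP => v /memv_addP[v1 V1 [v2 /right_partP[v3 V3 ->] ->]].
    apply: memvD; first exact: (subvP VM).
    apply: Mgen; first exact: (subvP VM).
    by apply: gen_le gh; rewrite /m ltnS leq_addr.
  apply: strip_inv_add; first exact: Vinv.
  apply: (strip_inv_mul sys) (Vinv _ V3).
  + by rewrite size_rcons addSn.
  + by apply: gen_le gh; rewrite size_rcons leq_addr.
  + rewrite /h mulrDl mulrDr -scalerAl -scalerAr (od_eproj sys) ?size_rcons //.
    by rewrite (c_eproj sys) ?size_rcons.
  + rewrite size_rcons => i i1 i2; have ni : (i.+1 < n)%N by apply: leq_trans i2 _.
    by rewrite (s_gen sys ni (gen_le i1 gh)).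
- apply: dim_add_mul => v vV vhV.
  have := key V d p1 s1 tg1 (K1 _ vV); rewrite (K1 _ vhV) => /esym/eqP.
  rewrite scaler_eq0 -mulr2n mulrn_eq0 /= (negbTE td) => /eqP e0.
  apply: (strip_inv_zero sys _ _ (strip_inv_perm _ (Vinv v vV)) _).
  + by rewrite cat_rcons; apply: s1.
  + by rewrite cat_rcons size_cat /= (perm_size p1) addnS.
  + by rewrite perm_sym.
  + by rewrite cat_rcons.
- move=> t' td' [R2 [g2 [p2 s2 tg2 K2]]]; exists R2, g2; split=> //.
  move=> v /memv_addP[v1 V1 [v2 /right_partP[v3 V3 ->] ->]].
  by rewrite !mulrDl K2 // add0r (key V) ?K2 // td' addr0 scale0r.
Qed.
End Step.

(** The first content [a] of the strip is peeled off. Each neighbour of [a] among the remaining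
    contents gives an annihilator and so one doubling, and [runs_cons] balances the doublings
    against the number of runs. *)
Theorem strip_bound R : forall T (U M : {vspace A}), std (T ++ R) -> (size (T ++ R) <= n)%N -> uniq R ->
  (U <= M)%VS -> (forall v, v \in U -> strip_inv T R v) ->
  (forall v y, v \in M -> gen (size (T ++ R)) y -> v * y \in M) ->
  (2 ^ size R * \dim U <= 2 ^ runs R * \dim (right_part M (eproj (T ++ R))))%N.
Proof.
elim: R => [|a R IH] T U M sTR TRn uR UM Uinv Mgen.
  rewrite /= cats0 !expn0 !mul1n; apply: dimvS; apply/subvP => v vU.
  by apply/right_partP; exists v; [apply: (subvP UM) | case: (Uinv v vU)].
have eTR : size (T ++ a :: R) = (size T + size R).+1 by rewrite size_cat /= addnS.
rewrite eTR in Mgen; have gTa : gen (size T + size R).+1 (eproj (rcons T a)).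
  by apply: (gen_eproj sys); rewrite ?size_rcons ?ltnS ?leq_addr // -eTR.
pose U1 := right_part U (eproj (rcons T a)).
have dU1 : \dim U1 = \dim U.
  apply: limg_dim_eq; apply/eqP; rewrite -subv0; apply/subvP => w.
  rewrite memv_cap memv_ker lfunE /= => /andP[wU /eqP w0].
  by rewrite (strip_inv_first0 sys sTR TRn (Uinv w wU) w0) mem0v.
have st1 : stage T R a M U1.
  split=> [|v /right_partP[w wU ->]]; last exact: (strip_inv_first sys sTR TRn (Uinv w wU)).
  by apply/subvP => v /right_partP[w wU ->]; apply: Mgen; rewrite ?(subvP UM).
have kil b t : neighbour a b t -> b \in R -> killed T R a U1 t.
  move=> nb bR; have [R' [pR' sR'] [g tg H]] := first_annihilator sys nb uR bR sTR TRn.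
  exists R', g; split=> // v /right_partP[w wU ->].
  have sz' : (size (T ++ a :: R') <= n)%N by rewrite size_cat /= (perm_size pR') addnS -eTR.
  by rewrite -[w * _ * _]mulrA -cat_rcons (eproj_prefix sys) cat_rcons //; apply/H/Uinv.
have fin V e : stage T R a M V -> \dim V = (2 ^ e * \dim U)%N -> (runs (a :: R) + e = (runs R).+1)%N ->
    (2 ^ (size R).+1 * \dim U <= 2 ^ runs (a :: R) * \dim (right_part M (eproj (T ++ a :: R))))%N.
  move=> [VM Vinv] dV re; have := IH (rcons T a) V M.
  have uR' : uniq R by case/andP: uR.
  rewrite cat_rcons eTR => /(_ sTR); rewrite -eTR => /(_ TRn uR' VM Vinv); rewrite eTR => /(_ Mgen).
  by rewrite dV => /expn_cancel; apply.
have := runs_cons uR; have k2E' := k2E C a.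
(* When both neighbours are present, the first doubling takes [d = - (a + 1)]: this is the value
   with [t' d = k2 a] for the parameter [t' = - a] of the lower neighbour, whose annihilator is
   still needed for the second doubling. *)
have dcross1 : k2 a - (- a%:R) * (- a.+1%:R) = 0 by rewrite k2E' -natr1; ring.
have dcross2 : k2 a - a.+1%:R * a%:R = 0 by rewrite k2E' -natr1; ring.
have dplus : k2 a - a.+1%:R * (- a.+1%:R) != 0.
  have -> : k2 a - a.+1%:R * (- a.+1%:R) = (a.+1 * (a + a.+1))%:R :> C.
    by rewrite k2E' natrM natrD -natr1; ring.
  by rewrite pnatr_eq0 muln_eq0 addnS.
have dminus : (0 < a)%N -> k2 a - (- a%:R) * a%:R != 0.
  move=> a0; have -> : k2 a - (- a%:R) * a%:R = (a * (a + a.+1))%:R :> C.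
    by rewrite k2E' natrM natrD -natr1; ring.
  by rewrite pnatr_eq0 muln_eq0 addnS orbF -lt0n.
have nplus : @neighbour C a a.+1 a.+1%:R by left.
have nminus : (0 < a)%N -> neighbour a a.-1 (- a%:R : C) by right; rewrite prednK.
have [aR|_] := boolP (a.+1 \in R).
  have [V [stV dV KV]] := stage_double TRn Mgen st1 (kil _ _ nplus aR) dplus.
  have [/andP[a0 aR']|_] := boolP ((0 < a)%N && _).
    have [V' [stV' dV' _]] := stage_double TRn Mgen stV (KV _ dcross1 (kil _ _ (nminus a0) aR')) (dminus a0).
    by rewrite -addnA => re; apply: (fin V' 2 stV') => //; rewrite dV' dV dU1 mulnA.
  by rewrite addn0 => re; apply: (fin V 1%N stV) => //; rewrite dV dU1.
have [/andP[a0 aR']|_] := boolP ((0 < a)%N && _).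
  have [V' [stV' dV' _]] := stage_double TRn Mgen st1 (kil _ _ (nminus a0) aR') (dminus a0).
  by rewrite addn0 => re; apply: (fin V' 1%N stV') => //; rewrite dV' dU1.
by rewrite !addn0 => re; apply: (fin U1 0%N st1) => //; rewrite ?dU1 ?mul1n ?addn0.
Qed.
End StripBound.

(** * Counting horizontal strips *)

Section RepeatedContent.
Local Open Scope nat_scope.
Implicit Types (T R : seq nat) (a b : nat).

Lemma seq_max R : R != [::] -> exists2 b, b \in R & all (fun d => d <= b) R.
Proof.
elim: R => //= a [|d R] IH _; first by exists a; rewrite ?mem_head //= leqnn.
have [//|b bR ab] := IH; have [ba|ba] := leqP a b.
  by exists b; rewrite ?ba ?ab // inE bR orbT.
exists a; rewrite ?mem_head // leqnn; apply/allP => e eR.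
by apply: leq_trans (ltnW ba); apply: (allP ab).
Qed.

Lemma max_once T R1 b R2 : std_ext T (R1 ++ b :: R2) -> all (fun d => d <= b) (R1 ++ b :: R2) ->
  b \notin R1 -> b \notin R2.
Proof.
move=> sR ab bR1; apply/negP => bR2.
have [R3 [R4 [eR2 _]]] : exists R3 R4, R2 = R3 ++ b :: R4 /\ b \notin R3.
  elim: R2 bR2 {sR ab} => //= d R2 IH; rewrite inE; case: eqVneq => [->|bd] /= h.
    by exists [::], R2.
  by have [R3 [R4 [-> bR3]]] := IH h; exists (d :: R3), R4; rewrite inE negb_or bd.
move: sR; rewrite eR2 -cat_cons std_ext_cat /= => /andP[_ /andP[/andP[_ /eqP h1]]].
rewrite std_ext_cat /= => /andP[_ /andP[/andP[_ /eqP h2] _]].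
have m0 Q : subseq Q (R1 ++ b :: R2) -> mult Q b.+1 = 0.
  move=> sQ; apply/count_memPn/negP => bQ; have := allP ab _ (mem_subseq sQ bQ); by rewrite ltnn.
have m1 : mult R1 b.+1 = 0 by apply: m0; apply: prefix_subseq.
have m3 : mult R3 b.+1 = 0.
  apply: m0; rewrite eR2; apply: subseq_trans (suffix_subseq _ _).
  by apply: subseq_trans (subseq_cons _ _); apply: prefix_subseq.
move: h1 h2; rewrite !(mult_cat, mult_rcons) m1 m3 eqxx (ltn_eqF (ltnSn b)).
lia.
Qed.

Lemma split_first b R : b \in R -> exists R1 R2, R = R1 ++ b :: R2 /\ b \notin R1.
Proof.
elim: R => //= d R IH; rewrite inE; case: eqVneq => [->|bd] /= h; first by exists [::], R.
by have [R3 [R4 [-> bR3]]] := IH h; exists (d :: R3), R4; rewrite inE negb_or bd.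
Qed.

Variant max_split T R : Prop :=
| MaxLast Q b : perm_eq (rcons Q b) R -> std_ext T (rcons Q b) -> ~~ uniq Q -> max_split T R
| MaxFirst Q b : perm_eq (b :: Q) R -> std_ext T (b :: Q) -> ~~ uniq Q -> max_split T R
| MaxMiddle Z a : perm_eq [:: a, a.+1 & rcons Z a] R -> all (far a.+1) Z ->
    std_ext T [:: a, a.+1 & rcons Z a] -> max_split T R.

Lemma repeated_split T R : std_ext T R -> ~~ uniq R -> max_split T R.
Proof.
move=> sR nu; have [//|b bR ab] := @seq_max R _; first by apply: contraNneq nu => ->.
have [R1 [R2 [eR bR1]]] := split_first bR.
move: (sR) (ab); rewrite eR => sR' ab'; have bR2 := max_once sR' ab' bR1.
have nu' : ~~ uniq (R1 ++ R2).
  by move: nu; rewrite eR (_ : R1 ++ b :: R2 = R1 ++ [:: b] ++ R2) // uniq_catCA /= mem_cat negb_or bR1 bR2.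
have cl : far_closed T (fun=> True) by [].
have fP Q : (forall d, d \in Q -> d <= b) -> b \notin Q -> b.-1 \notin Q -> all (far b) Q.
  move=> le nb nb'; apply/allP => d dQ; have := le d dQ.
  have : d != b by apply: contraNneq nb => <-.
  have : d != b.-1 by apply: contraNneq nb' => <-.
  by rewrite /far; clear; case: b => [|b] /=; case: (ltngtP d) => //; lia.
have le1 d : d \in R1 -> d <= b by move=> dR; apply: (allP ab'); rewrite mem_cat dR.
have le2 d : d \in R2 -> d <= b by move=> dR; apply: (allP ab'); rewrite mem_cat inE dR !orbT.
have [b2|b2] := boolP (b.-1 \in R2); last first.
  have := @bubble_right T _ R1 b R2 [::] cl (fP _ le2 bR2 b2); rewrite cats0 => /(_ sR' I)[sQ _].
  rewrite cats1 -rcons_cat in sQ; apply: (MaxLast _ sQ nu').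
  by rewrite -cats1 -catA perm_cat2l cats1 perm_rcons.
have [b1|b1] := boolP (b.-1 \in R1); last first.
  have [sQ _] := @bubble_left T _ [::] b R1 R2 cl (fP _ le1 bR1 b1) sR' I.
  by apply: (MaxFirst _ sQ nu'); rewrite -cat1s perm_catCA.
case: R1 b1 eR bR1 sR' nu' le1 {ab'} => // d R1 b1 eR bR1 sR' nu' le1.
have [b1'|b1'] := boolP (b.-1 \in R1).
  apply: (@MaxFirst _ _ (R1 ++ b :: R2) d); rewrite ?eR //.
  rewrite (_ : R1 ++ b :: R2 = R1 ++ [:: b] ++ R2) // uniq_catCA /= negb_and; apply/orP; right.
  by rewrite cat_uniq !negb_and negbK (_ : has _ _) ?orbT //; apply/hasP; exists b.-1.
have ed : d = b.-1 by move: b1; rewrite inE (negbTE b1') orbF => /eqP.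
case/lastP: R2 b2 eR bR2 sR' nu' le2 => // R2 e b2 eR bR2 sR' nu' le2.
have [b2'|b2'] := boolP (b.-1 \in R2).
  apply: (@MaxLast _ _ ((d :: R1) ++ b :: R2) e); rewrite ?rcons_cat //.
  by rewrite /= negb_and negbK mem_cat inE ed b2' !orbT.
have ee : e = b.-1 by move: b2; rewrite mem_rcons inE (negbTE b2') orbF => /eqP.
have b0 : 0 < b by move: bR1; rewrite inE ed; case: (b).
have f1 : all (far b) R1.
  by apply: fP => //; [move=> f fR; apply: le1; rewrite inE fR orbT|move: bR1; rewrite inE negb_or => /andP[]].
have f2 : all (far b) R2.
  by apply: fP => //; [move=> f fR; apply: le2; rewrite mem_rcons inE fR orbT|move: bR2; rewrite mem_rcons inE negb_or => /andP[]].
have [sQ _] := @bubble_left T _ [:: d] b R1 (rcons R2 e) cl f1 sR' I.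
apply: (@MaxMiddle _ _ (R1 ++ R2) b.-1); rewrite prednK //.
- rewrite ed ee rcons_cat /= perm_cons (_ : b :: rcons R2 _ = [:: b] ++ rcons R2 b.-1) //.
  by rewrite perm_sym perm_catCA.
- by rewrite all_cat f1 f2.
- by move: sQ; rewrite ed ee /= rcons_cat.
Qed.
End RepeatedContent.

Section StripZero.
Variables (C : numClosedFieldType) (A : falgType C) (n : nat) (c x s : nat -> A).
Hypothesis sys : sergeev_system n c x s.
Implicit Types (i j k : nat) (y z v f g : A) (T R W Z : seq nat) (a b : nat).
Local Notation k2 := (k2 C).
Local Notation od := (od c x).
Local Notation eproj := (@eproj C A x).
Local Notation tail := (@tail C A n c x).
Local Notation strip_inv := (@strip_inv C A x s).

(* The box of content [a + 1] is next to both boxes of content [a]; the two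
   resulting annihilators have a nonzero scalar anticommutator. *)
Lemma strip_zero_middle T a Z v : let R := [:: a, a.+1 & rcons Z a] in
  std (T ++ R) -> (size (T ++ R) <= n)%N -> all (far a.+1) Z -> strip_inv T R v -> v = 0.
Proof.
move=> R sTR TRn fZ vi; have [h1 _ _] := vi; pose k := size T.
have szR : size R = (size Z).+3 by rewrite /= size_rcons.
have kn : (k + (size Z).+3 <= n)%N by rewrite -szR -size_cat.
have vs i : (k <= i)%N -> (i <= k + (size Z).+1)%N -> v * s i = v.
  by move=> i1 i2; apply: h1 => //; rewrite szR addnS ltnS addnS.
have nA : @neighbour C a a.+1 a.+1%:R by left.
have nB : @neighbour C a.+1 a (- a.+1%:R) by right.
have [ka ka1 t0 nf _] := neighbourP nA; have [kb kb1 t0' nf' tb] := neighbourP nB.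
have fA : v * eproj (T ++ R) * (od k + a.+1%:R *: c k - (od k.+1 + a.+1%:R *: c k.+1)) = 0.
  by apply: (near_annihilator sys sTR TRn) => //; apply: vs; rewrite ?leq_addr.
have sT : std T /\ std_ext T R by apply/andP; rewrite -std_cat.
have sB : std (T ++ (a :: Z) ++ [:: a.+1; a]).
  have [sT1 sT2] := sT; rewrite std_cat sT1.
  have cl : far_closed T (fun=> True) by [].
  have := @bubble_right T _ [:: a] a.+1 Z [:: a] cl fZ; rewrite /= cats1 => /(_ sT2 I)[+ _].
  by rewrite /= => ->.
have nB' : (size (T ++ (a :: Z) ++ [:: a.+1; a]) <= n)%N by rewrite size_cat /= size_cat /= addn2.
have [gB tgB HB] := near_annihilator_tail sys kb kb1 t0' nf' sB nB'.
have [] := @annihilator_left _ _ _ _ _ _ sys T [:: a] Z a.+1 [:: a] _ gB tb fZ sB nB'.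
  by move: tgB; rewrite /= addn1 addnS.
move=> g tg /(_ v) Hg.
have fB : v * eproj (T ++ R) * (od k.+1 - a.+1%:R *: c k.+1 + g) = 0.
  move: Hg; rewrite /= addn1 cats1 !scaleNr; apply.
    by move=> i i1 i2; apply: vs; [apply: ltnW | rewrite addnS -addSn; apply: ltnW].
  rewrite addSn -addnS -scaleNr; apply: HB.
  by apply: vs; rewrite ?leq_addr //= addnS.
rewrite /= addn1 in tg; apply: (strip_inv_zero sys sTR TRn vi).
have k1n : (k.+1 < n)%N by apply: leq_trans kn; rewrite !addnS !ltnS leqW // leq_addr.
have := anticommutator sys (- a.+1%:R) (a.+1%:R) k1n tg; rewrite scaleNr.
have k0n : (k < n)%N by apply: ltnW.
have Xy : v * eproj (T ++ R) * sq x k.+1 = k2 a.+1 *: (v * eproj (T ++ R)).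
  rewrite -mulrA (std_wtr sys) // -?scalerAr; last by rewrite size_cat szR !addnS !ltnS leqW // leq_addr.
  by rewrite nth_cat ltnNge leqnSn /= subSnn.
have tA : tail k.+1 (od k.+1 - a.+1%:R *: c k.+1 + g).
  by apply: tail_add; [apply: tail_add; [apply: tail_od|rewrite -scaleNr; apply/tail_scale/tail_c]|apply: tail_le tg].
have eA h : h \in [:: c k; od k] -> h * (od k.+1 - a.+1%:R *: c k.+1 + g) = - ((od k.+1 - a.+1%:R *: c k.+1 + g) * h).
  by move=> hk; apply: (tail_anti sys (ltnSn k) k0n hk tA).
have := eA (c k); have := eA (od k); rewrite !inE !eqxx orbT => /(_ isT) + /(_ isT).
move: fA fB; move: (od k.+1 - a.+1%:R *: c k.+1 + g) (od k) (c k) => f p q.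
move: (od k.+1 + a.+1%:R *: c k.+1) (v * eproj (T ++ R)) Xy => L y Xy fA fB pf qf eL.
have : y * (f * L + L * f) = 0.
  have eP : (p + a.+1%:R *: q) * f = - (f * (p + a.+1%:R *: q)).
    by rewrite mulrDl mulrDr pf -scalerAl qf -scalerAr scalerN opprD.
  move: (p + _ *: q) fA eP => P fA eP.
  have yL : y * L = y * P by apply/esym/eqP; rewrite -subr_eq0 -mulrBr fA.
  by rewrite mulrDr !mulrA fB mul0r add0r yL -mulrA eP mulrN mulrA fB mul0r oppr0.
rewrite eL mulrBr mulrDr Xy -scalerAr mulr1 -scalerDl -scalerBl => /eqP; rewrite scaler_eq0 => /orP[|/eqP //].
rewrite ka1 !mulNr opprD !opprK (_ : _ + _ = (a.+1 * (a.+1 * 4 + 2))%:R); last by rewrite natrM natrD natrM; ring.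
by rewrite pnatr_eq0 muln_eq0 addn_eq0 andbF.
Qed.

Theorem strip_zero R : forall T v, std (T ++ R) -> (size (T ++ R) <= n)%N -> ~~ uniq R ->
  strip_inv T R v -> v = 0.
Proof.
have [m] := ubnP (size R); elim: m R => // m IH R szR T v sTR TRn nu vi.
have [sT sR] : std T /\ std_ext T R by apply/andP; rewrite -std_cat.
have tr R' : perm_eq R' R -> std_ext T R' -> [/\ std (T ++ R'), (size (T ++ R') <= n)%N & strip_inv T R' v].
  move=> pR sR'; split; first by rewrite std_cat sT.
    by rewrite size_cat (perm_size pR) -size_cat.
  by apply: strip_inv_perm vi; rewrite perm_sym.
case: (repeated_split sR nu) => [Q b pQ /(tr _ pQ)[s1 s2 s3] nuQ|Q b pQ /(tr _ pQ)[s1 s2 s3] nuQ|Z a pZ fZ /(tr _ pZ)[s1 s2 s3]].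
- apply: (strip_inv_last0 sys s1 s2 s3); apply: (IH Q _ T) (strip_inv_last sys s1 s2 s3) => //.
  + by move: szR; rewrite -(perm_size pQ) size_rcons.
  + by move: s1; rewrite -rcons_cat std_rcons => /andP[].
  + by apply: leq_trans s2; rewrite -rcons_cat size_rcons.
- apply: (strip_inv_first0 sys s1 s2 s3); apply: (IH Q _ (rcons T b)) (strip_inv_first sys s1 s2 s3) => //.
  + by move: szR; rewrite -(perm_size pQ).
  + by rewrite cat_rcons.
  + by rewrite cat_rcons.
- exact: (strip_zero_middle s1 s2 fZ s3).
Qed.
End StripZero.

Section Branching.
Local Open Scope nat_scope.

Section Branching.
Implicit Types (T R c k S : seq nat) (a b s t : nat).

Definition strip_part c k := [seq s <- undup c | mult k s < mult c s].

(** The coefficient of the skew polynomial [Q_(c/k)] in a single variable: the strip must have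
    distinct contents, and each of its connected components has one box whose mark is free. *)
Definition branch c k : nat :=
  if perm_eq c (k ++ strip_part c k) then 2 ^ runs (strip_part c k) else 0.

Lemma eq_runs R R' : perm_eq R R' -> runs R = runs R'.
Proof.
move=> p; rewrite /runs (seq.permP p); apply: eq_count => a.
by rewrite (perm_mem p).
Qed.

Lemma mem_mult T s : (s \in T) = (0 < mult T s). Proof. by rewrite mult_gt0. Qed.

Lemma strip_part_uniq c k : uniq (strip_part c k).
Proof. by rewrite filter_uniq ?undup_uniq. Qed.

Lemma strip_part_perm c k R : uniq R -> perm_eq c (k ++ R) -> perm_eq (strip_part c k) R.
Proof.
move=> uR p; apply: uniq_perm => //; first exact: strip_part_uniq.
move=> s; rewrite mem_filter mem_undup (perm_mem p) mem_cat (eq_mult p) mult_cat.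
by rewrite !mem_mult; clear; lia.
Qed.

Lemma branchE c k R : uniq R -> perm_eq c (k ++ R) -> branch c k = 2 ^ runs R.
Proof.
move=> uR p; have pR := strip_part_perm uR p; rewrite /branch (eq_runs pR).
by rewrite (perm_trans p) // perm_cat2l perm_sym.
Qed.

Lemma branch0 c k : (forall R, uniq R -> perm_eq c (k ++ R) -> False) -> branch c k = 0.
Proof.
rewrite /branch => H; case: ifP => // p; by case: (H _ (strip_part_uniq c k) p).
Qed.

Lemma branch_dec c k : (exists2 R, uniq R & perm_eq c (k ++ R)) \/ (forall R, uniq R -> perm_eq c (k ++ R) -> False).
Proof.
have [p|np] := boolP (perm_eq c (k ++ strip_part c k)).
  by left; exists (strip_part c k); rewrite ?strip_part_uniq.
right=> R uR p; case/negP: np; apply: perm_trans (p) _.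
by rewrite perm_cat2l perm_sym; apply: strip_part_perm.
Qed.

Lemma eq_branch c c' k k' : perm_eq c c' -> perm_eq k k' -> branch c k = branch c' k'.
Proof.
move=> pc pk; case: (branch_dec c k) => [[R uR p]|H].
  rewrite (branchE uR p) (@branchE c' k' R) //.
  by rewrite -(permPl pc) (perm_trans p) // perm_cat2r.
rewrite !branch0 // => R uR p; apply: (H R uR); rewrite (permPl pc) (perm_trans p) //.
by rewrite perm_cat2r perm_sym.
Qed.

Lemma branch_size c k : branch c k != 0 -> size k <= size c.
Proof.
case: (branch_dec c k) => [[R uR p]|H]; last by rewrite branch0.
by rewrite (perm_size p) size_cat leq_addr.
Qed.

(** The coefficient in [Q_1 Q_lambda] of the polynomial with one more box of content [s]: 1 if the
    box opens a new row, 2 otherwise. *)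
Definition content_weight s := if s == 0 then 1 else 2.

Lemma runs_weight R s : s \notin R -> uniq R ->
  content_weight s * 2 ^ runs (s :: R) * 2 ^ (s.+1 \in R) * 2 ^ ((0 < s) && (s.-1 \in R))
    = 2 * content_weight s * 2 ^ runs R.
Proof.
move=> sR uR; have := @runs_cons s R; rewrite /= sR uR => /(_ isT) e.
by rewrite -!mulnA -!expnD addnA e expnS mulnCA mulnA.
Qed.

Section Local.
Variables (c k : seq nat) (L : nat).
Hypotheses (sc : std c) (sk : std k) (cL : size c < L) (kL : size k < L).

Let drop1 T s := mult T s - mult T s.+1.

(** A telescoping sum over the diagonals below [l]. The second term is the balance carried past
    them: 2 at the start, and 0 beyond the last diagonal of [c]. *)
Let int_sum (R : seq nat) : uniq R -> perm_eq c (k ++ R) -> forall l,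
  \sum_(s < l) ((s : nat) \notin R) * addable c s * content_weight s * 2 ^ runs ((s : nat) :: R)
    + (if l is l'.+1 then if (l' \in R) || (l \in R) then 2 else 4 * drop1 c l' else 2) * 2 ^ runs R
  = 2 * 2 ^ runs R
    + \sum_(s < l) ((s : nat) \notin R) * removable k s * content_weight s * 2 ^ runs ((s : nat) :: R).
Proof.
move=> uR p; have mc s : mult c s = mult k s + (s \in R) by rewrite (eq_mult p) mult_cat -(count_uniq_mem _ uR).
elim=> [|l IH]; first by rewrite !big_ord0 add0n addn0.
rewrite !big_ord_recr /=; have [lR|lR] := boolP (l \in R).
  by move: IH; rewrite /= !mul0n !addn0; case: l lR => [|l] lR; rewrite ?lR ?orbT.
rewrite !mul1n.
have := runs_weight lR uR; have := std_count l sc; have := std_count l sk.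
have := std_count l.-1 sc; have := std_count l.-1 sk.
move: IH; rewrite /addable /removable /drop1 !mc (negbTE lR).
move: (2 ^ runs (l :: R)) (2 ^ runs R) => p1 p0.
move: (\sum_(s < l) _) (\sum_(s < l) _) => S1 S2.
case: (l.+1 \in R); case: l lR => [|l] lR /=; rewrite ?mc ?(negbTE lR).
all: rewrite ?andbF ?addn0 ?addn1 /content_weight /= ?expn0 ?expn1 ?muln1.
all: try case: (l \in R); rewrite ?addn0 ?addn1 /= ?expn0 ?expn1 ?muln1.
all: repeat match goal with |- context [mult k ?z] => move: (mult k z) => ? end.
all: repeat match goal with |- context [nat_of_bool (?z \in ?Q)] => move: (z \in Q) => [] /= end.
all: move=> + h1 h2 h3 h4 h5.
all: repeat match goal with |- context [?y - ?z] =>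
  let e := fresh in have [e|e] : y - z = 0 \/ y - z = 1; [lia|rewrite e|rewrite e] end.
all: try by repeat match goal with |- context [nat_of_bool ?b] => case: (boolP b) => ? /= end; lia.
Qed.

Let branch_rem s : s \in k -> branch (rcons c s) k = branch c (rem s k).
Proof.
move=> sk'; have pk := perm_to_rem sk'.
have e R : perm_eq (rcons c s) (k ++ R) = perm_eq c (rem s k ++ R).
  have pk' : perm_eq (k ++ R) (s :: (rem s k ++ R)) by rewrite -cat_cons perm_cat2r.
  by rewrite perm_rcons (permPr pk') perm_cons.
case: (branch_dec c (rem s k)) => [[R uR p]|H]; first by rewrite (branchE uR p) (branchE uR) ?e.
by rewrite !branch0 // => R uR p; apply: (H R uR); rewrite -e.
Qed.

(** Expand [Q_1 Q_c] with one variable [y] set apart and compare the coefficients of [Q_k] in the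
    other variables: [Q_1] splits into [2 y], giving the first term, and the [Q_1] of the other
    variables, giving the second. *)
Lemma local_pieri : \sum_(s < L | addable c s) content_weight s * branch (rcons c s) k
  = 2 * branch c k + \sum_(s < L | removable k s) content_weight s * branch c (rem (s : nat) k).
Proof.
have remk s : removable k s -> s \in k by case/andP; rewrite -mult_gt0; lia.
rewrite big_mkcond [X in _ = _ + X]big_mkcond /=.
case: (branch_dec c k) => [[R uR p]|H].
  have bc s : branch (rcons c s) k = (s \notin R) * 2 ^ runs (s :: R).
    have [sR|sR] := boolP (s \in R).
      rewrite mul0n branch0 // => R' uR' p'; have : perm_eq (s :: R) R'.
        rewrite -(perm_cat2l k) -(permPr p') perm_sym perm_rcons perm_sym.
        by rewrite -cat1s perm_catCA perm_cons perm_sym.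
      by move/perm_uniq; rewrite uR' /= sR.
    rewrite mul1n; apply: branchE; first by rewrite /= sR.
    by rewrite perm_rcons perm_sym -cat1s perm_catCA perm_cons perm_sym.
  have sR s : size c <= s -> s \notin c by move=> h; apply: contraTN h => /(std_lt_size sc); rewrite ltnNge.
  have Rc s : s \in R -> s \in c by rewrite (perm_mem p) mem_cat orbC => ->.
  have := int_sum uR p L; rewrite (branchE uR p); case: L cL kL => // L' cL' kL' /=.
  have -> : (L' \in R) || (L'.+1 \in R) = false.
    apply/negbTE; rewrite negb_or; apply/andP; split; apply/negP => /Rc; apply/negP/sR => //.
    exact: leqW.
  have -> : drop1 c L' = 0 by rewrite /drop1; move/sR: cL'; rewrite -mult_gt0 -eqn0Ngt => /eqP ->.
  rewrite muln0 mul0n addn0 => e; transitivity (\sum_(s < L'.+1) ((s : nat) \notin R) * addable c s * content_weight s * 2 ^ runs ((s : nat) :: R)).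
    by apply: eq_bigr => s _; rewrite bc; case: addable; rewrite ?muln0 ?mul0n ?muln1 // mulnCA mulnA.
  rewrite e; congr (_ + _); apply: eq_bigr => s _.
  case: ifP => [rs|_]; last by rewrite muln0 !mul0n.
  by rewrite -branch_rem ?remk // bc muln1 mulnCA mulnA.
rewrite (branch0 H) muln0 add0n; apply: eq_bigr => -[s /= sL] _.
case: (branch_dec (rcons c s) k) => [[R0 uR0 p0]|H0]; last first.
  rewrite (branch0 H0) muln0 if_same; case: ifP => // /remk sk'.
  by rewrite -branch_rem // branch0 ?muln0.
have sR0 : s \notin R0.
  apply/negP => sR0; apply: (H (rem s R0)); first exact: rem_uniq.
  rewrite -(perm_cons s) -(perm_rcons s c) (permPl p0) -cat1s perm_sym perm_catCA perm_cat2l.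
  by rewrite perm_sym perm_to_rem.
have sk' : s \in k.
  by have := perm_mem p0 s; rewrite mem_rcons mem_head mem_cat (negbTE sR0) orbF => <-.
rewrite branch_rem //.
have m0 t : mult c t + (s == t :> nat) = mult k t + (t \in R0).
  by have := eq_mult p0 t; rewrite mult_rcons mult_cat (count_uniq_mem t uR0 : mult R0 t = _).
have [-> ->] // : addable c s /\ removable k s.
have := m0 s; have := m0 s.-1; have := m0 s.+1; rewrite eqxx (negbTE sR0) (ltn_eqF (ltnSn s)).
have := std_count s sc; have := std_count s sk; have := std_count s.-1 sc; have := std_count s.-1 sk.
have : 0 < mult k s by rewrite mult_gt0.
rewrite /addable /removable; case: s {sL p0 sR0 sk' m0} => [|s] /=; first by move: (0 \in R0) (1 \in R0) => [] []; lia.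
by rewrite (gtn_eqF (ltnSn s)); move: (s \in R0) (s.+2 \in R0) => [] []; lia.
Qed.
End Local.
End Branching.
End Branching.

(** * Pieri rule and total counts *)

Section Pieri.
Local Open Scope nat_scope.

Lemma mulsumr I (r : seq I) (P : pred I) a (F : I -> nat) :
  a * (\sum_(i <- r | P i) F i) = \sum_(i <- r | P i) a * F i.
Proof. exact: big_distrr. Qed.

Lemma mulsuml I (r : seq I) (P : pred I) a (F : I -> nat) :
  (\sum_(i <- r | P i) F i) * a = \sum_(i <- r | P i) F i * a.
Proof. exact: big_distrl. Qed.

Section Shapes.
Variable n : nat.
Implicit Types (T R c k S : seq nat) (a b s t : nat).

(** One chosen filling per shape, so that a sum over shapes is a sum over the list [shapes]. *)
Definition shape_rep T := head [::] [seq R <- stds (size T) | perm_eq R T].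
Definition all_std := flatten [seq stds i | i <- iota 0 n.+1].
Definition shapes := undup [seq shape_rep T | T <- all_std].

Lemma shape_repP T : std T -> std (shape_rep T) /\ perm_eq (shape_rep T) T.
Proof.
move=> sT; have : T \in [seq R <- stds (size T) | perm_eq R T].
  by rewrite mem_filter perm_refl mem_stds sT eqxx.
have : forall R, R \in [seq R <- stds (size T) | perm_eq R T] -> std R /\ perm_eq R T.
  by move=> R; rewrite mem_filter mem_stds => /and3P[].
rewrite /shape_rep; case: [seq R <- _ | _] => //= R Q H _; apply: H; exact: mem_head.
Qed.

Lemma eq_shape_rep T R : perm_eq T R -> shape_rep T = shape_rep R.
Proof.
by move=> p; rewrite /shape_rep (perm_size p); congr head; apply: eq_filter => S; rewrite (permPr p).
Qed.

Lemma mem_all_std T : (T \in all_std) = std T && (size T <= n).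
Proof.
apply/flatten_mapP/andP => [[j + +] | [sT Tn]].
  by rewrite mem_iota mem_stds add0n ltnS => ni /andP[-> /eqP ->].
by exists (size T); rewrite ?mem_iota ?mem_stds ?sT ?eqxx.
Qed.

Lemma shapesP S : S \in shapes -> [/\ std S, size S <= n & shape_rep S = S].
Proof.
rewrite mem_undup => /mapP[T]; rewrite mem_all_std => /andP[sT Tn] ->.
have [sR pR] := shape_repP sT; split=> //; first by rewrite (perm_size pR).
exact: eq_shape_rep.
Qed.

Lemma mem_shape_rep T : std T -> size T <= n -> shape_rep T \in shapes.
Proof. by move=> sT Tn; rewrite mem_undup map_f // mem_all_std sT. Qed.

Lemma big_shape (V : nmodType) (F : seq nat -> V) T : std T -> size T <= n ->
  (\sum_(S <- shapes | perm_eq S T) F S = F (shape_rep T))%R.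
Proof.
move=> sT Tn; have [sR pR] := shape_repP sT.
rewrite big_mkcond /= (bigD1_seq (shape_rep T)) ?undup_uniq ?mem_shape_rep //= pR.
rewrite big_seq_cond big1 ?addr0 // => S /andP[/shapesP[_ _ e] ne].
case: ifP => // p; case/eqP: ne; rewrite -e; exact: eq_shape_rep.
Qed.

Lemma big_shape_nat (F : seq nat -> nat) T : std T -> size T <= n ->
  \sum_(S <- shapes | perm_eq S T) F S = F (shape_rep T).
Proof. exact: big_shape. Qed.

(** The value at [j] ones of the Schur polynomial [Q] of the shape of [c], obtained by removing one
    variable at a time. *)
Fixpoint strip_count j c : nat :=
  if j is j'.+1 then \sum_(k <- shapes) branch c k * strip_count j' k else nat_of_bool (nilp c).

Lemma eq_strip_count j c c' : perm_eq c c' -> strip_count j c = strip_count j c'.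
Proof.
case: j => [|j] p /=; first by rewrite /nilp (perm_size p).
by apply: eq_bigr => k _; rewrite (eq_branch p (perm_refl k)).
Qed.

Lemma sum_adds (F : nat -> nat) c : std c -> size c <= n ->
  \sum_(s <- adds c) F s = \sum_(s < n.+1 | addable c s) F s.
Proof.
move=> sc cn; rewrite -(big_mkord (addable c) F) -[RHS]big_filter; apply: perm_big.
apply: uniq_perm; rewrite ?adds_uniq ?filter_uniq ?iota_uniq // => s.
rewrite mem_adds // mem_filter mem_index_iota /= ltnS; case: (boolP (addable c s)) => //= h.
by rewrite (leq_trans (addable_le_size sc h)).
Qed.

Lemma eq_removable T R s : perm_eq T R -> removable T s = removable R s.
Proof. by move=> p; rewrite /removable !(eq_mult p). Qed.

Lemma sum_parents c k s : std k -> size k <= n ->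
  \sum_(h <- shapes | addable h s && perm_eq k (rcons h s)) branch c h
    = removable k s * branch c (rem s k).
Proof.
move=> sk kn; have [rs|nrs] := boolP (removable k s).
  have [W sW pW] := removable_perm sk rs.
  move: (sW); rewrite std_rcons => /andP[sW' aW].
  have Wn : size W <= n by move: kn; rewrite -(perm_size pW) size_rcons; apply: ltnW.
  have sk' : s \in k by case/andP: rs; rewrite -mult_gt0; lia.
  have pW' : perm_eq W (rem s k).
    by rewrite -(perm_cons s) -(perm_rcons s W) (permPl pW) perm_to_rem.
  rewrite mul1n -(eq_branch (perm_refl c) pW') -(eq_branch (perm_refl c) (shape_repP sW').2).
  rewrite -(big_shape_nat (branch c) sW' Wn); apply: eq_bigl => h.
  rewrite -(permPl pW) perm_rcons perm_sym perm_rcons perm_cons andbC.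
  by case: (boolP (perm_eq h W)) => //= p; rewrite (eq_addable _ p).
rewrite mul0n big_seq_cond big1 // => h /and3P[/shapesP[sh _ _] ah p].
have sr : std (rcons h s) by rewrite std_rcons sh.
by case/negP: nrs; rewrite (eq_removable _ p) last_removable.
Qed.

(** The expansion of [Q_1 Q_c] evaluated at [j] ones, where [Q_1] has the value [2 j]. Each variable
    contributes the first term of [local_pieri]. *)
Theorem pieri j c : std c -> size c < n ->
  \sum_(s <- adds c) content_weight s * strip_count j (rcons c s) = 2 * j * strip_count j c.
Proof.
elim: j c => [|j IH] c sc cn /=.
  by rewrite muln0 mul0n big1 // => s _; rewrite /nilp size_rcons muln0.
rewrite (sum_adds _ sc (ltnW cn)).
pose q := strip_count j.
transitivity (\sum_(s < n.+1 | addable c s) \sum_(k <- shapes) content_weight s * (branch (rcons c s) k * q k)).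
  by apply: eq_bigr => s _; apply: mulsumr.
rewrite exchange_big /=.
transitivity (\sum_(k <- shapes) (2 * (branch c k * q k)
    + \sum_(s < n.+1) content_weight s * (removable k s * branch c (rem (s : nat) k) * q k))).
  rewrite [LHS]big_seq [RHS]big_seq; apply: eq_bigr => k /shapesP[sk kn _].
  transitivity ((\sum_(s < n.+1 | addable c s) content_weight s * branch (rcons c s) k) * q k).
    by rewrite mulsuml; apply: eq_bigr => s _; rewrite mulnA.
  rewrite local_pieri ?ltnS ?(ltnW cn) // mulnDl mulnA mulsuml; congr (_ + _).
  rewrite big_mkcond; apply: eq_bigr => s _.
  by case: removable; rewrite ?mul1n ?mul0n ?muln0 ?mulnA.
rewrite big_split /= -mulsumr -[2 * j.+1 * _]mulnA mulSn mulnDr; congr (_ + _).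
transitivity (\sum_(h <- shapes) branch c h * (2 * j * q h)); last first.
  by rewrite mulnA mulsumr; apply: eq_bigr => h _; rewrite mulnCA.
transitivity (\sum_(h <- shapes) \sum_(s < n.+1) \sum_(k <- shapes)
    (addable h s && perm_eq k (rcons h s)) * (content_weight s * branch c h * q k)); last first.
  rewrite [LHS]big_seq [RHS]big_seq; apply: eq_bigr => h /shapesP[sh hn _].
  have [b0|bn] := eqVneq (branch c h) 0.
    by rewrite b0 mul0n big1 // => s _; rewrite big1 // => k _; rewrite muln0 mul0n muln0.
  have hn' : size h < n by apply: leq_ltn_trans cn; apply: branch_size.
  rewrite /q -IH // (sum_adds _ sh hn) mulsumr [RHS]big_mkcond; apply: eq_bigr => s _.
  case: (boolP (addable h s)) => [ah|nah] /=; last by rewrite big1 // => k _; rewrite mul0n.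
  have sr : std (rcons h s) by rewrite std_rcons sh.
  rewrite -(eq_strip_count _ (shape_repP sr).2) -[strip_count j _](big_shape_nat (strip_count j) sr) ?size_rcons //.
  rewrite !mulsumr [RHS]big_mkcond; apply: eq_bigr => k _.
  by case: perm_eq; rewrite ?mul0n ?mul1n // mulnCA mulnA.
rewrite [LHS]exchange_big [RHS]exchange_big /=; apply: eq_bigr => s _.
rewrite [RHS]exchange_big /= [LHS]big_seq [RHS]big_seq; apply: eq_bigr => k /shapesP[sk kn _].
rewrite -(sum_parents c s sk kn) mulsuml mulsumr big_mkcond; apply: eq_bigr => h _.
by case: (_ && _); rewrite ?mul0n ?mul1n // mulnA.
Qed.

Lemma strip_count_nil j : strip_count j [::] = 1.
Proof.
elim: j => //= j IH.
have sn : std [::] by []. have := big_shape_nat (fun k => branch [::] k * strip_count j k) sn (leq0n n).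
have pr := (shape_repP sn).2; rewrite (eq_strip_count _ pr) IH muln1.
have pr' : perm_eq [::] (shape_rep [::] ++ [::]) by rewrite cats0 perm_sym.
rewrite (branchE _ pr') //= expn0 => <-; rewrite [RHS]big_mkcond; apply: eq_bigr => k _.
case: ifP => // np; rewrite branch0 ?mul0n // => R _ /perm_size; rewrite size_cat => /esym/eqP.
by rewrite addn_eq0 size_eq0 => /andP[/eqP k0 _]; rewrite k0 in np.
Qed.

Definition path_weight T := \prod_(a <- T) content_weight a.

(** This is [Q_1 ^ m] at [j] ones, expanded along the growing sequences of shapes. *)
Lemma sum_strip_count j m : m <= n ->
  \sum_(T <- stds m) path_weight T * strip_count j T = (2 * j) ^ m.
Proof.
elim: m => [|m IH] mn /=; first by rewrite big_seq1 /path_weight big_nil mul1n strip_count_nil.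
rewrite big_allpairs_dep /= expnS -IH ?(ltnW mn) // mulsumr [LHS]big_seq [RHS]big_seq.
apply: eq_bigr => T; rewrite mem_stds => /andP[sT /eqP szT].
rewrite mulnCA -pieri ?szT // mulsumr; apply: eq_bigr => a _.
by rewrite /path_weight big_rcons /= mulnA [_ * content_weight a]mulnC.
Qed.

(** The coefficient of a monomial in the Schur polynomial [Q] of the shape of [c]; the head of [mu]
    is the exponent of the last variable. *)
Fixpoint kostka c (mu : seq nat) : nat :=
  if mu is m :: mu' then \sum_(k <- shapes | size c == size k + m) branch c k * kostka k mu'
  else nilp c.

Lemma eq_kostka mu c c' : perm_eq c c' -> kostka c mu = kostka c' mu.
Proof.
case: mu => [|m mu] p /=; first by rewrite /nilp (perm_size p).
by rewrite (perm_size p); apply: eq_bigr => k _; rewrite (eq_branch p (perm_refl k)).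
Qed.

Fixpoint compositions j : seq (seq nat) :=
  if j is j'.+1 then [seq a :: mu | a <- iota 0 n.+1, mu <- compositions j'] else [:: [::]].

Lemma compositionsS j : compositions j.+1
  = [seq a :: mu | a <- iota 0 n.+1, mu <- compositions j].
Proof. by []. Qed.

Lemma mem_compositions j mu : (mu \in compositions j) = (size mu == j) && all (fun a => a <= n) mu.
Proof.
elim: j mu => [|j IH] mu; first by rewrite inE; case: mu.
rewrite compositionsS.
apply/allpairsPdep/idP => [[a [nu [+ + ->]]]|].
  by rewrite mem_iota IH ltnS => /= -> /andP[/eqP -> ->]; rewrite eqxx.
case: mu => // a mu; rewrite [size _]/= [all _ _]/= eqSS => /and3P[sz an al].
by exists a, mu; rewrite mem_iota IH sz al /= ltnS.
Qed.

Lemma sum_kostka j c : size c <= n -> \sum_(mu <- compositions j) kostka c mu = strip_count j c.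
Proof.
elim: j c => [|j IH] c cn; first by rewrite /= big_seq1.
rewrite compositionsS big_allpairs_dep [strip_count _ _]/=.
transitivity (\sum_(k <- shapes) \sum_(a <- iota 0 n.+1) \sum_(mu <- compositions j)
    (size c == size k + a :> nat) * (branch c k * kostka k mu)).
  rewrite [RHS]exchange_big; apply: eq_bigr => a _; rewrite [RHS]exchange_big; apply: eq_bigr => mu _.
  by rewrite [LHS]big_mkcond; apply: eq_bigr => k _; case: eqP; rewrite ?mul1n.
rewrite [LHS]big_seq [RHS]big_seq; apply: eq_bigr => k /shapesP[sk kn _].
have [b0|bn] := eqVneq (branch c k) 0.
  by rewrite b0 mul0n big1 // => a _; rewrite big1 // => mu _; rewrite mul0n muln0.
have kc := branch_size bn.
rewrite (bigD1_seq (size c - size k)) ?iota_uniq ?mem_iota ?add0n ?ltnS ?(leq_trans (leq_subr _ _)) //=.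
rewrite subnKC // eqxx [X in _ + X]big1 ?addn0; last first.
  move=> a ne; rewrite big1 // => mu _; rewrite (_ : (size c == size k + a :> nat) = false) //.
  by apply: contraNF ne => /eqP ->; rewrite addKn.
by rewrite -IH // mulsumr; apply: eq_bigr => mu _; rewrite mul1n.
Qed.
End Shapes.
End Pieri.

(** * Left ideals of the Sergeev superalgebra *)

Lemma dim_limg_le (K : fieldType) (U V : vectType K) (f : 'Hom(U, V)) (W : {vspace U}) :
  (\dim (f @: W) <= \dim W)%N.
Proof. by rewrite -(limg_ker_dim f W) leq_addl. Qed.

Lemma dim_le_sum (K : fieldType) (U : vectType K) (I : Type) (r : seq I) (P : pred I)
    (V : {vspace U}) (W : I -> {vspace U}) (f : I -> U -> U) :
  (forall v, v \in V -> v = \sum_(i <- r | P i) f i v) ->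
  (forall i v, v \in V -> f i v \in W i) -> (\dim V <= \sum_(i <- r | P i) \dim (W i))%N.
Proof.
move=> fV fW; apply: (@leq_trans (\dim (\sum_(i <- r | P i) W i))).
  apply: dimvS; apply/subvP => v vV; rewrite (fV v vV).
  elim/big_rec2: _ => [|i z Z _ zZ]; first exact: mem0v.
  by rewrite memv_add // fW.
elim/big_rec2: _ => [|i d Z _ dZ]; first by rewrite dimv0.
by apply: leq_trans (dimv_add_leqif _ _).1 _; rewrite leq_add2l.
Qed.

Section InvariantBound.
Variables (C : numClosedFieldType) (A : falgType C) (n : nat) (c x s : nat -> A).
Hypothesis sys : sergeev_system n c x s.
Implicit Types (i j k : nat) (y z v f g : A) (T R W Z : seq nat) (a b : nat) (M U V : {vspace A}).
Local Notation eproj := (@eproj C A x).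
Local Notation shape_proj := (@shape_proj C A x).
Local Notation gen := (@gen C A c s).
Local Notation strip_inv := (@strip_inv C A x s).
Local Notation shapes := (shapes n).
Local Notation kostka := (kostka n).

Lemma dim_right_part_perm M T R : std T -> std R -> perm_eq T R -> (size T <= n)%N ->
  (forall v y, v \in M -> gen (size T) y -> v * y \in M) ->
  (\dim (right_part M (eproj T)) <= \dim (right_part M (eproj R)))%N.
Proof.
move=> sT sR p Tn Mgen; have [y [z [gy gz e]]] := eproj_link sys (spectrum sys (leqnn n)) (leqnn n) sT sR p Tn.
apply: leq_trans (dim_limg_le (amulr z) _); apply: dimvS; apply/subvP => w /right_partP[v vM ->].
apply/memv_imgP; exists (v * y * eproj R); last by rewrite lfunE /= e !mulrA.
by apply/right_partP; exists (v * y); [apply: Mgen|].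
Qed.

(** The head of [mu] is the size of the block standing last, so that the induction removes letters
    from the end. *)
Fixpoint block_inv (mu : seq nat) v : Prop :=
  if mu is m :: mu' then
    (forall i, (sumn mu' <= i)%N -> (i.+1 < sumn mu)%N -> v * s i = v) /\ block_inv mu' v
  else True.

Definition last_inv M k l : {vspace A} :=
  (M :&: \bigcap_(i < n | (k <= i)%N && (i.+1 < l)%N) lker (amulr (s i) - \1%VF))%VS.

Lemma last_invP M k l v : (l <= n)%N ->
  reflect (v \in M /\ forall i, (k <= i)%N -> (i.+1 < l)%N -> v * s i = v) (v \in last_inv M k l).
Proof.
move=> ln; rewrite memv_cap; apply: (iffP andP) => -[vM H]; split=> //.
  move=> i ki il; have ni : (i < n)%N by apply: leq_trans ln; apply: ltnW.
  move: H => /subv_bigcapP/(_ (Ordinal ni)); rewrite /= ki il => /(_ isT).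
  by rewrite -memvE memv_ker !lfun_simp /= subr_eq0 => /eqP.
rewrite memvE; apply/subv_bigcapP => i /andP[ki il].
by rewrite -memvE memv_ker !lfun_simp /= subr_eq0 H.
Qed.

Lemma sum_shape_proj k : (k <= n)%N -> \sum_(l <- shapes | size l == k) shape_proj k l = 1.
Proof.
move=> kn; rewrite -(sum_stds sys kn) /shape_proj_def.
under eq_bigr => l _ do rewrite big_mkcond.
rewrite exchange_big /= big_seq [RHS]big_seq; apply: eq_bigr => T; rewrite mem_stds => /andP[sT /eqP szT].
have Tn : (size T <= n)%N by rewrite szT.
rewrite -[RHS](big_shape (n := n) (fun=> eproj T) sT Tn) big_mkcond [RHS]big_mkcond.
apply: eq_bigr => l _; rewrite perm_sym; have [p|np] := boolP (perm_eq l T).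
  by rewrite (perm_size p) szT eqxx.
by rewrite if_same.
Qed.

(** If some filling of [l] starts with [k], the space consists of strip invariants and either
    [strip_bound] or [strip_zero] applies; if none does, the two projections multiply to 0. *)
Lemma strip_part_bound M (k l : seq nat) h m : std k -> std l -> size k = h -> size l = (m + h)%N ->
  (m + h <= n)%N -> (forall v y, v \in M -> gen (m + h) y -> v * y \in M) ->
  (2 ^ m * \dim (right_part (right_part (last_inv M h (m + h)) (eproj k)) (shape_proj (m + h) l))
    <= branch l k * \dim (right_part M (eproj l)))%N.
Proof.
move=> sk sl szk szl mn Mgen; have hn : (h <= n)%N by apply: leq_trans mn; apply: leq_addl.
set U := right_part (right_part _ _) _.
have gk : gen (m + h) (eproj k) by apply: (gen_eproj sys) => //; rewrite szk leq_addl.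
have UM : (U <= M)%VS.
  apply/subvP => v /right_partP[w /right_partP[u /(last_invP _ _ _ mn)[uM _] ->] ->].
  apply: (Mgen); first exact: (Mgen).
  rewrite /shape_proj_def big_seq_cond; elim/big_ind: _ => [||W /andP[]]; first exact: gen_zero.
    by move=> y z; apply: gen_add.
  by rewrite mem_stds => /andP[_ /eqP szW] _; apply: (gen_eproj sys); rewrite ?szW.
have inv R : std (k ++ R) -> perm_eq l (k ++ R) -> forall v, v \in U -> strip_inv k R v.
  move=> sR pR; have szR : size R = m.
    by have := perm_size pR; rewrite size_cat szl szk addnC => /addnI.
  have sz : (size k + size R = m + h)%N by rewrite szR szk addnC.
  move=> v /right_partP[w /right_partP[u /(last_invP _ _ _ mn)[uM uinv] ->] ->]; rewrite /strip_inv_def sz szk; split.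
  - move=> i hi im; have ni : (i.+1 < n)%N by apply: leq_trans mn.
    rewrite -mulrA (shape_proj_s sys) // mulrA -[u * _ * s i]mulrA.
    rewrite -(s_gen sys ni); first by rewrite mulrA uinv.
    by apply: (gen_eproj sys); rewrite ?szk // ltnW // ltnW.
  - by rewrite -mulrA (shape_proj_gen sys) // mulrA -[u * _ * eproj k]mulrA (std_idem sys) ?szk.
  - by rewrite -(@eq_shape_proj C A x _ _ _ pR) -mulrA (shape_proj_idem sys).
have [W|noW] := pickP (fun W : seq_sub (stds (m + h)) => perm_eq (val W) l && (take h (val W) == k)).
  case: W => W /= Win /andP[pW /eqP tW]; have := Win; rewrite mem_stds => /andP[sW /eqP szW].
  have eW : W = k ++ drop h W by rewrite -tW cat_take_drop.
  have pW' : perm_eq l (k ++ drop h W) by rewrite -eW perm_sym.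
  have sW' : std (k ++ drop h W) by rewrite -eW.
  have nW' : (size (k ++ drop h W) <= n)%N by rewrite -eW szW.
  have szR : size (drop h W) = m by rewrite size_drop szW addnK.
  have [uR|nuR] := boolP (uniq (drop h W)); last first.
    have -> : U = 0%VS; last by rewrite dimv0 muln0.
    apply/eqP; rewrite -subv0; apply/subvP => v vU.
    by rewrite (strip_zero sys sW' nW' nuR (inv _ sW' pW' v vU)) mem0v.
  rewrite (branchE uR pW') -[in (2 ^ m)%N]szR.
  apply: leq_trans (strip_bound sys sW' nW' uR UM (inv _ sW' pW') _) _.
    by rewrite -eW szW.
  rewrite leq_pmul2l ?expn_gt0 // -eW; apply: dim_right_part_perm => //; rewrite szW //.
have -> : U = 0%VS; last by rewrite dimv0 muln0.
apply/eqP; rewrite -subv0; apply/subvP => v /right_partP[w /right_partP[u _ ->] ->].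
rewrite -mulrA (_ : eproj k * _ = 0) ?mulr0 ?mem0v //.
rewrite /shape_proj_def mulr_sumr big_seq_cond big1 // => W /andP[Win pW].
have := noW (SeqSub Win); rewrite /= pW /= => /negbT ne.
move: Win; rewrite mem_stds => /andP[sW /eqP szW].
have szt : size (take h W) = h by rewrite size_takel // szW leq_addl.
have st : std (take h W) by move: sW; rewrite -{1}(cat_take_drop h W) std_cat => /andP[].
rewrite -(cat_take_drop h W) eproj_cat mulrA (std_orth sys) ?mul0r ?szk ?szt //.
by rewrite eq_sym.
Qed.

(** The invariants [W] of the last block are stable under the earlier letters, so the induction
    hypothesis applies with [W] in place of [M]. Each [W * eproj k] is then cut by the shape
    projections on all the letters. *)
Theorem invariants_bound mu M U : (sumn mu <= n)%N ->
  (forall v y, v \in M -> gen (sumn mu) y -> v * y \in M) ->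
  (U <= M)%VS -> (forall v, v \in U -> block_inv mu v) ->
  (2 ^ sumn mu * \dim U
    <= \sum_(l <- shapes | size l == sumn mu) kostka l mu * \dim (right_part M (eproj l)))%N.
Proof.
elim: mu M U => [|m mu IH] M U mun Mgen UM Uinv.
  rewrite /= expn0 mul1n; have sn : std [::] by [].
  have := @big_shape_nat n (fun l => kostka l [::] * \dim (right_part M (eproj l)))%N _ sn (leq0n n).
  have pr := (shape_repP sn).2; have -> : shape_rep [::] = [::].
    by move/perm_size: pr; case: (shape_rep [::]).
  rewrite /= mul1n => e; rewrite (eq_bigl (fun l => perm_eq l [::])); last first.
    by move=> l; case: l => // a l; apply/esym/negbTE/negP => /perm_size.
  rewrite e; apply: dimvS; apply: subv_trans UM _; apply/subvP => v vM; apply/right_partP.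
  by exists v; rewrite // mulr1.
have mn' : (m + sumn mu <= n)%N by [].
have hn : (sumn mu <= n)%N by apply: leq_trans mn'; apply: leq_addl.
set h := sumn mu in mn' hn *; pose W := last_inv M h (m + h).
have UW : (U <= W)%VS.
  apply/subvP => v vU; apply/(last_invP _ _ _ mn'); split; first exact: (subvP UM).
  by have [] := Uinv v vU.
have Wgen v y : v \in W -> gen h y -> v * y \in W.
  move=> /(last_invP _ _ _ mn')[vM vs] gy; apply/(last_invP _ _ _ mn'); split=> [|i hi im].
    by apply: Mgen => //; apply: gen_le gy; apply: leq_addl.
  have ni : (i.+1 < n)%N by apply: leq_trans mn'.
  by rewrite -mulrA -(s_gen sys ni (gen_le hi gy)) mulrA vs.
have := IH W U hn Wgen UW (fun v vU => (Uinv v vU).2); rewrite -/h => H.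
rewrite [sumn _]/= -/h expnD -mulnA.
apply: (@leq_trans (2 ^ m * \sum_(k <- shapes | size k == h) kostka k mu * \dim (right_part W (eproj k)))%N).
  by rewrite leq_pmul2l ?expn_gt0.
rewrite mulsumr; pose F (l k : seq nat) := (branch l k * \dim (right_part M (eproj l)))%N.
apply: (@leq_trans (\sum_(k <- shapes | size k == h) kostka k mu * \sum_(l <- shapes | size l == m + h) F l k)%N).
  rewrite big_seq_cond [leqRHS]big_seq_cond; apply: leq_sum => k /andP[/shapesP[sk kn _] /eqP szk].
  rewrite mulnCA leq_mul2l; apply/orP; right.
  apply: (@leq_trans (2 ^ m * \sum_(l <- shapes | size l == m + h) \dim (right_part (right_part W (eproj k)) (shape_proj (m + h) l)))%N).
    rewrite leq_pmul2l ?expn_gt0 //; set V := right_part W _.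
    apply: (@dim_le_sum _ _ _ _ _ _ _ (fun l v => v * shape_proj (m + h) l)) => [v vV|l v vV].
      by rewrite -mulr_sumr (sum_shape_proj mn') mulr1.
    by apply/right_partP; exists v.
  rewrite mulsumr big_seq_cond [leqRHS]big_seq_cond; apply: leq_sum => l /andP[/shapesP[sl ln _] /eqP szl].
  exact: strip_part_bound.
under eq_bigr => k _ do rewrite mulsumr.
rewrite exchange_big /= big_seq_cond [leqRHS]big_seq_cond; apply: leq_sum => l /andP[_ /eqP szl].
rewrite mulsuml szl [leqRHS](eq_bigl (fun k : seq nat => (size k == h :> nat))); last by move=> k; rewrite addnC eqn_add2r eq_sym.
by rewrite leq_eqVlt; apply/orP; left; apply/eqP/eq_bigr => k _; rewrite /F mulnCA mulnA.
Qed.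

Hypothesis gen_full : forall y, gen n y.

(** Here [M] is the right ideal of [eproj T], so by [dim_corner] only the shape of [T] contributes
    to the sum. *)
Corollary invariants_left_ideal mu T U : std T -> size T = n -> sumn mu = n ->
  (U <= left_ideal_part (eproj T))%VS -> (forall v, v \in U -> block_inv mu v) ->
  (2 ^ n * \dim U <= kostka T mu * box_weight T)%N.
Proof.
move=> sT szT mun UT Uinv; have mn : (sumn mu <= n)%N by rewrite mun.
have := invariants_bound mn _ UT Uinv; rewrite mun => H; apply: leq_trans (H _) _.
  by move=> v y /left_ideal_partP[w ->] _; apply/left_ideal_partP; exists (w * y); rewrite mulrA.
have Tn : (size T <= n)%N by rewrite szT.
rewrite -(eq_kostka _ _ (shape_repP sT).2).
rewrite -(@big_shape_nat n (fun l => kostka l mu * box_weight T)%N T sT Tn).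
rewrite [leqLHS]big_mkcond [leqRHS]big_mkcond /= [leqLHS]big_seq [leqRHS]big_seq; apply: leq_sum => l /shapesP[sl ln _].
case: eqP => // szl.
have := dim_corner sys gen_full sT sl szT szl; rewrite perm_sym => /leq_mul H'; move: (H' _ _ (leqnn (kostka l mu))).
by case: ifP => _; rewrite mulnC ?muln0 // [leqRHS]mulnC.
Qed.
End InvariantBound.

(** * The Sergeev superalgebra as a [sergeev_system] *)

Section FalgebraInstance.
Variables (C : fieldType) (n : nat).
HB.instance Definition _ := Vector.copy (sergeev C n) {ffun sergeev_index n -> C^o}.
HB.instance Definition _ := Algebra_isFalgebra.Build C (sergeev C n).
End FalgebraInstance.

Section AbstractSergeev.
Variables (C : numClosedFieldType) (n : nat) (A : falgType C) (cl : 'I_n -> A) (pe : 'S_n -> A).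
Implicit Types (a b d : 'I_n) (y z u w : A) (p q : 'S_n).
Hypotheses (pe1 : pe 1%g = 1) (peM : forall p q, pe p * pe q = pe (q * p)%g).
Hypotheses (clsqr : forall a, cl a * cl a = -1)
  (clN : forall a b, a != b -> cl a * cl b = - (cl b * cl a)).
Hypothesis peC : forall p a, pe p * cl a = cl (p a) * pe p.

Definition nat_clifford (i : nat) : A := if insub i is Some a then cl a else 0.
Definition nat_transposition (i : nat) : A :=
  if (insub i : option 'I_n) is Some a then
    if (insub i.+1 : option 'I_n) is Some b then pe (tperm a b) else 0 else 0.

Lemma nat_cliffordE a : nat_clifford a = cl a.
Proof. by rewrite /nat_clifford valK. Qed.

Lemma nat_transpositionE a b : b = a.+1 :> nat -> nat_transposition a = pe (tperm a b).
Proof. by move=> e; rewrite /nat_transposition valK -e valK. Qed.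

Lemma pe_tperm2 a b : pe (tperm a b) * pe (tperm a b) = 1.
Proof. by rewrite peM tperm2 pe1. Qed.

Lemma clifford_perm p a : cl a * pe p = pe p * cl ((p^-1)%g a).
Proof. by rewrite peC permKV. Qed.

Definition jm_term a b : A := pe (tperm a b) * (1 + cl a * cl b).

Definition jm (m : nat) : A := \sum_(b < n | b == m :> nat) \sum_(a < n | (a < b)%N) jm_term a b.

Lemma jmE b : jm b = \sum_(a : 'I_n | (a < b)%N) jm_term a b.
Proof. by rewrite /jm (big_pred1 b). Qed.

Lemma jm_term_perm p a b : pe p * jm_term a b = jm_term (p a) (p b) * pe p.
Proof.
rewrite /jm_term mulrA peM -[RHS]mulrA.
have -> : (1 + cl (p a) * cl (p b)) * pe p = pe p * (1 + cl a * cl b).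
  by rewrite mulrDl mulrDr mul1r mulr1 -mulrA -peC mulrA -peC mulrA.
rewrite [RHS]mulrA peM; congr (pe _ * _).
by rewrite -tpermJ conjgC.
Qed.

Lemma jm_perm p b : p b = b -> (forall a, (p a < b)%N = (a < b)%N) -> pe p * jm b = jm b * pe p.
Proof.
move=> pb pl; rewrite jmE mulr_sumr mulr_suml [RHS](reindex_inj (@perm_inj _ p)) /=.
by apply: eq_big => a; [rewrite pl | move=> _; rewrite jm_term_perm pb].
Qed.

Lemma jm_clifford a b : a != b -> jm b * cl a = cl a * jm b.
Proof.
move=> ab; rewrite jmE mulr_sumr mulr_suml; apply: eq_bigr => d db; rewrite /jm_term.
have bd : b != d by rewrite -val_eqE /= gtn_eqF.
have cc := clsqr; rewrite [RHS]mulrA clifford_perm tpermV -[LHS]mulrA -[RHS]mulrA; congr (_ * _).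
have [->|ad] := eqVneq a d.
  rewrite tpermL mulrDl mulrDr mul1r mulr1 addrC; congr (_ + _).
    by rewrite -mulrA (clN bd) mulrN mulrA cc mulN1r opprK.
  by rewrite mulrA (clN bd) mulNr -mulrA cc mulrN1 opprK.
rewrite tpermD 1?eq_sym // mulrDl mulrDr mul1r mulr1; congr (_ + _).
rewrite -mulrA (@clN b a) 1?eq_sym // mulrN mulrA.
by rewrite mulrA (@clN d a) 1?eq_sym // mulNr opprK.
Qed.

Lemma jm_clifford_anti b : jm b * cl b = - (cl b * jm b).
Proof.
rewrite jmE mulr_sumr mulr_suml -sumrN; apply: eq_bigr => d db; rewrite /jm_term.
have bd : b != d by rewrite -val_eqE /= gtn_eqF.
have cc := clsqr; rewrite [cl b * _]mulrA clifford_perm tpermV tpermR -[LHS]mulrA -[pe _ * _ * _]mulrA -mulrN; congr (_ * _).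
rewrite mulrDl mulrDr mul1r mulr1 mulrA cc mulN1r opprD opprK [RHS]addrC; congr (_ + _).
by rewrite -mulrA cc mulrN1.
Qed.

Lemma jm_comm a b : jm a * jm b = jm b * jm a.
Proof.
wlog ab : a b / (a < b)%N.
  move=> H; case: (ltngtP a b) => [|h|/val_inj ->] //; first exact: H.
  exact/esym/H.
rewrite [jm a]jmE mulr_suml mulr_sumr; apply: eq_bigr => d da; rewrite /jm_term.
have db := ltn_trans da ab.
have nb (e : 'I_n) : (e < b)%N -> e != b by move=> h; rewrite -val_eqE /= ltn_eqF.
have e1 : (1 + cl d * cl a) * jm b = jm b * (1 + cl d * cl a).
  rewrite mulrDl mulrDr mul1r mulr1 -mulrA -(jm_clifford (nb a ab)) mulrA -(jm_clifford (nb d db)).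
  by rewrite mulrA.
rewrite -[LHS]mulrA e1 mulrA jm_perm ?mulrA //; first by rewrite tpermD // nb.
by move=> e; case: tpermP => [->|->|] //; rewrite ?ab ?db.
Qed.

Lemma jm_transposition a b : b = a.+1 :> nat ->
  jm b * pe (tperm a b) = pe (tperm a b) * jm a + 1 - cl a * cl b.
Proof.
move=> e; have ab : (a < b)%N by rewrite e.
have nab : a != b by rewrite -val_eqE /= ltn_eqF.
rewrite [jm b]jmE (bigD1 a) //= mulrDl mulr_suml [jm a]jmE mulr_sumr addrC -addrA; congr (_ + _).
  apply: eq_big => [d|d /andP[db da]].
    by rewrite e ltnS ltn_neqAle andbC -val_eqE.
  have -> : jm_term d b = jm_term (tperm a b d) (tperm a b a).
    by rewrite tpermL tpermD // eq_sym // -val_eqE /= ltn_eqF.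
  by rewrite -jm_term_perm.
rewrite /jm_term -mulrA mulrDl mul1r -mulrA clifford_perm tpermV tpermR mulrA clifford_perm tpermV tpermL.
rewrite -mulrA mulrDr mulrA pe_tperm2 mul1r; congr (_ + _).
by rewrite (@clN b a) 1?eq_sym.
Qed.

(** Both summands of [jm_term] are thus involutions, the other one being a transposition; this is
    what makes the Jucys-Murphy elements self-adjoint. *)
Lemma jm_term_involution a b : a != b -> let u := pe (tperm a b) * (cl a * cl b) in u * u = 1.
Proof.
move=> ab u; rewrite /u -[LHS]mulrA [cl a * cl b * _]mulrA -[cl a * cl b * pe _]mulrA clifford_perm tpermV tpermR.
rewrite [cl a * (pe _ * _)]mulrA clifford_perm tpermV tpermL -!mulrA mulrA pe_tperm2 mul1r.
by rewrite [cl a * (cl a * _)]mulrA clsqr mulN1r mulrN clsqr opprK.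
Qed.

Hypothesis jm_ss : forall b z, jm b * (jm b * z) = 0 -> jm b * z = 0.
Hypothesis jm_sq_ss : forall b (m : nat) z, let h := jm b * jm b - m%:R in h * (h * z) = 0 -> h * z = 0.

Lemma abstract_systemP : sergeev_system n nat_clifford jm nat_transposition.
Proof.
have ord i : (i < n)%N -> exists a : 'I_n, i = a by move=> h; exists (Ordinal h).
have ord2 i : (i.+1 < n)%N -> exists a b : 'I_n, [/\ i = a, i.+1 = b & b = a.+1 :> nat].
  by move=> h; exists (Ordinal (ltnW h)), (Ordinal h).
have neq2 a b : b = a.+1 :> nat -> a != b by move=> e; rewrite -val_eqE /= e ltn_eqF.
split.
- by move=> i /ord[a ->]; rewrite nat_cliffordE clsqr.
- by move=> i j /ord[a ->] /ord[b ->] ab; rewrite !nat_cliffordE clN.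
- by move=> i /ord2[a [b [-> _ e]]]; rewrite (nat_transpositionE e) pe_tperm2.
- move=> i /ord2[a [b [-> _ e]]]; rewrite (nat_transpositionE e) -e !nat_cliffordE.
  by rewrite peC tpermL.
- move=> i j /ord2[a [b [-> _ e]]] /ord[d ->] da db; rewrite (nat_transpositionE e) !nat_cliffordE.
  by rewrite peC tpermD // eq_sym // -val_eqE /= e.
- move=> i h; have [a [b [ei ei1 e]]] := ord2 _ (ltnW h).
  have [b' [d [ei1' ei2 e']]] := ord2 _ h.
  have eb : b' = b by apply: val_inj; rewrite /= -ei1' -ei1.
  subst b'; rewrite ei (nat_transpositionE e) -e (nat_transpositionE e') !peM; congr pe.
  have da : d != a by rewrite -val_eqE /= e' e gtn_eqF // ltnW.
  have bd := neq2 _ _ e'; have ab := neq2 _ _ e.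
  have -> : (tperm a b * (tperm b d * tperm a b) = tperm b d ^ tperm a b)%g by rewrite conjgE tpermV.
  have -> : (tperm b d * (tperm a b * tperm b d) = tperm a b ^ tperm b d)%g by rewrite conjgE tpermV.
  by rewrite !tpermJ tpermR tpermL !tpermD // eq_sym.
- move=> i j ij h; have [a [b [ei _ e]]] := ord2 i (ltn_trans ij (ltnW h)).
  have [d [f [ej _ e']]] := ord2 _ h; rewrite ei ej (nat_transpositionE e) (nat_transpositionE e') !peM.
  have [ad bd] : (a < d)%N /\ (b < d)%N by rewrite e -ei -ej; split; [apply: ltnW|].
  have ne (g1 g2 : 'I_n) : (g1 < g2)%N -> g1 != g2 by move=> h'; rewrite -val_eqE /= ltn_eqF.
  have df : (d < f)%N by rewrite e'.
  congr pe; rewrite conjgC tpermJ !tpermD ?(ne a d) ?(ne b d) ?(ne a f) ?(ne b f) //; by apply: ltn_trans df.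
- move=> i /ord2[a [b [ei ei1 e]]]; rewrite ei1 ei (nat_transpositionE e) !nat_cliffordE.
  exact: jm_transposition.
- move=> i j /ord2[a [b [ei _ e]]] /ord[d ej] da db; rewrite ei ej (nat_transpositionE e).
  have da' : d != a by rewrite -val_eqE /= -ei -ej.
  have db' : d != b by rewrite -val_eqE /= e -ei -ej.
  apply: jm_perm; first by rewrite tpermD // eq_sym.
  move=> g; have : (a < d)%N = (b < d)%N.
    by rewrite e -ei -ej; move: da db; clear; lia.
  by case: tpermP => [->|->|].
- by rewrite /jm big1 // => b /eqP b0; rewrite big_pred0 // => a; rewrite b0.
- by move=> i j /ord[a ->] /ord[b ->]; apply: jm_comm.
- by move=> i j /ord[a ->] /ord[b ->] ab; rewrite nat_cliffordE jm_clifford // eq_sym.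
- by move=> i /ord[a ->]; rewrite nat_cliffordE jm_clifford_anti.
- by move=> i z /ord[a ->]; apply: jm_ss.
- by move=> i m z /ord[a ->]; apply: jm_sq_ss.
Qed.

Local Notation gen := (@gen C A nat_clifford nat_transposition n).

Lemma gen_clifford a : gen (cl a).
Proof. by rewrite -nat_cliffordE; apply: gen_c. Qed.

Lemma gen_perm p : gen (pe p).
Proof.
have tp m a b : (b <= m)%N -> (a < b)%N -> gen (pe (tperm a b)).
  elim: m b => [|m IH] b bm ab; first by move: ab; rewrite ltnNge (leq_trans bm).
  have [e|ne] := eqVneq (b : nat) a.+1.
    by rewrite -(nat_transpositionE e); apply: gen_s; rewrite -e.
  have b1 : (b.-1 < n)%N by apply: leq_ltn_trans (leq_pred b) _.
  pose b' := Ordinal b1; have eb : b = b'.+1 :> nat by rewrite /= prednK // (leq_trans _ ab).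
  have ab' : (a < b')%N by rewrite ltn_neqAle -ltnS -eb ab andbT; apply: contraNneq ne => ->; rewrite -eb.
  have -> : pe (tperm a b) = pe (tperm b' b) * pe (tperm a b') * pe (tperm b' b).
    have ba : b != a by rewrite -val_eqE /= gtn_eqF.
    have b'a : b' != a by rewrite -val_eqE /= gtn_eqF.
    have -> : tperm a b = (tperm a b' ^ tperm b' b)%g by rewrite tpermJ tpermL tpermD.
    by rewrite !peM conjgE tpermV.
  have gb : gen (pe (tperm b' b)) by rewrite -(nat_transpositionE eb); apply: gen_s; rewrite -eb.
  by apply: gen_mul => //; apply: gen_mul => //; apply: IH => //; rewrite -ltnS -eb.
have [ts -> _] := prod_tpermP p; elim/big_rec: _ => [|[a b] q _ gq]; first by rewrite pe1; apply: gen_one.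
rewrite -peM; apply: gen_mul => //=; case: (ltngtP a b) => [ab|ba|/val_inj ->].
- exact: tp ab.
- by rewrite tpermC; apply: tp ba.
- by rewrite tperm1 pe1; apply: gen_one.
Qed.
End AbstractSergeev.

Section Concrete.
Variables (C : numClosedFieldType) (n : nat).
Local Notation S := (sergeev C n).
Implicit Types (a b d : 'I_n) (g h : sergeev_index n) (y z : S) (p q : 'S_n).
Local Notation cl := (@clifford_gen C n).
Local Notation pe := (@perm_elt C n).
Local Notation jm := (jucys_murphy C n).

Lemma pe1 : pe (1 : 'S_n)%g = 1. Proof. by []. Qed.

Lemma jm_sumE b : jm b = \sum_(a : 'I_n | (a < b)%N) jm_term cl pe a b.
Proof. by rewrite /jucys_murphy (big_pred1 b). Qed.

(** The positive definite form with the [c_I s] as orthonormal basis. Multiplication by a basis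
    element permutes this basis up to signs and is therefore unitary; if it is also an involution,
    it is self-adjoint. *)
Definition herm y z : C := \sum_g (y g)^* * z g.

Lemma herm0 y : herm y y = 0 -> y = 0.
Proof.
move=> /eqP; rewrite psumr_eq0 => [|g _]; last by rewrite mulrC mul_conjC_ge0.
by move=> /allP h; apply/ffunP => g; have := h g (mem_index_enum _); rewrite mulrC mul_conjC_eq0 ffunE => /eqP.
Qed.

Lemma index_mul_inj g : injective (index_mul g).
Proof.
move=> [I p] [J q]; rewrite /index_mul /= => -[e /mulIg ->]; congr (_, _).
apply: (imset_inj (@perm_inj _ g.2)); apply/setP => a; move/setP/(_ a): e; rewrite !inE.
by case: (a \in g.1); case: (a \in _); case: (a \in _).
Qed.

Lemma basis_mulE g y k : (sergeev_elt C g * y) (index_mul g k) = (-1) ^+ index_sign g k * y k.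
Proof.
rewrite (basis_decomp y) mulr_sumr sum_ffunE (bigD1 k) //= [X in _ + X]big1 ?addr0.
  rewrite -scalerAr sergeev_elt_mul scalerA !ffunE eqxx /GRing.scale /= mulr1.
  rewrite -/(sergeev_elt C _) mulrC; congr (_ * _).
  by rewrite -basis_decomp.
move=> l lk; rewrite -scalerAr sergeev_elt_mul scalerA !ffunE (inj_eq (@index_mul_inj g)) eq_sym (negbTE lk).
by rewrite scaler0.
Qed.

Lemma herm_basis g y z : herm (sergeev_elt C g * y) (sergeev_elt C g * z) = herm y z.
Proof.
rewrite /herm (reindex_inj (@index_mul_inj g)); apply: eq_bigr => k _.
rewrite !basis_mulE rmorphM rmorphXn rmorphN rmorph1 mulrACA -expr2 -exprM mulnC exprM sqrrN expr1n.
by rewrite expr1n mul1r.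
Qed.

Lemma hermDl y1 y2 z : herm (y1 + y2) z = herm y1 z + herm y2 z.
Proof. by rewrite /herm -big_split; apply: eq_bigr => g _; rewrite ffunE rmorphD mulrDl. Qed.

Lemma hermDr y z1 z2 : herm y (z1 + z2) = herm y z1 + herm y z2.
Proof. by rewrite /herm -big_split; apply: eq_bigr => g _; rewrite ffunE mulrDr. Qed.

Lemma hermZl t y z : herm (t *: y) z = t^* * herm y z.
Proof. by rewrite /herm mulr_sumr; apply: eq_bigr => g _; rewrite ffunE rmorphM mulrA. Qed.

Lemma hermZr t y z : herm y (t *: z) = t * herm y z.
Proof. by rewrite /herm mulr_sumr; apply: eq_bigr => g _; rewrite ffunE mulrCA. Qed.

Definition self_adjoint (u : S) := forall y z, herm (u * y) z = herm y (u * z).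

Lemma self_adjointD u w : self_adjoint u -> self_adjoint w -> self_adjoint (u + w).
Proof. by move=> hu hw y z; rewrite !mulrDl hermDl hermDr hu hw. Qed.

Lemma self_adjoint_basis g (e : bool) : let u : S := (-1) ^+ e *: sergeev_elt C g in
  u * u = 1 -> self_adjoint u.
Proof.
move=> u uu y z; have iso w1 w2 : herm (u * w1) (u * w2) = herm w1 w2.
  rewrite /u -!scalerAl hermZl hermZr herm_basis mulrA rmorphXn rmorphN rmorph1.
  by rewrite -expr2 -exprM mulnC exprM sqrrN expr1n expr1n mul1r.
by rewrite -[z in LHS]mul1r -uu -mulrA iso.
Qed.

Lemma self_adjoint_jm b : self_adjoint (jm b).
Proof.
rewrite jm_sumE; elim/big_ind: _ => [y z|u w|a ab].
- by rewrite !mul0r /herm big1 ?big1 // => g _; rewrite ffunE ?rmorph0 ?mul0r ?mulr0.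
- exact: self_adjointD.
have nba : b != a by rewrite -val_eqE /= gtn_eqF.
rewrite (_ : jm_term cl pe a b = pe (tperm a b) + pe (tperm a b) * (cl a * cl b)); last first.
  by rewrite /jm_term [LHS]mulrDr mulr1.
apply: self_adjointD.
  rewrite -[pe _]scale1r -[1](expr0 (-1)) -[0%N]/(nat_of_bool false); apply: self_adjoint_basis.
  by rewrite expr0 !scale1r -/(pe _) perm_elt_mul tperm2.
have inv : let u := pe (tperm a b) * (cl a * cl b) in u * u = 1.
  apply: jm_term_involution; [exact: pe1|exact: perm_elt_mul|exact: clifford_gen_sqr|exact: perm_clifford|].
  by rewrite eq_sym.
have [g [e eu]] : exists g (e : bool), pe (tperm a b) * (cl a * cl b) = (-1) ^+ e *: sergeev_elt C g.
  eexists; eexists; rewrite /perm_elt /clifford_gen sergeev_elt_mul -scalerAr sergeev_elt_mul scalerA -signr_addb.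
  reflexivity.
by rewrite eu in inv *; apply: self_adjoint_basis.
Qed.

Lemma self_adjoint_ss u z : self_adjoint u -> u * (u * z) = 0 -> u * z = 0.
Proof.
move=> hu e; apply: herm0; rewrite hu e /herm big1 // => g _; by rewrite ffunE mulr0.
Qed.

Lemma self_adjoint_sq u (m : nat) : self_adjoint u -> self_adjoint (u * u - m%:R).
Proof.
move=> hu y z; rewrite !mulrBl -!mulrA -scaleN1r -[- (m%:R * z)]scaleN1r hermDl hermDr !hu.
rewrite !mulr_natl -!scaler_nat !scalerA hermZl hermZr; congr (_ + _ * _).
by rewrite rmorphM rmorphN rmorph1 rmorph_nat.
Qed.

Definition sergeev_c := nat_clifford (@clifford_gen C n).
Definition sergeev_s := nat_transposition (@perm_elt C n).

Theorem sergeev_systemP : sergeev_system n sergeev_c jm sergeev_s.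
Proof.
apply: abstract_systemP; [exact: pe1|exact: perm_elt_mul|exact: clifford_gen_sqr|exact: clifford_gen_anti|exact: perm_clifford| |].
- by move=> b z; apply/self_adjoint_ss/self_adjoint_jm.
- by move=> b m z; apply/self_adjoint_ss/self_adjoint_sq/self_adjoint_jm.
Qed.

Theorem sergeev_gen_full y : gen sergeev_c sergeev_s n y.
Proof.
rewrite (basis_decomp y); elim/big_ind: _ => [|u w|[I p] _]; first exact: gen_zero.
  exact: gen_add.
apply: gen_scale; rewrite -/(sergeev_elt C _) sergeev_eltE; apply: gen_mul.
  elim/big_ind: _ => [|u w|a _]; [exact: gen_one|exact: gen_mul|exact: gen_clifford].
by apply: gen_perm; [exact: pe1|exact: perm_elt_mul].
Qed.
End Concrete.

(** * Marked shifted tableaux *)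

Section ShiftedFillings.
Local Open Scope nat_scope.

(** The first diagonal [s0] on which the count drops carries a corner; it is removed, the induction
    applied, and the box added back. *)
Lemma std_of_count (c : nat -> nat) l : (forall s, c s.+1 <= c s <= (c s.+1).+1) ->
  (forall s, l <= s -> c s = 0) -> exists2 T, std T & mult T =1 c.
Proof.
move=> hc c0; have [m] := ubnP (\sum_(s < l) c s); elim: m c hc c0 => // m IH c hc c0 cm.
have mono i j : i <= j -> c j <= c i.
  move=> /subnK <-; elim: (j - i) => // d hd; rewrite addSn; apply: leq_trans hd; by case/andP: (hc (d + i)).
have [z|nz] := eqVneq (c 0) 0.
  exists [::] => // s; apply/esym/eqP; rewrite -leqn0 -z; exact: mono.
have ex : exists s, c s.+1 < c s.
  have [s hs|H] := pickP (fun s : 'I_l => c s.+1 < c s); first by exists s.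
  exfalso; have : forall k, k <= l -> c k = c 0.
    elim=> // k IHk kl; rewrite -(IHk (ltnW kl)); apply/eqP; rewrite eqn_leq mono //=.
    by have /negbT := H (Ordinal kl); rewrite /= -leqNgt.
  by move/(_ l (leqnn l)); rewrite c0 // => e; rewrite -e in nz.
pose s0 := ex_minn ex; have s0P : c s0.+1 < c s0 by rewrite /s0; case: ex_minnP.
have s0min s : s < s0 -> c s.+1 = c s.
  rewrite /s0; case: ex_minnP => k _ hk sk; apply/eqP; rewrite eqn_leq mono //= leqNgt.
  by apply/negP => /hk; rewrite leqNgt sk.
have s0l : s0 < l by rewrite ltnNge; apply/negP => /c0 e; rewrite e in s0P.
pose c' s := c s - (s == s0 :> nat).
have [|||T sT eT] := IH c'.
- move=> s; rewrite /c'; have := hc s; have [->|ns] := eqVneq s s0.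
    by rewrite (gtn_eqF (ltnSn s0)); move: s0P; case/andP: (hc s0); lia.
  have [e|ns'] := eqVneq s.+1 s0; last by rewrite !subn0.
  have := s0min s; rewrite -e ltnSn => /(_ isT); have := hc s.+1; rewrite e; move: s0P; lia.
- by move=> s ls; rewrite /c' c0.
- rewrite ltnS in cm; apply: leq_trans cm.
  rewrite (bigD1 (Ordinal s0l)) //= [X in _ < X](bigD1 (Ordinal s0l)) //= /c' eqxx.
  apply: (@leq_ltn_trans (c s0 - 1 + \sum_(i < l | i != Ordinal s0l) c i)).
    by rewrite leq_add2l; apply: leq_sum => i _; apply: leq_subr.
  by rewrite ltn_add2r; move: s0P; clear; lia.
exists (rcons T s0); last first.
  move=> s; rewrite mult_rcons eT /c'; have [->|ns] := eqVneq s s0.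
    by move: s0P => /=; clear; lia.
  by rewrite subn0 addn0.
rewrite std_rcons sT /addable !eT /c' eqxx; have := s0min s0.-1; have := hc s0; move: s0P.
case: s0 {s0min s0l c' eT sT T} => [|k] /=; first by move: (c 0) (c 1) => x y; lia.
rewrite ltnSn => h1 h2 /(_ isT) h3; rewrite (ltn_eqF (ltnSn k)) (gtn_eqF (ltnSn k.+1)) -h3 subn0.
move: h1 h2; lia.
Qed.

Lemma prod_eq0 (I : finType) (F : I -> nat) i : F i = 0 -> \prod_j F j = 0.
Proof. by move=> e; rewrite (bigD1 i) //= e. Qed.

Section Fillings.
Variables (N L : nat).
Local Notation box := ('I_L * 'I_L)%type.
Local Notation symbol := (marked_symbol N).
Implicit Types (p q b : box) (u v : symbol) (c : nat -> nat).

Definition in_diag c b := (b.1 <= b.2) && (b.1 < c (b.2 - b.1)).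

Definition compat p q u v : bool :=
  (((p.1 == q.1) && (p.2 < q.2)) ==> (symbol_code u <= symbol_code v) && ~~ ((u == v) && u.2))
  && (((p.2 == q.2) && (p.1 < q.1)) ==> (symbol_code u <= symbol_code v) && ~~ ((u == v) && ~~ u.2)).

Definition ocompat p q (x y : option symbol) :=
  if x is Some u then if y is Some v then compat p q u v else true else true.

Definition low j (x : option symbol) := if x is Some u then u.1 < j else true.

(** Fillings by letters below [j] live on one fixed square, with [None] outside the shape, so that
    the shape and the number of letters can vary within a single finite type. *)
Definition filling j c (f : {ffun box -> option symbol}) :=
  [&& [forall b, isSome (f b) == in_diag c b], [forall b, low j (f b)]
    & [forall p, forall q, ocompat p q (f p) (f q)]].

Definition has_letter (k : nat) (x : option symbol) := if x is Some u then (u.1 == k :> nat) else false.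

Definition letter_count (f : {ffun box -> option symbol}) k := #|[pred b | has_letter k (f b)]|.

Definition good_fillings j c (nu : nat -> nat) :=
  [pred f | filling j c f && [forall k : 'I_N, (k < j) ==> (letter_count f k == nu k :> nat)]].

Definition lower j (f : {ffun box -> option symbol}) : {ffun box -> option symbol} :=
  [ffun b => if f b is Some u then if u.1 < j then Some u else None else None].

Section Strip.
Variables (c k : nat -> nat).
Hypotheses (hc : forall s, c s.+1 <= c s <= (c s.+1).+1) (hk : forall s, k s.+1 <= k s <= (k s.+1).+1).
Hypothesis kc : forall s, k s <= c s.

Definition strip_box b := in_diag c b && ~~ in_diag k b.
Definition strip_left b := [exists p, [&& strip_box p, p.1 == b.1 & p.2 < b.2]].
Definition strip_below b := [exists q, [&& strip_box q, q.2 == b.2 & b.1 < q.1]].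
(** As [k'] precedes [k], a strip box with another one to its left cannot carry [k'], and one with
    another below it cannot carry [k]. Outside the strip exactly one value is allowed, so that those
    boxes contribute the factor 1. *)
Definition allowed b (m : bool) :=
  if strip_box b then ~~ (strip_left b && m) && ~~ (strip_below b && ~~ m) else ~~ m.

Lemma mono (f : nat -> nat) : (forall s, f s.+1 <= f s <= (f s.+1).+1) ->
  forall i d, f (d + i) <= f i <= f (d + i) + d.
Proof. by move=> h i; elim=> [|d IH]; [rewrite add0n; lia | have := h (d + i); rewrite addSn; lia]. Qed.

Lemma allowed_card b : #|allowed b| = if strip_box b then
    if strip_left b && strip_below b then 0 else if strip_left b || strip_below b then 1 else 2 else 1.
Proof.
rewrite -sum1_card big_mkcond big_bool /= /in_mem /= /allowed.
by case: strip_box; case: strip_left; case: strip_below.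
Qed.

(* A strip box on diagonal [s] with a strip box to its left or below it has one
   on diagonal [s - 1]. *)
Lemma strip_neighbour b : strip_box b ->
  (strip_left b -> [/\ b.1 < b.2, k (b.2 - b.1).-1 <= b.1 & b.1 < c (b.2 - b.1).-1])
  /\ (strip_below b -> [/\ b.1 < b.2, k (b.2 - b.1).-1 <= b.1.+1 & b.1.+1 < c (b.2 - b.1).-1]).
Proof.
case: b => i j; rewrite /strip_box /in_diag /= => /andP[/andP[ij ic]]; rewrite ij /= -leqNgt => ki.
split=> /existsP[[i' j']]; rewrite /strip_box /in_diag /= => /and3P[/andP[/andP[ij' ic']] + /eqP e lt].
  rewrite ij' /= -leqNgt => ki'; have ei : i' = i :> nat by rewrite e.
  have ji : i < j by apply: leq_ltn_trans lt; rewrite -ei.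
  have := mono hk (j' - i') ((j - i).-1 - (j' - i')); have := mono hc (j - i).-1 1.
  rewrite subnK; last by lia.
  by rewrite add1n prednK ?subn_gt0 //; rewrite ei in ki' *; split=> //; lia.
rewrite ij' /= -leqNgt => ki'; have ej : j' = j :> nat by rewrite e.
have ji : i < j by apply: leq_trans lt _; rewrite -ej.
have := mono hc (j' - i') ((j - i).-1 - (j' - i')); have := mono hk (j - i).-1 1.
rewrite subnK; last by lia.
by rewrite add1n prednK ?subn_gt0 //; rewrite ej in ki' ic' *; split=> //; lia.
Qed.

Hypothesis bound : forall s, 0 < c s -> c s + s <= L.

Lemma mk_box s i : i < c s -> exists b : box, (b.1 = i :> nat) /\ (b.2 = (i + s)%N :> nat).
Proof.
move=> ic; have cs : 0 < c s by apply: leq_ltn_trans ic.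
have h := bound cs; have i1 : i < L by lia.
have i2 : i + s < L by lia.
by exists (Ordinal i1, Ordinal i2).
Qed.

(** Of two strip boxes on diagonal [s], one is to the left of and the other below a strip box of
    content [s.+1], for which no mark is left. *)
Lemma strip_marks_bad s : k s + 2 <= c s -> \prod_b #|allowed b| = 0.
Proof.
move=> ks; have h1 := hk s; have h2 := hc s.
have [b [b1 b2]] := @mk_box s.+1 (k s) ltac:(lia).
have [p [p1 p2]] := @mk_box s (k s) ltac:(lia).
have [q [q1 q2]] := @mk_box s (k s).+1 ltac:(lia).
have sb : strip_box b.
  by rewrite /strip_box /in_diag b1 b2 leq_addr addKn /= -leqNgt; apply/andP; split; lia.
have sp : strip_box p.
  by rewrite /strip_box /in_diag p1 p2 leq_addr addKn /= -leqNgt; apply/andP; split; lia.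
have sq : strip_box q.
  by rewrite /strip_box /in_diag q1 q2 leq_addr addKn /= -leqNgt; apply/andP; split; lia.
have hl : strip_left b.
  by apply/existsP; exists p; rewrite sp -val_eqE /= p1 p2 b1 b2 eqxx /=; clear; lia.
have hb : strip_below b.
  by apply/existsP; exists q; rewrite sq -val_eqE /= q1 q2 b1 b2 ltnSn andbT /=; clear; lia.
by apply: (prod_eq0 (i := b)); rewrite allowed_card sb hl hb.
Qed.

(** A strip box has both marks at its disposal exactly when no strip box has the content one less,
    that is when it starts a run; every other one has a forced mark. *)
Lemma strip_marks R : uniq R -> (forall s, c s = k s + (s \in R)) ->
  \prod_b #|allowed b| = 2 ^ runs R.
Proof.
move=> uR cR; pose P b := [&& strip_box b, ~~ strip_left b & ~~ strip_below b].
have -> : \prod_b #|allowed b| = \prod_(b | P b) 2.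
  rewrite [RHS]big_mkcond; apply: eq_bigr => b _; rewrite allowed_card /P.
  have [sb|] //= := boolP (strip_box b); have [hl hb] := strip_neighbour sb.
  case: (boolP (strip_left b)) => [/hl[l1 l2 l3]|_]; case: (boolP (strip_below b)) => [/hb[g1 g2 g3]|_] //=.
  have := cR (b.2 - b.1).-1; by case: (_ \in R) => /=; lia.
rewrite prod_nat_const; congr (2 ^ _).
rewrite /runs -size_filter; set Q := filter _ R.
have uQ : uniq Q by rewrite filter_uniq.
have QR s : s \in Q -> s \in R by rewrite mem_filter => /andP[].
have inj : injective (fun b : box => (b.1 : nat, b.2 : nat)) by move=> [a b] [a' b'] [/ord_inj -> /ord_inj ->].
have eP : forall b, P b = ((b.1 : nat, b.2 : nat) \in [seq (k s, (k s + s)%N) | s <- Q]).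
  move=> b; apply/idP/mapP => [|[s sQ [e1 e2]]].
    move=> /and3P[sb nl nb]; exists (b.2 - b.1); move: (sb); rewrite /strip_box /in_diag => /andP[/andP[h1 h2]].
      rewrite h1 /= -leqNgt => h3; have e1 : k (b.2 - b.1) = b.1 by move: (cR (b.2 - b.1)); case: (_ \in R) => /=; lia.
      have inR : b.2 - b.1 \in R by move: (cR (b.2 - b.1)); case: (_ \in R) => //=; lia.
      rewrite mem_filter inR andbT; apply/orP; have [z|nz] := eqVneq (b.2 - b.1) 0; [by left|right].
      apply/negP => inR'; have := cR (b.2 - b.1).-1; rewrite inR' addn1; set s := (b.2 - b.1) in e1 h2 inR nz inR' *.
      have es : s = b.2 - b.1 by []; clearbody s.
      have := hk s.-1; have := hc s.-1; rewrite prednK ?lt0n // => hc' hk' cs'.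
      have [e|e] : k s.-1 = k s \/ k s.-1 = (k s).+1 by lia.
        have [p [p1 p2]] := @mk_box s.-1 (k s) ltac:(lia).
        case/negP: nl; apply/existsP; exists p; rewrite /strip_box /in_diag -val_eqE /= p1 p2 leq_addr addKn /= e1 eqxx e e1.
        by clear -cs' h1 nz es e e1; lia.
      have [p [p1 p2]] := @mk_box s.-1 (k s).+1 ltac:(lia).
      case/negP: nb; apply/existsP; exists p; rewrite /strip_box /in_diag -val_eqE /= p1 p2 leq_addr addKn /= e.
      by clear -cs' h1 nz es e e1; lia.
    rewrite h1 /= -leqNgt => h3; have e1 : k (b.2 - b.1) = b.1 by move: (cR (b.2 - b.1)); case: (_ \in R) => /=; lia.
    by rewrite e1 subnKC.
  have sR := QR s sQ; have es : b.2 - b.1 = s by rewrite e1 e2 addKn.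
  have sb : strip_box b.
    by rewrite /strip_box /in_diag es e1 e2 leq_addr /= cR sR addn1 ltnSn ltnn.
  rewrite /P sb /=; have [hl hb] := strip_neighbour sb; move: hl hb; rewrite es.
  move: sQ; rewrite mem_filter => /andP[sfree _].
  have s0 : b.1 < b.2 -> s != 0 by rewrite e1 e2; lia.
  have nR : b.1 < b.2 -> c s.-1 = k s.-1.
    by move=> /s0/negbTE h; move: sfree; rewrite h /= cR => /negbTE ->; rewrite addn0.
  move=> hl hb; apply/andP; split; apply/negP.
    by move=> /hl[lt h1 h2]; move: (nR lt) h1 h2; lia.
  by move=> /hb[lt h1 h2]; move: (nR lt) h1 h2; have := hk s.-1; rewrite e1; lia.
have um : uniq [seq (k s, (k s + s)%N) | s <- Q] by rewrite map_inj_in_uniq // => s t _ _ [-> /addnI].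
rewrite -[LHS]/#|P| cardE -(size_map (fun b : box => (b.1 : nat, b.2 : nat))) -(size_map (fun s => (k s, (k s + s)%N)) Q).
apply/perm_size/uniq_perm => //; first by rewrite map_inj_uniq ?enum_uniq.
move=> [x y]; apply/mapP/idP => [[b + ->]|/[dup] h /mapP[s sQ [ex ey]]].
  by rewrite mem_enum => Pb; rewrite -eP.
have [b [b1 b2]] := @mk_box s (k s) ltac:(by rewrite cR (QR s sQ) addn1).
exists b; last by rewrite b1 b2 ex ey.
by rewrite mem_enum; change (is_true (P b)); rewrite eP b1 b2; apply: (map_f (fun s => (k s, (k s + s)%N)) sQ).
Qed.
End Strip.

Section Recursion.
Variable n : nat.
Hypothesis nL : n + n < L.

Lemma std_bound T s : std T -> size T <= n -> 0 < mult T s -> mult T s + s <= L.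
Proof.
move=> sT Tn; rewrite mult_gt0 => /(std_lt_size sT) sz.
have := count_size (pred1 s) T; rewrite -/(mult T s) => h.
by apply: leq_trans (ltnW nL); apply: leq_add; [apply: leq_trans Tn | apply: leq_trans (ltnW sz) Tn].
Qed.

Lemma in_diag_le T R : std T -> size T <= n ->
  (forall b, in_diag (mult T) b -> in_diag (mult R) b) -> forall s, mult T s <= mult R s.
Proof.
move=> sT Tn H s; rewrite leqNgt; apply/negP => lt.
have [b [b1 b2]] := mk_box (fun s => @std_bound T s sT Tn) lt.
have := H b; rewrite /in_diag b1 b2 leq_addr addKn lt ltnn /= => /(_ isT); by [].
Qed.

Lemma perm_mult T R : mult T =1 mult R -> perm_eq T R.
Proof. by move=> e; apply/allP => x _; apply/eqP/e. Qed.

Lemma size_mult_le T R : (forall s, mult T s <= mult R s) -> size T <= size R.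
Proof.
by move=> /count_subseqP[S sS /perm_size ->]; apply: size_subseq.
Qed.

Lemma card_diag T : std T -> size T <= n -> #|[pred b | in_diag (mult T) b]| = size T.
Proof.
elim/last_ind: T => [|T a IH]; first by move=> _ _; apply: eq_card0 => b; rewrite inE /in_diag andbF.
move=> sTa; rewrite size_rcons => Tn; have := sTa; rewrite std_rcons => /andP[sT aT].
have [b0 [b1 b2]] : exists b : box, (b.1 = mult T a :> nat) /\ (b.2 = (mult T a + a)%N :> nat).
  apply: (mk_box (c := mult (rcons T a)) (fun s => @std_bound _ s sTa _)); first by rewrite size_rcons.
  by rewrite mult_rcons eqxx addn1.
rewrite -(IH sT (ltnW Tn)) -add1n; have <- : b0 \notin [pred b | in_diag (mult T) b] = 1 :> nat.
  by rewrite inE /in_diag b1 b2 leq_addr addKn ltnn.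
rewrite -cardU1; apply: eq_card => b; rewrite !inE /in_diag mult_rcons.
case: b b0 b1 b2 => [x y] [x0 y0] /= b1 b2; rewrite xpair_eqE -!val_eqE /= b1 b2.
have [e|ne] := eqVneq a (y - x); last first.
  rewrite addn0; case: eqP => //= e1; case: eqP => //= e2; case/eqP: ne; by rewrite e2 e1 addKn.
rewrite addn1 ltnS -e; case: (leqP x y) => [h|h] /=; last first.
  rewrite orbF; apply/esym/negbTE/negP => /andP[/eqP h1 /eqP h2]; move: h; rewrite h1 h2; lia.
by rewrite leq_eqVlt; case: eqP => //= h1; rewrite -h1 e addnC subnK ?eqxx.
Qed.

Lemma code_le u v : symbol_code u <= symbol_code v -> u.1 <= v.1.
Proof. by rewrite /symbol_code; case: u.2; case: v.2 => /=; rewrite -?muln2; lia. Qed.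

(** Because letters increase weakly, those below [j] fill a part closed under moving left and up;
    its diagonal counts satisfy the conditions of [std_of_count]. *)
Lemma lower_shape j T f : std T -> size T <= n -> filling j.+1 (mult T) f ->
  exists2 k, std k /\ size k <= size T & forall b, isSome (lower j f b) = in_diag (mult k) b.
Proof.
move=> sT Tn /and3P[/forallP dom /forallP lowf /forallP cmp]; set c := mult T.
have hc s : c s.+1 <= c s <= (c s.+1).+1 by apply: std_count.
pose dlow i s := [exists b : box, [&& b.1 == i :> nat, b.2 == (i + s)%N :> nat & isSome (lower j f b)]].
have lowP b : isSome (lower j f b) -> exists2 u, f b = Some u & u.1 < j.
  by rewrite ffunE; case: (f b) => // u; case: ifP => // h _; exists u.
have step p q : isSome (lower j f q) -> in_diag c p ->
   ((p.1 == q.1) && (p.2 < q.2)) || ((p.2 == q.2) && (p.1 < q.1)) -> isSome (lower j f p).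
  move=> /lowP[v fq vj] dp h; have := dom p; rewrite dp => /eqP; rewrite ffunE.
  case fp: (f p) => [u|] // _; have /forallP/(_ q) := cmp p; rewrite fp fq /= /compat.
  move=> cmp'; suff -> : u.1 < j by [].
  apply: leq_ltn_trans vj; apply: code_le; move: cmp'.
  by case/orP: h => -> /= /andP[] => [/andP[]|_ /andP[]].
have inc b : isSome (lower j f b) -> in_diag c b by move=> /lowP[u fb _]; have := dom b; rewrite fb => /eqP <-.
have dP i s : dlow i s -> i < c s.
  by move=> /existsP[b /and3P[/eqP b1 /eqP b2 /inc]]; rewrite /in_diag b1 b2 addKn => /andP[].
have mk i s : i < c s -> exists b : box, (b.1 = i :> nat) /\ (b.2 = (i + s)%N :> nat).
  by move=> h; apply: (mk_box (c := c) (fun s => @std_bound T s sT Tn)).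
have dleft i s : dlow i s.+1 -> dlow i s.
  move=> h; have ic := dP _ _ h; have ics : i < c s by case/andP: (hc s) => h1 _; apply: leq_trans h1.
  case/existsP: h => q /and3P[/eqP q1 /eqP q2 lq]; have [p [p1 p2]] := mk _ _ ics.
  apply/existsP; exists p; rewrite p1 p2 !eqxx /=; apply: (step p q) => //.
    by rewrite /in_diag p1 p2 leq_addr addKn.
  by rewrite -!val_eqE /= p1 p2 q1 q2 eqxx addnS ltnSn.
have dup i s : dlow i.+1 s -> dlow i s.+1.
  move=> h; have ic := dP _ _ h; have ics : i < c s.+1 by have := hc s; lia.
  case/existsP: h => q /and3P[/eqP q1 /eqP q2 lq]; have [p [p1 p2]] := mk _ _ ics.
  apply/existsP; exists p; rewrite p1 p2 !eqxx /=; apply: (step p q) => //.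
    by rewrite /in_diag p1 p2 leq_addr addKn.
  by rewrite -!val_eqE /= p1 p2 q1 q2 addSnnS eqxx ltnSn orbT.
have ddown s i d : dlow (i + d) s -> dlow i s.
  by elim: d => [|d IH]; rewrite ?addn0 // addnS => /dup/dleft/IH.
pose k s := find (fun i => ~~ dlow i s) (iota 0 L.+1).
have hasP s : has (fun i => ~~ dlow i s) (iota 0 L.+1).
  apply/hasP; exists L; first by rewrite mem_iota /=.
  by apply/negP => /existsP[b /and3P[/eqP b1 _ _]]; have := ltn_ord b.1; rewrite b1 ltnn.
have kL s : k s < L.+1 by have := hasP s; rewrite has_find size_iota.
have kP i s : dlow i s = (i < k s).
  apply/idP/idP => [h|h].
    rewrite ltnNge; apply/negP => ki; have := nth_find 0 (hasP s); rewrite nth_iota ?kL // add0n.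
    by case/negP; apply: (ddown s _ (i - k s)); rewrite -/(k s) subnKC.
  have := before_find 0 h; rewrite nth_iota ?add0n ?(ltn_trans h) ?kL // => /negbT; by rewrite negbK.
have hk s : k s.+1 <= k s <= (k s.+1).+1.
  apply/andP; split; rewrite leqNgt; apply/negP => h.
    by have := dleft (k s) s; rewrite !kP h ltnn => /(_ isT).
  by have := dup (k s.+1) s; rewrite !kP h ltnn => /(_ isT).
have k0 s : L <= s -> k s = 0.
  move=> Ls; apply/eqP; rewrite -leqn0 leqNgt; apply/negP; rewrite -kP => /existsP[b /and3P[_ /eqP b2 _]].
  by have := ltn_ord b.2; rewrite b2 add0n ltnNge Ls.
have [K sK eK] := std_of_count hk k0; exists K.
  split=> //; apply: size_mult_le => s; rewrite eK leqNgt; apply/negP => h.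
  by have := dP (c s) s; rewrite kP h ltnn => /(_ isT).
move=> b; rewrite /in_diag eK; apply/idP/andP => [h|[b12]].
  have := inc _ h; rewrite /in_diag => /andP[b12 _]; split=> //; rewrite -kP; apply/existsP; exists b.
  by rewrite eqxx subnKC // eqxx h.
rewrite -kP => /existsP[b' /and3P[/eqP e1 /eqP e2]]; rewrite subnKC // in e2.
suff -> : b' = b by []. by case: b b' e1 e2 {b12} => [x y] [x' y'] /= /val_inj -> /val_inj ->.
Qed.

Section Fibre.
Variables (T k : seq nat) (j : nat) (nu : nat -> nat) (g : {ffun box -> option symbol}).
Hypotheses (sT : std T) (Tn : size T <= n) (sk : std k) (kn : size k <= n) (jN : j < N).
Hypothesis kT : forall s, mult k s <= mult T s.
Hypothesis gg : good_fillings j (mult k) nu g.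
Let strip := strip_box (mult T) (mult k).
Let jo : 'I_N := Ordinal jN.

(** Parametrizes a fibre of [lower j]: the strip outside the shape of [g] receives the letter [j],
    marked according to [h]. *)
Definition glue (h : {ffun box -> bool}) : {ffun box -> option symbol} :=
  [ffun b => if g b is Some u then Some u else if strip b then Some (jo, h b) else None].

Let diag_kT b : in_diag (mult k) b -> in_diag (mult T) b.
Proof. by rewrite /in_diag => /andP[-> h]; apply: leq_trans h (kT _). Qed.

Let gdom b : isSome (g b) = in_diag (mult k) b.
Proof. by case/andP: gg => /and3P[/forallP/(_ b)/eqP]. Qed.

Let glow b u : g b = Some u -> u.1 < j.
Proof. by move=> e; case/andP: gg => /and3P[_ /forallP/(_ b)]; rewrite e. Qed.

Lemma lower_glue h : lower j (glue h) = g.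
Proof.
apply/ffunP => b; rewrite !ffunE; case e: (g b) => [u|]; first by rewrite (glow e).
by case: ifP => //; rewrite /= ltnn.
Qed.

Lemma glue_filling h : filling j.+1 (mult T) (glue h) = [forall b, strip b ==> allowed (mult T) (mult k) b (h b)].
Proof.
have hck s : mult k s.+1 <= mult k s <= (mult k s.+1).+1 by apply: std_count.
have code_lt u m : u.1 < j -> symbol_code u < symbol_code (jo, m).
  by rewrite /symbol_code /=; case: u.2; case: m => /=; rewrite -!muln2; lia.
have gl b : glue h b = if g b is Some u then Some u else if strip b then Some (jo, h b) else None by rewrite ffunE.
have sN b : strip b -> g b = None by move=> /andP[_]; rewrite -gdom; case: (g b).
have gs b : strip b -> glue h b = Some (jo, h b) by move=> sb; rewrite gl (sN b sb) sb.
apply/and3P/forallP => [[_ _ /forallP cmp] b|H].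
  apply/implyP => sb; rewrite /allowed -/(strip b) sb; apply/andP; split; apply/negP => /andP[].
    move=> /existsP[p /and3P[sp e lt]] hb; have /forallP/(_ b) := cmp p.
    rewrite (gs p sp) (gs b sb) /ocompat /compat e lt /= /symbol_code /= hb.
    rewrite xpair_eqE eqxx /=; case: (h p) => //=; rewrite -!muln2; by case/andP => /andP[]; lia.
  move=> /existsP[q /and3P[sq e lt]] hb; have /forallP/(_ q) := cmp b.
  rewrite (gs q sq) (gs b sb) /ocompat /compat (eq_sym b.2) e lt /= /symbol_code /= (negbTE hb).
  rewrite andbC xpair_eqE eqxx /=; case: (h q) => /=; rewrite -!muln2; by case/andP => /andP[]; lia.
split.
- apply/forallP => b; rewrite gl; have := gdom b; case: (g b) => [u|] /= e.
    by rewrite eq_sym; apply/eqP/diag_kT; rewrite -e.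
  by rewrite /strip /strip_box -e andbT; case: (in_diag (mult T) b).
- apply/forallP => b; rewrite gl; case e: (g b) => [u|] /=; first by apply: ltnW; apply: glow e.
  by case: (strip b) => /=.
apply/forallP => p; apply/forallP => q; rewrite !gl.
case ep: (g p) => [u|]; case eq: (g q) => [v|].
- by case/andP: gg => /and3P[_ _ /forallP/(_ p)/forallP/(_ q)]; rewrite ep eq.
- case: ifP => //= sq; have uq := code_lt u (h q) (glow ep); rewrite /compat (ltnW uq) /=.
  have -> : eq_op u (jo, h q) = false by apply/eqP => e; move: uq; rewrite e ltnn.
  by rewrite !implybT.
- case: ifP => //= sp; have dq : in_diag (mult k) q by rewrite -gdom eq.
  rewrite /compat; apply/andP; split; apply/implyP => /andP[/eqP e lt]; exfalso.
    case/andP: sp => /andP[p12 _]; case/negP; rewrite /in_diag p12 /=; case/andP: dq => q12; rewrite -e.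
    move=> h'; apply: leq_trans h' _; have := mono hck (p.2 - p.1) (q.2 - p.2).
    have en : q.2 - p.2 + (p.2 - p.1) = q.2 - p.1 := subn_chain p12 (ltnW lt).
    by rewrite en => /andP[h1 _].
  case/andP: sp => /andP[p12 _]; case/negP; rewrite /in_diag p12 /=; case/andP: dq => q12; rewrite -e in q12 *.
  have := mono hck (p.2 - q.1) (q.1 - p.1).
  rewrite addnC (subn_chain (ltnW lt) q12) => /andP[_ h1] h2.
  by have := leq_trans h2 h1; rewrite -{1}(subnKC (ltnW lt)) ltn_add2r.
case: ifP => //= sp; case: ifP => //= sq; rewrite /compat.
have /implyP/(_ sp) := H p; have /implyP/(_ sq) := H q; rewrite /allowed -!/(strip _) sp sq => /andP[hq _] /andP[_ hp].
apply/andP; split; apply/implyP => /andP[e lt].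
  have hl : strip_left (mult T) (mult k) q by apply/existsP; exists p; rewrite -/(strip p) sp e lt.
  move: hq; rewrite hl /= /symbol_code xpair_eqE eqxx /=; case: (h q) => // _; case: (h p) => //=; rewrite ?leqnn ?andbF //.
  by rewrite leq_add2l.
have hb : strip_below (mult T) (mult k) p by apply/existsP; exists q; rewrite -/(strip q) sq eq_sym e lt.
move: hp; rewrite hb /= negbK /symbol_code xpair_eqE eqxx /=; case: (h p) => // _; case: (h q) => //=; rewrite ?leqnn ?andbF //.
by rewrite leq_add2l.
Qed.

Lemma card_strip : #|[pred b | strip b]| = size T - size k.
Proof.
rewrite -(card_diag sT Tn) -(card_diag sk kn); apply/eqP; rewrite -(eqn_add2r #|[pred b | in_diag (mult k) b]|) subnK.
  rewrite addnC -cardUI [X in _ + X]eq_card0 ?addn0; last by move=> b; rewrite !inE /strip /strip_box; case: in_diag; rewrite ?andbF.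
  apply/eqP/eq_card => b; rewrite !inE /strip /strip_box; have := @diag_kT b.
  by case: (in_diag (mult k) b) => [->|_]; rewrite ?andbT.
by apply/subset_leq_card/subsetP => b; rewrite !inE; apply: diag_kT.
Qed.

Lemma letter_count_glue h : letter_count (glue h) j = size T - size k.
Proof.
rewrite -card_strip; apply: eq_card => b; rewrite !inE ffunE; case e: (g b) => [u|] /=.
  by rewrite (ltn_eqF (glow e)) /strip /strip_box -gdom e andbF.
by case: (strip b) => //=; rewrite eqxx.
Qed.

Lemma letter_count_glue_low h (i : 'I_N) : i < j -> letter_count (glue h) i = letter_count g i.
Proof.
move=> ij; apply: eq_card => b; rewrite !inE ffunE; case: (g b) => //=.
by case: (strip b) => //=; rewrite (gtn_eqF ij).
Qed.

Lemma fibre_card : #|[pred f | good_fillings j.+1 (mult T) nu f && (lower j f == g)]|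
  = if size T == size k + nu j :> nat then \prod_b #|allowed (mult T) (mult k) b| else 0.
Proof.
have szkT : size k <= size T by apply: size_mult_le.
have cnt h : [forall i : 'I_N, (i < j.+1) ==> (letter_count (glue h) i == nu i :> nat)] = (size T == size k + nu j :> nat).
  apply/forallP/eqP => [H|e i].
    have := H jo; rewrite /= ltnSn letter_count_glue /= => /eqP <-; by rewrite subnKC.
  apply/implyP; rewrite ltnS leq_eqVlt => /orP[/eqP ei|ij].
    by rewrite ei letter_count_glue e addKn.
  rewrite letter_count_glue_low //; by case/andP: gg => _ /forallP/(_ i)/implyP/(_ ij).
case: ifP => [e|ne]; last first.
  apply: eq_card0 => f; rewrite inE /= -topredE /=; apply/negP => /andP[/andP[fl /forallP fc] /eqP lf].
  have cj : letter_count f j = nu j by have /implyP/(_ (ltnSn j))/eqP := fc jo.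
  move/eqP: ne; apply; rewrite -cj.
  have dom b : isSome (f b) = in_diag (mult T) b by case/and3P: fl => /forallP/(_ b)/eqP.
  have lowf b u : f b = Some u -> u.1 <= j by move=> eb; case/and3P: fl => _ /forallP/(_ b); rewrite eb.
  have -> : letter_count f j = #|[pred b | strip b]|.
    apply: eq_card => b; rewrite !inE /strip /strip_box -dom -gdom -lf ffunE.
    case eb: (f b) => [u|] //=; have := lowf _ _ eb; rewrite leq_eqVlt; case: (ltngtP u.1 j) => //.
  by rewrite card_strip subnKC.
have -> : \prod_b #|allowed (mult T) (mult k) b| = #|[set h : {ffun box -> bool} in family (allowed (mult T) (mult k))]|.
  by rewrite cardsE card_family foldrE big_image.
have inj : {in [set h : {ffun box -> bool} in family (allowed (mult T) (mult k))] &, injective glue}.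
  move=> h h'; rewrite !inE => /familyP ha /familyP ha' eh; apply/ffunP => b.
  have := ha b; have := ha' b; rewrite !unfold_in /= /allowed; case: (boolP (strip_box (mult T) (mult k) b)) => [sb _ _|_].
    have gN : g b = None by move: sb => /andP[_]; rewrite -gdom; case: (g b).
    by move/ffunP/(_ b): eh; rewrite !ffunE gN /strip sb => -[].
  by case: (h b); case: (h' b).
rewrite -(card_in_imset inj); apply: eq_card => f; rewrite inE; apply/idP/imsetP => [/andP[/andP[fl fc] /eqP lf]|[h]].
  have dom b : isSome (f b) = in_diag (mult T) b by case/and3P: fl => /forallP/(_ b)/eqP.
  have lowf b u : f b = Some u -> u.1 <= j by move=> eb; case/and3P: fl => _ /forallP/(_ b); rewrite eb.
  pose h : {ffun box -> bool} := [ffun b => strip b && (if f b is Some u then u.2 else false)].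
  have fh : f = glue h.
    apply/ffunP => b; rewrite !ffunE; have lb : lower j f b = g b by rewrite lf.
    move: lb; rewrite ffunE; have := dom b; have := gdom b; rewrite /strip /strip_box.
    case eb: (f b) => [u|]; last by move=> _ /= <- <-.
    case: ifP => uj; first by move=> _ _ <-.
    move=> + /= <- eg; rewrite -eg /= => <- /=; congr (Some _); have := lowf _ _ eb.
    by case: u uj {eb} => x y /= /negbT; rewrite -leqNgt => h1 h2; congr (_, _); apply/val_inj/eqP; rewrite /= eqn_leq h1 h2.
  exists h => //; rewrite inE; apply/familyP => b; rewrite unfold_in /= /allowed.
  case: (boolP (strip_box _ _ b)) => sb; last by rewrite ffunE /strip (negbTE sb).
  have := glue_filling h; rewrite -fh fl => /esym/forallP/(_ b); rewrite /strip sb /= /allowed sb; exact.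
rewrite inE => /familyP ha ->; rewrite lower_glue eqxx andbT /good_fillings /= cnt e andbT glue_filling.
by apply/forallP => b; apply/implyP => _; apply: ha.
Qed.
End Fibre.

Lemma branch_prod T k : std T -> size T <= n -> std k -> (forall s, mult k s <= mult T s) ->
  \prod_b #|allowed (mult T) (mult k) b| = branch T k.
Proof.
move=> sT Tn sk kT; have hcT s : mult T s.+1 <= mult T s <= (mult T s.+1).+1 by apply: std_count.
have hck s : mult k s.+1 <= mult k s <= (mult k s.+1).+1 by apply: std_count.
have bd s : 0 < mult T s -> mult T s + s <= L by apply: std_bound.
case: (branch_dec T k) => [[R uR p]|H].
  rewrite (branchE uR p); apply: strip_marks => // s.
  by rewrite (eq_mult p) mult_cat (count_uniq_mem s uR : mult R s = _).
rewrite (branch0 H).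
have [s ks|ns] := pickP (fun s : 'I_L => mult k s + 2 <= mult T s).
  exact: (strip_marks_bad hcT hck bd ks).
case: (H (strip_part T k) (strip_part_uniq T k)); apply: perm_mult => s.
rewrite mult_cat (count_uniq_mem s (strip_part_uniq T k) : mult (strip_part T k) s = _) mem_filter mem_undup.
rewrite mem_mult; have [z|nz] := posnP (mult T s); first by have := kT s; rewrite z; lia.
have sL : s < L by have := bd s nz; lia.
by have := ns (Ordinal sL); have := kT s; rewrite /= andbT; case: ltnP => /=; lia.
Qed.

Lemma good_fillings_step T j nu : std T -> size T <= n -> j < N ->
  #|good_fillings j.+1 (mult T) nu|
  = \sum_(k <- shapes n | size T == size k + nu j) branch T k * #|good_fillings j (mult k) nu|.
Proof.
move=> sT Tn jN; pose agree (k : seq nat) (f : {ffun box -> option symbol}) :=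
  [forall b, isSome (lower j f b) == in_diag (mult k) b].
rewrite -sum1_card.
transitivity (\sum_(f in good_fillings j.+1 (mult T) nu) \sum_(k <- shapes n | agree k f) 1).
  apply: eq_bigr => f fg; have [K [sK szK] eK] := lower_shape sT Tn (andP fg).1.
  have Kn : size K <= n by apply: leq_trans Tn.
  rewrite -[LHS](@big_shape_nat n (fun=> 1) K sK Kn) [LHS]big_seq_cond [RHS]big_seq_cond.
  apply: eq_bigl => k; have [/shapesP[sk kn _]|//] := boolP (k \in shapes n); rewrite /=.
  apply/idP/forallP => [p b|H]; first by rewrite eK /in_diag (eq_mult p).
  apply: perm_mult => s; apply/eqP; rewrite eqn_leq !in_diag_le // => b; have := H b; rewrite eK => /eqP; by [move<-|move->].
rewrite (exchange_big_dep xpredT) //= big_seq_cond [RHS]big_seq_cond.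
rewrite [RHS]big_mkcond [LHS]big_mkcond; apply: eq_bigr => k _.
have [/shapesP[sk kn _]|//] := boolP (k \in shapes n); rewrite /= ?andbT.
have [kT|nkT] := boolP (all (fun s => mult k s <= mult T s) k); last first.
  have -> : branch T k = 0.
    apply: branch0 => R uR p; case/negP: nkT; apply/allP => s _; by rewrite (eq_mult p) mult_cat leq_addr.
  rewrite mul0n if_same big1 // => f /andP[fg /forallP ag]; case/negP: nkT; apply/allP => s _.
  apply: in_diag_le => // b; rewrite -(eqP (ag b)) ffunE; case/andP: fg => /and3P[/forallP/(_ b)/eqP <- _ _] _.
  by case: (f b).
have {}kT s : mult k s <= mult T s.
  have [sk'|/count_memPn e] := boolP (s \in k); first exact: (allP kT).
  by rewrite /mult e.
rewrite -(branch_prod sT Tn sk kT) (partition_big (lower j) (good_fillings j (mult k) nu)) /=; last first.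
  move=> f /andP[/andP[/and3P[/forallP dom /forallP lowf /forallP cmp] /forallP fc] /forallP ag].
  apply/andP; split; last first.
    apply/forallP => i; apply/implyP => ij; have /implyP := fc i; rewrite ltnS (ltnW ij) => /(_ isT).
    move=> /eqP <-; apply/eqP/eq_card => b; rewrite !inE ffunE; case: (f b) => // u /=; case: ifP => //= uj.
    by apply/esym/negbTE/eqP => e; rewrite e ij in uj.
  apply/and3P; split; first exact/forallP.
    by apply/forallP => b; rewrite ffunE; case: (f b) => // u; case: ifP.
  apply/forallP => p; apply/forallP => q; have /forallP/(_ q) := cmp p; rewrite !ffunE.
  by case: (f p) => [u|] //=; case: ifP => //= _; case: (f q) => [v|] //=; case: ifP.
transitivity (\sum_(g in good_fillings j (mult k) nu)
   (if size T == size k + nu j :> nat then \prod_b #|allowed (mult T) (mult k) b| else 0)); last first.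
  by case: ifP => _; rewrite sum_nat_const ?muln0 // mulnC.
apply: eq_bigr => g gg; rewrite -(fibre_card sT Tn sk kn jN kT gg) -sum1_card; apply: eq_bigl => f.
rewrite [RHS]inE /= -[f \in _]topredE /=; case: (boolP (eq_op (lower j f) g)) => [/eqP e|]; rewrite ?andbF ?andbT //.
have -> : agree k f = true; last by rewrite andbT.
apply/forallP => b; rewrite e; by case/andP: gg => /and3P[/forallP/(_ b)].
Qed.

(** Exponents from the last variable to the first, the order in which [kostka] consumes them. *)
Fixpoint content_list (nu : nat -> nat) j := if j is j'.+1 then nu j' :: content_list nu j' else [::].

Theorem card_good_fillings T j nu : std T -> size T <= n -> j <= N ->
  #|good_fillings j (mult T) nu| = kostka n T (content_list nu j).
Proof.
elim: j T => [|j IH] T sT Tn jN.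
  have gE f : f \in good_fillings 0 (mult T) nu = (f == [ffun=> None]) && nilp T.
    apply/andP/andP => [[/and3P[/forallP dom /forallP lowf _] _]|[/eqP -> /nilP ->]].
      have fN b : f b = None by have := lowf b; case: (f b).
      split; first by apply/eqP/ffunP => b; rewrite ffunE.
      have := card_diag sT Tn; rewrite eq_card0 => [e|b]; first by rewrite /nilp -e.
      by rewrite inE -(eqP (dom b)) fN.
    split; last by apply/forallP.
    apply/and3P; split; [|by apply/forallP => b; rewrite ffunE|].
      by apply/forallP => b; rewrite ffunE /in_diag andbF.
    by apply/forallP => p; apply/forallP => q; rewrite !ffunE.
  rewrite /=; case nT: (nilp T); last by apply: eq_card0 => f; rewrite gE nT andbF.
  rewrite -[RHS](card1 ([ffun=> None] : {ffun box -> option symbol})); apply: eq_card => f.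
  by rewrite gE nT andbT.
rewrite good_fillings_step //= big_seq_cond [RHS]big_seq_cond; apply: eq_bigr => k /andP[/shapesP[sk kn _] _].
by rewrite IH // ltnW.
Qed.
End Recursion.
End Fillings.
End ShiftedFillings.

Local Open Scope bool_scope.
Local Open Scope ring_scope.

Section LinearMaps.
Variables (K : fieldType) (V W : vectType K) (f : 'Hom(V, W)).
Lemma lfunZ t v : f (t *: v) = t *: f v. Proof. exact: linearZ. Qed.
Lemma lfunD v w : f (v + w) = f v + f w. Proof. exact: linearD. Qed.
Lemma lfun_sum (I : Type) (r : seq I) (P : pred I) (F : I -> V) :
  f (\sum_(i <- r | P i) F i) = \sum_(i <- r | P i) f (F i).
Proof. exact: linear_sum. Qed.
End LinearMaps.

Section Action.
Variables (K : fieldType) (N n : nat).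
Implicit Types y z : sergeev K n.

Lemma sergeev_actP t y z : sergeev_act N (t *: y + z) = t *: sergeev_act N y + sergeev_act N z.
Proof. exact: sergeev_act_linear. Qed.

Lemma sergeev_actD y z : sergeev_act N (y + z) = sergeev_act N y + sergeev_act N z.
Proof. by have := sergeev_actP 1 y z; rewrite !scale1r. Qed.

Lemma sergeev_act0 : sergeev_act N (0 : sergeev K n) = 0.
Proof. by apply: (addrI (sergeev_act N (0 : sergeev K n))); rewrite -sergeev_actD !addr0. Qed.

Lemma sergeev_actZ t y : sergeev_act N (t *: y) = t *: sergeev_act N y.
Proof. by have := sergeev_actP t y 0; rewrite sergeev_act0 !addr0. Qed.
End Action.

(** * Commutation of the two actions on the tensor power *)

Section Commutation.
Variables (K : fieldType) (N n : nat).
Local Notation S := (sergeev K n).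
Local Notation act := (sergeev_act N).
Local Notation word := (multi_index N n).
Local Notation elt := (@sergeev_elt K n).
Implicit Types (I J : {set 'I_n}) (g : sergeev_index n) (l : word) (a : 'I_n) (i j : super_index N).

Definition before I a : bool := \big[addb/false]_(b < n | (b < a)%N) (b \in I).

Lemma odd_cardE I : odd #|I| = \big[addb/false]_b (b \in I).
Proof.
rewrite -sum1_card (big_morph odd oddD (erefl _ : odd 0 = false)).
by rewrite [LHS]big_mkcond; apply: eq_bigr => a _; case: (a \in I).
Qed.

Lemma clifford_sign_set1r I a : clifford_sign I [set a] = odd #|I| (+) before I a.
Proof.
rewrite /clifford_sign odd_cardE /before [X in _ (+) X]big_mkcond -big_split; apply: eq_bigr => b _ /=.
rewrite (bigD1 a) //= big1 ?addbF => [|c ca]; last by rewrite !inE (negbTE ca) andbF.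
by rewrite !inE eqxx /=; case: (b \in I); case: (ltnP b a).
Qed.

Lemma before_symdiff I J a : before (symdiff I J) a = before I a (+) before J a.
Proof. by rewrite /before -big_split; apply: eq_bigr => b _; rewrite inE. Qed.

Lemma odd_beforeE l a : odd_before l a = before (odd_places l) a.
Proof. by apply: eq_bigr => b _; rewrite inE. Qed.

Lemma odd_places_update l a i : odd_places (update l a i)
  = if i.1 (+) (l a).1 then symdiff (odd_places l) [set a] else odd_places l.
Proof.
apply/setP => b; case: ifP => d; rewrite !inE ffunE; case: (eqVneq b a) => [->|_] //=;
  rewrite ?addbF //; by move: d; case: i.1; case: (l a).1.
Qed.

Lemma inversion_sign_set1 (p : 'S_n) a : inversion_sign p [set a] = false.
Proof.
rewrite /inversion_sign big1 // => i _; rewrite big1 // => j _.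
by rewrite !inE; case: eqP => //= ->; case: eqP => //= ->; rewrite ltnn.
Qed.

Lemma act_sign_update g l a i : act_sign g (update l a i) = act_sign g l
  (+) (i.1 (+) (l a).1)
      && (before (odd_places l) a (+) before (odd_places (act_index g l)) (g.2 a) (+) odd #|g.1|).
Proof.
rewrite /act_sign odd_places_update odd_places_act; case: (i.1 (+) (l a).1); last by rewrite addbF.
rewrite inversion_signD perm_imset_symdiff imset_set1 clifford_signDr !clifford_sign_set1r.
rewrite before_symdiff inversion_sign_set1 card_imset; last exact: perm_inj.
case: (odd #|g.1|); case: (odd #|odd_places l|); case: (inversion_sign _ (odd_places l));
case: (before (odd_places l) a); case: (before (_ @: _) _); case: (before g.1 _);
by case: (clifford_sign g.1 _).
Qed.

Lemma act_index_update g l a i : act_index g (update l a i)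
  = update (act_index g l) (g.2 a) (if g.2 a \in g.1 then opp_index i else i).
Proof.
apply/ffunP => b; rewrite !ffunE; have [->|ba] := eqVneq b (g.2 a); first by rewrite permK eqxx.
have e : ((g.2^-1)%g b == a) = false by apply: contraNF ba => /eqP <-; rewrite permKV.
by rewrite !e.
Qed.

Lemma in_copy_linear a c X Y : in_copy a (c *: X + Y) = c *: in_copy a X + in_copy a Y :> 'End(tensor_space K N n).
Proof.
apply: entryP => k l.
rewrite [RHS]/entry add_lfunE scale_lfunE !ffunE.
rewrite -[in_copy a X _ k]/(entry (in_copy a X) k l) -[in_copy a Y _ k]/(entry (in_copy a Y) k l) !entry_operator.
case: ifP => _; last by rewrite scaler0 addr0.
by rewrite /entry add_lfunE scale_lfunE !ffunE mulrDr /GRing.scale /= mulrCA.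
Qed.

Lemma act_basis g l : act (elt g) (basis_elt K l) = (-1) ^+ act_sign g l *: basis_elt K (act_index g l).
Proof. by rewrite sergeev_actE twisted_basis. Qed.

Lemma unit_act g a i j l : let o := g.2 a \in g.1 in
  let op (t : super_index N) := if o then opp_index t else t in
  in_copy (g.2 a) (matrix_unit K i j) (act (elt g) (basis_elt K l))
  = (-1) ^+ ((i.1 (+) j.1) && odd #|g.1|)
      *: act (elt g) (in_copy a (matrix_unit K (op i) (op j)) (basis_elt K l)).
Proof.
move=> o op; have opK : involutive op by move=> t; rewrite /op; case: (o); rewrite ?opp_indexK.
have op1 : (op i).1 (+) (op j).1 = i.1 (+) j.1.
  by rewrite /op; case: (o) => //=; rewrite addbN addNb negbK.
rewrite act_basis !lfunZ !in_copy_matrix_unit !lfunZ act_basis act_index_update -/(op _) opK.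
have -> : (act_index g l (g.2 a) == j) = (l a == op j).
  by rewrite ffunE permK -/o /op; case: (o) => //; rewrite (inv_eq (@opp_indexK N)).
have [e|_] := eqVneq (l a) (op j); last by rewrite !mulr0 !scale0r !scaler0.
rewrite !mulr1 !scalerA -!signr_addb op1; congr (_ ^+ nat_of_bool _ *: _).
rewrite act_sign_update e op1 !odd_beforeE.
case: (i.1 (+) j.1) => /=; last by rewrite !addbF.
case: (act_sign g l); case: (odd #|g.1|); case: (before (odd_places l) a); by case: (before _ _).
Qed.

(** Passing a [c_a] turns the unit with indices [i], [j] into the one with the opposite indices, so
    it only swaps the two halves of [queer_F]; the sign is that of the super commutation rule. *)
Lemma queer_act g a i j l :
  in_copy (g.2 a) (queer_F K i j) (act (elt g) (basis_elt K l))
  = (-1) ^+ ((i.1 (+) j.1) && odd #|g.1|) *: act (elt g) (in_copy a (queer_F K i j) (basis_elt K l)).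
Proof.
have Q (b : 'I_n) v : in_copy b (queer_F K i j) v
    = in_copy b (matrix_unit K i j) v + in_copy b (matrix_unit K (opp_index i) (opp_index j)) v.
  by rewrite /queer_F -[matrix_unit K i j in LHS]scale1r in_copy_linear scale1r add_lfunE.
rewrite !Q lfunD scalerDr !unit_act.
have -> : (opp_index i).1 (+) (opp_index j).1 = i.1 (+) j.1 by rewrite /=; case: i.1; case: j.1.
by case: ifP => _ //; rewrite !opp_indexK addrC.
Qed.

(** Even words suffice: the Jucys-Murphy elements, hence the idempotents, contain the [c_a] only in
    pairs. *)
Lemma tensor_act g i j v : ~~ odd #|g.1| ->
  tensor_action n (queer_F K i j) (act (elt g) v) = act (elt g) (tensor_action n (queer_F K i j) v).
Proof.
move=> /negbTE ev; rewrite (basis_decomp v) !lfun_sum; apply: eq_bigr => l _; rewrite !lfunZ; congr (_ *: _).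
rewrite /tensor_action !sum_lfunE lfun_sum (reindex_inj (@perm_inj _ g.2)); apply: eq_bigr => a _.
by rewrite queer_act ev andbF scale1r.
Qed.

Section Element.
Variables i j : super_index N.
Local Notation F := (tensor_action n (queer_F K i j)).
Definition commutes (y : S) := forall v, F (act y v) = act y (F v).

Lemma commutes_mul y z : commutes y -> commutes z -> commutes (y * z).
Proof. by move=> hy hz v; rewrite !sergeev_actM !comp_lfunE hy hz. Qed.

Lemma commutes_lin t y z : commutes y -> commutes z -> commutes (t *: y + z).
Proof. by move=> hy hz v; rewrite !sergeev_actP !add_lfunE !scale_lfunE lfunD lfunZ hy hz. Qed.

Lemma commutes_one : commutes 1.
Proof. by move=> v; rewrite sergeev_act1 !id_lfunE. Qed.

Lemma commutes_zero : commutes 0.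
Proof. by move=> v; rewrite sergeev_act0 !zero_lfunE linear0. Qed.

Lemma commutes_jm m : commutes (jucys_murphy K n m).
Proof.
have cD y z : commutes y -> commutes z -> commutes (y + z).
  by move=> hy hz; have := commutes_lin 1 hy hz; rewrite scale1r.
rewrite /jucys_murphy; elim/big_ind: _ => [||b _]; [exact: commutes_zero|exact: cD|].
elim/big_ind: _ => [||a ab]; [exact: commutes_zero|exact: cD|].
apply: commutes_mul; first by move=> v; apply: tensor_act; rewrite cards0.
apply: cD; first exact: commutes_one.
rewrite /clifford_gen sergeev_elt_mul -[_ *: _]addr0; apply: commutes_lin; last exact: commutes_zero.
by move=> v; apply: tensor_act; rewrite /= imset_perm1 odd_card_symdiff !cards1.
Qed.
End Element.
End Commutation.

Section QueerSubmodule.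
Variables (C : numClosedFieldType) (N n : nat).
Local Notation act := (sergeev_act N).

Lemma commutes_tableau (i j : super_index N) U m : commutes i j (idempotent_upto C n U m).
Proof.
elim: m => [|m IH] /=; first exact: commutes_one.
apply: commutes_mul => //; rewrite /idempotent_step -[_ *: _]addr0.
apply: commutes_lin; last exact: commutes_zero.
elim/big_ind: _ => [||b _]; [exact: commutes_one|exact: commutes_mul|].
rewrite addrC -scaleNr; apply: commutes_lin; [exact: commutes_one|exact: commutes_jm].
Qed.

Lemma queer_submodule_tableau U m : queer_submodule (limg (act (idempotent_upto C n U m))).
Proof.
move=> X XA; set E := act _.
have FE : forall v, tensor_action n X (E v) = E (tensor_action n X v).
  move=> v; rewrite /queer_algebra in XA; set r := [seq _ | _ <- _, _ <- _] in XA.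
  have lin b (I : Type) (t : seq I) (c : I -> C) (Y : I -> 'End(superspace C N)) :
      in_copy b (\sum_(k <- t) c k *: Y k) = \sum_(k <- t) c k *: in_copy b (Y k) :> 'End(tensor_space C N n).
    elim: t => [|k t IH]; last by rewrite !big_cons in_copy_linear IH.
    rewrite !big_nil; have := @in_copy_linear C N n b (-1) 0 0.
    by rewrite !scaleN1r oppr0 addr0 => ->; rewrite addNr.
  rewrite (coord_span (X := in_tuple r) XA) /tensor_action !sum_lfunE lfun_sum.
  set cf := (fun k => coord (in_tuple r) k X).
  have key b (w : tensor_space C N n) : in_copy b (\sum_(k < size r) cf k *: (in_tuple r)`_k) w = \sum_(k < size r) cf k *: in_copy b r`_k w.
    by rewrite lin sum_lfunE; apply: eq_bigr => k _; rewrite scale_lfunE.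
  rewrite (eq_bigr _ (fun b _ => key b (E v))) [RHS](eq_bigr _ (fun b _ => congr1 E (key b v))).
  rewrite [RHS](eq_bigr (fun b => \sum_(k < size r) cf k *: E (in_copy b r`_k v))) => [|b _]; last first.
    by rewrite lfun_sum; apply: eq_bigr => k _; rewrite lfunZ.
  rewrite [LHS]exchange_big [RHS]exchange_big; apply: eq_bigr => k _ /=.
  have : r`_k \in r by apply: mem_nth.
  case/allpairsP => [[i j]] /= [_ _ ->].
  rewrite -!scaler_sumr; congr (_ *: _); have := @commutes_tableau i j U m v.
  by rewrite /tensor_action !sum_lfunE lfun_sum.
apply/subvP => w /memv_imgP[u /memv_imgP[v _ ->] ->]; rewrite FE; exact: memv_img (memvf _).
Qed.
End QueerSubmodule.

(** * Weights of the tensor power *)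

Lemma lfun_entry (K : fieldType) (I : finType) (f : 'End({ffun I -> K^o})) v i :
  f v i = \sum_j entry f i j * v j.
Proof.
rewrite {1}(basis_decomp v) linear_sum sum_ffunE; apply: eq_bigr => j _.
by rewrite linearZ ffunE mulrC.
Qed.

Lemma idempotent_trace (K : fieldType) (I : finType) (f : 'End({ffun I -> K^o})) :
  (f \o f)%VF = f -> \sum_i entry f i i = (\dim (limg f))%:R.
Proof.
move=> ff; pose b := vbasis (limg f).
have fb k : f b`_k = b`_k \/ b`_k = 0.
  have [kl|kg] := ltnP k (size b); last by right; rewrite nth_default.
  left; have /memv_imgP[v _ ->] : b`_k \in limg f by apply/vbasis_mem/mem_nth.
  by rewrite -comp_lfunE ff.
transitivity (\sum_(k < \dim (limg f)) coord b k b`_k); last first.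
  transitivity (\sum_(k < \dim (limg f)) (1 : K)); last by rewrite sumr_const card_ord.
  by apply: eq_bigr => k _; rewrite coord_free ?eqxx // (basis_free (vbasisP _)).
transitivity (\sum_i \sum_(k < \dim (limg f)) coord b k (f (basis_elt K i)) * b`_k i).
  apply: eq_bigr => i _; rewrite /entry {1}(coord_vbasis (memv_img f (memvf (basis_elt K i)))) sum_ffunE.
  by apply: eq_bigr => k _; rewrite ffunE.
rewrite exchange_big; apply: eq_bigr => k _ /=.
have -> : b`_k = f b`_k by case: (fb k) => // ->; rewrite linear0.
rewrite [in RHS](basis_decomp b`_k) !linear_sum; apply: eq_bigr => i _.
by rewrite !linearZ mulrC; case: (fb k) => [->|->] //; rewrite linear0.
Qed.

Lemma sum_leq_eq (I : eqType) (r : seq I) (F G : I -> nat) :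
  (forall i, i \in r -> (F i <= G i)%N) -> (\sum_(i <- r) G i <= \sum_(i <- r) F i)%N ->
  forall i, i \in r -> F i = G i.
Proof.
elim: r => // i r IH H; rewrite !big_cons => le.
have Hr : forall j, j \in r -> (F j <= G j)%N by move=> j jr; apply: H; rewrite inE jr orbT.
have Hi : (F i <= G i)%N by apply: H; rewrite mem_head.
have s : (\sum_(j <- r) F j <= \sum_(j <- r) G j)%N by rewrite big_seq [leqRHS]big_seq; apply: leq_sum.
have ei : F i = G i by apply/eqP; rewrite eqn_leq Hi /= -(leq_add2r (\sum_(j <- r) G j)%N) (leq_trans le) // leq_add2l.
move=> j; rewrite inE => /orP[/eqP -> //|]; apply: IH => //.
by rewrite ei leq_add2l in le.
Qed.

Lemma size_content_list f j : size (content_list f j) = j.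
Proof. by elim: j => //= j ->. Qed.

Lemma all_content_list f m j : (forall i, (f i <= m)%N) -> all (fun a => (a <= m)%N) (content_list f j).
Proof. by move=> H; elim: j => //= j ->; rewrite H. Qed.

Section Tensor.
Variables (C : numClosedFieldType) (N n : nat).
Local Notation S := (sergeev C n).
Local Notation act := (sergeev_act N).
Local Notation word := (multi_index N n).
Local Notation V := (tensor_space C N n).
Local Notation c := (@sergeev_c C n).
Local Notation s := (@sergeev_s C n).
Local Notation x := (jucys_murphy C n).
Local Notation eproj := (@eproj C (sergeev C n) x).
Local Notation pe := (@perm_elt C n).
Implicit Types (y z : S) (k l w : word) (mu : seq nat) (T : seq nat).

Definition letter_content l (i : nat) : nat := #|[pred a | (l a).2 == i :> nat]|.
Definition word_content l := content_list (letter_content l) N.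

Lemma eq_content_list (f g : nat -> nat) j : (forall i, (i < j)%N -> f i = g i) -> content_list f j = content_list g j.
Proof.
by elim: j => //= j IH H; rewrite H // IH // => i ij; apply: H; apply: ltnW.
Qed.

Lemma content_list_inj (f g : nat -> nat) j : content_list f j = content_list g j ->
  forall i, (i < j)%N -> f i = g i.
Proof.
elim: j => //= j IH [e /IH H] i; rewrite ltnS leq_eqVlt => /orP[/eqP -> //|]; exact: H.
Qed.

Lemma word_content_act g l : word_content (act_index g l) = word_content l.
Proof.
apply: eq_content_list => i _; rewrite /letter_content -!sum1_card [RHS](reindex_inj (@perm_inj _ (g.2^-1)%g)).
apply: eq_bigl => a; rewrite !inE ffunE; by case: (a \in g.1).
Qed.

Lemma entry_actE y k l : entry (act y) k l = \sum_g y g * ((-1) ^+ act_sign g l * (k == act_index g l)%:R).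
Proof.
rewrite /entry sergeev_actE /twisted sum_ffunE; apply: eq_bigr => g _.
rewrite sum_ffunE (bigD1 l) //= big1 ?addr0 => [|m ml]; last by rewrite !ffunE (negbTE ml) !mulr0 scale0r.
by rewrite !ffunE eqxx mulr1 /GRing.scale /= mulrA [y g * _]mulrC.
Qed.

Lemma entry_act0 y k l : word_content k != word_content l -> entry (act y) k l = 0.
Proof.
move=> ne; rewrite entry_actE big1 // => g _; case: eqP => [e|_]; last by rewrite !mulr0.
by rewrite e word_content_act eqxx in ne.
Qed.

Definition wproj mu : 'End(V) := operator (fun k l => ((k == l) && (word_content l == mu))%:R).

Lemma wprojE mu (v : V) k : wproj mu v k = if word_content k == mu then v k else 0.
Proof.
rewrite operatorE (bigD1 k) //= eqxx big1 ?addr0 => [|l lk]; last by rewrite eq_sym (negbTE lk) mul0r.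
by case: eqP; rewrite /= ?mul1r ?mul0r.
Qed.

Lemma wproj_idem mu : (wproj mu \o wproj mu)%VF = wproj mu.
Proof. by apply/lfunP => v; apply/ffunP => k; rewrite comp_lfunE !wprojE; case: (word_content k == mu). Qed.

Lemma wproj_act mu y : (wproj mu \o act y)%VF = (act y \o wproj mu)%VF.
Proof.
apply/lfunP => v; apply/ffunP => k; rewrite !comp_lfunE wprojE [RHS]lfun_entry.
case: eqP => [e|ne].
  rewrite lfun_entry; apply: eq_bigr => l _; rewrite wprojE; case: eqP => // ne.
  by rewrite entry_act0 ?mul0r // e eq_sym; apply/eqP.
rewrite big1 // => l _; rewrite wprojE; case: eqP => [e|_]; last by rewrite mulr0.
by rewrite entry_act0 ?mul0r // e; apply/eqP.
Qed.

Definition wtrace mu y : C := \sum_(l | word_content l == mu) entry (act y) l l.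
Definition wdim mu y : nat := \dim (limg (act y \o wproj mu)%VF).

Lemma wtraceD mu y z : wtrace mu (y + z) = wtrace mu y + wtrace mu z.
Proof.
rewrite /wtrace -big_split; apply: eq_bigr => l _.
by rewrite /entry sergeev_actD add_lfunE ffunE.
Qed.

Lemma wtraceZ mu t y : wtrace mu (t *: y) = t * wtrace mu y.
Proof.
by rewrite /wtrace mulr_sumr; apply: eq_bigr => l _; rewrite /entry sergeev_actZ scale_lfunE ffunE.
Qed.

Lemma wtrace_sum mu (I : Type) (r : seq I) (F : I -> S) :
  wtrace mu (\sum_(i <- r) F i) = \sum_(i <- r) wtrace mu (F i).
Proof.
elim: r => [|i r IH]; last by rewrite !big_cons wtraceD IH.
by rewrite !big_nil /wtrace big1 // => l _; rewrite /entry sergeev_act0 zero_lfunE ffunE.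
Qed.

Lemma wtrace1 mu : wtrace mu 1 = #|[pred l | word_content l == mu]|%:R.
Proof.
rewrite /wtrace -sum1_card natr_sum; apply: eq_bigr => l _.
by rewrite /entry sergeev_act1 id_lfunE ffunE eqxx.
Qed.

Lemma wtraceC mu y z : wtrace mu (y * z) = wtrace mu (z * y).
Proof.
have E u v : wtrace mu (u * v) = \sum_(l | word_content l == mu) \sum_(k | word_content k == mu) entry (act u) l k * entry (act v) k l.
  apply: eq_bigr => l /eqP el; rewrite /entry sergeev_actM comp_lfunE lfun_entry [RHS]big_mkcond.
  apply: eq_bigr => k _; case: eqP => // ne; rewrite entry_act0 ?mul0r // el eq_sym; exact/eqP.
by rewrite !E exchange_big; apply: eq_bigr => l _; apply: eq_bigr => k _; rewrite mulrC.
Qed.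

Lemma wtrace_dim mu y : y * y = y -> wtrace mu y = (wdim mu y)%:R.
Proof.
move=> yy; rewrite /wdim -idempotent_trace.
  rewrite [LHS]big_mkcond; apply: eq_bigr => l _; rewrite /entry -wproj_act comp_lfunE wprojE.
  by case: ifP.
rewrite -comp_lfunA [(wproj mu \o (_ \o _))%VF]comp_lfunA wproj_act -comp_lfunA wproj_idem comp_lfunA.
by rewrite -sergeev_actM yy.
Qed.

Section Word.
Variable l0 : word.
Let nu := letter_content l0.

Fixpoint block_word j : seq nat := if j is j'.+1 then block_word j' ++ nseq (nu j') j' else [::].

Lemma size_block_word j : size (block_word j) = sumn (content_list nu j).
Proof. by elim: j => //= j IH; rewrite size_cat size_nseq IH addnC. Qed.

Lemma size_block_word_le p q : (p <= q)%N -> (size (block_word p) <= size (block_word q))%N.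
Proof.
move=> /subnK <-; elim: (q - p)%N => // d hd; rewrite addSn /= size_cat; exact: leq_trans (leq_addr _ _).
Qed.

Lemma nth_block_word j m i : (j < m)%N -> (size (block_word j) <= i < size (block_word j.+1))%N ->
  nth 0%N (block_word m) i = j.
Proof.
elim: m => // m IH; rewrite ltnS leq_eqVlt => /orP[/eqP ->|jm] /=.
  by rewrite size_cat size_nseq nth_cat => /andP[h1 h2]; rewrite ltnNge h1 /= nth_nseq ltn_subLR // h2.
move=> h; rewrite nth_cat; case: ifP => [_|/negbT]; first exact: IH.
case/negP; case/andP: h => _ h; apply: leq_trans h _; exact: (@size_block_word_le j.+1 m jm).
Qed.

Lemma count_block_word j i : count_mem i (block_word j) = if (i < j)%N then nu i else 0%N.
Proof.
elim: j => //= j IH; rewrite count_cat IH count_nseq /= [in RHS]ltnS.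
by case: (ltngtP i j) => [h|h|->]; rewrite ?eqxx ?mul0n ?addn0 ?add0n ?mul1n.
Qed.

Lemma perm_block_word : perm_eq [seq val (l0 a).2 | a <- enum 'I_n] (block_word N).
Proof.
apply/allP => i _; apply/eqP; rewrite count_block_word.
have -> : count_mem i [seq val (l0 a).2 | a <- enum 'I_n] = nu i.
  rewrite count_map /nu /letter_content -sum1_count big_enum_cond -sum1_card.
  by apply: eq_bigl => a; rewrite !inE.
case: ifP => // /negbT; rewrite -leqNgt => Ni; apply: eq_card0 => a; rewrite inE.
by apply/negbTE; rewrite neq_ltn (leq_trans _ Ni).
Qed.

Lemma size_blocks : sumn (word_content l0) = n.
Proof. by rewrite -size_block_word -(perm_size perm_block_word) size_map size_enum_ord. Qed.

Lemma sorted_word : exists w : word, [/\ forall a, (w a).1 = false,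
  forall a, val (w a).2 = nth 0%N (block_word N) a
  & exists p : 'S_n, forall a, (w (p a)).2 = (l0 a).2].
Proof.
have sz : size (block_word N) == n by rewrite size_block_word; apply/eqP/size_blocks.
pose t := Tuple sz; pose t0 : n.-tuple nat := [tuple val (l0 a).2 | a < n].
have pt : perm_eq t0 t by move: perm_block_word; rewrite -val_ord_tuple.
have lt (a : 'I_n) : (nth 0%N (block_word N) a < N)%N.
  have : nth 0%N (block_word N) a \in block_word N by rewrite mem_nth // (eqP sz).
  by rewrite -(perm_mem perm_block_word) => /mapP[b _ ->]; exact: ltn_ord.
have /tuple_permP[p ep] := pt.
exists [ffun a => (false, Ordinal (lt a))]; split=> [a|a|]; rewrite ?ffunE //.
exists p => a; rewrite ffunE; apply: val_inj => /=.
have := congr1 (fun u => nth 0%N u a) ep; rewrite !nth_mktuple => ->.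
by rewrite (tnth_nth 0%N).
Qed.

(** A permutation puts the letters in place, then the [c_a] at the odd places of [l] change the
    parities. *)
Lemma sorted_orbit w (p : 'S_n) l : (forall a, (w a).1 = false) -> (forall a, (w (p a)).2 = (l0 a).2) ->
  word_content l = word_content l0 -> exists z, act z (basis_elt C w) = basis_elt C l.
Proof.
move=> w1 w2 el.
have [q qP] : exists q : 'S_n, forall a, (w (q a)).2 = (l a).2.
  have pl : perm_eq [seq val (l a).2 | a <- enum 'I_n] [seq val (l0 a).2 | a <- enum 'I_n].
    have cm (l' : word) i : count_mem i [seq val (l' a).2 | a <- enum 'I_n] = letter_content l' i.
      rewrite count_map /letter_content -sum1_count big_enum_cond -sum1_card.
      by apply: eq_bigl => a; rewrite !inE.
    apply/allP => i _; apply/eqP; rewrite !cm.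
    have [iN|Ni] := ltnP i N; first exact: (content_list_inj el iN).
    have z (l' : word) : letter_content l' i = 0%N.
      by apply: eq_card0 => a; rewrite inE; apply/negbTE; rewrite neq_ltn (leq_trans _ Ni).
    by rewrite !z.
  have pt : perm_eq [tuple val (l a).2 | a < n] [tuple val (l0 a).2 | a < n] by move: pl; rewrite -val_ord_tuple.
  have /tuple_permP[r er] := pt; exists (r * p)%g => a; rewrite permM w2; apply: val_inj.
  by have := congr1 (fun u => nth 0%N u a) er; rewrite !nth_mktuple tnth_mktuple => <-.
pose g : sergeev_index n := ([set a | (l a).1], (q^-1)%g).
have eg : act_index g w = l.
  apply/ffunP => a; have wq : w (q a) = (false, (l a).2) by rewrite [LHS]surjective_pairing w1 qP.
  by rewrite ffunE /g /= invgK inE wq; case: (l a) => [[] k].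
exists ((-1) ^+ act_sign g w *: sergeev_elt C g).
rewrite sergeev_actZ scale_lfunE sergeev_actE /sergeev_elt twisted_basis eg.
by rewrite scalerA -expr2 sqrr_sign scale1r.
Qed.
End Word.

(** The [e_T] part of the weight space is the image of the right ideal of [eproj T] under the map
    sending [y] to [y] applied to the sorted word. Averaging [y] on the right over the stabilizer
    does not change this image, so the invariants already fill the whole part. *)
Lemma wdim_bound mu T : std T -> size T = n ->
  (2 ^ n * wdim mu (eproj T) <= kostka n T mu * box_weight T)%N.
Proof.
move=> sT szT; have [l0 /eqP e0|no] := pickP (fun l : word => word_content l == mu); last first.
  have -> : wdim mu (eproj T) = 0%N; last by rewrite muln0.
  apply/eqP; rewrite dimv_eq0 -subv0; apply/subvP => v /memv_imgP[u _ ->].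
  rewrite comp_lfunE (_ : wproj mu u = 0) ?linear0 ?mem0v //.
  by apply/ffunP => k; rewrite wprojE no ffunE.
have [w [w1 w2 [p wp]]] := sorted_word l0.
pose stab (g : 'S_n) := [forall a, w (g a) == w a].
pose U : {vspace S} := (left_ideal_part (eproj T) :&: \bigcap_(g | stab g) lker (amulr (pe g) - \1%VF))%VS.
have UP v : v \in U -> v \in left_ideal_part (eproj T) /\ forall g, stab g -> v * pe g = v.
  rewrite /U memv_cap [X in _ && X]memvE => /andP[vE /subv_bigcapP H]; split=> //.
  by move=> g sg; have := H g sg; rewrite -memvE memv_ker !lfun_simp /= subr_eq0 => /eqP.
have Uin v : v \in left_ideal_part (eproj T) -> (forall g, stab g -> v * pe g = v) -> v \in U.
  move=> vE H; rewrite /U memv_cap vE /= memvE; apply/subv_bigcapP => g sg.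
  by rewrite -memvE memv_ker !lfun_simp /= subr_eq0 H.
have szmu : sumn mu = n by rewrite -e0 size_blocks.
have bi v : v \in U -> block_inv s mu v.
  move=> /UP[_ vs]; rewrite -e0 /word_content.
  have: forall j, (j <= N)%N -> block_inv s (content_list (letter_content l0) j) v; last by apply.
  elim=> //= j IH jN; split; last exact: IH (ltnW jN).
  move=> i i1 i2; have b1 : (letter_content l0 j + sumn (content_list (letter_content l0) j) = size (block_word l0 j.+1))%N.
    by rewrite /= size_cat size_nseq size_block_word addnC.
  rewrite b1 in i2.
  have in1 : (size (block_word l0 j) <= i)%N by rewrite size_block_word.
  have ni : (i.+1 < n)%N.
    by apply: leq_trans i2 _; rewrite -szmu -e0 /word_content -size_block_word; apply: size_block_word_le.
  have ha : nth 0%N (block_word l0 N) i = j by apply: (nth_block_word jN); rewrite in1 (ltnW i2).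
  have hb : nth 0%N (block_word l0 N) i.+1 = j by apply: (nth_block_word jN); rewrite (leqW in1) i2.
  pose a := Ordinal (ltnW ni); pose b := Ordinal ni.
  rewrite /sergeev_s (@nat_transpositionE _ _ _ pe a b) // vs //; apply/forallP => d; apply/eqP.
  have wab : w a = w b.
    rewrite (surjective_pairing (w a)) (surjective_pairing (w b)) !w1; congr (_, _); apply: val_inj.
    by rewrite !w2 /= ha hb.
  by case: tpermP => [->|->|].
have sysn := sergeev_systemP C n.
have := invariants_left_ideal sysn (sergeev_gen_full (C := C) (n := n)) sT szT szmu (capvSl _ _ : (U <= _)%VS) bi.
apply: leq_trans; rewrite leq_pmul2l ?expn_gt0 // /wdim.
pose f : 'Hom(S, V) := linfun (fun y : S => act y (basis_elt C w)).
have fE y : f y = act y (basis_elt C w).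
  have fl : linear (fun y : S => act y (basis_elt C w)).
    by move=> t u1 u2; rewrite sergeev_actP add_lfunE scale_lfunE.
  pose aux := GRing.isLinear.Build _ _ _ _ (fun y : S => act y (basis_elt C w)) fl.
  pose F : {linear S -> V} := HB.pack (fun y : S => act y (basis_elt C w)) aux.
  by rewrite /f -[(fun y => _)]/(F : S -> V) lfunE.
apply: leq_trans (dim_limg_le f U); apply: dimvS; apply/subvP => v /memv_imgP[u _ ->].
rewrite comp_lfunE (basis_decomp (wproj mu u)) lfun_sum; apply: memv_suml => l _.
rewrite lfunZ wprojE.
case: eqP => [el|_]; last by rewrite scale0r mem0v.
apply: memvZ; have [z <-] := sorted_orbit w1 wp (etrans el (esym e0)).
rewrite -comp_lfunE -sergeev_actM; set y := eproj T * z.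
pose v' := (#|[pred g | stab g]|%:R)^-1 *: \sum_(g | stab g) y * pe g.
have stab1 : stab 1%g by apply/forallP => a; rewrite perm1.
have m0 : #|[pred g | stab g]|%:R != 0 :> C.
  by rewrite pnatr_eq0 -lt0n; apply/card_gt0P; exists 1%g.
have peW g : stab g -> act (pe g) (basis_elt C w) = basis_elt C w.
  move=> /forallP sg; rewrite sergeev_actE twisted_basis /act_sign /= cards0.
  have -> : odd_places w = set0 by apply/setP => a; rewrite !inE w1.
  rewrite inversion_sign0 imset0 clifford_sign0l expr0 scale1r; congr (basis_elt _ _).
  apply/ffunP => a; rewrite ffunE inE; have /eqP := sg ((g^-1)%g a); by rewrite permKV => ->.
apply/memv_imgP; exists v'; last first.
  have fS : f (\sum_(g | stab g) y * pe g) = \sum_(g | stab g) act y (basis_elt C w).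
    by rewrite lfun_sum; apply: eq_bigr => g sg; rewrite fE sergeev_actM comp_lfunE peW.
  by rewrite /v' lfunZ fS sumr_const -scaler_nat scalerA mulVf // scale1r.
apply: Uin => [|h sh].
  apply/left_ideal_partP; exists (z * ((#|[pred g | stab g]|%:R)^-1 *: \sum_(g | stab g) pe g)).
  by rewrite /v' mulrA -/y -scalerAr mulr_sumr.
rewrite /v' -scalerAl mulr_suml; congr (_ *: _); rewrite [RHS](reindex_inj (mulgI h)) /=.
apply: eq_big => [g|g _]; last by rewrite -mulrA perm_elt_mul.
apply/forallP/forallP => H a; first by rewrite permM (eqP (H _)); exact: (forallP sh).
by have := H ((h^-1)%g a); rewrite permM permKV => /eqP ->; rewrite -(eqP (forallP sh ((h^-1)%g a))) permKV.
Qed.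

(** Compares the bound on the corner with the Pieri coefficients; the excess [2 ^ n] is exactly what
    the strip bounds gain. *)
Lemma box_path_weight T : box_weight T = (2 ^ size T * path_weight T)%N.
Proof.
rewrite /box_weight /path_weight; elim: T => [|a T IH]; first by rewrite !big_nil.
rewrite !big_cons IH /content_weight expnS; case: (a == 0%N); ring.
Qed.

Lemma sum_wdim mu : (\sum_(T <- stds n) wdim mu (eproj T) = #|[pred l | word_content l == mu]|)%N.
Proof.
have sysn := sergeev_systemP C n.
apply/eqP; rewrite -(eqr_nat C) -wtrace1 -(sum_stds sysn (leqnn n)) wtrace_sum natr_sum; apply/eqP.
rewrite big_seq [RHS]big_seq; apply: eq_bigr => T; rewrite mem_stds => /andP[sT /eqP szT].
by rewrite wtrace_dim // (std_idem sysn) // szT.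
Qed.

Theorem wdim_eproj mu T : std T -> size T = n -> mu \in compositions n N ->
  wdim mu (eproj T) = (kostka n T mu * path_weight T)%N.
Proof.
move=> sT szT mun.
pose r := [seq (nu, R) | nu <- compositions n N, R <- stds n].
pose F (q : seq nat * seq nat) := (2 ^ n * wdim q.1 (eproj q.2))%N.
pose G (q : seq nat * seq nat) := (kostka n q.2 q.1 * box_weight q.2)%N.
have H1 q : q \in r -> (F q <= G q)%N.
  by move=> /allpairsPdep[nu [R [_ + ->]]]; rewrite mem_stds => /andP[sR /eqP szR]; apply: wdim_bound.
have H3 : (mu, T) \in r.
  by apply/allpairsPdep; exists mu; exists T; rewrite mem_stds sT szT eqxx.
have H2 : (\sum_(q <- r) G q <= \sum_(q <- r) F q)%N.
  rewrite /r !big_allpairs_dep /F /G /=.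
  apply: (@leq_trans (2 ^ n * (2 * N) ^ n)%N).
    rewrite -(@sum_strip_count n N n (leqnn n)) mulsumr exchange_big /= big_seq [leqRHS]big_seq; apply: leq_sum => R.
    rewrite mem_stds => /andP[sR /eqP szR]; rewrite -mulsuml sum_kostka ?szR // box_path_weight szR.
    by rewrite mulnA [(strip_count _ _ _ * _)%N]mulnC mulnAC -mulnA.
  under eq_bigr => nu _ do rewrite -mulsumr sum_wdim.
  rewrite -mulsumr leq_pmul2l ?expn_gt0 //.
  have -> : ((2 * N) ^ n = #|word|)%N by rewrite card_ffun card_prod card_bool !card_ord.
  rewrite -sum1_card; apply: (@leq_trans (\sum_(l : word) \sum_(nu <- compositions n N | word_content l == nu) 1)%N).
    apply: leq_sum => l _; rewrite (big_rem (word_content l)) /= ?eqxx ?leq_addr //.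
    rewrite mem_compositions; apply/andP; split.
      by rewrite size_content_list.
    by apply: all_content_list => i; rewrite /letter_content (leq_trans (max_card _)) ?card_ord.
  rewrite (exchange_big_dep xpredT) //=; apply: leq_sum => nu _.
  by rewrite -sum1_card.
have := sum_leq_eq H1 H2 H3.
rewrite /F /G /= box_path_weight szT mulnCA => /eqP; rewrite eqn_pmul2l ?expn_gt0 // => /eqP ->.
by rewrite mulnC.
Qed.
End Tensor.

(** * Idempotents of barred tableaux *)

Section Idempotent.
Variables (C : numClosedFieldType) (n : nat).
Local Notation S := (sergeev C n).
Local Notation c := (@sergeev_c C n).
Local Notation s := (@sergeev_s C n).
Local Notation x := (jucys_murphy C n).
Local Notation X i := (x i * x i).
Local Notation eproj := (@eproj C (sergeev C n) x).
Local Notation k2 := (k2_def C).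
Implicit Types (y : barred_entry) (z : S) (p : {poly C}).

Lemma signed_content_sqr y : signed_content C y ^+ 2 = k2 (content y.1).
Proof. by rewrite /signed_content exprMn sqrr_sign mul1r sqrtCK. Qed.

Lemma signed_content_eq0 y : (signed_content C y == 0) = (content y.1 == 0%N).
Proof.
rewrite -[LHS](expf_eq0 _ 2) signed_content_sqr.
by have [->|h] := eqVneq (content y.1) 0%N; [rewrite /k2_def mul0n eqxx | rewrite (negbTE (k2_neq0 C h))].
Qed.

Lemma signed_content_twin y : signed_content C (y.1, ~~ y.2) = - signed_content C y.
Proof. by rewrite /signed_content /=; case: y.2; rewrite /= !expr0 !expr1 !mulN1r ?opprK !mul1r. Qed.

(** The square gives the diagonal and thereby the box; the sign gives the bar, which is absent when
    the content is 0. Hence the denominators of the idempotents do not vanish. *)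
Lemma signed_content_inj B y y' : growth B -> grows B y.1 -> grows B y'.1 -> bar_ok y -> bar_ok y' ->
  signed_content C y = signed_content C y' -> y = y'.
Proof.
move=> gB gy gy' by_ by' e; have [sT dB] := growthP gB.
have ec : content y.1 = content y'.1 by apply: (@k2_inj C); rewrite -!signed_content_sqr e.
move: gy gy'; rewrite !growsE // => /and3P[h1 /eqP h2 _] /and3P[h3 /eqP h4 _].
have e1 : y.1 = y'.1.
  rewrite [LHS]surjective_pairing [RHS]surjective_pairing; congr (_, _); first by rewrite h2 h4 ec.
  by rewrite -(subnKC h1) -(subnKC h3) -/(content _) -/(content y'.1) ec h2 h4 ec.
have [c0|cn] := boolP (content y.1 == 0%N).
  have d u : is_true (bar_ok u) -> (u.1.1 <= u.1.2)%N -> content u.1 == 0%N -> u.2 = false.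
    rewrite /bar_ok /content subn_eq0 => b l1 l2; apply/negbTE/negP => u2; move: b; rewrite u2 /=.
    by rewrite eqn_leq l1 l2.
  rewrite [LHS]surjective_pairing [RHS]surjective_pairing e1 (d y) // (d y') //.
  by rewrite -ec.
rewrite -signed_content_eq0 in cn.
rewrite [LHS]surjective_pairing [RHS]surjective_pairing e1; congr (_, _); apply/eqP/negPn/negP => ne.
have e2 : signed_content C y' = - signed_content C y.
  rewrite -signed_content_twin; congr (signed_content C _).
  by rewrite [LHS]surjective_pairing e1; congr (_, _); move: ne; case: y.2; case: y'.2.
have /eqP : signed_content C y = - signed_content C y by rewrite -e2.
by rewrite -addr_eq0 -mulr2n mulrn_eq0 /= (negbTE cn).
Qed.

Lemma horner_zero p (a : S) z : a * z = 0 -> horner_alg a p * z = p.[0] *: z.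
Proof. by move=> e; apply: horner_alg_eig; rewrite e scale0r. Qed.

(** Splits [z] into the eigenvectors [a * z + t *: z] and [a * z - t *: z] of [a], up to the factor
    [t *+ 2]. *)
Lemma horner_pair p (a : S) z (t : C) : t != 0 -> a * (a * z) = t ^+ 2 *: z ->
  horner_alg a p * z
  = (t *+ 2)^-1 *: (p.[t] *: (a * z + t *: z) - p.[- t] *: (a * z - t *: z)).
Proof.
move=> t0 e; have t20 : t *+ 2 != 0 by rewrite mulrn_eq0.
have ez : z = (t *+ 2)^-1 *: ((a * z + t *: z) - (a * z - t *: z)).
  by rewrite opprB addrC addrA subrK -scalerDl -mulr2n scalerA mulVf // scale1r.
rewrite [in LHS]ez -scalerAr mulrBr; congr (_ *: (_ - _)); apply: horner_alg_eig.
  by rewrite mulrDr e -scalerAr scalerDr scalerA -expr2 addrC.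
by rewrite mulrBr e -scalerAr scaleNr scalerBr scalerA -expr2 opprB.
Qed.

Variable U : seq barred_entry.
Hypotheses (gU : growth (unzip1 U)) (bU : all bar_ok U) (szU : size U = n).
Let d : barred_entry := (0, 0, false)%N.
Let T := contents (unzip1 U).
Let V m := take m U.
Let u m := nth d U m.
Let TV m := contents (unzip1 (V m)).
Let kap m : C := signed_content C (u m).
Let bs m := [seq signed_content C y | y <- additions (V m) & y != u m].
(** Each step of the idempotent is an interpolation polynomial in [x m], equal to 1 at the chosen
    signed content and to 0 at all its competitors. *)
Let q m : {poly C} := (\prod_(b <- bs m) (kap m - b))^-1 *: \prod_(b <- bs m) ('X - b%:P).
Let h m : S := horner_alg (x m) (q m).
Let upto m : S := idempotent_upto C n U m.
Let sysn := sergeev_systemP C n.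
Let sT : std T := (growthP gU).1.
Let szT : size T = n. Proof. by rewrite !size_map. Qed.

Let TVE m : TV m = take m T. Proof. by rewrite /TV /T /contents /unzip1 /V !map_take. Qed.
Let gV m : growth (unzip1 (V m)). Proof. by rewrite /unzip1 /V map_take; apply: growth_take. Qed.
Let bV m : all bar_ok (V m). Proof. by apply/allP => y /mem_take yU; apply: (allP bU). Qed.
Let sV m : std (TV m) := (growthP (gV m)).1.
Let nT m : (m < n)%N -> nth 0%N T m = content (u m).1.
Proof. by move=> mn; rewrite /T /contents /unzip1 -map_comp (nth_map d) ?szU. Qed.
Let VS m : (m < n)%N -> V m.+1 = rcons (V m) (u m).
Proof. by move=> mn; rewrite /V (take_nth d) ?szU. Qed.
Let TVS m : (m < n)%N -> TV m.+1 = rcons (TV m) (nth 0%N T m).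
Proof. by move=> mn; rewrite !TVE (take_nth 0%N) ?szT. Qed.
Let gu m : (m < n)%N -> grows (unzip1 (V m)) (u m).1.
Proof. by move=> mn; have := gV m.+1; rewrite VS // /unzip1 map_rcons growth_rcons => /andP[]. Qed.
Let bu m : (m < n)%N -> bar_ok (u m).
Proof. by move=> mn; apply: (allP bU); rewrite mem_nth ?szU. Qed.
Let szV m : (m < n)%N -> size (V m) = m.
Proof. by move=> mn; rewrite size_takel // szU ltnW. Qed.
Let szTV m : (m <= n)%N -> size (TV m) = m.
Proof. by move=> mn; rewrite TVE size_takel // szT. Qed.

Let uptoS m : (m < n)%N -> upto m.+1 = upto m * h m.
Proof.
move=> mn; rewrite /upto /= -/(V m) -/(u m) /idempotent_step szV // /h /q linearZ /= mulr_algl rmorph_prod.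
congr (_ * (_ *: _)); apply: eq_bigr => b _; by rewrite rmorphB /= horner_algX horner_algC.
Qed.

Let q_kap m : (m < n)%N -> (q m).[kap m] = 1.
Proof.
move=> mn; rewrite /q hornerZ horner_prod.
transitivity ((\prod_(b <- bs m) (kap m - b))^-1 * \prod_(b <- bs m) (kap m - b)).
  by congr (_ * _); apply: eq_bigr => b _; rewrite hornerXsubC.
rewrite mulVf // prodf_seq_neq0; apply/allP => b /mapP[y]; rewrite mem_filter => /andP[yu ya] ->.
rewrite /= subr_eq0; apply: contra yu => /eqP e; apply/eqP.
have /andP[gy by_] := additions_grows ya.
by apply: (signed_content_inj (gV m) gy (gu mn) by_ (bu mn)); rewrite -e.
Qed.

Let q_zero m t : t \in bs m -> (q m).[t] = 0.
Proof.
move=> tb; apply/eqP; rewrite /q hornerZ horner_prod mulf_eq0 prodf_seq_eq0; apply/orP; right.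
by apply/hasP; exists t => //=; rewrite hornerXsubC subrr.
Qed.

Let q_twin m : (m < n)%N -> kap m != 0 -> (q m).[- kap m] = 0.
Proof.
move=> mn k0; apply: q_zero; rewrite /kap -signed_content_twin; apply: map_f.
rewrite mem_filter; apply/andP; split.
  by apply/eqP => /(congr1 snd) /=; case: (u m).2.
apply: (@grows_additions _ ((u m).1, ~~ (u m).2) (gV m) (bV m) (gu mn)); rewrite /bar_ok /=; apply/implyP => _.
move: k0; rewrite signed_content_eq0; apply: contra => /eqP e; by rewrite /content e subnn.
Qed.

Let q_other m a e : (m < n)%N -> addable (TV m) a -> a != nth 0%N T m -> (e ==> (a != 0%N)) ->
  (q m).[(-1) ^+ e * sqrtC (k2 a)] = 0.
Proof.
move=> mn aV ne ea; pose y : barred_entry := (mult (TV m) a, mult (TV m) a + a, e)%N.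
have cy : content y.1 = a by rewrite /content /= addKn.
have -> : (-1) ^+ e * sqrtC (k2 a) = signed_content C y by rewrite /signed_content -/(content y.1) cy.
apply: q_zero; apply: map_f; rewrite mem_filter; apply/andP; split.
  by apply: contra ne => /eqP e1; rewrite nT // -e1 cy.
apply: (@grows_additions _ y (gV m) (bV m)).
  by have [sV' dV] := growthP (gV m); rewrite growsE // cy aV /= leq_addr eqxx.
rewrite /bar_ok /=; apply/implyP => e1; move: ea; rewrite e1 /=; apply: contra => /eqP e2.
by rewrite -(eqn_add2l (mult (TV m) a)) addn0 -e2.
Qed.

Let xx0 m z : (m < n)%N -> X m * z = 0 -> x m * z = 0.
Proof. by move=> mn e; apply: (sys_xss sysn mn); rewrite mulrA. Qed.

Let h_kill m a z : (m < n)%N -> addable (TV m) a -> a != nth 0%N T m -> X m * z = k2 a *: z -> h m * z = 0.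
Proof.
move=> mn aV ne e; have [a0|a0] := eqVneq a 0%N.
  have xz : x m * z = 0 by apply: xx0 => //; rewrite e a0 /k2_def mul0n scale0r.
  rewrite /h horner_zero //; have := @q_other m a false mn aV ne isT.
  by rewrite a0 /k2_def mul0n sqrtC0 mulr0 => ->; rewrite scale0r.
have t0 : sqrtC (k2 a) != 0 by rewrite sqrtC_eq0 k2_neq0.
rewrite /h (@horner_pair _ _ _ _ t0) ?sqrtCK ?mulrA //.
have := @q_other m a false mn aV ne isT; rewrite expr0 mul1r => ->.
have := @q_other m a true mn aV ne a0; rewrite expr1 mulN1r => ->.
by rewrite !scale0r subrr scaler0.
Qed.

(** Over the chosen content, two signs of [x m] remain when the content is nonzero, and [h m]
    projects on the sign prescribed by the bar; for content 0 there is nothing to split. *)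
Let h_keep m z : (m < n)%N -> X m * z = k2 (nth 0%N T m) *: z ->
  if nth 0%N T m == 0%N then (x m * z = 0) /\ (h m * z = z)
  else h m * z = (kap m *+ 2)^-1 *: (x m * z + kap m *: z).
Proof.
move=> mn e; have k0 : (kap m == 0) = (nth 0%N T m == 0%N) by rewrite signed_content_eq0 nT.
have ks : kap m ^+ 2 = k2 (nth 0%N T m) by rewrite signed_content_sqr nT.
have hk := q_kap mn; rewrite -k0; case: eqP => [z0|/eqP nz].
  have xz : x m * z = 0 by apply: xx0 => //; rewrite e -ks z0 expr0n scale0r.
  by split=> //; rewrite /h horner_zero // -z0 hk scale1r.
rewrite /h (@horner_pair _ _ _ _ nz) ?ks ?mulrA // hk scale1r.
by rewrite q_twin // scale0r subr0.
Qed.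

Let E m := eproj (TV m).

Let E_S m : (m < n)%N -> E m.+1 = eproj (rcons (TV m) (nth 0%N T m)).
Proof. by move=> mn; rewrite /E TVS. Qed.

Let XE m : (m < n)%N -> X m * E m.+1 = k2 (nth 0%N T m) *: E m.+1.
Proof.
move=> mn; rewrite /E -[x m * x m]/(sq x m) (std_wt sysn) ?szTV //.
by rewrite TVS // nth_rcons szTV ?(ltnW mn) // ltnn eqxx.
Qed.

Let hE m R : (m < n)%N -> (size R <= n)%N -> h m * eproj R = eproj R * h m.
Proof.
by move=> mn Rn; apply/esym/horner_alg_intertwine; rewrite (x_eproj sysn).
Qed.

Let hES m : (m < n)%N -> h m * E m = h m * E m.+1.
Proof.
move=> mn; have szm := szTV (ltnW mn).
rewrite /E -(sum_adds_eproj sysn (sV m)) ?szm // mulr_sumr TVS //.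
have aT : nth 0%N T m \in adds (TV m).
  by rewrite mem_adds //; have := sV m.+1; rewrite TVS // std_rcons => /andP[].
rewrite (bigD1_seq _ aT (adds_uniq _)) /= big_seq_cond big1 ?addr0 // => a /andP[]; rewrite mem_adds // => aV ne.
apply: (h_kill mn aV ne); rewrite -[x m * x m]/(sq x m) (std_wt sysn) ?size_rcons ?szm //.
  by rewrite nth_rcons szm ltnn eqxx.
by rewrite std_rcons sV.
Qed.

(** The signed contents refine the squared ones: by [h_kill], the step [h m] already kills every
    addable content except the chosen one. *)
Let uptoE m : (m <= n)%N -> upto m = upto m * E m.
Proof.
elim: m => [|m IH] mn; first by rewrite /E TVE take0 [upto 0]/upto /= mul1r.
rewrite uptoS // {1}IH ?(ltnW mn) // -mulrA -hE ?szTV ?(ltnW mn) // hES // -!mulrA.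
by rewrite hE ?szTV // [RHS]mulrA [in RHS]IH ?(ltnW mn) //.
Qed.

Let comm_upto z m : (m <= n)%N -> (forall i, (i < m)%N -> z * x i = x i * z) -> z * upto m = upto m * z.
Proof.
elim: m => [|m IH] mn H; first by rewrite /upto /= mulr1 mul1r.
rewrite uptoS // mulrA IH ?(ltnW mn) // => [|i im]; last by apply: H; apply: ltnW.
by rewrite -!mulrA; congr (_ * _); apply: horner_alg_intertwine; apply: H.
Qed.

Let xhE m : (m < n)%N -> x m * (h m * E m.+1) = kap m *: (h m * E m.+1).
Proof.
move=> mn; have := h_keep mn (XE mn); have k0 : (kap m == 0) = (nth 0%N T m == 0%N) by rewrite signed_content_eq0 nT.
have ks : kap m ^+ 2 = k2 (nth 0%N T m) by rewrite signed_content_sqr nT.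
rewrite -k0; case: eqP => [z0 [e1 ->]|_ ->]; first by rewrite e1 z0 scale0r.
rewrite -scalerAr [RHS]scalerA [kap m * _]mulrC -[RHS]scalerA; congr (_ *: _); rewrite mulrDr mulrA XE // -ks scalerDr -scalerAr scalerA -expr2 addrC //.
Qed.

Let x_upto m i : (m <= n)%N -> (i < m)%N -> x i * upto m = kap i *: upto m.
Proof.
elim: m => // m IH mn; rewrite ltnS leq_eqVlt => /orP[/eqP ->|im]; last first.
  by rewrite uptoS // mulrA IH ?(ltnW mn) // scalerAl.
rewrite (uptoE mn) uptoS // -mulrA mulrA comm_upto ?(ltnW mn) // => [|j jm]; last first.
  by rewrite (sys_xx sysn) // (ltn_trans jm).
by rewrite -[LHS]mulrA xhE // -scalerAr.
Qed.

Let upto_fix m : (m <= n)%N -> upto m * upto n = upto n.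
Proof.
elim: m => [|m IH] mn; first by rewrite /upto /= mul1r.
rewrite uptoS // -mulrA /h (@horner_alg_eig _ _ _ _ (kap m)) ?q_kap // ?scale1r ?IH ?(ltnW mn) //.
exact: x_upto.
Qed.

Lemma tableau_idempotentE : tableau_idempotent C n U = upto n.
Proof. by rewrite /tableau_idempotent szU. Qed.

Lemma tableau_idempotent_idem : tableau_idempotent C n U * tableau_idempotent C n U = tableau_idempotent C n U.
Proof. by rewrite tableau_idempotentE upto_fix. Qed.

Section Trace.
Variable tr : S -> C.
Hypotheses (trD : forall y z : S, tr (y + z) = tr y + tr z)
  (trZ : forall t (y : S), tr (t *: y) = t * tr y) (trC : forall y z : S, tr (y * z) = tr (z * y)).

Let tr_odd m (y : S) : (m < n)%N -> c m * y = - (y * c m) -> tr y = 0.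
Proof.
move=> mn e; have cc := sys_cc sysn mn.
have trN z : tr (- z) = - tr z by rewrite -scaleN1r trZ mulN1r.
have : tr (c m * (y * c m)) = tr (y * c m * c m) by rewrite trC.
rewrite mulrA e mulNr trN -mulrA cc mulrN1 trN opprK => /eqP.
by rewrite -addr_eq0 -mulr2n mulrn_eq0 => /eqP.
Qed.

Let eT := eproj T.

Let XT m : (m < n)%N -> X m * eT = k2 (nth 0%N T m) *: eT.
Proof. by move=> mn; rewrite -[x m * x m]/(sq x m) (std_wt sysn) ?szT. Qed.

(** Off the diagonal, [h m] acts on [eT] as half of [1 + x m / kap m]. The part with [x m]
    anticommutes with the invertible [c m] and has trace 0, so the box halves the trace whatever its
    bar. *)
Let tr_step m : (m < n)%N -> tr (upto m * eT) = (content_weight (nth 0%N T m))%:R * tr (upto m.+1 * eT).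
Proof.
move=> mn; rewrite uptoS // -mulrA; have := h_keep mn (XT mn).
have k0 : (kap m == 0) = (nth 0%N T m == 0%N) by rewrite signed_content_eq0 nT.
rewrite /content_weight; case: ifP => [_ [_ ->]|nz ->]; first by rewrite mul1r.
rewrite nz in k0; rewrite -scalerAr trZ mulrDr trD -scalerAr trZ.
rewrite (@tr_odd m (upto m * (x m * eT))) // ?add0r.
  by rewrite mulrCA [2 * (_ * _)]mulrA mulr_natl mulrA mulVf ?mul1r // mulrn_eq0 k0.
have cu : c m * upto m = upto m * c m.
  apply: comm_upto => [|i im]; first exact: ltnW.
  by rewrite (sys_xc sysn) // ?(ltn_trans im) // ltn_eqF.
rewrite [LHS]mulrA cu -[LHS]mulrA.
have -> : c m * (x m * eT) = - (x m * (c m * eT)).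
  by rewrite !mulrA (sys_xcN sysn) // mulNr opprK.
by rewrite (c_eproj sysn) ?szT // mulrN -!mulrA.
Qed.

Lemma trace_tableau : tr eT = (path_weight T)%:R * tr (tableau_idempotent C n U).
Proof.
have H m : (m <= n)%N -> tr eT = (path_weight (take m T))%:R * tr (upto m * eT).
  elim: m => [|m IH] mn; first by rewrite take0 /path_weight big_nil /upto /= !mul1r.
  rewrite IH ?(ltnW mn) // tr_step // mulrA -natrM (take_nth 0%N) ?szT //.
  by rewrite /path_weight big_rcons /= mulnC.
rewrite (H n) // -{1}szT take_size tableau_idempotentE [in RHS]uptoE //.
have -> // : E n = eT by rewrite /E TVE take_oversize // szT.
Qed.
End Trace.
End Idempotent.

(** * Characters and supertraces *)

Lemma sumn_kostka n T mu : kostka n T mu != 0%N -> size T = sumn mu.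
Proof.
elim: mu T => [|m mu IH] T /=; first by case: T.
move=> nz; apply/eqP; apply: contraNT nz => ne; rewrite big1_seq // => k /andP[/eqP e _].
have [->|/IH ek] := eqVneq (kostka n k mu) 0%N; first by rewrite muln0.
by rewrite e ek addnC eqxx in ne.
Qed.

Lemma path_weight_gt0 T : (0 < path_weight T)%N.
Proof. by apply: prodn_gt0 => a; rewrite /content_weight; case: ifP. Qed.

Section DiagonalOperators.
Variables (K : comNzRingType) (N n : nat).

Lemma in_copy_diag (a : 'I_n) (Z : 'End(superspace K N)) (v : tensor_space K N n) k :
  (forall i j, i != j -> entry Z i j = 0) -> in_copy a Z v k = entry Z (k a) (k a) * v k.
Proof.
move=> dZ; rewrite /in_copy operatorE (bigD1 k) //= [X in _ + X]big1 ?addr0 => [|l lk].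
  rewrite addbb /= expr0 mul1r (_ : [forall b, _] = true) //.
  by apply/forallP => b; rewrite eqxx implybT.
case: ifP => [/forallP H|_]; last by rewrite mul0r.
rewrite dZ ?mulr0 ?mul0r //; apply: contra lk => /eqP e; apply/eqP/ffunP => b; symmetry.
by have [->|ba] := eqVneq b a; [rewrite e | have /implyP/(_ ba)/eqP := H b].
Qed.
End DiagonalOperators.

Section Coefficients.
Variables (K : comNzRingType) (N : nat).
Implicit Types nu : 'X_{1..N}.

Lemma mcoeff_prod_var (I : finType) (f : I -> 'I_N) nu :
  (\prod_(p : I) 'X_(f p) : {mpoly K[N]})@_nu
  = [forall i, #|[pred p | f p == i]| == nu i]%:R.
Proof.
have -> : (\prod_(p : I) 'X_(f p) : {mpoly K[N]}) = 'X_[(\big[+%MM/0%MM]_(p : I) U_(f p))%MM].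
  exact/esym/(big_morph (fun m => 'X_[m]) (@mpolyXD N K) (@mpolyX0 N K)).
rewrite mcoeffX; congr (nat_of_bool _)%:R.
have E i : (\big[+%MM/0%MM]_(p : I) U_(f p))%MM i = #|[pred p | f p == i]|.
  by rewrite mnm_sumE -sum1_card [RHS]big_mkcond; apply: eq_bigr => p _; rewrite mnm1E inE; case: eqP.
apply/eqP/forallP => [<- i|H]; first by rewrite E.
by apply/mnmP => i; rewrite E; apply/eqP.
Qed.
End Coefficients.

Definition extend_content N (f : 'I_N -> nat) (i : nat) : nat := oapp f 0%N (insub i).

Lemma extend_contentE N (f : 'I_N -> nat) (k : 'I_N) : extend_content f k = f k.
Proof. by rewrite /extend_content valK. Qed.

Section Weights.
Variables (C : numClosedFieldType) (N n : nat).
Local Notation act := (sergeev_act N).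
Local Notation word := (multi_index N n).
Implicit Types (l : word) (k : 'I_N) (mu : {ffun 'I_N -> int}).

Lemma word_contentE l (f : 'I_N -> nat) :
  (word_content l == content_list (extend_content f) N) = [forall k : 'I_N, letter_content l k == f k].
Proof.
apply/eqP/forallP => [/content_list_inj H k|H]; first by rewrite (H k) // extend_contentE.
by apply: eq_content_list => i iN; have /eqP := H (Ordinal iN); rewrite /= => ->; rewrite -(extend_contentE f (Ordinal iN)).
Qed.

Lemma tensor_weight k (v : tensor_space C N n) l :
  tensor_action n (queer_F C (false, k) (false, k)) v l = (letter_content l k)%:R * v l.
Proof.
rewrite /tensor_action sum_lfunE sum_ffunE.
have En i j : entry (queer_F C (false, k) (false, k)) i j
    = ((i == (false, k)) && (j == (false, k)))%:R + ((i == (true, k)) && (j == (true, k)))%:R.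
  by rewrite /queer_F /entry add_lfunE ffunE; congr (_ + _); exact: entry_matrix_unit.
rewrite (eq_bigr (fun a => ((l a).2 == k)%:R * v l)) => [|a _].
  rewrite -mulr_suml; congr (_ * _); rewrite /letter_content -sum1_card natr_sum [RHS]big_mkcond.
  by apply: eq_bigr => a _; rewrite inE -val_eqE; case: eqP.
rewrite in_copy_diag => [|i j ij]; last first.
  have H t : (i == t) && (j == t) = false by apply/negbTE; apply: contra ij => /andP[/eqP -> /eqP ->].
  by rewrite En !H addr0.
rewrite En !andbb; case: (l a) => [[] b]; rewrite !xpair_eqE /= ?addr0 ?add0r //.
Qed.

Variable e : sergeev C n.
Hypothesis ee : e * e = e.
Let M := limg (act e).

Let M_fix v : v \in M -> act e v = v.
Proof. by case/memv_imgP => w _ ->; rewrite -comp_lfunE -sergeev_actM ee. Qed.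

Lemma mem_weight_space mu v : v \in weight_space M mu <->
  v \in M /\ forall l k, v l != 0 -> (letter_content l k)%:Z = mu k.
Proof.
have H k : (v \in passmx.leigenspace (tensor_action n (queer_F C (false, k) (false, k))) (mu k)%:~R)
    <-> forall l, v l != 0 -> (letter_content l k)%:Z = mu k.
  rewrite /passmx.leigenspace memv_ker add_lfunE opp_lfunE scale_lfunE id_lfunE subr_eq0.
  split=> [/eqP/ffunP H l nz|H].
    have := H l; rewrite tensor_weight !ffunE => /(mulIf nz) e1.
    by apply/eqP; rewrite -(eqr_int C) -e1.
  apply/eqP/ffunP => l; rewrite tensor_weight !ffunE.
  by have [->|/H <-] := eqVneq (v l) 0; rewrite ?mulr0 // scaler0.
rewrite /weight_space memv_cap; split.
  move=> /andP[vM]; rewrite memvE => /subv_bigcapP h; split=> // l k.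
  by apply: (proj1 (H k)); rewrite memvE; apply: h.
move=> [vM h]; rewrite vM memvE; apply/subv_bigcapP => k _; rewrite -memvE; apply/H => l; exact: h.
Qed.

Definition abs_content mu := content_list (extend_content (fun k => `|mu k|%N)) N.

Lemma dim_weight_space mu : \dim (weight_space M mu)
  = if [forall k, 0 <= mu k] then wdim N (abs_content mu) e else 0%N.
Proof.
case: ifP => [/forallP pos|/negbT]; last first.
  rewrite negb_forall => /existsP[k neg]; apply/eqP; rewrite dimv_eq0 -subv0; apply/subvP => v /mem_weight_space[_ H].
  rewrite (_ : v = 0) ?mem0v //; apply/ffunP => l; rewrite ffunE; apply/eqP; apply: contraNT neg => nz; rewrite -(H l k nz) //.
rewrite /wdim; congr (\dim _); apply/vspaceP => v; apply/idP/idP.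
  move=> /mem_weight_space[vM H].
  have vE : wproj C N n (abs_content mu) v = v.
    apply/ffunP => l; rewrite wprojE; case: ifP => // /negbT; rewrite word_contentE negb_forall => /existsP[k ne].
    apply/esym/eqP; apply: contraNT ne => nz; by rewrite -(H l k nz) absz_nat.
  by rewrite -(M_fix vM) -vE -comp_lfunE memv_img ?memvf.
case/memv_imgP => u _ ->; apply/mem_weight_space; split; first by rewrite comp_lfunE memv_img ?memvf.
move=> l k; rewrite -wproj_act comp_lfunE wprojE; case: ifP => [|_]; last by rewrite eqxx.
by rewrite word_contentE => /forallP/(_ k)/eqP -> _; rewrite gez0_abs.
Qed.

Lemma integral_weights : integral_weight_module M.
Proof.
pose wt l : {ffun 'I_N -> int} := [ffun k : 'I_N => (letter_content l k)%:Z].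
exists [seq wt l | l <- enum word]; apply/subvP => v vM.
rewrite big_map big_enum /= -(M_fix vM) (basis_decomp v) lfun_sum; apply: memv_suml => l _; rewrite lfunZ.
apply: memvZ; have : act e (basis_elt C l) \in weight_space M (wt l).
  apply/mem_weight_space; split; first by rewrite memv_img ?memvf.
  move=> m k; rewrite -[act e _ m]/(entry (act e) m l) => nz.
  have ec : word_content m = word_content l by apply/eqP; apply: contraNT nz => /(entry_act0 e) ->.
  by rewrite ffunE (content_list_inj ec).
by rewrite !memvE => h; apply: subv_trans h _; apply: (sumv_sup l).
Qed.

(** The signs in [Y] cancel those of the supertrace, so the coefficient of a monomial is the
    ordinary trace on the corresponding weight space. *)
Lemma super_trace_coef nu :
  (super_trace (extend_scalars (@mpolyC N C) (act e) \o tensor_Y C N n)%VF)@_nu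
  = wtrace N (content_list (extend_content (fun k => nu k)) N) e.
Proof.
have EY i j : entry (variable_Y C N) i j = (i == j)%:R * ((-1) ^+ i.1 * 'X_(i.2)).
  rewrite /variable_Y /entry sum_lfunE sum_ffunE (bigD1 i) //= big1 ?addr0 => [|k ki].
    rewrite scale_lfunE ffunE -[matrix_unit _ _ _ _ _]/(entry (matrix_unit {mpoly C[N]} i i) i j) entry_matrix_unit eqxx eq_sym.
    by rewrite /GRing.scale /= mulrC.
  rewrite scale_lfunE ffunE -[matrix_unit _ _ _ _ _]/(entry (matrix_unit {mpoly C[N]} k k) i j) entry_matrix_unit.
  by rewrite eq_sym (negbTE ki) scaler0.
have YE (v : tensor_space {mpoly C[N]} N n) l :
    tensor_Y C N n v l = (\prod_(a < n) ((-1) ^+ (l a).1 * 'X_((l a).2))) * v l.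
  rewrite /tensor_Y; elim: (index_enum _) => [|a r IH]; first by rewrite !big_nil id_lfunE mul1r.
  rewrite !big_cons comp_lfunE in_copy_diag => [|i j ij]; last by rewrite EY (negbTE ij) mul0r.
  by rewrite EY eqxx mul1r IH mulrA.
have TE l : entry (extend_scalars (@mpolyC N C) (act e) \o tensor_Y C N n)%VF l l
    = (\prod_(a < n) ((-1) ^+ (l a).1 * 'X_((l a).2))) * (entry (act e) l l)%:MP.
  rewrite {1}/entry comp_lfunE /extend_scalars operatorE (bigD1 l) //= big1 ?addr0 => [|m ml].
    by rewrite YE ffunE eqxx mulr1 mulrC.
  by rewrite YE ffunE (negbTE ml) !mulr0.
rewrite /super_trace raddf_sum /= /wtrace [RHS]big_mkcond; apply: eq_bigr => l _.
rewrite TE big_split /= !mulrA.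
have -> : (-1) ^+ (\big[addb/false]_(a < n) (l a).1) * \prod_(a < n) (-1) ^+ (l a).1 = 1 :> {mpoly C[N]}.
  have -> : \prod_(a < n) (-1) ^+ (l a).1 = (-1) ^+ (\big[addb/false]_(a < n) (l a).1) :> {mpoly C[N]}.
    by elim/big_rec2: _ => [|a b1 b2 _ ->]; rewrite ?expr0 ?signr_addb.
  by rewrite -expr2 sqrr_sign.
rewrite mul1r mulrC mcoeffCM mcoeff_prod_var word_contentE.
have -> : [forall i : 'I_N, #|[pred p | (l p).2 == i]| == nu i] = [forall k : 'I_N, letter_content l k == nu k].
  by apply: eq_forallb => i; congr (_ == _); apply: eq_card => a; rewrite !inE -val_eqE.
by case: ifP => _; rewrite ?mulr1 ?mulr0.
Qed.
End Weights.

(** * Coefficients of the Schur Q-polynomial *)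

Section SchurCount.
Variables (C : numClosedFieldType) (N : nat) (lam : seq nat) (U : seq barred_entry).
Hypotheses (N0 : (0 < N)%N) (slam : strict_partition lam) (sU : standard_barred lam U).
Let n := size U.
(** Side of a square containing the diagram: a column number is a row number plus a content, and
    each is at most [n]. *)
Let L := (n + n).+1.
Let T := contents (unzip1 U).
Let gU : growth (unzip1 U) := strict_growth slam sU.
Let sT : std T := (growthP gU).1.
Let szT : size T = n. Proof. by rewrite !size_map. Qed.
Local Notation dbox := (diagram_box lam).
Local Notation box := ('I_L * 'I_L)%type.
Implicit Types (F : {ffun dbox -> marked_symbol N}) (p q : dbox) (b : box).

Let inD (p : nat * nat) : (p \in shifted_diagram lam) = (p.1 <= p.2)%N && (p.1 < mult T (p.2 - p.1))%N.
Proof. by case/and3P: sU => pm _ _; rewrite -(perm_mem pm) (growthP gU).2. Qed.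

Let inL p : ((val p).1 < L)%N && ((val p).2 < L)%N.
Proof.
have := valP p; rewrite inD => /andP[h1 h2].
have h3 : (mult T ((val p).2 - (val p).1) <= n)%N by rewrite -szT; apply: count_size.
have h4 : ((val p).2 - (val p).1 < n)%N.
  by rewrite -szT; apply: std_lt_size => //; rewrite -mult_gt0; apply: leq_ltn_trans h2.
by move: (val p).1 (val p).2 (mult _ _) h1 h2 h3 h4; rewrite /L; clear; move=> i j m; lia.
Qed.

Definition box_of p : box := (inord (val p).1, inord (val p).2).

Let box_of1 p : (box_of p).1 = (val p).1 :> nat.
Proof. by rewrite /= inordK //; case/andP: (inL p). Qed.
Let box_of2 p : (box_of p).2 = (val p).2 :> nat.
Proof. by rewrite /= inordK //; case/andP: (inL p). Qed.

Definition box_filling F : {ffun box -> option (marked_symbol N)} :=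
  [ffun b : box => omap F (insub (b.1 : nat, b.2 : nat))].

Let box_ofP b : (exists2 p, b = box_of p & insub (b.1 : nat, b.2 : nat) = Some p)
  \/ (~~ in_diag (mult T) b /\ insub (b.1 : nat, b.2 : nat) = None :> option dbox).
Proof.
case: insubP => [p pD e|nD]; [left; exists p => // | right; split => //].
  rewrite [LHS]surjective_pairing /box_of e /=; congr (_, _); apply: val_inj; by rewrite /= inordK.
by move: nD; rewrite inD.
Qed.

Let insub_box p : insub ((box_of p).1 : nat, (box_of p).2 : nat) = Some p.
Proof. by rewrite box_of1 box_of2 -surjective_pairing valK. Qed.

Let box_fillingE F p : box_filling F (box_of p) = Some (F p).
Proof. by rewrite ffunE insub_box. Qed.

Let box_of_inj : injective box_of.
Proof. by move=> p q e; apply: Some_inj; rewrite -!insub_box e. Qed.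

Let box_filling_inj : injective box_filling.
Proof. by move=> F G e; apply/ffunP => p; apply: Some_inj; rewrite -!box_fillingE e. Qed.

Let letter_box F (k : nat) : letter_count (box_filling F) k = #|[pred p | (F p).1 == k :> nat]|.
Proof.
rewrite -(card_image box_of_inj); apply: eq_card => b; apply/idP/imageP.
  rewrite inE; have [[p -> _]|[_ e]] := box_ofP b; last by rewrite ffunE e.
  by rewrite box_fillingE /= => h; exists p.
by move=> [p pk ->]; rewrite inE box_fillingE.
Qed.

Let filling_box F : filling N (mult T) (box_filling F) = marked_shifted F.
Proof.
have cE p q : compat (box_of p) (box_of q) (F p) (F q) =
    ((((val p).1 == (val q).1) && ((val p).2 < (val q).2)%N ==>
           (symbol_code (F p) <= symbol_code (F q))%N && ~~ ((F p == F q) && (F p).2))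
       && (((val p).2 == (val q).2) && ((val p).1 < (val q).1)%N ==>
           (symbol_code (F p) <= symbol_code (F q))%N && ~~ ((F p == F q) && ~~ (F p).2))).
  have v1 : ((box_of p).1 == (box_of q).1) = ((val p).1 == (val q).1).
    by apply/eqP/eqP => h; [rewrite -(box_of1 p) -(box_of1 q) h | apply: ord_inj; rewrite box_of1 box_of1].
  have v2 : ((box_of p).2 == (box_of q).2) = ((val p).2 == (val q).2).
    by apply/eqP/eqP => h; [rewrite -(box_of2 p) -(box_of2 q) h | apply: ord_inj; rewrite box_of2 box_of2].
  by rewrite /compat v1 v2 !box_of1 !box_of2.
apply/and3P/forallP => [[_ _ /forallP H] p|H].
  by apply/forallP => q; have /forallP/(_ (box_of q)) := H (box_of p); rewrite !box_fillingE /= cE.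
split.
- apply/forallP => b; have [[p -> _]|[nb e]] := box_ofP b.
    rewrite box_fillingE /= /in_diag box_of1 box_of2 -(inD (val p)) (valP p) //.
  by rewrite ffunE e (negbTE nb).
- by apply/forallP => b; rewrite ffunE; case: insub => //= p; exact: ltn_ord.
apply/forallP => b; apply/forallP => b'.
have [[p -> _]|[_ e]] := box_ofP b; last by rewrite ffunE e.
rewrite box_fillingE; have [[q -> _]|[_ e]] := box_ofP b'; last by rewrite ffunE e.
by rewrite box_fillingE /= cE; have /forallP := H p; apply.
Qed.

Let filling_surj g : filling N (mult T) g -> exists F, g = box_filling F.
Proof.
move=> /and3P[/forallP dom _ _].
(* The default symbol only completes the definition: [g] has a value on every box of the diagram. *)
exists [ffun p => odflt (Ordinal N0, false) (g (box_of p))]; apply/ffunP => b.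
have := dom b; have [[p -> _]|[/negbTE -> e]] := box_ofP b.
  rewrite box_fillingE ffunE /in_diag box_of1 box_of2 -(inD (val p)) (valP p).
  by case: (g _).
by rewrite [RHS]ffunE e; case: (g b).
Qed.

Lemma mcoeff_schur_Q (nu : 'X_{1..N}) :
  (schur_Q C N lam)@_nu = (kostka n T (content_list (extend_content (fun k => nu k)) N))%:R.
Proof.
rewrite /schur_Q raddf_sum /=.
rewrite (eq_bigr (fun F : {ffun dbox -> marked_symbol N} => [forall i, #|[pred p | (F p).1 == i]| == nu i]%:R)); last first.
  by move=> F _; exact: mcoeff_prod_var.
have LL : (n + n < L)%N by [].
rewrite -(@card_good_fillings N L n LL T N _ sT) ?szT // -natr_sum; congr _%:R.
rewrite -sum1_card (eq_bigr (fun F : {ffun dbox -> marked_symbol N} => nat_of_bool [forall i, #|[pred p | (F p).1 == i]| == nu i])) //.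
rewrite -big_mkcondr /= [LHS]sum1_card -(card_image box_filling_inj); rewrite sum1_card; apply: eq_card => g.
have lE F : [forall i, #|[pred p | (F p).1 == i]| == nu i]
    = [forall k : 'I_N, (k < N)%N ==> (letter_count (box_filling F) k == extend_content (fun k => nu k) k :> nat)].
  by apply: eq_forallb => i; rewrite ltn_ord /= extend_contentE letter_box.
apply/imageP/idP => [[F FP ->]|].
  by case/andP: FP => m c; apply/andP; split; [rewrite filling_box | rewrite -lE].
move=> /andP[fg lg]; have [F eF] := filling_surj fg; exists F => //.
by apply/andP; split; [rewrite -filling_box -eF | rewrite lE -eF].
Qed.
End SchurCount.

Section Character.
Variables (C : numClosedFieldType) (N n : nat) (lam : seq nat) (U : seq barred_entry).
Hypotheses (N0 : (0 < N)%N) (slam : strict_partition lam) (sU : standard_barred lam U) (szU : size U = n).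
Let gU : growth (unzip1 U) := strict_growth slam sU.
Let bU : all bar_ok U. Proof. by case/and3P: sU. Qed.
Let T := contents (unzip1 U).
Let sT : std T := (growthP gU).1.
Let szT : size T = n. Proof. by rewrite !size_map. Qed.
Let e := tableau_idempotent C n U.
Let ee : e * e = e := tableau_idempotent_idem C gU bU szU.

(** On each weight space the trace of [eproj T] is [path_weight T] times that of [e], and
    [wdim_eproj] shows the same factor, which cancels. *)
Lemma wdim_tableau mu : size mu = N -> wdim N mu e = kostka n T mu.
Proof.
move=> sz; have [h|h] := boolP (mu \in compositions n N).
  have := trace_tableau gU bU szU (@wtraceD C N n mu) (@wtraceZ C N n mu) (@wtraceC C N n mu).
  rewrite !wtrace_dim // ?(std_idem (sergeev_systemP C n)) ?szT // wdim_eproj // -natrM => /eqP.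
  by rewrite eqr_nat mulnC eqn_pmul2l ?path_weight_gt0 // => /eqP.
(* Outside [compositions n N] some entry of [mu] exceeds [n]; no word has this content, and [kostka]
   vanishes because the sum of [mu] is not [n]. *)
have nw (l : multi_index N n) : word_content l != mu.
  apply: contra h => /eqP <-; rewrite mem_compositions; apply/andP; split.
    by rewrite size_content_list.
  by apply: all_content_list => i; rewrite /letter_content (leq_trans (max_card _)) ?card_ord.
have -> : wdim N mu e = 0%N.
  apply/eqP; rewrite dimv_eq0 -subv0; apply/subvP => v /memv_imgP[u _ ->].
  rewrite comp_lfunE (_ : wproj C N n mu u = 0) ?linear0 ?mem0v //.
  by apply/ffunP => k; rewrite wprojE (negbTE (nw k)) ffunE.
apply/esym/eqP; apply: contraNT h => /sumn_kostka; rewrite szT => sn.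
rewrite mem_compositions sz eqxx /= sn; clear; elim: mu => //= a mu IH; rewrite leq_addr /=.
by apply: sub_all IH => b; move/leq_trans; apply; rewrite leq_addl.
Qed.

Theorem character_tableau : has_character (limg (sergeev_act N e)) (schur_Q C N lam)
  /\ super_trace (extend_scalars (@mpolyC N C) (sergeev_act N e) \o tensor_Y C N n)%VF = schur_Q C N lam.
Proof.
split; last first.
  apply/mpolyP => nu; rewrite (super_trace_coef e nu) (@wtrace_dim C N n _ e ee) wdim_tableau ?size_content_list //.
  by rewrite (mcoeff_schur_Q C N0 slam sU) szU.
split; [exact: queer_submodule_tableau | exact: integral_weights |] => mu.
rewrite dim_weight_space // /laurent_coef; case: ifP => // _.
rewrite wdim_tableau ?size_content_list // (mcoeff_schur_Q C N0 slam sU) szU; congr (kostka _ _ _)%:R.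
by apply: eq_content_list => m mN; rewrite -[m]/(val (Ordinal mN)) !extend_contentE mnmE.
Qed.
End Character.

Theorem proposition3p1 (R : realType) (N n : nat) (lam : seq nat)
    (U : seq barred_entry) :
  (1 <= N)%N -> strict_partition lam -> sumn lam = n -> standard_barred lam U ->
  let E_U := sergeev_act N (tableau_idempotent R[i] n U) in
  has_character (limg E_U) (schur_Q R[i] N lam)
  /\ super_trace (extend_scalars (@mpolyC N R[i]) E_U \o tensor_Y R[i] N n)%VF
     = schur_Q R[i] N lam.
Proof.
move=> N0 slam sn sU; apply: character_tableau => //.
have /and3P[pm _ _] := sU; rewrite -(size_map fst) (perm_size pm) size_allpairs_dep -sn.
congr sumn; rewrite -[RHS](mkseq_nth 0%N); by apply: eq_map => i; rewrite size_iota.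
Qed.
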